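(* Let $f(u+iv)=\alpha(u,v)+i\beta(u,v)$ be an intrinsic holomorphic function defined on an intrinsic complex domain $\Omega_2\subset\mathbb{C}$. Then for $m\ge3$ and odd we have $$\Delta_{\mathbb{R}^{m+1}}^{\frac{m-3}2}\mathcal{D}[f(x_0+\underline{x})]=\gamma_m\,HGCK[f^{(m-2)}(x_0),0],$$ where $f^{(m-2)}$ denotes the $(m-2)$-th derivative and $\gamma_m=\frac{(-1)^{\frac{m-1}2}2^{m-1}}{(m-1)!}\left[\Gamma\left(\frac{m+1}2\right)\right]^2$. Setting $\Omega_1=\Omega_2\cap\mathbb{R}$, and $\Omega$ being an axially symmetric slice domain, one obtains the (commutative) diagram with three rows $$S:\mathcal{A}(\Omega_1)\otimes\mathbb{R}_m\to\mathcal{SM}(\Omega),\qquad HGCK:(\mathcal{A}(\Omega_1)\otimes\mathbb{R}_m)^2\to\mathcal{AH}(\Omega),\qquad GCK:\mathcal{A}(\Omega_1)\otimes\mathbb{R}_m\to\mathcal{AM}(\Omega),$$ whose left column consists of the maps $$\mathcal{A}(\Omega_1)\otimes\mathbb{R}_m\xrightarrow{\ \gamma_m(\partial_{x_0}^{m-2},\,0)\ }(\mathcal{A}(\Omega_1)\otimes\mathbb{R}_m)^2\xrightarrow{\ \partial_{x_0}P_1\ }\mathcal{A}(\Omega_1)\otimes\mathbb{R}_m$$ and whose right column consists of the maps $$\mathcal{SM}(\Omega)\xrightarrow{\ \Delta_{\mathbb{R}^{m+1}}^{\frac{m-3}2}\mathcal{D}\ }\mathcal{AH}(\Omega)\xrightarrow{\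 \overline{\mathcal{D}}\ }\mathcal{AM}(\Omega),$$ where $P_1$ is the projection on the first component; that is, $\Delta_{\mathbb{R}^{m+1}}^{\frac{m-3}2}\mathcal{D}\circ S=HGCK\circ\gamma_m(\partial_{x_0}^{m-2},0)$ and $\overline{\mathcal{D}}\circ HGCK=GCK\circ\partial_{x_0}P_1$.
   Context: $\mathbb{R}_m$ is the real associative Clifford algebra generated by $e_1,\dots,e_m$ with $e_je_\ell+e_\ell e_j=-2\delta_{j\ell}$; points of $\mathbb{R}^{m+1}$ are paravectors $x=x_0+\underline{x}$, $\underline{x}=\sum_{j=1}^m x_je_j$, $r=|\underline{x}|$, $\underline{\omega}=\underline{x}/|\underline{x}|$. $\Delta_{\mathbb{R}^{m+1}}=\sum_{j=0}^m\partial_{x_j}^2$, $\partial_{\underline{x}}=\sum_{j=1}^me_j\partial_{x_j}$, $\mathcal{D}=\partial_{x_0}+\partial_{\underline{x}}$, $\overline{\mathcal{D}}=\partial_{x_0}-\partial_{\underline{x}}$. An intrinsic complex domain is an open connected subset of $\mathbb{C}$ that meets the real axis and is symmetric about it. A holomorphic $f=\alpha+i\beta$ on it is intrinsic if $\alpha(u,-v)=\alpha(u,v)$ and $\beta(u,-v)=-\beta(u,v)$ ($\alpha,\beta$ real-valued), equivalently $f|_{\mathbb{R}}$ is real-valued; $f(x_0+\underline{x})$ denotes $\alpha(x_0,r)+\underline{\omega}\beta(x_0,r)$. $\mathcal{A}(\Omega_1)$ is the space of real-valued analytic functions on $\Omega_1$ with a unique holomorphic extension to $\Omega_2$. The axially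 symmetric slice domain associated with $\Omega_2$ is $\Omega=\Omega_2\times\mathbb{S}^{m-1}=\{u+\underline{\omega}v:(u,v)\in\Omega_2,\ \underline{\omega}\in\mathbb{S}^{m-1}\}$, with $\mathbb{S}^{m-1}$ the unit sphere of 1-vectors. $S[f_0](x)=\sum_{j\ge0}\frac{\underline{x}^j}{j!}f_0^{(j)}(x_0)$ is the slice operator. $\mathcal{SM}(\Omega)$ is the module of slice monogenic functions: $f:\Omega\to\mathbb{R}_m$ with $(\partial_u+\underline{\omega}\partial_v)f(u+\underline{\omega}v)=0$ on $\Omega\cap\{u+v\underline{\omega}:u,v\in\mathbb{R}\}$ for every $\underline{\omega}\in\mathbb{S}^{m-1}$. $\mathcal{AH}(\Omega)$ (resp. $\mathcal{AM}(\Omega)$) is the set of real-analytic functions of the form $\alpha(x_0,r)+\underline{\omega}\beta(x_0,r)$, with $\alpha,\beta$ real-analytic and $\mathbb{R}_m$-valued, $\alpha$ even and $\beta$ odd in the second variable, lying in the kernel of $\Delta_{\mathbb{R}^{m+1}}$ (resp. of $\mathcal{D}$). The harmonic and monogenic generalized Cauchy–Kovalevskaya extensions are $$HGCK[A_0,A_1](x_0,\underline{x})=\Gamma\left(\tfrac m2\right)\left[\sum_{j\ge0}\frac{(-1)^j|\underline{x}|^{2j}A_0^{(2j)}(x_0)}{2^{2j}j!\,\Gamma(\frac m2+j)}+\frac m2\,\underline{x}\sum_{j\ge0}\frac{(-1)^j|\underline{x}|^{2j}A_1^{(2j)}(x_0)}{2^{2j}j!\,\Gamma(\frac m2+j+1)}\right],$$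 $$GCK[f_0](x_0,\underline{x})=\Gamma\left(\tfrac m2\right)\left[\sum_{j\ge0}\frac{(-1)^j|\underline{x}|^{2j}f_0^{(2j)}(x_0)}{2^{2j}j!\,\Gamma(\frac m2+j)}+\frac{\underline{x}}2\sum_{j\ge0}\frac{(-1)^j|\underline{x}|^{2j}f_0^{(2j+1)}(x_0)}{2^{2j}j!\,\Gamma(\frac m2+j+1)}\right].$$
   Formalization: The lower square is stated only for A_1=0 (it fails for HGCK[0,1]); HGCK, GCK map into AH(Ω), AM(Ω) only if intrinsic holomorphic functions on Ω_2 have intrinsic primitives (fails on an annulus); S, HGCK, GCK on Ω mean the unique extension of the series, which may diverge. *)

(* Defs.v *)
From HB Require Import structures.
From mathcomp Require Import all_boot all_order all_algebra.
From mathcomp Require Export complex.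
From mathcomp Require Import all_classical all_reals all_analysis.

Set Implicit Arguments.
Unset Strict Implicit.
Unset Printing Implicit Defensive.

Import Order.TTheory GRing.Theory Num.Theory numFieldNormedType.Exports.

Local Open Scope classical_set_scope.
Local Open Scope ring_scope.
Local Open Scope complex_scope.

(* The Clifford algebra R_m in the basis e_A (A a set of indices), where
   e_A is the product of the e_i, i in A, in increasing order. *)
Section CliffordAlgebra.
Variables (R : comNzRingType) (m : nat).

Definition clifford := {ffun {set 'I_m} -> R}.

HB.instance Definition _ := GRing.Zmodule.copy clifford {ffun {set 'I_m} -> R}.

Definition symdiff (A B : {set 'I_m}) : {set 'I_m} :=
  [set i | (i \in A) (+) (i \in B)].

(* e_A e_B = cl_sign A B e_(A symdiff B): reordering e_A e_B costs a factor
   -1 for each pair (i, j) in A x B with j < i, and e_i ^+ 2 = -1 costs a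
   further -1 for each i in both A and B. *)
Definition cl_sign (A B : {set 'I_m}) : R :=
  \prod_(i in A) \prod_(j in B | (j <= i)%N) -1.

Definition cl_one : clifford := [ffun A => (A == finset.set0)%:R].

Definition cl_mul (a b : clifford) : clifford :=
  [ffun C => \sum_(A : {set 'I_m})
     cl_sign A (symdiff A C) * (a A * b (symdiff A C))].

Definition cl_scale (k : R) (a : clifford) : clifford := [ffun A => k * a A].

Let symdiffA : associative symdiff.
Proof. by move=> A B C; apply/setP=> i; rewrite !inE addbA. Qed.

Let symdiffK A : involutive (symdiff A).
Proof. by move=> B; apply/setP=> i; rewrite !inE addbA addbb addFb. Qed.

Let symdiffAA A : symdiff A A = finset.set0.
Proof. by apply/setP=> i; rewrite !inE addbb. Qed.

Let symdiff0 A : symdiff A finset.set0 = A.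
Proof. by apply/setP=> i; rewrite !inE addbF. Qed.

Let symdiff0l A : symdiff finset.set0 A = A.
Proof. by apply/setP=> i; rewrite !inE. Qed.

Let prod_symdiff (P : pred 'I_m) (f : 'I_m -> R) A B :
  (forall i, f i * f i = 1) ->
  \prod_(i in symdiff A B | P i) f i =
  \prod_(i in A | P i) f i * \prod_(i in B | P i) f i.
Proof.
move=> f1; rewrite !(big_mkcondl _ _ _ P) -big_split; apply: eq_bigr => i _.
by rewrite inE; do 2 case: (i \in _); rewrite /= ?f1 ?mulr1 ?mul1r.
Qed.

Let sqr_prodN1 (P : pred 'I_m) :
  \prod_(j | P j) (-1 : R) * \prod_(j | P j) -1 = 1.
Proof. by rewrite -big_split big1 // => i _; rewrite /= mulrNN mulr1. Qed.

Let cl_signDl A B C : cl_sign (symdiff A B) C = cl_sign A C * cl_sign B C.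
Proof.
have := @prod_symdiff predT (fun i => \prod_(j in C | (j <= i)%N) -1) A B.
rewrite /cl_sign => /(_ (fun i => sqr_prodN1 _)).
by rewrite !(eq_bigl _ _ (fun i => andbT _)).
Qed.

Let cl_signDr A B C : cl_sign A (symdiff B C) = cl_sign A B * cl_sign A C.
Proof.
rewrite /cl_sign -big_split; apply: eq_bigr => i _ /=.
by apply: prod_symdiff => j; rewrite mulrNN mulr1.
Qed.

Let cl_mulA : associative cl_mul.
Proof.
move=> a b c; apply/ffunP => D; rewrite !ffunE.
under eq_bigr => A _ do rewrite ffunE !mulr_sumr.
under [RHS]eq_bigr => E _ do rewrite ffunE mulr_suml mulr_sumr.
rewrite [RHS]exchange_big; apply: eq_bigr => A _ /=.
rewrite [RHS](reindex_inj (inv_inj (@symdiffK A))); apply: eq_bigr => B _ /=.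
set C := symdiff B (symdiff A D).
have -> : symdiff A D = symdiff B C by rewrite /C symdiffK.
have -> : symdiff (symdiff A B) D = C.
  by rewrite /C; apply/setP=> i; rewrite !inE addbCA addbA.
rewrite symdiffK cl_signDr cl_signDl -!mulrA [LHS]mulrCA; congr (_ * _).
by rewrite [RHS]mulrCA; congr (_ * _); rewrite mulrCA.
Qed.

Let cl_mul1l : left_id cl_one cl_mul.
Proof.
move=> a; apply/ffunP => C; rewrite !ffunE (bigD1 finset.set0) //= big1.
  by rewrite ffunE eqxx symdiff0l /cl_sign big_set0 addr0 !mul1r.
by move=> A A0; rewrite ffunE (negbTE A0) mul0r mulr0.
Qed.

Let cl_mul1r : right_id cl_one cl_mul.
Proof.
move=> a; apply/ffunP => C; rewrite !ffunE (bigD1 C) //= big1.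
  rewrite ffunE symdiffAA eqxx mulr1 addr0 /cl_sign big1 ?mul1r // => i _.
  by rewrite big1 // => j; rewrite inE.
move=> A AC; rewrite ffunE; case: eqP => [AC0|_]; last by rewrite !mulr0.
by move: AC; rewrite -(symdiffK A C) AC0 symdiff0 eqxx.
Qed.

Let cl_mulDl : left_distributive cl_mul +%R.
Proof.
move=> a b c; apply/ffunP => C; rewrite !ffunE -big_split.
by apply: eq_bigr => A _; rewrite ffunE mulrDl mulrDr.
Qed.

Let cl_mulDr : right_distributive cl_mul +%R.
Proof.
move=> a b c; apply/ffunP => C; rewrite !ffunE -big_split.
by apply: eq_bigr => A _; rewrite ffunE !mulrDr.
Qed.

Let cl_one_neq0 : cl_one != 0.
Proof.
apply/eqP => /ffunP/(_ finset.set0)/eqP.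
by rewrite !ffunE eqxx oner_eq0.
Qed.

HB.instance Definition _ := GRing.Zmodule_isNzRing.Build clifford
  cl_mulA cl_mul1l cl_mul1r cl_mulDl cl_mulDr cl_one_neq0.

Let cl_scaleA a b v : cl_scale a (cl_scale b v) = cl_scale (a * b) v.
Proof. by apply/ffunP=> A; rewrite !ffunE mulrA. Qed.

Let cl_scale1 : left_id 1 cl_scale.
Proof. by move=> v; apply/ffunP=> A; rewrite !ffunE mul1r. Qed.

Let cl_scaleDr : right_distributive cl_scale +%R.
Proof. by move=> k u v; apply/ffunP=> A; rewrite !ffunE mulrDr. Qed.

Let cl_scaleDl v : {morph cl_scale^~ v : a b / a + b}.
Proof. by move=> a b; apply/ffunP=> A; rewrite !ffunE mulrDl. Qed.

HB.instance Definition _ := GRing.Zmodule_isLmodule.Build R clifford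
  cl_scaleA cl_scale1 cl_scaleDr cl_scaleDl.

Let cl_scaleAl (k : R) (u v : clifford) : k *: (u * v) = (k *: u) * v.
Proof.
apply/ffunP=> C; rewrite !ffunE mulr_sumr; apply: eq_bigr => A _.
by rewrite ffunE !mulrA (mulrC k).
Qed.

HB.instance Definition _ :=
  GRing.Lmodule_isLalgebra.Build R clifford cl_scaleAl.

Let cl_scaleAr (k : R) (u v : clifford) : k *: (u * v) = u * (k *: v).
Proof.
apply/ffunP=> C; rewrite !ffunE mulr_sumr; apply: eq_bigr => A _.
by rewrite ffunE mulrCA; congr (_ * _); rewrite mulrCA.
Qed.

HB.instance Definition _ :=
  GRing.Lalgebra_isAlgebra.Build R clifford cl_scaleAr.

Definition cl_basis (A : {set 'I_m}) : clifford := [ffun B => (B == A)%:R].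

Definition cl_gen (j : 'I_m) : clifford := cl_basis [set j]%SET.

Lemma cl_basisM A B :
  cl_basis A * cl_basis B = cl_sign A B *: cl_basis (symdiff A B).
Proof.
apply/ffunP => C; rewrite !ffunE (bigD1 A) //= big1.
  rewrite !ffunE eqxx mul1r addr0.
  case: (eqVneq C (symdiff A B)) => [->|CAB]; first by rewrite symdiffK eqxx.
  case: eqP => [CB|_]; last by rewrite !mulr0.
  by move: CAB; rewrite -CB symdiffK eqxx.
by move=> E /negbTE EA; rewrite ffunE EA mul0r mulr0.
Qed.

Lemma cl_gen_anticomm j l :
  cl_gen j * cl_gen l + cl_gen l * cl_gen j = - ((j == l)%:R *+ 2).
Proof.
have sE (a b : 'I_m) : cl_sign [set a]%SET [set b]%SET
    = if (b <= a)%N then -1 else 1.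
  rewrite /cl_sign big_set1; case: ifPn => ba.
    rewrite (big_pred1 b) // => i; rewrite !inE.
    by case: eqVneq => // ->.
  by rewrite big1 // => i; rewrite !inE => /andP[/eqP->]; rewrite (negbTE ba).
rewrite !cl_basisM !sE; have -> : symdiff [set l]%SET [set j]%SET
    = symdiff [set j]%SET [set l]%SET.
  by apply/setP=> i; rewrite !inE addbC.
case: eqVneq => [->|jl].
  rewrite leqnn symdiffAA -scalerDl -opprD scaleNr; congr (- _).
  by rewrite -mulr2n scaler_nat; congr (_ *+ 2); apply/ffunP=> B; rewrite !ffunE.
rewrite mul0rn oppr0 -scalerDl.
have : nat_of_ord j != l by [].
by case: ltngtP => // _ _; rewrite ?subrr ?addNr scale0r.
Qed.

End CliffordAlgebra.

Section Definitions.
Variables (R : realType) (m : nat).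

Local Notation C := (R[i]^o).
Local Notation Cl := (clifford R m).
Local Notation point := 'rV[R]_m.+1.

Definition Gamma (x : R) : R :=
  \int[lebesgue_measure]_(t in `]0, +oo[) (t `^ (x - 1) * expR (- t)).

Definition gamma_const : R :=
  (-1) ^+ (m.-1)./2 * 2 ^+ m.-1 / (m.-1)`!%:R * Gamma (m.+1%:R / 2) ^+ 2.

(** Paravectors: x = x_0 + sum_j x_j e_j is the row vector (x_0, ..., x_m). *)

Definition sc (x : point) : R := x ord0 ord0.

Definition vc (x : point) : 'rV[R]_m := \row_j x ord0 (lift ord0 j).

Definition mkpoint (u : R) (w : 'rV[R]_m) : point :=
  \row_i (if unlift ord0 i is Some j then w ord0 j else u).

(* The norm carried by 'rV[R]_m in the library is the sup norm. *)
Definition enorm (w : 'rV[R]_m) : R := Num.sqrt (\sum_j w ord0 j ^+ 2).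

Definition onevec (w : 'rV[R]_m) : Cl := \sum_j w ord0 j *: cl_gen R j.

Definition cl_derive (n : nat) (F : R -> Cl) (t : R) : Cl :=
  [ffun A => derive1n n (fun s => F s A) t].

Definition partial (i : 'I_m.+1) (g : point -> Cl) (x : point) : Cl :=
  [ffun A => 'D_(delta_mx ord0 i) (fun y => g y A) x].

Definition Dvec (g : point -> Cl) (x : point) : Cl :=
  \sum_(j < m) cl_gen R j * partial (lift ord0 j) g x.

Definition Dop (g : point -> Cl) (x : point) : Cl :=
  partial ord0 g x + Dvec g x.

Definition Dbar (g : point -> Cl) (x : point) : Cl :=
  partial ord0 g x - Dvec g x.

Definition laplacian (g : point -> Cl) (x : point) : Cl :=
  \sum_(i < m.+1) partial i (partial i g) x.

Definition lapD : (point -> Cl) -> point -> Cl :=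
  fun g => iter (m - 3)./2 laplacian (Dop g).

Definition intrinsic_domain (Om2 : set C) : Prop :=
  [/\ open Om2, connected Om2, (exists t : R, Om2 t%:C) &
      forall z, Om2 z -> Om2 (conjc z)].

Definition real_trace (Om2 : set C) : set R := [set t | Om2 t%:C].

Definition slice_domain (Om2 : set C) : set point :=
  [set x | exists u v w,
     [/\ Om2 (u +i* v), enorm w = 1 & x = mkpoint u (v *: w)]].

(* The z = u + iv such that Om2 contains an open disc centred at the real
   point u of radius larger than |v|: over this set the Taylor-type series at
   u that define the extension operators below converge. *)
Definition taylor_core (Om2 : set C) : set C :=
  [set z | exists rho : R, `|complex.Im z| < rho /\
     forall w : C, `|w - (complex.Re z)%:C| < rho%:C -> Om2 w].

Definition holomorphic_on (Om2 : set C) (f : C -> C) : Prop :=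
  forall z, Om2 z -> derivable f z 1.

Definition intrinsic_holomorphic (Om2 : set C) (f : C -> C) : Prop :=
  holomorphic_on Om2 f /\
  forall u v : R, Om2 (u +i* v) ->
    complex.Re (f (u -i* v)) = complex.Re (f (u +i* v)) /\
    complex.Im (f (u -i* v)) = - complex.Im (f (u +i* v)).

Definition intrinsic_primitives (Om2 : set C) : Prop :=
  forall f, intrinsic_holomorphic Om2 f ->
    exists F, intrinsic_holomorphic Om2 F /\
      forall z, Om2 z -> derive1 F z = f z.

(* alpha(x_0, r) + omega beta(x_0, r); omega is read as 0 when r = 0, where
   beta vanishes, being odd. *)
Definition axial (alpha beta : R -> R -> Cl) (x : point) : Cl :=
  let r := enorm (vc x) in
  alpha (sc x) r + (r^-1 *: onevec (vc x)) * beta (sc x) r.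

Definition slice_fun (f : C -> C) : point -> Cl :=
  axial (fun u v => (complex.Re (f (u +i* v)))%:A)
        (fun u v => (complex.Im (f (u +i* v)))%:A).

(** Real-analytic functions: near a, the function is the sum of an absolutely
    convergent power series in n variables. *)

Definition monomial n (h : 'rV[R]_n) (nu : 'I_n -> nat) : R :=
  \prod_i h ord0 i ^+ nu i.

Definition analytic_at n (f : 'rV[R]_n -> R) (a : 'rV[R]_n) : Prop :=
  exists (c : ('I_n -> nat) -> R) (rho : R), 0 < rho /\
    forall h : 'rV[R]_n, (forall i, `|h ord0 i| < rho) ->
      let term nu := c nu * monomial h nu in
      (exists M : R, forall N : nat,
         \sum_(nu : {ffun 'I_n -> 'I_N}) `|term (fun i => nu i)| <= M) /\
      (fun N : nat => \sum_(nu : {ffun 'I_n -> 'I_N}) term (fun i => nu i))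
        @ \oo --> f (a + h).

Definition cl_analytic_at n (f : 'rV[R]_n -> Cl) (a : 'rV[R]_n) : Prop :=
  forall A, analytic_at (fun x => f x A) a.

(* A(Omega_1); a function on Omega_1 is given by a total function whose values
   outside Omega_1 are irrelevant. *)
Definition calA (Om2 : set C) (a : R -> R) : Prop :=
  let extends (F : C -> C) := holomorphic_on Om2 F /\
    forall t, real_trace Om2 t -> F t%:C = (a t)%:C in
  (forall t, real_trace Om2 t ->
     analytic_at (fun p : 'rV[R]_1 => a (p ord0 ord0)) (const_mx t)) /\
  exists F, extends F /\
    forall G, extends G -> forall z, Om2 z -> G z = F z.

Definition calA_Cl (Om2 : set C) (f0 : R -> Cl) : Prop :=
  forall A, calA Om2 (fun t => f0 t A).

Definition SM (Om2 : set C) (g : point -> Cl) : Prop :=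
  (forall x, slice_domain Om2 x ->
     forall A, differentiable (fun y => g y A) x) /\
  forall (w : 'rV[R]_m) (u v : R), enorm w = 1 ->
    slice_domain Om2 (mkpoint u (v *: w)) ->
    cl_derive 1 (fun s => g (mkpoint s (v *: w))) u +
    onevec w * cl_derive 1 (fun t => g (mkpoint u (t *: w))) v = 0.

Definition axial_analytic (Om2 : set C) (g : point -> Cl) : Prop :=
  (forall x, slice_domain Om2 x -> cl_analytic_at g x) /\
  exists alpha beta : R -> R -> Cl,
    [/\ forall u v, Om2 (u +i* v) ->
          cl_analytic_at (fun p : 'rV[R]_2 => alpha (p ord0 ord0) (p ord0 ord_max))
            (\row_i (if i == ord0 then u else v)),
        forall u v, Om2 (u +i* v) ->
          cl_analytic_at (fun p : 'rV[R]_2 => beta (p ord0 ord0) (p ord0 ord_max))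
            (\row_i (if i == ord0 then u else v)),
        forall u v, Om2 (u +i* v) ->
          alpha u (- v) = alpha u v /\ beta u (- v) = - beta u v &
        forall x, slice_domain Om2 x -> g x = axial alpha beta x].

Definition AH (Om2 : set C) (g : point -> Cl) : Prop :=
  axial_analytic Om2 g /\ forall x, slice_domain Om2 x -> laplacian g x = 0.

Definition AM (Om2 : set C) (g : point -> Cl) : Prop :=
  axial_analytic Om2 g /\ forall x, slice_domain Om2 x -> Dop g x = 0.

(** Pointwise sums of the defining series: X_sum ... x s says that the series
    converge at x and that the resulting value is s. *)

Definition cl_sum (u : nat -> Cl) (s : Cl) : Prop :=
  forall A, series (fun j => u j A) @ \oo --> s A.

Definition S_sum (f0 : R -> Cl) (x : point) (s : Cl) : Prop :=
  cl_sum (fun j => j`!%:R^-1 *: (onevec (vc x) ^+ j * cl_derive j f0 (sc x))) s.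

Definition HGCK_sum (A0 A1 : R -> Cl) (x : point) (s : Cl) : Prop :=
  let r := enorm (vc x) in
  exists s0 s1 : Cl,
  [/\ cl_sum (fun j =>
        ((-1) ^+ j * r ^+ (2 * j) /
         (2 ^+ (2 * j) * j`!%:R * Gamma (m%:R / 2 + j%:R)))
        *: cl_derive (2 * j) A0 (sc x)) s0,
      cl_sum (fun j =>
        ((-1) ^+ j * r ^+ (2 * j) /
         (2 ^+ (2 * j) * j`!%:R * Gamma (m%:R / 2 + j%:R + 1)))
        *: cl_derive (2 * j) A1 (sc x)) s1 &
      s = Gamma (m%:R / 2) *: (s0 + (m%:R / 2) *: (onevec (vc x) * s1))].

Definition GCK_sum (f0 : R -> Cl) (x : point) (s : Cl) : Prop :=
  let r := enorm (vc x) in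
  exists s0 s1 : Cl,
  [/\ cl_sum (fun j =>
        ((-1) ^+ j * r ^+ (2 * j) /
         (2 ^+ (2 * j) * j`!%:R * Gamma (m%:R / 2 + j%:R)))
        *: cl_derive (2 * j) f0 (sc x)) s0,
      cl_sum (fun j =>
        ((-1) ^+ j * r ^+ (2 * j) /
         (2 ^+ (2 * j) * j`!%:R * Gamma (m%:R / 2 + j%:R + 1)))
        *: cl_derive (2 * j + 1) f0 (sc x)) s1 &
      s = Gamma (m%:R / 2) *: (s0 + 2^-1 *: (onevec (vc x) * s1))].

(** The operators as function-valued maps. The series do not converge on all of
    Omega in general (already when Omega_2 is a disc): they converge where the
    Taylor discs fit in Omega_2, and near_HGCK, near_GCK describe their sums
    there. S[f0], HGCK[A0, A1], GCK[f0] as functions on Omega are the elements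
    of SM(Omega), AH(Omega), AM(Omega) extending these sums. *)

Definition near_HGCK (Om2 : set C) (A0 A1 : R -> Cl) (g : point -> Cl) : Prop :=
  AH (taylor_core Om2) g /\
  forall x, slice_domain (taylor_core Om2) x -> HGCK_sum A0 A1 x (g x).

Definition near_GCK (Om2 : set C) (f0 : R -> Cl) (g : point -> Cl) : Prop :=
  AM (taylor_core Om2) g /\
  forall x, slice_domain (taylor_core Om2) x -> GCK_sum f0 x (g x).

Definition is_S (Om2 : set C) (f0 : R -> Cl) (g : point -> Cl) : Prop :=
  SM Om2 g /\
  forall x, slice_domain (taylor_core Om2) x -> S_sum f0 x (g x).

Definition is_HGCK (Om2 : set C) (A0 A1 : R -> Cl) (g : point -> Cl) : Prop :=
  AH Om2 g /\
  forall x, slice_domain (taylor_core Om2) x -> HGCK_sum A0 A1 x (g x).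

Definition is_GCK (Om2 : set C) (f0 : R -> Cl) (g : point -> Cl) : Prop :=
  AM Om2 g /\
  forall x, slice_domain (taylor_core Om2) x -> GCK_sum f0 x (g x).

End Definitions.

Arguments slice_domain {R} m Om2.
Arguments slice_fun {R} m f.

(* Main.v *)
(* Componentwise, a slice monogenic function is the slice function of a family
   of intrinsic holomorphic functions f. Put T_k f = (v^-1 d/dv)^k (v^-1 Im f).
   Off the real axis D maps the slice function of f to -(m-1) T_0 f, and the
   Laplacian maps T_k f to (m-2k-3) T_(k+1) f; so, for m = 2n+3, Delta^n D
   is a constant times T_n f, and by continuity this also holds on the axis.
   Expanding T_n f in powers of v at a real point gives, once the Gamma
   factors are matched, the series HGCK[gamma_m f^(m-2), 0]; applying -m Dvec to
   such a function gives HGCK[0, gamma_m f^(m)], and applying Dbar gives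
   GCK[gamma_m f^(m-1)]. Hence the extensions of given data are built from
   iterated primitives, which always exist on discs, and the solutions over discs
   agree where they overlap, being sums of the same series. Uniqueness on Omega is
   the identity theorem on the planes spanned by 1 and a unit 1-vector.
   Holomorphic functions are expanded in Taylor series without Cauchy's formula:
   by Goursat's argument in polar coordinates the circle means of
   f(zeta) zeta^-k do not depend on the radius, and Bessel's inequality for the
   difference quotient of f at z makes the remainder at z tend to 0. *)

Require Import Defs.
From mathcomp Require Import all_boot all_order all_algebra.
From mathcomp Require Import all_classical all_reals all_analysis.
From mathcomp Require Import measurable_realfun.
From mathcomp Require Import ring lra zify.
Import Order.TTheory GRing.Theory Num.Theory numFieldNormedType.Exports.
Set Implicit Arguments.
Unset Strict Implicit.
Unset Printing Implicit Defensive.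
Local Open Scope classical_set_scope.
Local Open Scope ring_scope.
Local Open Scope complex_scope.

(** * Unordered sums *)

Section UnorderedSums.
Variable R : realType.

(** The radius [enorm (vc x)] is not differentiable on the real axis, so every operator is computed
    where [vc x != 0]. Passing to the axis by continuity presupposes that both sides are analytic
    there; this holds because the Taylor coefficients of an intrinsic function at a real point are
    real, which makes $\mathrm{Re} f$ and $v^{-1}\mathrm{Im} f$ power series in $v^2$, that is in
    the polynomial $|\underline{x}|^2$. The orders of the primitives are dictated by the data: [A0]
    must be a constant times $f^{(m-2)}$, [A1] a constant times $k^{(m)}$, and [f0] a constant times
    $f^{(m-1)}$. On a domain with holes such functions need not exist: on $\mathbb{C}$ minus the
    points $\pm i$ the intrinsic function $z/(z^2+1)$ has no primitive. Hence extensions to all of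
    $\Omega$ are asserted under [intrinsic_primitives], whereas the sums over [taylor_core] are
    obtained disc by disc. The squares of the diagram need no primitive on the domain: the data of
    the upper one are derivatives already, and the lower one is local. *)

Definition bsum (I : eqType) (f : I -> R) (M : R) :=
  forall s : seq I, uniq s -> \sum_(i <- s) `|f i| <= M.

(** Convergence along the net of finite subsets, encoded by duplicate-free lists. No enumeration of
    the index type is chosen, so multi-indices, pairs and fibres can be summed in any order. *)
Definition hsum (I : eqType) (f : I -> R) (S : R) :=
  forall e : R, 0 < e -> exists s0 : seq I, forall s, uniq s ->
    {subset s0 <= s} -> `|\sum_(i <- s) f i - S| <= e.

Section Basics.
Variable I : eqType.
Implicit Types (f g : I -> R).

Lemma hsum_uniq f S S' : hsum f S -> hsum f S' -> S = S'.
Proof.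
move=> h h'; apply/eqP/negPn/negP => d0.
have d1 : 0 < `|S - S'| by rewrite normr_gt0 subr_eq0.
have e0 : 0 < `|S - S'| / 4 by rewrite divr_gt0.
have [s0 h0] := h _ e0; have [s1 h1] := h' _ e0.
have H2 := h0 (undup (s0 ++ s1)) (undup_uniq _).
have H1 := h1 (undup (s0 ++ s1)) (undup_uniq _).
move: H1 H2; set T := \sum_(i <- _) _ => H1 H2.
have {}H1 : `|T - S'| <= `|S - S'| / 4.
  by apply: H1 => x xs; rewrite mem_undup mem_cat xs orbT.
have {}H2 : `|T - S| <= `|S - S'| / 4.
  by apply: H2 => x xs; rewrite mem_undup mem_cat xs.
have : `|S - S'| <= `|T - S'| + `|T - S|.
  have -> : S - S' = (T - S') - (T - S) by ring.
  exact: ler_normB.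
by move=> H3; lra.
Qed.

Lemma hsumD f g S T : hsum f S -> hsum g T -> hsum (fun i => f i + g i) (S + T).
Proof.
move=> h h' e e0; have e2 : 0 < e / 2 by rewrite divr_gt0.
have [s0 h0] := h _ e2; have [s1 h1] := h' _ e2.
exists (s0 ++ s1) => s us ss; rewrite big_split /=.
have H1 : `|\sum_(i <- s) g i - T| <= e / 2.
  by apply: h1 => // x xs; apply: ss; rewrite mem_cat xs orbT.
have H2 : `|\sum_(i <- s) f i - S| <= e / 2.
  by apply: h0 => // x xs; apply: ss; rewrite mem_cat xs.
by rewrite opprD addrACA (le_trans (ler_normD _ _)) //; lra.
Qed.

Lemma hsumZ f S k : hsum f S -> hsum (fun i => k * f i) (k * S).
Proof.
move=> h e e0; have k0 : 0 < `|k| + 1 by rewrite ltr_wpDl.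
have [s0 h0] := h _ (divr_gt0 e0 k0); exists s0 => s us ss.
rewrite -mulr_sumr -mulrBr normrM.
apply: le_trans (ler_wpM2l (normr_ge0 _) (h0 s us ss)) _.
rewrite mulrCA ger_pMr // ler_pdivrMr // mul1r.
by rewrite lerDl.
Qed.

Lemma hsum0 : hsum (fun=> 0 : R) (0 : R) (I := I).
Proof. by move=> e e0; exists [::] => s _ _; rewrite big1 // subr0 normr0 ltW. Qed.

Lemma hsumN f S : hsum f S -> hsum (fun i => - f i) (- S).
Proof.
by move/(@hsumZ _ _ (-1)); rewrite mulN1r; congr hsum; apply/funext => i;
  rewrite mulN1r.
Qed.

Lemma hsum_sum (J : Type) (s : seq J) (f : J -> I -> R) S :
  (forall j, hsum (f j) (S j)) ->
  hsum (fun i => \sum_(j <- s) f j i) (\sum_(j <- s) S j).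
Proof.
move=> h; elim: s => [|j s IH].
  by rewrite big_nil; have := hsum0; congr hsum; apply/funext => i; rewrite big_nil.
rewrite big_cons; have := hsumD (h j) IH.
by congr hsum; apply/funext => i; rewrite big_cons.
Qed.

Lemma le_sum_subset f (s s' : seq I) : (forall i, 0 <= f i) -> uniq s ->
  {subset s <= s'} -> \sum_(i <- s) f i <= \sum_(i <- s') f i.
Proof.
move=> f0; elim: s s' => [|x s IH] s' /=; first by rewrite big_nil sumr_ge0.
move=> /andP[xs us] ss; have xs' := ss x (mem_head _ _).
rewrite big_cons (perm_big _ (perm_to_rem xs')) big_cons lerD2l IH // => y ys.
have := ss y; rewrite inE ys orbT => /(_ isT).
rewrite (perm_mem (perm_to_rem xs')) inE => /predU1P[yx|//].
by rewrite yx (negbTE xs) in ys.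
Qed.

Lemma bsum_ge0 f M : bsum f M -> 0 <= M.
Proof. by move/(_ [::] isT); rewrite big_nil. Qed.

Lemma bsum_pt f M i : bsum f M -> `|f i| <= M.
Proof. by move/(_ [:: i] isT); rewrite big_seq1. Qed.

Lemma le_bsum f g M : (forall i, `|f i| <= `|g i|) -> bsum g M -> bsum f M.
Proof. by move=> fg h s us; apply: le_trans (h s us); apply: ler_sum => i _. Qed.

Lemma bsumZ f M k : bsum f M -> bsum (fun i => k * f i) (`|k| * M).
Proof.
move=> h s us; under eq_bigr do rewrite normrM.
by rewrite -mulr_sumr ler_wpM2l // h.
Qed.

Lemma bsumD f g M N : bsum f M -> bsum g N -> bsum (fun i => f i + g i) (M + N).
Proof.
move=> h h' s us; apply: le_trans (lerD (h s us) (h' s us)).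
by rewrite -big_split; apply: ler_sum => i _; exact: ler_normD.
Qed.

Lemma hsum_le f S M : bsum f M -> hsum f S -> `|S| <= M.
Proof.
move=> b h; apply/ler_addgt0Pr => e e0; have [s0 h0] := h _ e0.
have := h0 (undup s0) (undup_uniq _).
set T := \sum_(i <- _) _ => H.
have {}H : `|T - S| <= e by apply: H => x; rewrite mem_undup.
have -> : S = T - (T - S) by ring.
apply: le_trans (ler_normB _ _) _; apply: lerD => //.
by apply: le_trans (ler_norm_sum _ _ _) _; exact: b (undup_uniq _).
Qed.

(** A nonnegative family sums to the supremum of its finite sums; a general one is the difference of
    the nonnegative families [|f| + f] and [|f|]. *)
Lemma bsum_hsum f M : bsum f M -> exists S, hsum f S.
Proof.
have pos g N : (forall i, 0 <= g i) -> bsum g N -> exists S, hsum g S.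
  move=> g0 b; pose E := [set x | exists2 s : seq I, uniq s & x = \sum_(i <- s) g i].
  have hsE : has_sup E.
    split; first by exists 0, [::]; rewrite ?big_nil.
    exists N => _ [s us ->]; apply: le_trans (b s us).
    by apply: ler_sum => i _; rewrite ger0_norm.
  exists (sup E) => e e0; have [_ [s0 us0 ->] hs0] := sup_adherent e0 hsE.
  exists s0 => s us ss; have h1 := le_sum_subset g0 us0 ss.
  have h2 : \sum_(i <- s) g i <= sup E by apply: sup_upper_bound => //; exists s.
  by rewrite ler_norml; lra.
move=> b; have [S1 h1] : exists S, hsum (fun i => `|f i| + f i) S.
  apply: (pos _ (M + M)); last first.
    by apply: bsumD => //; apply: le_bsum b => i; rewrite normr_id.
  by move=> i; rewrite -lerBlDr sub0r -normrN ler_norm.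
have [S2 h2] : exists S, hsum (fun i => `|f i|) S.
  by apply: (pos _ M) => //; apply: le_bsum b => i; rewrite normr_id.
exists (S1 - S2); have := hsumD h1 (hsumN h2).
by congr hsum; apply/funext => i; rewrite addrAC subrr add0r.
Qed.

Lemma hsum1 (x : I) (k : R) : hsum (fun i => if i == x then k else 0) k.
Proof.
move=> e e0; exists [:: x] => s us ss.
have xs : x \in s by apply: ss; rewrite mem_head.
rewrite (bigD1_seq x) //= eqxx big1 ?addr0 ?subrr ?normr0 ?ltW // => i /negbTE ->.
by [].
Qed.

End Basics.

Lemma hsum_fiber (I J : eqType) (p : I -> J) (f : I -> R) S (t : J -> R) :
  hsum f S -> (forall j, hsum (fun i => if p i == j then f i else 0) (t j)) ->
  hsum t S.
Proof.
move=> h hj e e0; have e2 : 0 < e / 2 by rewrite divr_gt0.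
have [s0 h0] := h _ e2; exists (map p s0) => sJ uJ ssJ.
have [s1 h1] := hsum_sum sJ hj e2.
(* One finite set serves both approximations: its part over [sJ] sums nearly to [S], and summed
   fibre by fibre it is near the sum of the [t j]. *)
pose s' := undup (s0 ++ s1).
have {}h1 : `|\sum_(i <- s') \sum_(j <- sJ) (if p i == j then f i else 0)
             - \sum_(j <- sJ) t j| <= e / 2.
  by apply: h1; rewrite ?undup_uniq // => x xs; rewrite mem_undup mem_cat xs orbT.
have {}h0 : `|\sum_(i <- [seq i <- s' | p i \in sJ]) f i - S| <= e / 2.
  apply: h0; first by rewrite filter_uniq ?undup_uniq.
  move=> x xs; rewrite mem_filter mem_undup mem_cat xs andbT.
  by rewrite ssJ // map_f.
move: h1; have -> : \sum_(i <- s') \sum_(j <- sJ) (if p i == j then f i else 0)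
    = \sum_(i <- [seq i <- s' | p i \in sJ]) f i.
  rewrite big_filter [RHS]big_mkcond; apply: eq_bigr => i _.
  case: ifPn => pi; last first.
    rewrite big_seq big1 // => j jJ; case: eqP => // pj.
    by move: pi; rewrite pj jJ.
  rewrite (bigD1_seq (p i)) //= eqxx big1 ?addr0 // => j /negbTE jp.
  by rewrite eq_sym jp.
move: h0; set T := \sum_(i <- [seq _ <- _ | _]) _ => h0 h1.
have -> : \sum_(j <- sJ) t j - S = (T - S) - (T - \sum_(j <- sJ) t j) by ring.
by apply: le_trans (ler_normB _ _) _; lra.
Qed.

Lemma hsum_push (I J : eqType) (e : I -> J) (f : I -> R) (t : J -> R) S :
  injective e -> (forall i, t (e i) = f i) ->
  (forall j, (forall i, e i <> j) -> t j = 0) ->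
  hsum f S -> hsum t S.
Proof.
move=> einj te t0 h; apply: (hsum_fiber (p := e) h) => j.
have [[i ij]|nij] := pselect (exists i, e i = j).
  have := hsum1 i (t j); congr hsum; apply/funext => i'.
  rewrite -ij te; case: eqVneq => [->|ii]; first by rewrite eqxx.
  by case: eqP => // /einj/eqP; rewrite (negbTE ii).
rewrite t0; last by move=> i ij; apply: nij; exists i.
have := hsum0 I; congr hsum; apply/funext => i.
by case: eqP => // ij; case: nij; exists i.
Qed.

Lemma bsum_push (I J : eqType) (e : I -> J) (f : I -> R) (t : J -> R) M :
  injective e -> (forall i, t (e i) = f i) ->
  (forall j, (forall i, e i <> j) -> t j = 0) ->
  bsum f M -> bsum t M.
Proof.
move=> einj te t0 b s us.
have [s' [us' ss']] : exists s' : seq I, uniq s' /\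
    [seq j <- s | `[< exists i, e i = j >]] = map e s'.
  elim: s us => [_|j s IH /= /andP[js us]]; first by exists [::].
  have [s' [us' ss']] := IH us; case: asboolP => [[i ij]|_]; last by exists s'.
  exists (i :: s'); rewrite /= ij ss' us' andbT; split=> //.
  apply/negP => is'; move: js; rewrite -ij.
  have : e i \in map e s' by rewrite map_f.
  by rewrite -ss' mem_filter => /andP[_ ->].
rewrite (bigID (fun j => `[< exists i, e i = j >])) /= -big_filter ss' big_map.
rewrite [X in _ + X]big1 ?addr0.
  by under eq_bigr do rewrite te; exact: b.
by move=> j /asboolPn nj; rewrite t0 ?normr0 // => i ij; apply: nj; exists i.
Qed.

Lemma bsum_pair (I J : eqType) (F : I -> J -> R) (b : I -> R) B :
  (forall i, bsum (F i) (b i)) -> bsum b B ->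
  bsum (fun x : I * J => F x.1 x.2) B.
Proof.
move=> hb hB s us.
have -> : \sum_(x <- s) `|F x.1 x.2| =
    \sum_(i <- undup (map fst s)) \sum_(x <- s | x.1 == i) `|F x.1 x.2|.
  rewrite [RHS](exchange_big_dep predT) // big_seq [RHS]big_seq.
  apply: eq_bigr => x xs.
  rewrite -big_filter (_ : [seq _ <- _ | _] = [:: x.1]) ?big_seq1 //.
  apply: perm_small_eq => //; apply: uniq_perm; rewrite ?filter_uniq ?undup_uniq //.
  move=> i; rewrite mem_filter inE mem_undup [i == _]eq_sym.
  case: (x.1 =P i) => [<-|//]; rewrite /=.
  by rewrite map_f.
apply: le_trans (hB _ (undup_uniq _)); apply: ler_sum => i _.
apply: (le_trans _ (ler_norm _)).
rewrite -big_filter; have -> : \sum_(x <- [seq x <- s | x.1 == i]) `|F x.1 x.2| =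
    \sum_(j <- map snd [seq x <- s | x.1 == i]) `|F i j|.
  rewrite big_map big_seq [RHS]big_seq; apply: eq_bigr => x.
  by rewrite mem_filter => /andP[/eqP-> _].
apply: hb; rewrite map_inj_in_uniq ?filter_uniq // => x y.
rewrite !mem_filter => /andP[/eqP x1 _] /andP[/eqP y1 _].
by case: x y x1 y1 => [? ?] [? ?] /= -> -> ->.
Qed.

(** Fubini: both iterated sums are groupings of one absolutely summable family over pairs, along
    [fst] and along [snd]. *)
Lemma hsum_pair (I J : eqType) (F : I -> J -> R) (b : I -> R) B (r : I -> R)
    (c : J -> R) S :
  (forall i, bsum (F i) (b i)) -> bsum b B ->
  (forall i, hsum (F i) (r i)) -> (forall j, hsum (F ^~ j) (c j)) ->
  hsum r S -> hsum c S.
Proof.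
move=> hb hB hr hc hS; have hF := bsum_pair hb hB.
have [S' hS'] := bsum_hsum hF.
have hr' : hsum r S'.
  apply: (hsum_fiber (p := fst) hS') => i.
  apply: (hsum_push (e := fun j => (i, j)) _ _ _ (hr i)) => /=.
  - by move=> ? ? [].
  - by move=> j; rewrite eqxx.
  - by case=> i' j /= ne; case: eqP => // ii; case: (ne j); rewrite ii.
rewrite (hsum_uniq hS hr'); apply: (hsum_fiber (p := snd) hS') => j.
apply: (hsum_push (e := fun i => (i, j)) _ _ _ (hc j)) => /=.
- by move=> ? ? [].
- by move=> i; rewrite eqxx.
- by case=> i j' /= ne; case: eqP => // jj; case: (ne i); rewrite jj.
Qed.

Lemma hsum_series (f : nat -> R) S : hsum f S -> series f @ \oo --> S.
Proof.
move=> h; apply/cvgrPdist_le => e e0; have [s0 h0] := h _ e0.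
exists (\max_(i <- s0) i).+1 => //= N /= hN; rewrite distrC.
rewrite /series /=; apply: h0; first exact: iota_uniq.
move=> x xs; rewrite mem_index_iota /=; apply: leq_trans hN.
by rewrite ltnS; exact: (@leq_bigmax_seq _ s0 xpredT id x).
Qed.

Lemma bsum_geo (a q : R) : 0 <= a -> 0 <= q < 1 ->
  bsum (fun n : nat => a * q ^+ n) (a / (1 - q)).
Proof.
move=> a0 /andP[q0 q1] s us.
have pos n : 0 <= a * q ^+ n by rewrite mulr_ge0 // exprn_ge0.
under eq_bigr do rewrite ger0_norm //.
apply: (@le_trans _ _ (\sum_(n <- iota 0 (\max_(i <- s) i).+1) a * q ^+ n)).
  apply: le_sum_subset => // x xs; rewrite mem_iota add0n /= ltnS.
  exact: (@leq_bigmax_seq _ s xpredT id x).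
have q1' : 0 < 1 - q by rewrite subr_gt0.
set N := _.+1; rewrite -mulr_sumr ler_wpM2l // -[leRHS]mul1r ler_pdivlMr //.
have -> : \sum_(i <- iota 0 N) q ^+ i = \sum_(i < N) q ^+ i.
  by rewrite -[N in iota 0 N]subn0 -/(index_iota 0 N) big_mkord.
by rewrite mulrC -opprB mulNr -subrX1 opprB gerBl exprn_ge0.
Qed.

End UnorderedSums.

(** * Power series in several variables *)

Section PowerSeries.
Variables (R : realType) (n : nat).
Local Notation J := {ffun 'I_n -> nat}.
Local Notation V := 'rV[R]_n.
Implicit Types (c : J -> R) (g : V -> R) (nu : J) (h : V) (rho M : R).

Definition small rho h := forall i, `|h ord0 i| <= rho.

Definition deg nu : nat := \sum_i nu i.

Definition incr (i : 'I_n) nu : J := [ffun j => (nu j + (j == i))%N].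

Definition decr (i : 'I_n) nu : J := [ffun j => (nu j - (j == i))%N].

Lemma incrK i : cancel (incr i) (decr i).
Proof. by move=> nu; apply/ffunP => j; rewrite !ffunE addnK. Qed.

Lemma decrK i nu : (0 < nu i)%N -> incr i (decr i nu) = nu.
Proof.
move=> h; apply/ffunP => j; rewrite !ffunE; case: eqVneq => [->|_].
  by rewrite subnK.
by rewrite subn0 addn0.
Qed.

Lemma incr_neq0 i nu : (0 < incr i nu i)%N.
Proof. by rewrite ffunE eqxx addn1. Qed.

Lemma deg_incr i nu : deg (incr i nu) = (deg nu).+1.
Proof.
rewrite /deg -addn1; under eq_bigr do rewrite ffunE.
rewrite big_split /=; congr addn.
by rewrite (bigD1 i) //= eqxx big1 // => j /negbTE ->.
Qed.

Lemma leq_deg i nu : (nu i <= deg nu)%N.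
Proof. by rewrite /deg (bigD1 i) //= leq_addr. Qed.

Lemma monomial_incr i nu h : monomial h (incr i nu) = h ord0 i * monomial h nu.
Proof.
rewrite /monomial (bigD1 i) //= [in RHS](bigD1 i) //= ffunE eqxx exprD expr1.
rewrite mulrA [_ ^+ _ * _]mulrC; congr (_ * _).
by apply: eq_bigr => j ji; rewrite ffunE (negbTE ji) addn0.
Qed.

Definition nu0 : J := [ffun=> 0%N].

Lemma monomial0 h : monomial h nu0 = 1.
Proof. by rewrite /monomial big1 // => i _; rewrite ffunE. Qed.

Lemma deg0 : deg nu0 = 0%N.
Proof. by rewrite /deg big1 // => i _; rewrite ffunE. Qed.

Lemma deg_eq0 nu : deg nu = 0%N -> nu = nu0.
Proof.
move=> h; apply/ffunP => i; rewrite ffunE; apply/eqP.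
by rewrite -leqn0 -h leq_deg.
Qed.

Lemma monomial_0 nu : nu != nu0 -> monomial (0 : V) nu = 0.
Proof.
move=> h; have [i ni] : exists i, nu i != 0%N.
  apply: contrapT => ne; move/eqP: h; apply; apply/ffunP => i.
  by rewrite ffunE; apply/eqP/negPn/negP => ni; apply: ne; exists i.
by rewrite /monomial (bigD1 i) //= mxE expr0n (negbTE ni) mul0r.
Qed.

Lemma monomial_le rho h nu : small rho h -> `|monomial h nu| <= rho ^+ deg nu.
Proof.
move=> hh; rewrite /monomial normr_prod /deg -prodrXr.
apply: ler_prod => i _; rewrite normr_ge0 normrX /=.
by apply: lerXn2r; rewrite ?nnegrE ?normr_ge0 //; exact: le_trans (hh i).
Qed.

(** The bound [M] is on the weighted l1 norm of the coefficients. This norm is submultiplicative, so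
    products and substitutions are controlled by [rho] and [M] alone, without formulas for their
    coefficients. *)
Definition repc rho M c g :=
  bsum (fun nu => c nu * rho ^+ deg nu) M /\
  forall h, small rho h -> hsum (fun nu => c nu * monomial h nu) (g h).

Definition rep rho M g := exists c, repc rho M c g.

Lemma small0 rho : 0 <= rho -> small rho 0.
Proof. by move=> r0 i; rewrite mxE normr0. Qed.

Lemma repc_bsum rho rho' M c g : repc rho M c g -> 0 <= rho' <= rho ->
  bsum (fun nu => c nu * rho' ^+ deg nu) M.
Proof.
case=> b _ /andP[r0 rr]; apply: le_bsum b => nu; rewrite !normrM ler_wpM2l //.
rewrite !normrX; apply: lerXn2r; rewrite ?nnegrE ?normr_ge0 //.
by rewrite !ger0_norm // (le_trans r0).
Qed.

Lemma small_le rho rho' h : rho' <= rho -> small rho' h -> small rho h.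
Proof. by move=> rr hh i; exact: le_trans rr. Qed.

Lemma repc_shrink rho rho' M c g : 0 <= rho' <= rho -> repc rho M c g ->
  repc rho' M c g.
Proof.
move=> rr H; split; first exact: repc_bsum H rr.
by move=> h hh; apply: H.2; apply: small_le hh; case/andP: rr.
Qed.

Lemma repc_bsum_small rho M c g h : repc rho M c g -> small rho h ->
  bsum (fun nu => c nu * monomial h nu) M.
Proof.
move=> H hh; apply: le_bsum H.1 => nu.
rewrite !normrM ler_wpM2l //; apply: le_trans (monomial_le nu hh) _.
exact: ler_norm.
Qed.

Lemma repc_bound rho M c g h : repc rho M c g -> small rho h -> `|g h| <= M.
Proof. by move=> H hh; exact: hsum_le (repc_bsum_small H hh) (H.2 h hh). Qed.

Lemma repc_center rho M c g : 0 <= rho -> repc rho M c g -> g 0 = c nu0.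
Proof.
move=> r0 H; apply: (hsum_uniq (H.2 0 (small0 r0))).
have := hsum1 nu0 (c nu0); congr hsum; apply/funext => nu.
case: eqVneq => [->|ne]; first by rewrite monomial0 mulr1.
by rewrite monomial_0 ?mulr0.
Qed.

Lemma eq_rep rho M g g' : (forall h, small rho h -> g h = g' h) ->
  rep rho M g -> rep rho M g'.
Proof. by move=> e [c [b H]]; exists c; split=> // h hh; rewrite -e //; exact: H. Qed.

Lemma rep_shrink rho rho' M g : 0 <= rho' <= rho -> rep rho M g -> rep rho' M g.
Proof. by move=> rr [c H]; exists c; exact: repc_shrink rr H. Qed.

Lemma rep_le rho M M' g : M <= M' -> rep rho M g -> rep rho M' g.
Proof.
by move=> MM [c [b H]]; exists c; split=> // s us; apply: le_trans (b s us) MM.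
Qed.

Lemma rep_cst rho k : rep rho `|k| (fun=> k).
Proof.
exists (fun nu => if nu == nu0 then k else 0); split; last first.
  move=> h _; have := hsum1 nu0 k; congr hsum; apply/funext => nu.
  by case: eqVneq => [->|_]; rewrite ?monomial0 ?mulr1 ?mul0r.
have := bsum_push (e := fun _ : unit => nu0) (f := fun=> k).
apply => //=.
- by case=> [] [].
- by rewrite eqxx deg0 expr0 mulr1.
- by move=> nu /(_ tt); case: eqVneq => [->//|]; rewrite mul0r.
- case=> [_|[] s /=]; first by rewrite big_nil.
  by case: s => [|[] s] //= _; rewrite big_seq1.
Qed.

(** Multiplying by a coordinate shifts the exponents and costs a factor [rho]. Products are built
    from this case and completeness, which avoids the Cauchy product. *)
Lemma rep_shift rho M g i : 0 <= rho -> rep rho M g ->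
  rep rho (rho * M) (fun h => h ord0 i * g h).
Proof.
move=> r0 [c [b H]].
exists (fun nu => if (0 < nu i)%N then c (decr i nu) else 0).
have ne nu : (forall mu, incr i mu <> nu) -> (0 < nu i)%N = false.
  by move=> h; apply/negP => /(decrK (i := i)); exact: h.
split.
  apply: (bsum_push (e := incr i) (f := fun nu => rho * (c nu * rho ^+ deg nu))).
  - exact: can_inj (incrK i).
  - by move=> nu; rewrite incr_neq0 incrK deg_incr exprS; ring.
  - by move=> nu /ne ->; rewrite mul0r.
  - by have := bsumZ rho b; rewrite (ger0_norm r0).
move=> h hh.
apply: (hsum_push (e := incr i) _ _ _ (hsumZ (h ord0 i) (H h hh))).
- exact: can_inj (incrK i).
- by move=> nu; rewrite incr_neq0 incrK monomial_incr; ring.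
- by move=> nu /ne ->; rewrite mul0r.
Qed.

Lemma rep_coord rho i : 0 <= rho -> rep rho rho (fun h => h ord0 i).
Proof.
move=> r0; have := rep_shift i r0 (rep_cst rho 1).
by rewrite normr1 mulr1; apply: eq_rep => h _; rewrite mulr1.
Qed.

Lemma repD rho M N g f : rep rho M g -> rep rho N f ->
  rep rho (M + N) (fun h => g h + f h).
Proof.
move=> [c [b H]] [d [b' H']]; exists (fun nu => c nu + d nu); split.
  have := bsumD b b'; congr bsum; apply/funext => nu; ring.
move=> h hh; have := hsumD (H h hh) (H' h hh); congr hsum; apply/funext => nu; ring.
Qed.

Lemma repZ rho M g k : rep rho M g -> rep rho (`|k| * M) (fun h => k * g h).
Proof.
move=> [c [b H]]; exists (fun nu => k * c nu); split.
  have := bsumZ k b; congr bsum; apply/funext => nu; ring.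
move=> h hh; have := hsumZ k (H h hh); congr hsum; apply/funext => nu; ring.
Qed.

(* Completeness of the weighted l^1 algebra of power series. *)
Lemma rep_hsum (I : eqType) rho (g : I -> V -> R) (M : I -> R) B (G : V -> R) :
  0 < rho -> (forall i, rep rho (M i) (g i)) -> bsum M B ->
  (forall h, small rho h -> hsum (g ^~ h) (G h)) -> rep rho B G.
Proof.
move=> r0 /choice[c hc] bM hG.
have pw nu : 0 < rho ^+ deg nu by rewrite exprn_gt0.
have bc nu : bsum (fun i => c i nu * rho ^+ deg nu) B.
  apply: le_bsum bM => i; apply: le_trans (ler_norm _).
  exact: (bsum_pt nu (hc i).1).
have /choice[d hd] nu : exists d, hsum (fun i => c i nu) d.
  have /bsum_hsum[S hS] := bc nu; exists ((rho ^+ deg nu)^-1 * S).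
  have := hsumZ (rho ^+ deg nu)^-1 hS; congr hsum; apply/funext => i.
  by rewrite mulrC mulfK // gt_eqF.
exists d; split.
  move=> s us.
  (* The signs of the [d nu] turn the sum of their moduli into the limit of a single finite
     combination, which the [M i] dominate. *)
  have H := hsum_sum s (fun nu => hsumZ (Num.sg (d nu) * rho ^+ deg nu) (hd nu)).
  have -> : \sum_(nu <- s) `|d nu * rho ^+ deg nu| =
      \sum_(nu <- s) Num.sg (d nu) * rho ^+ deg nu * d nu.
    apply: eq_bigr => nu _; rewrite normrM (gtr0_norm (pw _)) normrEsg; ring.
  apply: le_trans (ler_norm _) _; apply: hsum_le H; apply: le_bsum bM => i.
  apply: le_trans (ler_norm_sum _ _ _) _; apply: le_trans (ler_norm _).
  apply: le_trans ((hc i).1 s us); apply: ler_sum => nu _.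
  rewrite !normrM normr_sg [leRHS]mulrC ler_wpM2r //.
  by rewrite -[leRHS]mul1r ler_wpM2r // lern1 leq_b1.
move=> h hh.
apply: (hsum_pair (F := fun i nu => c i nu * monomial h nu) (b := M) _ bM _ _ (hG h hh)).
- by move=> i; exact: repc_bsum_small (hc i) hh.
- by move=> i; exact: (hc i).2.
- move=> nu; have := hsumZ (monomial h nu) (hd nu); rewrite mulrC; congr hsum.
  by apply/funext => i; rewrite mulrC.
Qed.

Lemma rep_monomial rho M g nu : 0 <= rho -> rep rho M g ->
  rep rho (rho ^+ deg nu * M) (fun h => monomial h nu * g h).
Proof.
move=> r0 Hg; elim: (deg nu) {-2}nu (erefl (deg nu)) => [|N IH] {}nu dnu.
  rewrite dnu expr0 mul1r; apply: eq_rep Hg => h _.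
  by rewrite (deg_eq0 dnu) monomial0 mul1r.
have [i ni] : exists i, (0 < nu i)%N.
  apply: contrapT => ne; suff : deg nu = 0%N by rewrite dnu.
  rewrite /deg big1 // => i _; apply/eqP; rewrite -leqn0 leqNgt; apply/negP => ni.
  by apply: ne; exists i.
rewrite -(decrK ni) in dnu *; rewrite deg_incr in dnu; case: dnu => dnu.
rewrite deg_incr exprS -mulrA; have := rep_shift i r0 (IH _ dnu); apply: eq_rep => h _.
by rewrite monomial_incr mulrA.
Qed.

(** Only the first factor is expanded: the product is the sum over [nu] of
    [c nu * (monomial h nu * f h)], whose norms are summable, and completeness applies. *)
Lemma repM rho M N g f : 0 < rho -> rep rho M g -> rep rho N f ->
  rep rho (M * N) (fun h => g h * f h).
Proof.
move=> r0 [c [b H]] Hf.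
apply: (@rep_hsum _ rho (fun nu h => c nu * (monomial h nu * f h))
  (fun nu => `|c nu| * (rho ^+ deg nu * N))) => //.
- by move=> nu; apply: repZ; apply: rep_monomial => //; exact: ltW.
- have N0 : 0 <= N by case: Hf => d [/bsum_ge0].
  have := bsumZ N b; rewrite (ger0_norm N0) [N * M]mulrC.
  apply: le_bsum => nu; rewrite !normrM normr_id (ger0_norm N0).
  by have -> : `|c nu| * (`|rho ^+ deg nu| * N) = N * (`|c nu| * `|rho ^+ deg nu|)
    by ring.
- move=> h hh; have := hsumZ (f h) (H h hh); rewrite mulrC; congr hsum.
  by apply/funext => nu; ring.
Qed.

Lemma rep_pow rho M g k : 0 < rho -> rep rho M g ->
  rep rho (M ^+ k) (fun h => g h ^+ k).
Proof.
move=> r0 Hg; elim: k => [|k IH].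
  by have := rep_cst rho 1; rewrite normr1 expr0.
rewrite exprS; apply: eq_rep (repM r0 Hg IH) => h _; by rewrite exprS.
Qed.

Lemma rep_prod (I : Type) (s : seq I) rho (M : I -> R) (g : I -> V -> R) : 0 < rho ->
  (forall i, rep rho (M i) (g i)) ->
  rep rho (\prod_(i <- s) M i) (fun h => \prod_(i <- s) g i h).
Proof.
move=> r0 Hg; elim: s => [|i s IH].
  rewrite big_nil; have := rep_cst rho 1; rewrite normr1; apply: eq_rep => h _.
  by rewrite big_nil.
rewrite big_cons; apply: eq_rep (repM r0 (Hg i) IH) => h _; by rewrite big_cons.
Qed.

(** A form of Schwarz's lemma: without constant term every exponent has degree at least 1, so each
    weighted coefficient gains the factor [rho' / rho]. It makes the inner functions of a
    composition small. *)
Lemma rep_shrink0 rho rho' M g : 0 < rho' <= rho -> g 0 = 0 -> rep rho M g ->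
  rep rho' (rho' / rho * M) g.
Proof.
case/andP=> r0 rr g0 [c Hc]; have r1 := lt_le_trans r0 rr.
exists c; split; last first.
  by move=> h hh; apply: Hc.2; exact: small_le hh.
have -> : rho' / rho * M = `|rho' / rho| * M.
  by rewrite ger0_norm // divr_ge0 // ltW.
apply: le_bsum (bsumZ (rho' / rho) Hc.1) => nu.
case: (eqVneq nu nu0) => [->|ne].
  by rewrite -(repc_center (ltW r1) Hc) g0 !mul0r mulr0.
have d0 : (0 < deg nu)%N.
  by rewrite lt0n; apply: contra ne => /eqP /deg_eq0 ->.
rewrite !normrM [leRHS]mulrCA ler_wpM2l // -(prednK d0) !exprS !normrM.
rewrite normfV; have -> : `|rho'| * `|rho|^-1 * (`|rho| * `|rho ^+ (deg nu).-1|) =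
  `|rho'| * `|rho ^+ (deg nu).-1|.
  by rewrite mulrA divfK // normr_eq0 gt_eqF.
rewrite ler_wpM2l // !normrX; apply: lerXn2r; rewrite ?nnegrE //.
by rewrite !gtr0_norm.
Qed.

End PowerSeries.

(** Each monomial of [phi] becomes a product of functions of norm at most [d]; as [d <= rho'], the
    norms [|c mu| * d ^+ deg mu] are still summable. *)
Lemma rep_subst (R : realType) n p (rho rho' M : R) (phi : 'rV[R]_p -> R)
    (k : 'I_p -> 'rV[R]_n -> R) (d : R) :
  0 < rho -> 0 <= d <= rho' -> rep rho' M phi -> (forall j, rep rho d (k j)) ->
  rep rho M (fun h => phi (\row_j k j h)).
Proof.
move=> r0 /andP[d0 dr] [c Hc] Hk.
apply: (@rep_hsum _ _ _ rho (fun mu h => c mu * monomial (\row_j k j h) mu)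
   (fun mu => `|c mu| * d ^+ deg mu)) => //.
- move=> mu; apply: repZ.
  have := rep_prod (index_enum 'I_p) r0 (fun j => rep_pow (mu j) r0 (Hk j)).
  rewrite prodrXr -/(deg mu); apply: eq_rep => h _.
  by rewrite /monomial; apply: eq_bigr => j _; rewrite mxE.
- have dd : 0 <= d <= rho' by rewrite d0.
  by apply: le_bsum (repc_bsum Hc dd) => mu; rewrite !normrM normr_id.
- move=> h hh; apply: Hc.2 => j; rewrite mxE; apply: le_trans dr.
  by case: (Hk j) => e He; exact: repc_bound He hh.
Qed.

(** The difference quotient multiplied out, over any numeric field: one criterion serves real
    directional derivatives and complex derivatives, and [t = 0] need not be excluded. *)
Lemma is_deriveP (K : numFieldType) (V W : normedModType K) (f : V -> W) a v l :
  is_derive a v f l <-> forall e : K, 0 < e -> exists2 d : K, 0 < d &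
    forall t : K, `|t| < d -> `|f (t *: v + a) - f a - t *: l| <= e * `|t|.
Proof.
pose q := fun t : K => t^-1 *: (f (t *: v + a) - f a).
have qE t : t != 0 -> `|f (t *: v + a) - f a - t *: l| = `|t| * `|q t - l|.
  by move=> t0; rewrite -normrZ scalerBr /q scalerA divff // scale1r.
have -> : is_derive a v f l <-> q @ 0^' --> l.
  split=> [[df <-]|h]; first exact: df.
  by split; [apply/cvg_ex; exists l | exact/cvg_lim].
split=> [/cvgrPdist_le H e e0|H].
  have /nbhs_ballP[d d0 Hd] := H e e0; exists d => // t td.
  have [->|t0] := eqVneq t 0.
    by rewrite !scale0r add0r subrr subr0 !normr0 mulr0.
  rewrite qE // mulrC ler_pM2r ?normr_gt0 // distrC.
  by apply: Hd => //; rewrite -ball_normE /= sub0r normrN.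
apply/cvgrPdist_le => e e0; have [d d0 Hd] := H e e0.
apply/nbhs_ballP; exists d => // t; rewrite -ball_normE /= sub0r normrN => td t0.
rewrite distrC -(ler_pM2l (x := `|t|)) ?normr_gt0 // -qE // mulrC.
exact: Hd.
Qed.

Lemma quad_derive (R : realType) (V : normedModType R) (f : V -> R) a v l (C d : R) :
  0 < d -> (forall t : R, `|t| <= d -> `|f (t *: v + a) - f a - t * l| <= C * t ^+ 2) ->
  is_derive a v f l.
Proof.
move=> d0 H; apply/is_deriveP => e e0.
have C1 : 0 < `|C| + 1 by rewrite ltr_wpDl.
exists (Num.min d (e / (`|C| + 1))); first by rewrite lt_min d0 divr_gt0.
move=> t; rewrite lt_min => /andP[td te]; apply: le_trans (H t (ltW td)) _.
have -> : t ^+ 2 = `|t| * `|t| by rewrite -normrM -expr2 ger0_norm ?sqr_ge0.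
rewrite mulrA ler_wpM2r //.
move: te; rewrite ltr_pdivlMr // => te; apply: le_trans (ltW te).
rewrite mulrC; apply: ler_wpM2l => //.
by apply: le_trans (ler_norm _) _; rewrite lerDl.
Qed.

(* Only meaningful for k >= 2; multiplying by s^2 avoids truncated exponents. *)
Lemma pow_quad (R : realType) (x t s : R) (k : nat) : 0 <= s -> `|x| <= s ->
  `|x + t| <= s ->
  s ^+ 2 * `|(x + t) ^+ k - x ^+ k - k%:R * x ^+ k.-1 * t| <=
    k%:R ^+ 2 * s ^+ k * t ^+ 2.
Proof.
move=> s0 xs xts; elim: k => [|k IH].
  by rewrite !expr0 subrr !mul0r subr0 normr0 expr0n !mul0r mulr0.
set E := (X in s ^+ 2 * `|X|) in IH.
have -> : (x + t) ^+ k.+1 - x ^+ k.+1 - k.+1%:R * x ^+ k.+1.-1 * t =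
    (x + t) * E + k%:R * x ^+ k.-1 * t ^+ 2.
  rewrite /E /=; case: k {IH E} => [|k] /=; first by rewrite !expr0 !expr1; ring.
  by rewrite !exprS -!natr1; ring.
have H1 : s ^+ 2 * `|(x + t) * E| <= s * (k%:R ^+ 2 * s ^+ k * t ^+ 2).
  rewrite normrM mulrCA; apply: ler_pM => //.
  by rewrite mulr_ge0 // exprn_ge0.
have H2 : s ^+ 2 * `|k%:R * x ^+ k.-1 * t ^+ 2| <= k%:R * s ^+ k.+1 * t ^+ 2.
  case: k {IH E H1} => [|k] /=; first by rewrite !mul0r normr0 mulr0.
  have -> : `|k.+1%:R * x ^+ k * t ^+ 2| = k.+1%:R * `|x| ^+ k * t ^+ 2.
    rewrite (normrM (k.+1%:R * x ^+ k)) (normrM k.+1%:R) normr_nat normrX.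
    by rewrite (ger0_norm (sqr_ge0 t)).
  have -> : s ^+ 2 * (k.+1%:R * `|x| ^+ k * t ^+ 2) =
    `|x| ^+ k * (s ^+ 2 * (k.+1%:R * t ^+ 2)) by ring.
  have -> : k.+1%:R * s ^+ k.+2 * t ^+ 2 = s ^+ k * (s ^+ 2 * (k.+1%:R * t ^+ 2)).
    by rewrite !exprS; ring.
  apply: ler_wpM2r; first exact: mulr_ge0 (sqr_ge0 s) (mulr_ge0 (ler0n _ _) (sqr_ge0 t)).
  by apply: lerXn2r; rewrite ?nnegrE.
apply: le_trans (ler_wpM2l _ (ler_normD _ _)) _; first by rewrite exprn_ge0.
rewrite mulrDr; apply: le_trans (lerD H1 H2) _.
rewrite -[k.+1%:R]natr1 (exprS s k).
have -> : s * (k%:R ^+ 2 * s ^+ k * t ^+ 2) + k%:R * (s * s ^+ k) * t ^+ 2 =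
   (k%:R ^+ 2 + k%:R) * (s * s ^+ k * t ^+ 2) by ring.
rewrite -[leRHS]mulrA; apply: ler_wpM2r.
  by rewrite mulr_ge0 ?sqr_ge0 // mulr_ge0 // exprn_ge0.
by rewrite sqrrD1 -addrA lerD2l mulr2n -addrA lerDl addr_ge0.
Qed.

(** * Termwise differentiation of power series in several variables *)

Section Derivatives.
Variables (R : realType) (n : nat).
Local Notation J := {ffun 'I_n -> nat}.
Local Notation V := 'rV[R]_n.
Implicit Types (c : J -> R) (g : V -> R) (nu : J) (h : V) (rho M : R).

Definition dcoef i c nu := (nu i).+1%:R * c (incr i nu).

Lemma le_sqr_pow4 (k : nat) : k%:R ^+ 2 <= 4 ^+ k :> R.
Proof.
rewrite -natrX -natrX ler_nat (_ : 4 = 2 ^ 2)%N // -expnM mulnC expnM.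
by rewrite leq_exp2r // ltnW // ltn_expl.
Qed.

Lemma bsum_inj (I I' : eqType) (e : I -> I') (f : I' -> R) M : injective e ->
  bsum f M -> bsum (f \o e) M.
Proof.
move=> ei b s us; rewrite -(big_map e xpredT (fun i => `|f i|)).
by apply: b; rewrite map_inj_uniq.
Qed.

(** The radius drops to [rho / 4] to absorb the factor [(nu i).+1], which is at most
    [4 ^+ (deg nu).+1]. *)
Lemma bsum_dcoef i c rho M : 0 < rho ->
  bsum (fun nu => c nu * rho ^+ deg nu) M ->
  bsum (fun nu => dcoef i c nu * (rho / 4) ^+ deg nu) (4 / rho * M).
Proof.
move=> r0 b; have rp : 0 <= 4 / rho by rewrite divr_ge0 // ltW.
have := bsumZ (4 / rho) (bsum_inj (can_inj (incrK i)) b).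
rewrite (ger0_norm rp); apply: le_bsum => nu /=.
rewrite [leRHS]normrM (ger0_norm rp) /dcoef deg_incr !normrM normr_nat.
rewrite !(@ger0_norm _ (_ ^+ _)) ?exprn_ge0 ?divr_ge0 ?(ltW r0) //.
rewrite exprMn exprS.
have -> : 4 / rho * (`|c (incr i nu)| * (rho * rho ^+ deg nu)) =
   4 * (`|c (incr i nu)| * rho ^+ deg nu) by field; rewrite gt_eqF.
have -> : (nu i).+1%:R * `|c (incr i nu)| * (rho ^+ deg nu * 4^-1 ^+ deg nu) =
   ((nu i).+1%:R * 4^-1 ^+ deg nu) * (`|c (incr i nu)| * rho ^+ deg nu) by ring.
apply: ler_wpM2r; first by rewrite mulr_ge0 // exprn_ge0 ?ltW.
rewrite exprVn ler_pdivrMr ?exprn_gt0 // -exprS.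
apply: le_trans (le_sqr_pow4 _); apply: (@le_trans _ _ (deg nu).+1%:R).
  by rewrite ler_nat ltnS leq_deg.
by rewrite expr2 ler_peMl // ler1n.
Qed.

Lemma monomial_decr i nu h :
  (nu i)%:R * monomial h (decr i nu) =
  (nu i)%:R * h ord0 i ^+ (nu i).-1 * \prod_(j | j != i) h ord0 j ^+ nu j.
Proof.
case: (posnP (nu i)) => [->|ni]; first by rewrite !mul0r.
rewrite /monomial (bigD1 i) //= mulrA ffunE eqxx subn1; congr (_ * _).
by apply: eq_bigr => j ji; rewrite ffunE (negbTE ji) subn0.
Qed.

Lemma monomial_quad i nu h t s : small s h -> `|h ord0 i + t| <= s -> 0 <= s ->
  s ^+ 2 * `|monomial (t *: delta_mx ord0 i + h) nu - monomial h nu -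
     t * ((nu i)%:R * monomial h (decr i nu))| <=
  4 ^+ deg nu * s ^+ deg nu * t ^+ 2.
Proof.
move=> hs hts s0; rewrite monomial_decr /monomial.
rewrite (bigD1 i) //= [X in _ - X - _](bigD1 i) //=.
rewrite !mxE !eqxx mulr1.
have -> : \prod_(j | j != i) (t *: delta_mx ord0 i + h) ord0 j ^+ nu j =
    \prod_(j | j != i) h ord0 j ^+ nu j.
  by apply: eq_bigr => j ji; rewrite !mxE eqxx (negbTE ji) mulr0 add0r.
set P := \prod_(j | _) _.
have -> : (t + h ord0 i) ^+ nu i * P - h ord0 i ^+ nu i * P -
  t * ((nu i)%:R * h ord0 i ^+ (nu i).-1 * P) =
  ((h ord0 i + t) ^+ nu i - h ord0 i ^+ nu i -
   (nu i)%:R * h ord0 i ^+ (nu i).-1 * t) * P by rewrite [t + _]addrC; ring.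
rewrite normrM mulrA.
have HP : `|P| <= \prod_(j | j != i) s ^+ nu j.
  rewrite normr_prod; apply: ler_prod => j _; rewrite normr_ge0 normrX /=.
  by apply: lerXn2r; rewrite ?nnegrE.
apply: le_trans (ler_pM _ _ (pow_quad (nu i) s0 (hs i) hts) HP) _ => //.
  by rewrite mulr_ge0 // exprn_ge0.
have -> : s ^+ deg nu = s ^+ nu i * \prod_(j | j != i) s ^+ nu j.
  by rewrite /deg -prodrXr (bigD1 i).
have -> : (nu i)%:R ^+ 2 * s ^+ nu i * t ^+ 2 * \prod_(j | j != i) s ^+ nu j =
 (nu i)%:R ^+ 2 * (s ^+ nu i * \prod_(j | j != i) s ^+ nu j) * t ^+ 2 by ring.
rewrite ler_wpM2r ?sqr_ge0 // ler_wpM2r //.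
  by rewrite mulr_ge0 ?exprn_ge0 // prodr_ge0 // => j _; rewrite exprn_ge0.
apply: le_trans (le_sqr_pow4 _) _.
by apply: ler_weXn2l; rewrite ?leq_deg // ler1n.
Qed.

(** The second-order remainders of the monomials add up to at most a constant times [t ^+ 2], so the
    termwise derivative is the derivative. Points within [rho / 8] leave room for increments up to
    [rho / 8] inside the radius [rho / 4]. *)
Lemma repc_deriv rho M c g i : 0 < rho -> repc rho M c g ->
  exists2 dg, repc (rho / 4) (4 / rho * M) (dcoef i c) dg &
    forall h, small (rho / 8) h -> is_derive h (delta_mx ord0 i) g (dg h).
Proof.
move=> r0 Hc; have r4 : 0 < rho / 4 by rewrite divr_gt0.
have bd := bsum_dcoef i r0 Hc.1.
have /choice[dg Hdg] (h : V) : exists d, small (rho / 4) h ->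
    hsum (fun nu => dcoef i c nu * monomial h nu) d.
  have [hh|nh] := pselect (small (rho / 4) h); last by exists 0.
  have /bsum_hsum[d hd] : bsum (fun nu => dcoef i c nu * monomial h nu)
      (4 / rho * M).
    apply: le_bsum bd => nu; rewrite !normrM ler_wpM2l //.
    by apply: le_trans (monomial_le nu hh) _; exact: ler_norm.
  by exists d.
exists dg; first by split.
move=> h hh; have h4 : small (rho / 4) h by apply: small_le hh; lra.
apply: (@quad_derive _ _ _ _ _ _ (16 / rho ^+ 2 * M) (rho / 8)).
  by rewrite divr_gt0.
move=> t tr; have ht : small (rho / 4) (t *: delta_mx ord0 i + h).
  move=> j; rewrite !mxE eqxx /=; case: eqP => [_|_].
    rewrite mulr1; apply: le_trans (ler_normD _ _) _.
    by have := hh j; lra.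
  by rewrite mulr0 add0r h4.
have lr (x : V) : small (rho / 4) x -> small rho x by apply: small_le; lra.
have Hd : hsum (fun nu => (nu i)%:R * c nu * monomial h (decr i nu)) (dg h).
  apply: (hsum_push (e := incr i) _ _ _ (Hdg h h4)).
  - exact: can_inj (incrK i).
  - by move=> nu; rewrite incrK /dcoef ffunE eqxx addn1.
  - move=> nu ne; suff -> : nu i = 0%N by rewrite !mul0r.
    by apply/eqP; rewrite -leqn0 leqNgt; apply/negP => /decrK; exact: ne.
have := hsumD (hsumD (Hc.2 _ (lr _ ht)) (hsumN (Hc.2 _ (lr _ h4))))
  (hsumN (hsumZ t Hd)).
have K0 : 0 <= 16 / rho ^+ 2 * t ^+ 2.
  by rewrite mulr_ge0 ?sqr_ge0 // divr_ge0 // sqr_ge0.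
have -> : 16 / rho ^+ 2 * M * t ^+ 2 = `|16 / rho ^+ 2 * t ^+ 2| * M.
  by rewrite ger0_norm //; ring.
apply: hsum_le; apply: le_bsum (bsumZ _ Hc.1) => nu.
have -> : c nu * monomial (t *: delta_mx ord0 i + h) nu - c nu * monomial h nu -
     t * ((nu i)%:R * c nu * monomial h (decr i nu)) =
   c nu * (monomial (t *: delta_mx ord0 i + h) nu - monomial h nu -
     t * ((nu i)%:R * monomial h (decr i nu))) by ring.
set Q := monomial _ nu - _ - _.
rewrite [leLHS]normrM [leRHS]normrM (normrM (c nu)) mulrCA ler_wpM2l // {}/Q.
have s0 : 0 < (rho / 4) ^+ 2 by rewrite exprn_gt0.
rewrite -(ler_pM2l s0); apply: le_trans (monomial_quad nu h4 _ (ltW r4)) _.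
  by apply: le_trans (ler_normD _ _) _; have := hh i; lra.
rewrite (ger0_norm K0) (ger0_norm (exprn_ge0 _ (ltW r0))) -exprMn; have -> : 4 * (rho / 4) = rho by field.
have -> // : (rho / 4) ^+ 2 * (16 / rho ^+ 2 * t ^+ 2 * rho ^+ deg nu) =
  rho ^+ deg nu * t ^+ 2.
by field; rewrite gt_eqF.
Qed.

End Derivatives.

(** The differential is zero. Added to an affine map, this turns a quadratic remainder into
    differentiability. *)
Lemma differentiable_littleo0 (R : realType) (V : normedModType R) (q : V -> R) (a : V) :
  q a = 0 -> (forall e : R, 0 < e -> \forall y \near a, `|q y| <= e * `|y - a|) -> differentiable q a.
Proof.
move=> q0 H.
apply/diffP => /=.
apply: (@getPex _ (fun (df : {linear V -> R}) => continuous df /\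
  forall y, q y = q (lim (nbhs a)) + df (y - lim (nbhs a))
                  +o_(y \near a) (y - lim (nbhs a)))).
exists ('d (cst (0 : R)) a); rewrite diff_cst; split; first exact: cst_continuous.
have qo : q = cst (q (lim (nbhs a))) + (fun y => (0 : R)) +o_a (fun y => y - lim (nbhs a)).
  apply/eqaddoP => _/posnumP[e]; have := H e%:num [gt0 of e%:num].
  apply: filterS => y; rewrite lim_id //.
  rewrite -![(_ + _ : _ -> _) _]/(_ + _) -![(- _ : _ -> _) _]/(- _) /cst.
  by rewrite q0 addr0 subr0.
move=> y; move: qo; rewrite funeqE => /(_ y) {1}->.
by [].
Qed.

(** * Real-analytic functions *)

Section Analytic.
Variable R : realType.

Section OneSpace.
Variable n : nat.
Local Notation J := {ffun 'I_n -> nat}.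
Local Notation V := 'rV[R]_n.
Implicit Types (g f : V -> R) (a h : V) (rho M : R).

Definition ana g a := exists rho M, 0 < rho /\ rep rho M (fun h => g (a + h)).

Definition box (N : nat) : seq J :=
  [seq [ffun i => b i : nat] | b : {ffun 'I_n -> 'I_N}].

Lemma box_uniq N : uniq (box N).
Proof.
rewrite map_inj_uniq ?enum_uniq // => b b' /ffunP e; apply/ffunP => i.
by apply: val_inj; have := e i; rewrite !ffunE.
Qed.

Lemma box_sum N (F : J -> R) :
  \sum_(b : {ffun 'I_n -> 'I_N}) F [ffun i => b i : nat] = \sum_(nu <- box N) F nu.
Proof. by rewrite big_map big_enum. Qed.

Lemma sub_box (s : seq J) : exists N0, forall N, (N0 <= N)%N -> {subset s <= box N}.
Proof.
exists (\max_(nu <- s) deg nu).+1 => N hN nu nus.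
have lt i : (nu i < N)%N.
  apply: leq_trans hN; rewrite ltnS; apply: leq_trans (leq_deg i nu) _.
  exact: (@leq_bigmax_seq _ s xpredT (@deg n) nu).
apply/mapP; exists [ffun i => Ordinal (lt i)]; first by rewrite mem_enum.
by apply/ffunP => i; rewrite !ffunE.
Qed.

(** Cubes of exponents are cofinal among the finite sets of multi-indices, so absolute convergence
    along cubes is unordered summability. The weighted norm is read off at the diagonal point
    [const_mx r], where every monomial equals [r ^+ deg nu]. *)
Lemma analytic_atP g a : analytic_at g a <-> ana g a.
Proof.
split=> [[c [rho [r0 H]]]|[rho [M [r0 [c Hc]]]]]; last first.
  exists (fun nu => c [ffun i => nu i]), rho; split=> // h hr.
  have hh : small rho h by move=> i; exact/ltW.
  split.
    exists M => N.
    rewrite (eq_bigr (fun b : {ffun 'I_n -> 'I_N} =>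
      `|c [ffun i => b i : nat] * monomial h [ffun i => b i : nat]|)).
      rewrite (box_sum N (fun nu => `|c nu * monomial h nu|)).
      exact: repc_bsum_small Hc hh _ (box_uniq N).
    move=> b _; congr (`|_ * _|); rewrite /monomial; apply: eq_bigr => i _.
    by rewrite ffunE.
  apply/cvgrPdist_le => e e0; have [s0 h0] := Hc.2 h hh e e0.
  have [N0 HN0] := sub_box s0; exists N0 => //= N /= hN; rewrite distrC.
  rewrite (eq_bigr (fun b : {ffun 'I_n -> 'I_N} =>
      c [ffun i => b i : nat] * monomial h [ffun i => b i : nat])).
    rewrite (box_sum N (fun nu => c nu * monomial h nu)).
    by apply: h0; [exact: box_uniq | exact: HN0].
  move=> b _; congr (_ * _); rewrite /monomial; apply: eq_bigr => i _.
  by rewrite ffunE.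
(* [small] describes a closed polydisc and the hypothesis an open one; the smaller radius reconciles
   them. *)
pose c' (nu : J) := c nu; pose r := rho / 2.
have r1 : 0 < r by rewrite divr_gt0.
have rr : r < rho by rewrite /r; lra.
have toJ h N (b : {ffun 'I_n -> 'I_N}) :
    c (fun i => b i) * monomial h (fun i => b i) =
    c' [ffun i => b i : nat] * monomial h [ffun i => b i : nat].
  by congr (c _ * monomial h _); apply/funext => i; rewrite ffunE.
have [|[M HM] _] := H (const_mx r).
  by move=> i; rewrite mxE gtr0_norm.
have bc : bsum (fun nu => c' nu * r ^+ deg nu) M.
  move=> s us; have [N HN] := sub_box s.
  apply: le_trans (HM N).
  under [leRHS]eq_bigr do rewrite toJ.
  rewrite (box_sum N (fun nu => `|c' nu * monomial (const_mx r) nu|)).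
  apply: (@le_trans _ _ (\sum_(nu <- box N) `|c' nu * r ^+ deg nu|)).
    by apply: le_sum_subset => //; exact: HN.
  rewrite le_eqVlt; apply/orP; left; apply/eqP; apply: eq_bigr => nu _.
  congr (`|_ * _|); rewrite /monomial /deg -prodrXr; apply: eq_bigr => i _.
  by rewrite mxE.
exists r, M; split=> //; exists c'; split=> // h hh.
have [|_ Hl] := H h; first by move=> i; apply: le_lt_trans (hh i) _.
have bh : bsum (fun nu => c' nu * monomial h nu) M.
  apply: le_bsum bc => nu; rewrite !normrM ler_wpM2l //.
  by apply: le_trans (monomial_le nu hh) _; exact: ler_norm.
have [S HS] := bsum_hsum bh.
suff <- : S = g (a + h) by [].
apply: cvg_unique Hl => //; apply/cvgrPdist_le => e e0.
have [s0 h0] := HS e e0; have [N0 HN0] := sub_box s0.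
exists N0 => //= N /= hN; rewrite distrC.
under eq_bigr do rewrite toJ.
rewrite (box_sum N (fun nu => c' nu * monomial h nu)).
by apply: h0; [exact: box_uniq | exact: HN0].
Qed.

Lemma nbhs_small a (P : set V) :
  nbhs a P <-> exists2 d : R, 0 < d & forall h, small d h -> P (a + h).
Proof.
split=> [/nbhs_ballP[d d0 Hd]|[d d0 Hd]].
  exists (d / 2); first by rewrite divr_gt0.
  move=> h hh; apply: Hd; rewrite mx_norm_ball /ball_ /= opprD addNKr normrN.
  rewrite [`|_|]mx_normrE; apply: bigmax_lt => // [[i j] _] /=.
  by rewrite (ord1 i); apply: le_lt_trans (hh j) _; rewrite ltr_pdivrMr // ltr_pMr // ltr1n.
apply/nbhs_ballP; exists d => // x; rewrite mx_norm_ball /ball_ /= => hx.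
rewrite -(subrK a x) addrC; apply: Hd => i.
apply: le_trans (ltW hx); rewrite -normrN opprB.
rewrite [leRHS]mx_normrE; apply: le_trans (le_bigmax _ _ (ord0, i)).
by [].
Qed.

Lemma eq_ana g f a : (\near a, g a = f a) -> ana g a -> ana f a.
Proof.
move=> /nbhs_small[d d0 Hd] [rho [M [r0 H]]].
exists (Num.min rho d), M; split; first by rewrite lt_min r0.
apply: eq_rep; last first.
  by apply: rep_shrink H; rewrite ge_min lexx andbT le_min !ltW.
move=> h hh; apply: Hd; apply: small_le hh; by rewrite ge_min lexx orbT.
Qed.

Lemma eq1_ana g f a : g =1 f -> ana g a -> ana f a.
Proof. by move=> /funext ->. Qed.

Lemma ana_cst k a : ana (fun=> k) a.
Proof. by exists 1, `|k|; split => //; exact: rep_cst. Qed.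

Lemma ana_coord i a : ana (fun x => x ord0 i) a.
Proof.
exists 1, (`|a ord0 i| + 1); split => //.
apply: eq_rep (repD (rep_cst _ _ _) (rep_coord i ler01)) => h _; by rewrite mxE.
Qed.

Lemma ana2 g f a : ana g a -> ana f a -> exists rho M N,
  [/\ 0 < rho, rep rho M (fun h => g (a + h)) & rep rho N (fun h => f (a + h))].
Proof.
move=> [r [M [r0 Hg]]] [s [N [s0 Hf]]]; exists (Num.min r s), M, N; split.
- by rewrite lt_min r0.
- by apply: rep_shrink Hg; rewrite ge_min lexx andbT le_min !ltW.
- by apply: rep_shrink Hf; rewrite ge_min lexx orbT andbT le_min !ltW.
Qed.

Lemma anaD g f a : ana g a -> ana f a -> ana (fun x => g x + f x) a.
Proof.
move=> Hg Hf; have [r [M [N [r0 H1 H2]]]] := ana2 Hg Hf.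
by exists r, (M + N); split=> //; exact: repD.
Qed.

Lemma anaM g f a : ana g a -> ana f a -> ana (fun x => g x * f x) a.
Proof.
move=> Hg Hf; have [r [M [N [r0 H1 H2]]]] := ana2 Hg Hf.
by exists r, (M * N); split=> //; exact: repM.
Qed.

Lemma anaZ k g a : ana g a -> ana (fun x => k * g x) a.
Proof. by move=> H; apply: anaM => //; exact: ana_cst. Qed.

Lemma anaN g a : ana g a -> ana (fun x => - g x) a.
Proof.
by move=> /(anaZ (-1)); apply: eq1_ana => x; rewrite mulN1r.
Qed.

Lemma anaB g f a : ana g a -> ana f a -> ana (fun x => g x - f x) a.
Proof. by move=> Hg Hf; apply: anaD => //; exact: anaN. Qed.

Lemma ana_sum (I : Type) (s : seq I) (P : pred I) (g : I -> V -> R) a :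
  (forall i, P i -> ana (g i) a) -> ana (fun x => \sum_(i <- s | P i) g i x) a.
Proof.
move=> H; elim: s => [|i s IH].
  by apply: eq1_ana (ana_cst 0 a) => x; rewrite big_nil.
case: (boolP (P i)) => Pi.
  by apply: eq1_ana (anaD (H i Pi) IH) => x; rewrite big_cons Pi.
by apply: eq1_ana IH => x; rewrite big_cons (negbTE Pi).
Qed.

Lemma ana_deriv g a i : ana g a ->
  derivable g a (delta_mx ord0 i) /\ ana ('D_(delta_mx ord0 i) g) a.
Proof.
move=> [rho [M [r0 [c Hc]]]]; have [dg Hdg Hd] := repc_deriv i r0 Hc.
have r8 : 0 < rho / 8 by rewrite divr_gt0.
have tr h : is_derive h (delta_mx ord0 i) (fun h => g (a + h)) (dg h) ->
    is_derive (a + h) (delta_mx ord0 i) g (dg h).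
  move=> /is_deriveP H; apply/is_deriveP => e e0; have [d d0 Hd'] := H e e0.
  exists d => // t td; have := Hd' t td.
  by rewrite addrCA.
split.
  by have := tr 0 (Hd 0 (small0 (ltW r8))); rewrite addr0 => -[].
exists (rho / 8), (4 / rho * M); split=> //.
apply: (@eq_rep _ _ _ _ dg).
  by move=> h hh; have [_ ->] := tr h (Hd h hh).
exists (dcoef i c); apply: repc_shrink Hdg; rewrite (ltW r8) /=; lra.
Qed.

(** Both mixed derivatives are the constant term of the series derived twice, an expression
    symmetric in [i] and [j]. *)
Lemma ana_comm g a i j : ana g a ->
  'D_(delta_mx ord0 i) ('D_(delta_mx ord0 j) g) a =
  'D_(delta_mx ord0 j) ('D_(delta_mx ord0 i) g) a.
Proof.
move=> [rho [M [r0 [c Hc]]]].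
have D2 k l : 'D_(delta_mx ord0 k) ('D_(delta_mx ord0 l) g) a =
    dcoef k (dcoef l c) (nu0 n).
  have [dg Hdg Hd] := repc_deriv l r0 Hc.
  have r4 : 0 < rho / 4 by rewrite divr_gt0.
  have r8 : 0 < rho / 8 by rewrite divr_gt0.
  have [ddg Hddg Hdd] := repc_deriv k r4 Hdg.
  rewrite -(repc_center _ Hddg); last by rewrite ltW // divr_gt0.
  have := Hdd 0 (small0 (ltW (divr_gt0 r4 (ltr0Sn _ 7)))).
  move=> /is_deriveP H; apply: (derive_val (is_derive := _)).
  apply/is_deriveP => e e0; have [d d0 Hd'] := H e e0.
  exists (Num.min d (rho / 8)); first by rewrite lt_min d0.
  move=> t; rewrite lt_min => /andP[td tr]; have := Hd' t td.
  have E h : small (rho / 8) h -> 'D_(delta_mx ord0 l) g (h + a) = dg h.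
    move=> hh; have /is_deriveP H' := Hd h hh.
    apply: (derive_val (is_derive := _)).
    apply/is_deriveP => e' e0'; have [d' d0' Hd''] := H' e' e0'.
    exists d' => // t' td'; have := Hd'' t' td'.
    by rewrite (addrC h a) addrCA.
  rewrite addr0 E; last first.
    move=> m; rewrite !mxE eqxx /=; case: eqP => _; rewrite ?mulr1 ?mulr0 ?normr0 ltW //.
  by rewrite -[in 'D_ _ g a](add0r a) E //; exact: small0 (ltW r8).
rewrite !D2 /dcoef !ffunE.
have -> : incr j (incr i (nu0 n)) = incr i (incr j (nu0 n)).
  by apply/ffunP => m; rewrite !ffunE addnAC.
by rewrite eq_sym; ring.
Qed.

Fixpoint derivs (s : seq 'I_n) g : V -> R :=
  if s is i :: s' then derivs s' ('D_(delta_mx ord0 i) g) else g.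

Lemma ana_derivs s g a : ana g a -> ana (derivs s g) a.
Proof. by elim: s g => //= i s IH g /(ana_deriv i)[_ /IH]. Qed.

(** Differentiating in a direction where [nu] is positive lowers the degree and multiplies the
    coefficient by a nonzero integer; at degree 0 the coefficient is a value of an iterated
    derivative. *)
Lemma coef_derivs N g rho M c : 0 < rho -> repc rho M c g ->
  (forall s, derivs s g 0 = 0) -> forall nu, deg nu = N -> c nu = 0.
Proof.
elim: N g rho M c => [|N IH] g rho M c r0 Hc H nu dnu.
  by rewrite (deg_eq0 dnu) -(repc_center (ltW r0) Hc); exact: (H [::]).
have [i ni] : exists i, (0 < nu i)%N.
  apply: contrapT => ne; suff : deg nu = 0%N by rewrite dnu.
  rewrite /deg big1 // => i _; apply/eqP; rewrite -leqn0 leqNgt; apply/negP => ni.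
  by apply: ne; exists i.
have [dg Hdg Hd] := repc_deriv i r0 Hc.
have r8 : 0 < rho / 8 by rewrite divr_gt0.
have /IH K : repc (rho / 8) (4 / rho * M) (dcoef i c) ('D_(delta_mx ord0 i) g).
  have [b Hb] : repc (rho / 8) (4 / rho * M) (dcoef i c) dg.
    apply: repc_shrink Hdg; rewrite (ltW r8) /=; lra.
  by split=> // h hh; have [_ ->] := Hd h hh; exact: Hb.
have dn : deg (decr i nu) = N.
  by move: dnu; rewrite -{1}(decrK ni) deg_incr => -[].
have := K r8 (fun s => H (i :: s)) _ dn.
by rewrite /dcoef decrK // => /eqP; rewrite mulf_eq0 pnatr_eq0 /= => /eqP.
Qed.

Lemma derivs_shift s g a h : derivs s (fun x => g (a + x)) h = derivs s g (a + h).
Proof.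
elim: s g => //= i s IH g; rewrite -IH; congr (derivs s _ h); apply/funext => x.
rewrite /derive; set F := (X in lim (X @ _)); set G := (X in _ = lim (X @ _)).
by suff -> : F = G by []; apply/funext => t; rewrite /F /G /= addrCA.
Qed.

Lemma ana_eq0 g a : ana g a -> (forall s, derivs s g a = 0) -> \near a, g a = 0.
Proof.
move=> [rho [M [r0 [c Hc]]]] H; apply/nbhs_small; exists rho => // h hh.
apply: (hsum_uniq (Hc.2 h hh)); have := @hsum0 R {ffun 'I_n -> nat}.
congr hsum; apply/funext => nu.
rewrite (coef_derivs r0 Hc _ (erefl (deg nu))) ?mul0r // => s.
by rewrite derivs_shift addr0.
Qed.

Lemma derivs_near0 s g a : (\near a, g a = 0) -> \near a, derivs s g a = 0.
Proof.
elim: s g => //= i s IH g H; apply: IH.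
have := nbhs_interior H; apply: filterS => x Hx.
have Hx' : \near x, g x = cst 0 x by apply: filterS Hx => y ->.
by rewrite (near_eq_derive _ Hx') derive_cst.
Qed.

(** The terms of degree 0 and 1 are written as families on the same multi-indices and subtracted
    termwise; every remaining term has degree at least 2 and gains the factor [(s / rho) ^+ 2]. *)
Lemma ana_quad g a : ana g a -> exists (l : 'I_n -> R) (rho K : R), [/\ 0 < rho, 0 <= K &
  forall h s, small s h -> 0 <= s <= rho ->
    `|g (a + h) - g a - \sum_i l i * h ord0 i| <= K * s ^+ 2].
Proof.
move=> [rho [M [r0 [c Hc]]]].
pose e1 i : J := incr i (nu0 n).
have e1E i h : monomial h (e1 i) = h ord0 i by rewrite monomial_incr monomial0 mulr1.
have e1inj i j : e1 i = e1 j -> i = j.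
  move=> /ffunP/(_ i); rewrite !ffunE eqxx add0n => /esym.
  by case: eqVneq.
have e1deg i : deg (e1 i) = 1%N by rewrite deg_incr deg0.
pose L h := \sum_i c (e1 i) * h ord0 i.
exists (fun i => c (e1 i)), rho, (M / rho ^+ 2); split=> //.
  by rewrite divr_ge0 ?sqr_ge0 //; case: (Hc) => /bsum_ge0.
move=> h s hs /andP[s0 sr]; have hh := small_le sr hs.
  have H0 : hsum (fun nu => if nu == nu0 n then c (nu0 n) else 0) (g a).
    have -> : g a = c (nu0 n) by rewrite -(repc_center (ltW r0) Hc) addr0.
    exact: hsum1.
  have H1 : hsum (fun nu => \sum_i (if nu == e1 i then c (e1 i) * h ord0 i else 0))
     (L h) by apply: hsum_sum => i; exact: hsum1.
  have H2 := hsumD (hsumD (Hc.2 h hh) (hsumN H0)) (hsumN H1).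
  apply: hsum_le H2.
  have -> : M / rho ^+ 2 * s ^+ 2 = `|(s / rho) ^+ 2| * M.
    by rewrite ger0_norm ?sqr_ge0 // exprMn exprVn; ring.
  apply: le_bsum (bsumZ _ Hc.1) => nu.
  have [dnu|] := posnP (deg nu).
    rewrite (deg_eq0 dnu) eqxx monomial0 mulr1 subrr big1 ?subr0 ?normr0 // => i _.
    by case: eqP => // e; have := e1deg i; rewrite -e deg0.
  case dnu : (deg nu) => [//|[|k]] _.
    have [i ni] : exists i, (0 < nu i)%N.
      apply: contrapT => ne; suff : deg nu = 0%N by rewrite dnu.
      rewrite /deg big1 // => i _; apply/eqP; rewrite -leqn0 leqNgt; apply/negP => ni.
      by apply: ne; exists i.
    have -> : nu = e1 i.
      rewrite -(decrK ni); congr incr; apply: deg_eq0; move: dnu.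
      by rewrite -{1}(decrK ni) deg_incr => -[].
    rewrite (bigD1 i) //= eqxx big1 ?addr0; last first.
      by move=> j /negbTE ji; case: eqP => // /e1inj/eqP; rewrite eq_sym ji.
    case: eqP => [e|_]; first by have := e1deg i; rewrite e deg0.
    by rewrite e1E subr0 subrr normr0.
  case: eqP => [e|_]; first by move: dnu; rewrite e deg0.
  rewrite big1 ?subr0; last first.
    by move=> i _; case: eqP => // e; move: dnu; rewrite e e1deg.
  rewrite [leLHS]normrM [leRHS]normrM (normrM (c nu)) mulrCA ler_wpM2l //.
  apply: le_trans (monomial_le nu hs) _; rewrite !ger0_norm ?exprn_ge0 ?(ltW r0) //.
    rewrite dnu -addn2 !exprD exprMn exprVn.
    have -> : s ^+ 2 * (rho ^+ 2)^-1 * (rho ^+ k * rho ^+ 2) = rho ^+ k * s ^+ 2.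
      by field; rewrite gt_eqF.
    rewrite ler_wpM2r ?sqr_ge0 //; apply: lerXn2r; rewrite ?nnegrE //.
    exact: ltW.
  by rewrite divr_ge0 // ltW.
Qed.

Lemma ana_differentiable g a : ana g a -> differentiable g a.
Proof.
move=> /ana_quad[l [rho [K [r0 K0 quad]]]]; pose L (h : V) := \sum_i l i * h ord0 i.
have Ld : differentiable (fun x : V => g a + \sum_i l i *: (x ord0 i - a ord0 i)) a.
  apply: differentiableD => //.
  rewrite (_ : (fun x : V => _) = \sum_i (fun h : V => l i *: (h ord0 i - a ord0 i))).
    apply: differentiable_sum => i; apply: differentiableZ.
    by apply: differentiableB => //; exact: differentiable_coord.
  by apply/funext => h; rewrite fct_sumE.
have LE (x : V) : \sum_i l i *: (x ord0 i - a ord0 i) = L (x - a).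
  by apply: eq_bigr => i _; rewrite !mxE.
have Qd : differentiable (fun x : V => g x - (g a + \sum_i l i *: (x ord0 i - a ord0 i))) a.
  apply: differentiable_littleo0.
    by rewrite big1 ?addr0 ?subrr // => i _; rewrite subrr scaler0.
  move=> e e0.
  have K1 : 0 < K + 1 by rewrite ltr_wpDl.
  have d0 : 0 < Num.min rho (e / (K + 1)) by rewrite lt_min r0 divr_gt0.
  apply/nbhs_ballP; exists (Num.min rho (e / (K + 1))) => // x.
  rewrite mx_norm_ball /ball_ /= lt_min => /andP[x1 x2]; rewrite distrC in x1.
  rewrite distrC in x2.
  rewrite LE opprD addrA -{1}(subrK a x) addrC [x - a + a]addrC addrC.
  apply: le_trans (quad (x - a) `|x - a| _ _) _.
  - by move=> i; rewrite [leRHS]mx_normrE; apply: le_trans (le_bigmax _ _ (ord0, i)).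
  - by rewrite normr_ge0 ltW.
  rewrite expr2 mulrA ler_wpM2r //.
  move: x2; rewrite ltr_pdivlMr // => /ltW; apply: le_trans.
  by rewrite mulrC ler_wpM2l // lerDl.
rewrite (_ : g = (fun x : V => (g a + \sum_i l i *: (x ord0 i - a ord0 i)) +
  (g x - (g a + \sum_i l i *: (x ord0 i - a ord0 i))))).
  exact: differentiableD Ld Qd.
by apply/funext => x; rewrite addrC subrK.
Qed.

End OneSpace.

Lemma ana_small n (g : 'rV[R]_n -> R) a L : 0 < L -> ana g a -> g a = 0 ->
  exists2 r0, 0 < r0 & forall r, 0 < r <= r0 -> rep r L (fun h => g (a + h)).
Proof.
move=> L0 [rho [N [r0 Hc]]] ga.
have N0 : 0 <= N by case: Hc => c [/bsum_ge0].
have N1 : 0 < N + 1 by rewrite ltr_wpDl.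
exists (Num.min rho (rho * L / (N + 1))).
  by rewrite lt_min r0 divr_gt0 // mulr_gt0.
move=> r /andP[r1]; rewrite le_min => /andP[r2 r3].
apply: (@rep_le _ _ _ (r / rho * N)); last first.
  by apply: rep_shrink0 Hc; rewrite ?r1 // addr0.
move: r3; rewrite ler_pdivlMr // => r3.
rewrite mulrAC ler_pdivrMr // [L * _]mulrC; apply: le_trans r3.
by rewrite ler_wpM2l ?lerDl // ltW.
Qed.

(** The inner functions are recentred so as to vanish at [a]; on a small enough polydisc their norms
    then fit into the radius [rp] of [phi]. *)
Lemma ana_comp n p (phi : 'rV[R]_p -> R) (k : 'I_p -> 'rV[R]_n -> R) a :
  ana phi (\row_j k j a) -> (forall j, ana (k j) a) ->
  ana (fun x => phi (\row_j k j x)) a.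
Proof.
move=> [rp [M [rp0 Hphi]]] Hk.
have /choice[r Hr] : forall j, exists r, 0 < r /\ forall r', 0 < r' <= r ->
    rep r' rp (fun h => k j (a + h) - k j a).
  move=> j; have kj : ana (fun x => k j x - k j a) a.
    by apply: anaB => //; exact: ana_cst.
  by have [|r ? ?] := ana_small rp0 kj; [rewrite subrr | exists r].
pose s := \big[Num.min/1]_j r j.
have s0 : 0 < s by apply: lt_bigmin => // j _; exact: (Hr j).1.
exists s, M; split=> //.
apply: eq_rep (rep_subst (d := rp) s0 _ Hphi
  (fun j => (Hr j).2 s _)) => [h hh||j].
- by congr phi; apply/rowP => j; rewrite !mxE addrC subrK.
- by rewrite lexx ltW.
- by rewrite s0 bigmin_le_cond.
Qed.

End Analytic.

Notation cabs := (@Normc.normc _).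

(** * Complex differentiation *)

Section Modulus.
Variable R : realType.
Local Notation C := R[i].
Implicit Types (x y z : C) (r : R).

Lemma cabsD x y : cabs (x + y) <= cabs x + cabs y.
Proof. exact: (@le_normcD R x y). Qed.

Lemma cabsN x : cabs (- x) = cabs x.
Proof. exact: (@normcN R x). Qed.

Lemma cabsB x y : cabs (x - y) <= cabs x + cabs y.
Proof. by rewrite -(cabsN y); exact: cabsD. Qed.

Lemma cabs_distC x y : cabs (x - y) = cabs (y - x).
Proof. by rewrite -cabsN opprB. Qed.

Lemma cabsM x y : cabs (x * y) = cabs x * cabs y.
Proof. exact: Normc.normcM. Qed.

Lemma cabs0 : cabs (0 : C) = 0.
Proof. exact: Normc.normc0. Qed.

Lemma cabs1 : cabs (1 : C) = 1.
Proof. exact: Normc.normc1. Qed.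

Lemma cabsX x n : cabs (x ^+ n) = cabs x ^+ n.
Proof. by elim: n => [|n IH]; rewrite ?expr0 ?cabs1 // !exprS cabsM IH. Qed.

Lemma cabsV x : cabs x^-1 = (cabs x)^-1.
Proof. exact: Normc.normcV. Qed.

Lemma cabs_ge0 x : 0 <= cabs x.
Proof. by case: x => a b; exact: sqrtr_ge0. Qed.

Lemma cabs_eq0 x : (cabs x == 0) = (x == 0).
Proof. by apply/eqP/eqP => [/Normc.eq0_normc //|->]; rewrite cabs0. Qed.

Lemma cabs_gt0 x : (0 < cabs x) = (x != 0).
Proof. by rewrite lt_def cabs_ge0 andbT cabs_eq0. Qed.

Lemma cabsr r : cabs (r%:C) = `|r|.
Proof. by rewrite /Normc.normc /= expr0n /= addr0 sqrtr_sqr. Qed.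

Lemma cabs_Re x : `|complex.Re x| <= cabs x.
Proof.
case: x => a b /=; rewrite -sqrtr_sqr ler_wsqrtr // lerDl.
exact: sqr_ge0.
Qed.

Lemma cabs_Im x : `|complex.Im x| <= cabs x.
Proof.
case: x => a b /=; rewrite -sqrtr_sqr ler_wsqrtr // lerDr.
exact: sqr_ge0.
Qed.

Lemma cabs_le x : cabs x <= `|complex.Re x| + `|complex.Im x|.
Proof.
case: x => a b /=; rewrite -[leRHS]ger0_norm ?addr_ge0 // -sqrtr_sqr ler_wsqrtr //.
rewrite sqrrD !real_normK ?num_real // addrAC lerDl.
by rewrite mulrn_wge0 // mulr_ge0.
Qed.

Lemma cabsi : cabs ('i : C) = 1.
Proof. by rewrite /Normc.normc /= expr0n /= add0r expr1n sqrtr1. Qed.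

Lemma cabsJ x : cabs (conjc x) = cabs x.
Proof. by case: x => a b /=; rewrite sqrrN. Qed.

Lemma mulCJ x : x * conjc x = ((cabs x) ^+ 2)%:C.
Proof.
case: x => a b; rewrite /Normc.normc sqr_sqrtr ?addr_ge0 ?sqr_ge0 //.
apply/eqP; rewrite eq_complex /=; apply/andP; split; apply/eqP; ring.
Qed.

Lemma cabs_sum (I : Type) (s : seq I) (f : I -> C) :
  cabs (\sum_(i <- s) f i) <= \sum_(i <- s) cabs (f i).
Proof.
elim: s => [|i s IH]; first by rewrite !big_nil cabs0.
by rewrite !big_cons; apply: le_trans (cabsD _ _) _; rewrite lerD2l.
Qed.

Lemma normcE' x : `|x| = (cabs x)%:C.
Proof. by rewrite normc_def; case: x. Qed.

Lemma cReD x y : complex.Re (x + y) = complex.Re x + complex.Re y.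
Proof. by case: x; case: y. Qed.

Lemma cImD x y : complex.Im (x + y) = complex.Im x + complex.Im y.
Proof. by case: x; case: y. Qed.

Lemma cReN x : complex.Re (- x) = - complex.Re x. Proof. by case: x. Qed.

Lemma cImN x : complex.Im (- x) = - complex.Im x. Proof. by case: x. Qed.

Lemma cReM x y : complex.Re (x * y) =
  complex.Re x * complex.Re y - complex.Im x * complex.Im y.
Proof. by case: x; case: y. Qed.

Lemma cImM x y : complex.Im (x * y) =
  complex.Re x * complex.Im y + complex.Im x * complex.Re y.
Proof. by case: x; case: y. Qed.

Lemma complex_eq x y : complex.Re x = complex.Re y -> complex.Im x = complex.Im y ->
  x = y.
Proof. by case: x; case: y => ? ? ? ? /= -> ->. Qed.

End Modulus.

Section ComplexDerivative.
Variable R : realType.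
Local Notation C := R[i].
Implicit Types (f g H : C -> C) (z l : C).

(** The derivative is expressed with the real modulus [cabs], because the norm of [R[i]] is itself
    [R[i]]-valued. *)
Definition cderiv f z l := forall e : R, 0 < e -> exists2 d : R, 0 < d &
  forall t : C, cabs t < d -> cabs (f (z + t) - f z - t * l) <= e * cabs t.

Definition ccont f z := forall e : R, 0 < e -> exists2 d : R, 0 < d &
  forall t : C, cabs t < d -> cabs (f (z + t) - f z) <= e.

Lemma cderivP (f : R[i]^o -> R[i]^o) (z l : R[i]^o) : is_derive z 1 f l <-> cderiv f z l.
Proof.
apply: (iff_trans (is_deriveP _ _ _ _)); split=> H e e0.
  have e0' : (0 : R[i]) < e%:C by rewrite ltcR.
  have [d d0 Hd] := H _ e0'; exists (complex.Re d).
    by move: d0; rewrite ltcE /= => /andP[].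
  move=> t td; have := Hd t; rewrite !normcE' -rmorphM lecR.
  rewrite -[t *: 1]/(t * 1) -[t *: l]/(t * l) mulr1 [t + z]addrC; apply.
  move: d0; rewrite !ltcE /= => /andP[/eqP-> _]; by rewrite eqxx.
have eE : e = (complex.Re e)%:C.
  by move: e0; rewrite ltcE; case: e => a b /= /andP[/eqP-> _].
have e0' : 0 < complex.Re e by move: e0; rewrite ltcE => /andP[].
have [d d0 Hd] := H _ e0'; exists d%:C; first by rewrite ltcR.
move=> t; rewrite normcE' ltcR => td; have := Hd t td.
set r := complex.Re e in eE *; rewrite {}eE.
by rewrite !normcE' -rmorphM lecR -[t *: 1]/(t * 1) -[t *: l]/(t * l) mulr1 [t + z]addrC.
Qed.

Lemma cderiv_cont f z l : cderiv f z l -> ccont f z.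
Proof.
move=> H e e0; have [d d0 Hd] := H 1 ltr01.
have l1 : 0 < 1 + cabs l by rewrite ltr_wpDr ?cabs_ge0.
exists (Num.min d (e / (1 + cabs l))); first by rewrite lt_min d0 divr_gt0.
move=> t; rewrite lt_min => /andP[td te].
rewrite -(subrK (t * l) (f (z + t) - f z)); apply: le_trans (cabsD _ _) _.
apply: le_trans (lerD (Hd t td) (lexx _)) _.
rewrite cabsM [cabs t * _]mulrC -mulrDl; move: te; rewrite ltr_pdivlMr // => /ltW.
by rewrite mulrC.
Qed.

Lemma cderiv_cst k z : cderiv (fun=> k) z 0.
Proof.
by move=> e e0; exists 1 => // t _; rewrite subrr mulr0 subr0 cabs0 mulr_ge0 ?cabs_ge0 ?ltW.
Qed.

Lemma cderiv_id z : cderiv id z 1.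
Proof.
move=> e e0; exists 1 => // t _.
have -> : id (z + t) - id z - t * 1 = 0 by rewrite /=; ring.
by rewrite cabs0 mulr_ge0 ?cabs_ge0 ?ltW.
Qed.

Lemma cderivD f g z l k : cderiv f z l -> cderiv g z k ->
  cderiv (fun x => f x + g x) z (l + k).
Proof.
move=> Hf Hg e e0; have e2 : 0 < e / 2 by rewrite divr_gt0.
have [d d0 Hd] := Hf _ e2; have [d' d0' Hd'] := Hg _ e2.
exists (Num.min d d'); first by rewrite lt_min d0.
move=> t; rewrite lt_min => /andP[td td'].
have -> : f (z + t) + g (z + t) - (f z + g z) - t * (l + k) =
  (f (z + t) - f z - t * l) + (g (z + t) - g z - t * k) by ring.
apply: le_trans (cabsD _ _) _; have := Hd t td; have := Hd' t td'; lra.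
Qed.

Lemma cderivM f g z l k : cderiv f z l -> cderiv g z k ->
  cderiv (fun x => f x * g x) z (l * g z + f z * k).
Proof.
move=> Hf Hg e e0.
pose B := cabs (f z) + cabs (g z) + cabs l + 1.
have B0 : 0 < B by rewrite /B ltr_wpDl // !addr_ge0 ?cabs_ge0.
have e3 : 0 < e / (3 * B) by rewrite divr_gt0 // mulr_gt0.
have [d d0 Hd] := Hf _ e3; have [d' d0' Hd'] := Hg _ e3.
have [d1 d10 Hd1] := cderiv_cont Hg e3.
have [d2 d20 Hd2] := cderiv_cont Hg ltr01.
exists (Num.min (Num.min d d') (Num.min d1 d2)); first by rewrite !lt_min d0 d0' d10.
move=> t; rewrite !lt_min => /andP[/andP[td td'] /andP[td1 td2]].
have -> : f (z + t) * g (z + t) - f z * g z - t * (l * g z + f z * k) =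
  (f (z + t) - f z - t * l) * g (z + t) + t * l * (g (z + t) - g z) +
  f z * (g (z + t) - g z - t * k) by ring.
have G : cabs (g (z + t)) <= B.
  rewrite -(subrK (g z) (g (z + t))); apply: le_trans (cabsD _ _) _.
  have := Hd2 t td2; have := cabs_ge0 (f z); have := cabs_ge0 l; rewrite /B; lra.
have H1 := Hd t td; have H2 := Hd1 t td1; have H3 := Hd' t td'.
have t0 := cabs_ge0 t.
have E0 : e / (3 * B) * B = e / 3 by field; rewrite gt_eqF.
have K1 : cabs ((f (z + t) - f z - t * l) * g (z + t)) <= e / 3 * cabs t.
  rewrite cabsM -E0 mulrAC; apply: ler_pM; rewrite ?cabs_ge0 //.
have K2 : cabs (t * l * (g (z + t) - g z)) <= e / 3 * cabs t.
  rewrite !cabsM -E0 -mulrA mulrC; apply: ler_wpM2r => //.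
  rewrite mulrC; apply: ler_pM; rewrite ?cabs_ge0 //.
  rewrite /B; have := cabs_ge0 (f z); have := cabs_ge0 (g z); lra.
have K3 : cabs (f z * (g (z + t) - g z - t * k)) <= e / 3 * cabs t.
  rewrite cabsM -E0 [e / _ * B]mulrC -mulrA; apply: ler_pM; rewrite ?cabs_ge0 //.
  rewrite /B; have := cabs_ge0 l; have := cabs_ge0 (g z); lra.
apply: le_trans (cabsD _ _) _; apply: le_trans (lerD (cabsD _ _) (lexx _)) _; lra.
Qed.

Lemma cderivZ k f z l : cderiv f z l -> cderiv (fun x => k * f x) z (k * l).
Proof.
by move=> H; have := cderivM (cderiv_cst k z) H; rewrite mul0r add0r.
Qed.

Lemma cderivB f g z l k : cderiv f z l -> cderiv g z k ->
  cderiv (fun x => f x - g x) z (l - k).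
Proof.
move=> Hf /(cderivZ (-1)) Hg; have := cderivD Hf Hg; rewrite mulN1r.
by congr cderiv; apply/funext => x; rewrite mulN1r.
Qed.

Lemma cderivX n f z l : cderiv f z l ->
  cderiv (fun x => f x ^+ n) z (n%:R * f z ^+ n.-1 * l).
Proof.
move=> H; elim: n => [|n IH].
  rewrite !mul0r; exact: cderiv_cst.
have := cderivM H IH; congr cderiv; last first.
  case: n {IH} => [|n] /=; first by rewrite !expr0; ring.
  by rewrite !exprS -!natr1; ring.
by apply/funext => x; rewrite exprS.
Qed.

Lemma cderivV f z l : f z != 0 -> cderiv f z l ->
  cderiv (fun x => (f x)^-1) z (- l / f z ^+ 2).
Proof.
move=> fz H e e0.
have a0 : 0 < cabs (f z) by rewrite cabs_gt0.
set a := cabs (f z) in a0.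
have a2 : 0 < a / 2 by rewrite divr_gt0.
have [d1 d10 H1] := cderiv_cont H a2.
(* [e1] and [e3] are tuned so that, with [f (z + t)] bounded below by [a / 2], each of the two terms
   contributes at most half of [e * cabs t]. *)
pose e1 := e * a ^+ 2 / 4; have e10 : 0 < e1 by rewrite divr_gt0 // mulr_gt0 // exprn_gt0.
have [d2 d20 H2] := H _ e10.
pose e3 := e * a ^+ 3 / (4 * (cabs l + 1)).
have l0 : 0 < cabs l + 1 by rewrite ltr_wpDl ?cabs_ge0.
have e30 : 0 < e3 by rewrite divr_gt0 // ?mulr_gt0 // exprn_gt0.
have [d3 d30 H3] := cderiv_cont H e30.
exists (Num.min d1 (Num.min d2 d3)); first by rewrite !lt_min d10 d20.
move=> t; rewrite !lt_min => /andP[/H1 K1 /andP[/H2 K2 /H3 K3]].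
have b : a / 2 <= cabs (f (z + t)).
  have : a <= cabs (f (z + t)) + cabs (f (z + t) - f z).
    have -> : a = cabs (f (z + t) - (f (z + t) - f z)) by rewrite subKr.
    exact: cabsB.
  by lra.
have b0 : 0 < cabs (f (z + t)) by apply: lt_le_trans b.
have ft : f (z + t) != 0 by rewrite -cabs_gt0.
have -> : (f (z + t))^-1 - (f z)^-1 - t * (- l / f z ^+ 2) =
  ((f z)^-1 * (f (z + t))^-1) * (- (f (z + t) - f z - t * l)
     + t * l * (f z)^-1 * (f (z + t) - f z)).
  by field; rewrite ft fz.
rewrite !cabsM !cabsV -/a.
apply: (@le_trans _ _ (a^-1 * (2 / a) * (e1 * cabs t + cabs t * cabs l * a^-1 * e3))).
  apply: ler_pM; rewrite ?cabs_ge0 //; first by rewrite mulr_ge0 ?invr_ge0 ?cabs_ge0.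
    apply: ler_wpM2l; first by rewrite invr_ge0 ltW.
    rewrite -[2 / a]invf_div; by rewrite lef_pV2 ?posrE.
  apply: le_trans (cabsD _ _) _; rewrite cabsN !cabsM cabsV; apply: lerD => //.
  by apply: ler_wpM2l => //; rewrite !mulr_ge0 ?cabs_ge0 ?invr_ge0 // ltW.
have -> : a^-1 * (2 / a) * (e1 * cabs t + cabs t * cabs l * a^-1 * e3) =
  e * cabs t * (1 / 2 + 1 / 2 * (cabs l / (cabs l + 1))).
  by rewrite /e1 /e3; field; rewrite !gt_eqF.
rewrite -[leRHS]mulr1 ler_wpM2l // ?mulr_ge0 ?cabs_ge0 ?(ltW e0) //.
have : cabs l / (cabs l + 1) <= 1 by rewrite ler_pdivrMr // mul1r lerDl.
lra.
Qed.

End ComplexDerivative.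

(** * Goursat's theorem and Taylor expansion *)

Section RealIntegral.
Variable R : realType.
Local Notation mu := (@lebesgue_measure R).
Implicit Types (h k P : R -> R) (a b c : R).

Definition rint a b h := \int[mu]_(x in `[a, b]) h x.

Lemma rint_integrable a b h : continuous h -> mu.-integrable `[a, b] (EFin \o h).
Proof.
move=> ch; apply: continuous_compact_integrable; first exact: segment_compact.
exact: continuous_subspaceT.
Qed.

Lemma rintD a b h k : continuous h -> continuous k ->
  rint a b (fun x => h x + k x) = rint a b h + rint a b k.
Proof. by move=> ch ck; rewrite /rint RintegralD //; exact: rint_integrable. Qed.

Lemma rintZ a b r h : continuous h -> rint a b (fun x => r * h x) = r * rint a b h.
Proof. by move=> ch; rewrite /rint RintegralZl //; exact: rint_integrable. Qed.

Lemma rint_cst a b r : a <= b -> rint a b (fun=> r) = r * (b - a).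
Proof.
move=> ab; rewrite /rint Rintegral_cst //= lebesgue_measure_itv /= lte_fin.
by case: ltgtP ab => // -> _; rewrite subrr.
Qed.

Lemma rint_bound a b h M : continuous h -> a <= b ->
  (forall x, a <= x <= b -> `|h x| <= M) -> `|rint a b h| <= M * (b - a).
Proof.
move=> ch ab H; rewrite -rint_cst //.
apply: le_trans (le_normr_Rintegral _ (rint_integrable _ _ ch)) _ => //.
apply: le_Rintegral => //.
- apply: rint_integrable => x; apply: continuous_comp; first exact: ch.
  exact: norm_continuous.
- by apply: rint_integrable => x; exact: cst_continuous.
Qed.

Lemma rint_ge0 a b h : (forall x, 0 <= h x) -> 0 <= rint a b h.
Proof. by move=> h0; apply: Rintegral_ge0. Qed.

Lemma rint_split a c b h : continuous h -> a <= c <= b ->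
  rint a b h = rint a c h + rint c b h.
Proof.
move=> ch /andP[ac cb]; have := Rintegral_itvB (rint_integrable a b ch) (x := c).
rewrite !bnd_simp => /(_ ac cb) H.
rewrite /rint -[LHS](subrK (\int[mu]_(t in `[a, c]) h t)) H addrC; congr (_ + _).
rewrite Rintegral_itv_obnd_cbnd //.
by apply: integrableS (rint_integrable c b ch) => //; exact: subset_itv_oc_cc.
Qed.

Lemma rint_FTC a b P h : a <= b -> continuous h -> (forall x : R, is_derive x 1 P (h x)) ->
  rint a b h = P b - P a.
Proof.
move=> ab ch dP; case: (ltgtP a b) ab => // [ab _|-> _]; last first.
  by rewrite subrr /rint set_itv1 Rintegral_set1.
have cP : continuous P.
  by move=> x; apply: differentiable_continuous; apply/derivable1_diffP; exact: ex_derive.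
rewrite /rint /Rintegral (continuous_FTC2 (F := P)) //.
- exact: continuous_subspaceT.
- split.
  + by move=> x _; have [] := dP x.
  + exact/cvg_at_right_filter/cP.
  + exact/cvg_at_left_filter/cP.
- by move=> x _; rewrite derive1E; have [] := dP x.
Qed.

End RealIntegral.

(** * Integrals of complex functions of a real variable *)

Section ComplexIntegral.
Variable R : realType.
Local Notation C := R[i].
Implicit Types (h k P : R -> C) (a b c : R).

Definition cint a b h : C :=
  rint a b (fun x => complex.Re (h x)) +i* rint a b (fun x => complex.Im (h x)).

Definition curve h := continuous (fun x => complex.Re (h x) : R) /\
  continuous (fun x => complex.Im (h x) : R).

Definition cder P h := forall x : R, is_derive x 1 (fun x => complex.Re (P x) : R) (complex.Re (h x))
  /\ is_derive x 1 (fun x => complex.Im (P x) : R) (complex.Im (h x)).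

Lemma curve_cst (z : C) : curve (fun=> z).
Proof. by split=> x; exact: cst_continuous. Qed.

Lemma curveD h k : curve h -> curve k -> curve (fun x => h x + k x).
Proof.
move=> [h1 h2] [k1 k2]; split.
  rewrite (_ : (fun x => _) = (fun x => complex.Re (h x) + complex.Re (k x))).
    by move=> x; exact: (continuousD (h1 x) (k1 x)).
  by apply/funext => x; rewrite cReD.
rewrite (_ : (fun x => _) = (fun x => complex.Im (h x) + complex.Im (k x))).
  by move=> x; exact: (continuousD (h2 x) (k2 x)).
by apply/funext => x; rewrite cImD.
Qed.

Lemma curveM h k : curve h -> curve k -> curve (fun x => h x * k x).
Proof.
move=> [h1 h2] [k1 k2]; split.
  rewrite (_ : (fun x => _) = (fun x => complex.Re (h x) * complex.Re (k x) -
     complex.Im (h x) * complex.Im (k x))).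
    move=> x; apply: (continuousB (f := fun x => complex.Re (h x) * complex.Re (k x))
      (g := fun x => complex.Im (h x) * complex.Im (k x))).
      exact: (continuousM (h1 x) (k1 x)).
    exact: (continuousM (h2 x) (k2 x)).
  by apply/funext => x; rewrite cReM.
rewrite (_ : (fun x => _) = (fun x => complex.Re (h x) * complex.Im (k x) +
     complex.Im (h x) * complex.Re (k x))).
  move=> x; apply: (continuousD (f := fun x => complex.Re (h x) * complex.Im (k x))
      (g := fun x => complex.Im (h x) * complex.Re (k x))).
    exact: (continuousM (h1 x) (k2 x)).
  exact: (continuousM (h2 x) (k1 x)).
by apply/funext => x; rewrite cImM.
Qed.

Lemma curveN h : curve h -> curve (fun x => - h x).
Proof.
move=> /(curveM (curve_cst (-1))); congr curve; apply/funext => x; by rewrite mulN1r.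
Qed.

Lemma curveB h k : curve h -> curve k -> curve (fun x => h x - k x).
Proof. by move=> hh /curveN; exact: curveD. Qed.

Lemma curveX n h : curve h -> curve (fun x => h x ^+ n).
Proof.
move=> hh; elim: n => [|n IH].
  by have := curve_cst 1; congr curve; apply/funext => x; rewrite expr0.
by have := curveM hh IH; congr curve; apply/funext => x; rewrite exprS.
Qed.

Lemma curveJ h : curve h -> curve (fun x => conjc (h x)).
Proof.
move=> [h1 h2]; split.
  rewrite (_ : (fun x => _) = (fun x => complex.Re (h x))) //.
  by apply/funext => x; case: (h x).
rewrite (_ : (fun x => _) = (fun x => - complex.Im (h x))).
  by move=> x; exact: (continuousN (h2 x)).
by apply/funext => x; case: (h x).
Qed.

Lemma cder_curve P h : cder P h -> curve P.
Proof.
move=> H; split=> x; apply: differentiable_continuous; apply/derivable1_diffP.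
  by case: (H x) => -[].
by case: (H x) => _ [].
Qed.

Lemma cder_cst (z : C) : cder (fun=> z) (fun=> 0).
Proof. by move=> x; split; exact: is_derive_cst. Qed.

Lemma cderD P Q h k : cder P h -> cder Q k ->
  cder (fun x => P x + Q x) (fun x => h x + k x).
Proof.
move=> HP HQ x; have [p1 p2] := HP x; have [q1 q2] := HQ x; split.
  rewrite cReD (_ : (fun x => _) = (fun x => complex.Re (P x)) + (fun x => complex.Re (Q x))).
    exact: is_deriveD.
  by apply/funext => y; rewrite cReD.
rewrite cImD (_ : (fun x => _) = (fun x => complex.Im (P x)) + (fun x => complex.Im (Q x))).
  exact: is_deriveD.
by apply/funext => y; rewrite cImD.
Qed.

Lemma cderM P Q h k : cder P h -> cder Q k ->
  cder (fun x => P x * Q x) (fun x => h x * Q x + P x * k x).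
Proof.
move=> HP HQ x; have [p1 p2] := HP x; have [q1 q2] := HQ x; split.
  rewrite (_ : (fun x => _) = (fun x => complex.Re (P x)) * (fun x => complex.Re (Q x)) -
     (fun x => complex.Im (P x)) * (fun x => complex.Im (Q x))).
    apply: (is_derive_eq (is_deriveB (is_deriveM p1 q1) (is_deriveM p2 q2))).
    rewrite !cReD !cReM /GRing.scale /=; ring.
  by apply/funext => y; rewrite cReM.
rewrite (_ : (fun x => _) = (fun x => complex.Re (P x)) * (fun x => complex.Im (Q x)) +
     (fun x => complex.Im (P x)) * (fun x => complex.Re (Q x))).
  apply: (is_derive_eq (is_deriveD (is_deriveM p1 q2) (is_deriveM p2 q1))).
  rewrite !cImD !cImM /GRing.scale /=; ring.
by apply/funext => y; rewrite cImM.
Qed.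

Lemma cderZ (z : C) P h : cder P h -> cder (fun x => z * P x) (fun x => z * h x).
Proof.
move=> H; have := cderM (cder_cst z) H; congr cder; apply/funext => x.
by rewrite mul0r add0r.
Qed.

Lemma cderX n P h : cder P h -> cder (fun x => P x ^+ n) (fun x => n%:R * P x ^+ n.-1 * h x).
Proof.
move=> H; elim: n => [|n IH].
  have := cder_cst 1; congr cder; apply/funext => x; by rewrite ?expr0 // !mul0r.
have := cderM H IH; congr cder; apply/funext => x; first by rewrite exprS.
case: n {IH} => [|n] /=; first by rewrite !expr0; ring.
by rewrite !exprS -!natr1; ring.
Qed.

Lemma continuousZ (r : R) (f : R -> R) : continuous f -> continuous (fun x => r * f x).
Proof. by move=> cf x; apply: cvgM; [exact: cvg_cst | exact: cf]. Qed.

Lemma cintD a b h k : curve h -> curve k ->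
  cint a b (fun x => h x + k x) = cint a b h + cint a b k.
Proof.
move=> [h1 h2] [k1 k2]; apply: complex_eq => /=.
  rewrite -rintD //; congr rint; apply/funext => x; by rewrite cReD.
rewrite -rintD //; congr rint; apply/funext => x; by rewrite cImD.
Qed.

Lemma cintZ a b (z : C) h : curve h -> cint a b (fun x => z * h x) = z * cint a b h.
Proof.
move=> [h1 h2]; apply: complex_eq; rewrite ?cReM ?cImM /=.
  rewrite -!rintZ // -mulN1r -rintZ -?rintD //.
  - by congr rint; apply/funext => x; rewrite cReM mulN1r.
  - exact: continuousZ.
  - by do 2 apply: continuousZ.
  - exact: continuousZ.
rewrite -!rintZ // -?rintD //.
- by congr rint; apply/funext => x; rewrite cImM.
- exact: continuousZ.
- exact: continuousZ.
Qed.

Lemma cintN a b h : curve h -> cint a b (fun x => - h x) = - cint a b h.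
Proof.
move=> ch; rewrite -mulN1r -cintZ //; congr cint; apply/funext => x.
by rewrite mulN1r.
Qed.

Lemma cintB a b h k : curve h -> curve k ->
  cint a b (fun x => h x - k x) = cint a b h - cint a b k.
Proof. by move=> ch ck; rewrite cintD ?cintN //; exact: curveN. Qed.

Lemma cintJ a b h : curve h -> cint a b (fun x => conjc (h x)) = conjc (cint a b h).
Proof.
move=> [h1 h2]; apply: complex_eq => /=.
  by congr rint; apply/funext => x; case: (h x).
rewrite -mulN1r -rintZ //; congr rint; apply/funext => x; rewrite mulN1r.
by case: (h x).
Qed.

Lemma cint_split a c b h : curve h -> a <= c <= b ->
  cint a b h = cint a c h + cint c b h.
Proof. by move=> [h1 h2] acb; apply: complex_eq => /=; exact: rint_split. Qed.

(** Real and imaginary parts are bounded separately, whence the factor 2; the estimates that use it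
    have constants to spare. *)
Lemma cint_bound a b h (M : R) : curve h -> a <= b ->
  (forall x, a <= x <= b -> cabs (h x) <= M) -> cabs (cint a b h) <= 2 * M * (b - a).
Proof.
move=> [h1 h2] ab H; apply: le_trans (cabs_le _) _; rewrite -mulrA mulrDl mul1r /=.
apply: lerD; apply: rint_bound => // x /H; apply: le_trans.
  exact: cabs_Re.
exact: cabs_Im.
Qed.

Lemma cint_FTC a b P h : a <= b -> curve h -> cder P h -> cint a b h = P b - P a.
Proof.
move=> ab [h1 h2] H; apply: complex_eq; rewrite ?cReD ?cImD ?cReN ?cImN /=.
  by apply: (rint_FTC (P := fun x => complex.Re (P x))) => // x; case: (H x).
by apply: (rint_FTC (P := fun x => complex.Im (P x))) => // x; case: (H x).
Qed.

Lemma cint_cst a b (z : C) : a <= b -> cint a b (fun=> z) = z * (b - a)%:C.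
Proof.
move=> ab; apply: complex_eq; rewrite ?cReM ?cImM /= rint_cst // mulr0.
  by rewrite subr0.
by rewrite add0r.
Qed.

Lemma curve_comp (f : C -> C) h : (forall x, ccont f (h x)) -> curve h ->
  curve (fun x => f (h x)).
Proof.
move=> cf [h1 h2].
suff H x : forall e, 0 < e -> \forall y \near x, cabs (f (h y) - f (h x)) <= e.
  split=> x; apply/cvgrPdist_le => e e0; have := H x e e0; apply: filterS => y hy;
    rewrite distrC -?cReN -?cImN -?cReD -?cImD; apply: le_trans hy.
    exact: cabs_Re.
  exact: cabs_Im.
move=> e e0; have [d d0 Hd] := cf x e e0.
have d2 : 0 < d / 3 by rewrite divr_gt0.
have /cvgrPdist_le/(_ _ d2) H1 := h1 x; have /cvgrPdist_le/(_ _ d2) H2 := h2 x.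
near=> y.
have K1 : `|complex.Re (h x) - complex.Re (h y)| <= d / 3 by near: y.
have K2 : `|complex.Im (h x) - complex.Im (h y)| <= d / 3 by near: y.
have := Hd (h y - h x); rewrite [h x + _]addrC subrK; apply.
apply: le_lt_trans (cabs_le _) _; rewrite cReD cImD cReN cImN.
rewrite distrC in K1; rewrite distrC in K2; lra.
Unshelve. all: by end_near. Qed.

End ComplexIntegral.

(** * Goursat's argument on parameter rectangles *)

Section Goursat.
Variable R : realType.
Local Notation C := R[i].

Lemma nested_point (a b : nat -> R) : (forall k, a k <= a k.+1) ->
  (forall k, b k.+1 <= b k) -> (forall k, a k <= b k) ->
  exists t, forall k, a k <= t <= b k.
Proof.
move=> ha hb hab.
have am : {homo a : k l / (k <= l)%N >-> k <= l} by apply: homo_leq => //; exact: le_trans.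
have bm k l : (k <= l)%N -> b l <= b k.
  elim: l => [|l IH]; first by rewrite leqn0 => /eqP ->.
  by rewrite leq_eqVlt ltnS => /predU1P[->//|/IH]; exact: le_trans.
have ab k l : a k <= b l.
  apply: le_trans (am _ _ (leq_maxl k l)) _; apply: le_trans (hab _) _.
  exact/bm/leq_maxr.
have hs : has_sup (range a) by split; [exists (a 0%N), 0%N | exists (b 0%N) => _ [k _ <-]].
exists (sup (range a)) => k; apply/andP; split.
  by apply: sup_upper_bound => //; exists k.
by apply: sup_le_ub => //; [case: hs | move=> _ [l _ <-]].
Qed.

Lemma pow2_small (S d : R) : 0 < d -> exists k, S / 2 ^+ k < d.
Proof.
move=> d0; exists (Num.bound `|S / d|).
rewrite ltr_pdivrMr ?exprn_gt0 // mulrC -ltr_pdivrMr //.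
apply: (@lt_trans _ _ (Num.bound `|S / d|)%:R).
  apply: le_lt_trans (ler_norm _) _; by apply: archi_boundP.
by rewrite -natrX ltr_nat ltn_expl.
Qed.

Lemma quarters (x p q r s : R) : x <= p + q + (r + s) ->
  4 * p < x -> 4 * q < x -> 4 * r < x -> x <= 4 * s.
Proof. by lra. Qed.

Lemma midpoint (a b : R) : a <= b -> let e := (a + b) / 2 in
  [/\ a <= e, e <= b, e - a = (b - a) / 2 & b - e = (b - a) / 2].
Proof. by move=> ab /=; split; lra. Qed.

(** Among the four quarters of a rectangle one keeps at least a quarter of the modulus. The local
    bound at the common point of the nested rectangles decreases by the same factor 4 at each stage,
    so it carries back to the first rectangle with an arbitrarily small [e]. *)
Lemma bisection (Phi : R -> R -> R -> R -> C) (a b c d : R) : a <= b -> c <= d ->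
  (forall a e b c d, a <= e <= b -> c <= d ->
     Phi a b c d = Phi a e c d + Phi e b c d) ->
  (forall a b c e d, a <= b -> c <= e <= d ->
     Phi a b c d = Phi a b c e + Phi a b e d) ->
  (forall t s e, 0 < e -> exists2 r : R, 0 < r & forall a b c d,
     a <= t <= b -> c <= s <= d -> b - a < r -> d - c < r ->
     cabs (Phi a b c d) <= e * ((b - a) + (d - c)) ^+ 2) ->
  Phi a b c d = 0.
Proof.
move=> ab cd add1 add2 loc.
pose Q := (R * R * (R * R))%type.
pose F (q : Q) := cabs (Phi q.1.1 q.1.2 q.2.1 q.2.2).
pose ok (q : Q) := (q.1.1 <= q.1.2) && (q.2.1 <= q.2.2).
pose good (q q' : Q) := [/\ ok q', q.1.1 <= q'.1.1, q'.1.2 <= q.1.2, q.2.1 <= q'.2.1 &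
   q'.2.2 <= q.2.2] /\ [/\ q'.1.2 - q'.1.1 = (q.1.2 - q.1.1) / 2,
   q'.2.2 - q'.2.1 = (q.2.2 - q.2.1) / 2 & F q <= 4 * F q'].
have step q : exists q', ok q -> good q q'.
  case: q => [[a1 b1] [c1 d1]]; case: (boolP (ok _)) => [|_]; last first.
    by exists ((0, 0), (0, 0)).
  rewrite /ok /= => /andP[ab1 cd1].
  pose e := (a1 + b1) / 2; pose f := (c1 + d1) / 2.
  have [ae1 eb1 he1 he2] := midpoint ab1; have [cf1 fd1 hf1 hf2] := midpoint cd1.
  rewrite -/e in ae1 eb1 he1 he2; rewrite -/f in cf1 fd1 hf1 hf2.
  have ae : a1 <= e <= b1 by rewrite ae1.
  have cf : c1 <= f <= d1 by rewrite cf1.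
  have HF : F ((a1, b1), (c1, d1)) <= F ((a1, e), (c1, f)) + F ((e, b1), (c1, f)) +
      (F ((a1, e), (f, d1)) + F ((e, b1), (f, d1))).
    rewrite /F /= (add2 a1 b1 c1 f d1) // (add1 a1 e b1 c1 f) // (add1 a1 e b1 f d1) //.
    apply: le_trans (cabsD _ _) _; apply: lerD; exact: cabsD.
  have [H1|H1] := leP (F ((a1, b1), (c1, d1))) (4 * F ((a1, e), (c1, f))).
    by exists ((a1, e), (c1, f)) => _; split; split; rewrite /ok /= ?lexx ?ae1 ?eb1 ?cf1 ?fd1 ?he1 ?he2 ?hf1 ?hf2 //.
  have [H2|H2] := leP (F ((a1, b1), (c1, d1))) (4 * F ((e, b1), (c1, f))).
    by exists ((e, b1), (c1, f)) => _; split; split; rewrite /ok /= ?lexx ?ae1 ?eb1 ?cf1 ?fd1 ?he1 ?he2 ?hf1 ?hf2 //.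
  have [H3|H3] := leP (F ((a1, b1), (c1, d1))) (4 * F ((a1, e), (f, d1))).
    by exists ((a1, e), (f, d1)) => _; split; split; rewrite /ok /= ?lexx ?ae1 ?eb1 ?cf1 ?fd1 ?he1 ?he2 ?hf1 ?hf2 //.
  have H4 := quarters HF H1 H2 H3.
  by exists ((e, b1), (f, d1)) => _; split; split; rewrite /ok /= ?lexx ?ae1 ?eb1 ?cf1 ?fd1 ?he1 ?he2 ?hf1 ?hf2 //.
have [g Hg] := choice step.
pose q k := iter k g ((a, b), (c, d)).
have okq k : ok (q k).
  elim: k => [|k IH]; first by rewrite /ok /= ab.
  by have [[]] := Hg _ IH.
have gq k : good (q k) (q k.+1) by exact: Hg.
have [t Ht] : exists t, forall k, (q k).1.1 <= t <= (q k).1.2.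
  apply: nested_point => k.
  - by have [[]] := gq k.
  - by have [[]] := gq k.
  - by have /andP[] := okq k.
have [s Hs] : exists s, forall k, (q k).2.1 <= s <= (q k).2.2.
  apply: nested_point => k.
  - by have [[]] := gq k.
  - by have [[]] := gq k.
  - by have /andP[] := okq k.
have len1 k : (q k).1.2 - (q k).1.1 = (b - a) / 2 ^+ k.
  elim: k => [|k IH]; first by rewrite divr1.
  have [_ [-> _ _]] := gq k; rewrite IH exprS; field.
  by rewrite expf_neq0 // pnatr_eq0.
have len2 k : (q k).2.2 - (q k).2.1 = (d - c) / 2 ^+ k.
  elim: k => [|k IH]; first by rewrite divr1.
  have [_ [_ -> _]] := gq k; rewrite IH exprS; field.
  by rewrite expf_neq0 // pnatr_eq0.
have Fk k : cabs (Phi a b c d) <= 4 ^+ k * F (q k).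
  elim: k => [|k IH]; first by rewrite mul1r.
  apply: le_trans IH _; rewrite exprSr -mulrA ler_wpM2l ?exprn_ge0 //.
  by have [_ [_ _ ->]] := gq k.
apply/eqP; rewrite -cabs_eq0 eq_le cabs_ge0 andbT.
pose S := (b - a) + (d - c).
apply/ler_addgt0Pr => e e0; rewrite add0r.
have S1 : 0 < S ^+ 2 + 1 by rewrite ltr_wpDl ?sqr_ge0.
have [r r0 Hr] := loc t s (e / (S ^+ 2 + 1)) (divr_gt0 e0 S1).
have [k Hk] := pow2_small S r0.
have p2 : 0 < (2 : R) ^+ k by rewrite exprn_gt0.
have small1 : (q k).1.2 - (q k).1.1 < r.
  rewrite len1; apply: le_lt_trans Hk; rewrite ler_pM2r ?invr_gt0 // /S lerDl; lra.
have small2 : (q k).2.2 - (q k).2.1 < r.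
  rewrite len2; apply: le_lt_trans Hk; rewrite ler_pM2r ?invr_gt0 // /S lerDr; lra.
apply: le_trans (Fk k) _.
have K := Hr _ _ _ _ (Ht k) (Hs k) small1 small2.
apply: le_trans (ler_wpM2l _ K) _; first by rewrite exprn_ge0.
rewrite len1 len2 -mulrDl -/S.
have -> : (4 : R) ^+ k = 2 ^+ k * 2 ^+ k by rewrite -exprMn -natrM.
have -> : 2 ^+ k * 2 ^+ k * (e / (S ^+ 2 + 1) * (S / 2 ^+ k) ^+ 2) =
  e * (S ^+ 2 / (S ^+ 2 + 1)) by field; rewrite !gt_eqF.
by rewrite ler_piMr ?(ltW e0) // ler_pdivrMr // mul1r lerDl.
Qed.

Section Pullback.
Variables (Z Zt Zs : R -> R -> C) (K : C -> C) (L : R).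
Hypothesis L0 : 0 < L.
Hypothesis dZt : forall s, cder (Z ^~ s) (Zt ^~ s).
Hypothesis dZs : forall t, cder (Z t) (Zs t).
Hypothesis cZt : forall s, curve (Zt ^~ s).
Hypothesis cZs : forall t, curve (Zs t).
Hypothesis bZt : forall t s, cabs (Zt t s) <= L.
Hypothesis bZs : forall t s, cabs (Zs t s) <= L.
Hypothesis HK : forall t s, exists l, cderiv K (Z t s) l.

Definition side (z z' : R -> C) a b := cint a b (fun x => K (z x) * z' x).

(** The integral of the form [K dZ] along the image under [Z] of the boundary of a rectangle. After
    pulling back, only rectangles with sides parallel to the axes are ever subdivided, whatever the
    curves in the plane. *)
Definition boundary a b c d := side (Z ^~ c) (Zt ^~ c) a b + side (Z b) (Zs b) c d -
  side (Z ^~ d) (Zt ^~ d) a b - side (Z a) (Zs a) c d.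

(** The affine approximation of [K] at [w0] has an explicit primitive. A side therefore contributes
    two end-point values, which cancel around the rectangle, and an error [r] coming from the
    remainder of the approximation. *)
Lemma side_local (z z' : R -> C) a b (w0 l : C) (e D : R) :
  cder z z' -> curve z' -> curve (fun x => K (z x)) -> a <= b ->
  (forall x, cabs (z' x) <= L) ->
  (forall x, a <= x <= b -> cabs (K (z x) - K w0 - (z x - w0) * l) <= e * D) ->
  0 <= e * D ->
  exists2 r : C, cabs r <= 2 * (e * D * L) * (b - a) & side z z' a b = r +
    ((K w0 * z b + l / 2 * (z b - w0) ^+ 2) - (K w0 * z a + l / 2 * (z a - w0) ^+ 2)).
Proof.
move=> dz cz' cK ab bz' H eD.
have cz := cder_curve dz.
pose E x := (K (z x) - K w0 - (z x - w0) * l) * z' x.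
pose G x := (K w0 + l * (z x - w0)) * z' x.
have cw : curve (fun x => z x - w0) by apply: curveB => //; exact: curve_cst.
have cE : curve E.
  apply: curveM => //; apply: curveB; first by apply: curveB => //; exact: curve_cst.
  by apply: curveM => //; exact: curve_cst.
have cG : curve G.
  apply: curveM => //; apply: curveD; first exact: curve_cst.
  by apply: curveM => //; exact: curve_cst.
have dG : cder (fun x => K w0 * z x + l / 2 * (z x - w0) ^+ 2) G.
  have d1 := cderZ (K w0) dz.
  have d2 := cderZ (l / 2) (cderX 2 (cderD dz (cder_cst (- w0)))).
  have := cderD d1 d2; congr cder; apply/funext => x; rewrite /G /= expr1 addr0.
  by field.
exists (cint a b E).
  apply: cint_bound => // x xab; rewrite /E cabsM; apply: ler_pM; rewrite ?cabs_ge0 //.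
  exact: H.
rewrite -(cint_FTC ab cG dG) -cintD // /side; congr cint; apply/funext => x.
by rewrite /E /G; ring.
Qed.

Lemma curveKt s : curve (fun t => K (Z t s)).
Proof.
apply: (curve_comp (h := Z ^~ s)); last exact: cder_curve (dZt s).
by move=> x; have [l Hl] := HK x s; exact: cderiv_cont Hl.
Qed.

Lemma curveKs t : curve (fun s => K (Z t s)).
Proof.
apply: (curve_comp (h := Z t)); last exact: cder_curve (dZs t).
by move=> x; have [l Hl] := HK t x; exact: cderiv_cont Hl.
Qed.

Lemma lipschitz_cder (z z' : R -> C) x y : cder z z' -> curve z' ->
  (forall x, cabs (z' x) <= L) -> cabs (z x - z y) <= 2 * L * `|x - y|.
Proof.
move=> dz cz bz; wlog xy : x y / y <= x => [W|].
  have [|/ltW] := leP y x; first exact: W.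
  by move=> /W; rewrite cabs_distC distrC.
by rewrite -(cint_FTC xy cz dz) ger0_norm ?subr_ge0 //; exact: cint_bound.
Qed.

Lemma boundary0 a b c d : a <= b -> c <= d -> boundary a b c d = 0.
Proof.
move=> ab cd; have c1 s : curve (fun t => K (Z t s) * Zt t s).
  exact: curveM (curveKt s) (cZt s).
have c2 t : curve (fun s => K (Z t s) * Zs t s) by exact: curveM (curveKs t) (cZs t).
apply: bisection => //.
- move=> a1 e b1 c0 d0 /= aeb _; rewrite /boundary /side.
  by rewrite (cint_split (c := e) (c1 c0)) // (cint_split (c := e) (c1 d0)) //; ring.
- move=> a1 b1 c0 e d0 /= _ ced; rewrite /boundary /side.
  by rewrite (cint_split (c := e) (c2 b1)) // (cint_split (c := e) (c2 a1)) //; ring.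
move=> t0 s0 e e0; have [l Hl] := HK t0 s0.
(* With [D = 2 * L * S] the four errors add up to [8 * e' * L ^+ 2 * S ^+ 2], half of what is
   allowed. *)
pose e' := e / (16 * L ^+ 2).
have e'0 : 0 < e' by rewrite divr_gt0 // mulr_gt0 // exprn_gt0.
have [r r0 Hr] := Hl e' e'0.
exists (r / (8 * L)); first by rewrite divr_gt0 // mulr_gt0.
clear a b c d ab cd => a b c d /andP[at0 tb] /andP[cs0 sd] abr cdr.
have ab : a <= b by exact: le_trans tb.
have cd : c <= d by exact: le_trans sd.
pose S := (b - a) + (d - c); pose D := 2 * L * S.
have S0 : 0 <= S by rewrite /S; lra.
have D0 : 0 <= D by rewrite mulr_ge0 // mulr_ge0 // ltW.
have eD0 : 0 <= e' * D by rewrite mulr_ge0 // ltW.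
have Dr : D < r.
  have L8 : 0 < 8 * L by rewrite mulr_gt0.
  rewrite ltr_pdivlMr // in abr; rewrite ltr_pdivlMr // in cdr.
  have -> : D = ((b - a) * (8 * L) + (d - c) * (8 * L)) / 4 by rewrite /D /S; field.
  lra.
have HZ t s : a <= t <= b -> c <= s <= d -> cabs (Z t s - Z t0 s0) <= D.
  move=> /andP[at_ tb'] /andP[cs' sd'].
  have -> : Z t s - Z t0 s0 = (Z t s - Z t0 s) + (Z t0 s - Z t0 s0) by ring.
  apply: le_trans (cabsD _ _) _.
  have H1 := lipschitz_cder t t0 (dZt s) (cZt s) (fun x => bZt x s).
  have H2 := lipschitz_cder s s0 (dZs t0) (cZs t0) (bZs t0).
  apply: le_trans (lerD H1 H2) _; rewrite -mulrDr /D ler_wpM2l ?mulr_ge0 ?(ltW L0) //.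
  by apply: lerD; rewrite ler_norml; lra.
have HE t s : a <= t <= b -> c <= s <= d ->
    cabs (K (Z t s) - K (Z t0 s0) - (Z t s - Z t0 s0) * l) <= e' * D.
  move=> ht hs; have H := HZ t s ht hs.
  have := Hr (Z t s - Z t0 s0); rewrite [Z t0 s0 + _]addrC subrK.
  move=> /(_ (le_lt_trans H Dr)) /le_trans; apply.
  by rewrite ler_wpM2l // ltW.
have cc : c <= c <= d by rewrite lexx. have dd : c <= d <= d by rewrite lexx cd.
have aa : a <= a <= b by rewrite lexx. have bb : a <= b <= b by rewrite lexx ab.
have [r1 B1 E1] := side_local (dZt c) (cZt c) (curveKt c) ab (fun x => bZt x c)
  (fun x hx => HE x c hx cc) eD0.
have [r2 B2 E2] := side_local (dZs b) (cZs b) (curveKs b) cd (bZs b)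
  (fun x hx => HE b x bb hx) eD0.
have [r3 B3 E3] := side_local (dZt d) (cZt d) (curveKt d) ab (fun x => bZt x d)
  (fun x hx => HE x d hx dd) eD0.
have [r4 B4 E4] := side_local (dZs a) (cZs a) (curveKs a) cd (bZs a)
  (fun x hx => HE a x aa hx) eD0.
rewrite /boundary E1 E2 E3 E4.
set q1 := K _ * Z b c + _; set q2 := K _ * Z a c + _; set q3 := K _ * Z b d + _.
set q4 := K _ * Z a d + _.
have -> : r1 + (q1 - q2) + (r2 + (q3 - q1)) - (r3 + (q3 - q4)) - (r4 + (q4 - q2)) =
  (r1 + r2) - (r3 + r4) by ring.
apply: le_trans (cabsB _ _) _; apply: le_trans (lerD (cabsD _ _) (cabsD _ _)) _.
apply: le_trans (lerD (lerD B1 B2) (lerD B3 B4)) _.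
have -> : 2 * (e' * D * L) * (b - a) + 2 * (e' * D * L) * (d - c) +
  (2 * (e' * D * L) * (b - a) + 2 * (e' * D * L) * (d - c)) = e / 2 * S ^+ 2.
  by rewrite /D /S /e'; field; rewrite gt_eqF.
rewrite -/S ler_wpM2r ?sqr_ge0 //; lra.
Qed.

End Pullback.
End Goursat.

(** * Means over circles and Bessel's inequality *)

Section CircleMeans.
Variable R : realType.
Local Notation C := R[i].

Definition cis (t : R) : C := cos t +i* sin t.

Lemma cder_cis : cder cis (fun t => 'i * cis t).
Proof.
move=> x; rewrite cReM cImM /=; split.
  by rewrite mul0r mul1r sub0r; exact: is_derive_cos.
by rewrite mul0r mul1r add0r; exact: is_derive_sin.
Qed.

Lemma curve_cis : curve cis. Proof. exact: cder_curve cder_cis. Qed.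

Lemma cabs_cis t : cabs (cis t) = 1.
Proof. by rewrite /Normc.normc /= cos2Dsin2 sqrtr1. Qed.

Lemma cis_neq0 t : cis t != 0.
Proof. by rewrite -cabs_gt0 cabs_cis. Qed.

Lemma cis_period : cis (2 * pi) = cis 0.
Proof. by rewrite /cis mulr_natl cos2pi sin2pi cos0 sin0. Qed.

Lemma two_pi_gt0 : 0 < 2 * pi :> R.
Proof. by rewrite mulr_gt0 // pi_gt0. Qed.

Definition mean (h : R -> C) : C := ((2 * pi)^-1 : R)%:C * cint 0 (2 * pi) h.

Lemma meanD h k : curve h -> curve k -> mean (fun x => h x + k x) = mean h + mean k.
Proof. by move=> ch ck; rewrite /mean cintD // mulrDr. Qed.

Lemma meanB h k : curve h -> curve k -> mean (fun x => h x - k x) = mean h - mean k.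
Proof. by move=> ch ck; rewrite /mean cintB // mulrBr. Qed.

Lemma meanZ z h : curve h -> mean (fun x => z * h x) = z * mean h.
Proof. by move=> ch; rewrite /mean cintZ // mulrCA. Qed.

Lemma mean_cst z : mean (fun=> z) = z.
Proof.
rewrite /mean cint_cst ?(ltW two_pi_gt0) // subr0 mulrCA -rmorphM mulVf ?mulr1 //.
by rewrite gt_eqF // two_pi_gt0.
Qed.

Lemma meanJ h : curve h -> mean (fun x => conjc (h x)) = conjc (mean h).
Proof.
move=> ch; rewrite /mean cintJ // rmorphM /=; congr (_ * _).
by rewrite /= oppr0.
Qed.

Lemma mean_bound h (M : R) : curve h -> (forall x, cabs (h x) <= M) ->
  cabs (mean h) <= 2 * M.
Proof.
move=> ch H; rewrite /mean cabsM cabsr ger0_norm ?invr_ge0 ?(ltW two_pi_gt0) //.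
rewrite mulrC ler_pdivrMr ?two_pi_gt0 //.
have := cint_bound ch (ltW two_pi_gt0) (fun x _ => H x); by rewrite subr0.
Qed.

Lemma mean_ge0 h : (forall x, 0 <= complex.Re (h x)) -> 0 <= complex.Re (mean h).
Proof.
move=> H; rewrite cReM /= mul0r subr0 mulr_ge0 ?invr_ge0 ?(ltW two_pi_gt0) //.
exact: rint_ge0.
Qed.

Lemma mean_pow_cis n : (0 < n)%N -> mean (fun t => cis t ^+ n) = 0.
Proof.
move=> n0; have d := cderX n cder_cis.
have cv : curve (fun x => n%:R * cis x ^+ n.-1 * ('i * cis x)).
  apply: curveM; apply: curveM; try exact: curve_cst.
    by apply: curveX; exact: curve_cis.
  exact: curve_cis.
have := cint_FTC (ltW two_pi_gt0) cv d; rewrite cis_period subrr.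
have -> : (fun x => n%:R * cis x ^+ n.-1 * ('i * cis x)) =
    (fun x => n%:R * 'i * cis x ^+ n).
  apply/funext => x; have -> : cis x ^+ n = cis x * cis x ^+ n.-1.
    by rewrite -exprS prednK.
  by ring.
have cn : curve (fun x => cis x ^+ n) by apply: curveX; exact: curve_cis.
rewrite cintZ // => /eqP; rewrite !mulf_eq0 pnatr_eq0 (gtn_eqF n0) /=.
have /negbTE -> /= : ('i : C) != 0 by rewrite -cabs_gt0 cabsi.
by move=> /eqP H; rewrite /mean H mulr0.
Qed.

Section Bessel.
Variable U : R -> C.
Hypothesis cU : curve U.
Hypothesis U1 : forall t, cabs (U t) = 1.
Hypothesis mU : forall n, (0 < n)%N -> mean (fun t => U t ^+ n) = 0.
Variable Q : R -> C.
Hypothesis cQ : curve Q.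

(** [U] stays abstract because both [cis] and its conjugate are used, for the Fourier coefficients
    of either sign. *)
Definition fcoef j := mean (fun t => Q t * conjc (U t) ^+ j).

Let cUX n : curve (fun t => U t ^+ n). Proof. exact: curveX. Qed.
Let cUJ n : curve (fun t => conjc (U t) ^+ n). Proof. by apply/curveX/curveJ. Qed.

Let UJ t : U t * conjc (U t) = 1.
Proof. by rewrite mulCJ U1 expr1n. Qed.

Let res N t := Q t - \sum_(j < N) fcoef j * U t ^+ j.

Let cres N : curve (res N).
Proof.
elim: N => [|N IH].
  by have := cQ; congr curve; apply/funext => t; rewrite /res big_ord0 subr0.
have := curveB IH (curveM (curve_cst (fcoef N)) (cUX N)).
by congr curve; apply/funext => t; rewrite /res big_ord_recr /=; ring.
Qed.

Let mean_res N k : (N <= k)%N -> mean (fun t => res N t * conjc (U t) ^+ k) = fcoef k.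
Proof.
elim: N => [|N IH] Nk.
  by congr mean; apply/funext => t; rewrite /res big_ord0 subr0.
rewrite -(IH (ltnW Nk)).
have -> : (fun t => res N.+1 t * conjc (U t) ^+ k) =
   (fun t => res N t * conjc (U t) ^+ k - fcoef N * conjc (U t ^+ (k - N))).
  apply/funext => t; rewrite /res big_ord_recr /= rmorphXn /=.
  have -> : conjc (U t) ^+ k = conjc (U t) ^+ N * conjc (U t) ^+ (k - N).
    by rewrite -exprD subnKC // ltnW.
  have := UJ t => /(congr1 (fun x => x ^+ N)); rewrite exprMn expr1n => H.
  set S := \sum_(i < N) _.
  transitivity ((Q t - S) * (conjc (U t) ^+ N * conjc (U t) ^+ (k - N)) -
    fcoef N * conjc (U t) ^+ (k - N) * (U t ^+ N * conjc (U t) ^+ N)); first by ring.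
  by rewrite H mulr1.
rewrite meanB ?meanZ ?meanJ ?mU ?subn_gt0 ?conjc0 ?mulr0 ?subr0 //.
- exact: curveJ.
- exact: curveM.
- by apply: curveM; [exact: curve_cst | exact: curveJ].
Qed.

(** Pythagoras' theorem: the residue after [n] terms still has all its later coefficients, by
    [mean_res], so removing the component along [U ^+ n] lowers the mean square by exactly the
    squared modulus of [fcoef n]. *)
Lemma bessel N : \sum_(0 <= j < N) cabs (fcoef j) ^+ 2 <= complex.Re (mean (fun t => Q t * conjc (Q t))).
Proof.
have key n : mean (fun t => res n t * conjc (res n t)) =
   mean (fun t => Q t * conjc (Q t)) - \sum_(0 <= j < n) (cabs (fcoef j) ^+ 2)%:C.
  elim: n => [|n IH].
    rewrite big_geq // subr0; congr mean; apply/funext => t.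
    by rewrite /res big_ord0 subr0.
  rewrite big_nat_recr // opprD addrA -IH -[X in _ - X]mulCJ.
  have -> : (fun t => res n.+1 t * conjc (res n.+1 t)) = (fun t =>
     (res n t * conjc (res n t) + fcoef n * conjc (fcoef n)) -
     (conjc (fcoef n) * (res n t * conjc (U t) ^+ n) +
      fcoef n * conjc (res n t * conjc (U t) ^+ n))).
    apply/funext => t.
    have -> : res n.+1 t = res n t - fcoef n * U t ^+ n.
      by rewrite /res big_ord_recr /=; ring.
    have := UJ t => /(congr1 (fun x => x ^+ n)); rewrite exprMn expr1n => H.
    move: (fcoef n) (res n t) => c r; rewrite rmorphB !rmorphM !rmorphXn /= conjcK.
    transitivity (r * conjc r + c * conjc c * (U t ^+ n * conjc (U t) ^+ n) -
      (conjc c * (r * conjc (U t) ^+ n) + c * (conjc r * U t ^+ n))); first by ring.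
    by rewrite H mulr1.
  have k1 : curve (fun t => res n t * conjc (U t) ^+ n) by exact: curveM.
  have k2 : curve (fun t => res n t * conjc (res n t)) by apply: curveM => //; exact: curveJ.
  have k3 := curveJ k1.
  rewrite meanB ?meanD ?mean_cst ?meanZ ?meanJ ?mean_res //; first by ring.
  - by apply: curveM => //; exact: curve_cst.
  - by apply: curveM => //; exact: curve_cst.
  - exact: curve_cst.
  - by apply: curveD => //; exact: curve_cst.
  - by apply: curveD; apply: curveM => //; exact: curve_cst.
have := @mean_ge0 (fun t => res N t * conjc (res N t)).
rewrite key cReD cReN; have -> : complex.Re (\sum_(0 <= j < N) (cabs (fcoef j) ^+ 2)%:C) =
  \sum_(0 <= j < N) cabs (fcoef j) ^+ 2.
  by elim/big_ind2: _ => //= x1 x2 y1 y2 <- <-; rewrite cReD.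
rewrite subr_ge0; apply => t; rewrite mulCJ /=; exact: sqr_ge0.
Qed.

Lemma fcoef_cvg0 (e : R) : 0 < e -> exists N0, forall N, (N0 <= N)%N -> cabs (fcoef N) <= e.
Proof.
move=> e0; set B := complex.Re (mean (fun t => Q t * conjc (Q t))).
have cv : cvgn (series (fun j => cabs (fcoef j) ^+ 2)).
  apply: nondecreasing_is_cvgn.
    by apply: nondecreasing_series => n _ _; exact: sqr_ge0.
  by exists B => _ [N _ <-]; exact: bessel.
have /cvgrPdist_le/(_ (e ^+ 2) (exprn_gt0 _ e0)) [N0 _ H] := cvg_series_cvg_0 cv.
exists N0 => N /H /=; rewrite sub0r normrN ger0_norm ?sqr_ge0 //.
by rewrite ler_sqr // ?nnegrE ?cabs_ge0 // ltW.
Qed.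

End Bessel.

Section MeanValue.
Variables (rho : R) (H : C -> C).
Hypothesis rho0 : 0 < rho.
Hypothesis dH : forall z, 0 < cabs z < rho -> exists l, cderiv H z l.

(* A smooth bijection from R onto ]0, rho[: polar coordinates then have a
   rectangle without boundary as parameter domain. *)
Definition logistic (t : R) : R := rho * (1 - (1 + expR t)^-1).

Let logistic' (t : R) : R := rho * (expR t / (1 + expR t) ^+ 2).

Let den0 (t : R) : 0 < 1 + expR t :> R.
Proof. by rewrite addr_gt0 // expR_gt0. Qed.

Lemma is_derive_logistic (t : R) : is_derive t 1 logistic (logistic' t).
Proof.
have h1 : is_derive t 1 (cst 1 + expR) (0 + expR t).
  exact: is_deriveD (is_derive_cst _ _ _) (is_derive_expR t).
have h2 := @is_deriveV _ (cst 1 + expR) t _ 1 (lt0r_neq0 (den0 t)) h1.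
have h3 := is_deriveM (is_derive_cst rho t 1) (is_deriveB (is_derive_cst (1 : R) t 1) h2).
apply: (is_derive_eq h3); rewrite /GRing.scale /= /logistic' /cst.
have -> : ((fun=> 1) + expR) t = 1 + expR t by [].
by field; rewrite gt_eqF.
Qed.

Lemma logistic_range t : 0 < logistic t < rho.
Proof.
have := den0 t; have := expR_gt0 t; rewrite /logistic => e0 d0.
have : (1 + expR t)^-1 < 1 by rewrite invf_lt1 // ltrDl.
have : 0 < (1 + expR t)^-1 by rewrite invr_gt0.
move: (_^-1) => x x0 x1; rewrite mulr_gt0 ?subr_gt0 //=.
by rewrite gtr_pMr // gtrBl.
Qed.

Lemma logistic_onto s : 0 < s < rho -> exists t, logistic t = s.
Proof.
move=> /andP[s0 sr]; have r0 : 0 < rho - s by rewrite subr_gt0.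
exists (ln (s / (rho - s))); rewrite /logistic lnK ?posrE ?divr_gt0 //.
have -> : 1 + s / (rho - s) = rho / (rho - s) by field; rewrite gt_eqF.
by rewrite invf_div; field; rewrite gt_eqF.
Qed.

Let logistic'_bound t : 0 <= logistic' t <= rho.
Proof.
have := den0 t; have := expR_gt0 t => e0 d0; rewrite /logistic'.
apply/andP; split.
  by apply: mulr_ge0; [exact: ltW | apply: divr_ge0; [exact: ltW | exact: sqr_ge0]].
rewrite ler_piMr ?(ltW rho0) // ler_pdivrMr ?exprn_gt0 // mul1r.
move: (expR t) e0 => x x0; rewrite -subr_ge0.
have -> : (1 + x) ^+ 2 - x = 1 + x + x ^+ 2 by ring.
by rewrite !addr_ge0 ?sqr_ge0 // ltW.
Qed.

Let cder_logistic : cder (fun t => (logistic t)%:C) (fun t => (logistic' t)%:C).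
Proof. by move=> t; split; [exact: is_derive_logistic | exact: is_derive_cst]. Qed.

Let curve_logistic' : curve (fun t => (logistic' t)%:C).
Proof.
split; last by move=> x; exact: cst_continuous.
move=> t; rewrite /= /logistic'; apply: cvgM; first exact: cvg_cst.
apply: cvgM; first exact: continuous_expR.
apply: cvgV; first by rewrite expf_neq0 // gt_eqF.
by apply: cvgM; (apply: cvgD; [exact: cvg_cst | exact: continuous_expR]).
Qed.

(** Goursat's theorem for [H z / z] over a polar rectangle. By periodicity of [cis] the two radial
    sides cancel, and on a circle [dz / z] is ['i] times the angular form, so the two circular sides
    are multiples of the two means. *)
Lemma circle_cst s s' : 0 < s < rho -> 0 < s' < rho ->
  mean (fun t => H (s%:C * cis t)) = mean (fun t => H (s'%:C * cis t)).
Proof.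
move=> /logistic_onto[a <-] /logistic_onto[b <-] {s s'}.
wlog ab : a b / a <= b => [W|].
  by case: (leP a b) => [ab|/ltW ba]; [exact: W | apply/esym; exact: W].
pose Z t s := (logistic t)%:C * cis s.
pose Zt t s := (logistic' t)%:C * cis s.
pose Zs t s := (logistic t)%:C * ('i * cis s).
pose K z := H z * z^-1.
have Zn t s : cabs (Z t s) = logistic t.
  have /andP[l0 _] := logistic_range t.
  by rewrite cabsM cabs_cis mulr1 cabsr gtr0_norm.
have Z0 t s : Z t s != 0.
  by rewrite -cabs_gt0 Zn; case/andP: (logistic_range t).
have dK t s : exists l, cderiv K (Z t s) l.
  have [|l Hl] := @dH (Z t s); first by rewrite Zn; exact: logistic_range.
  by eexists; exact: (cderivM Hl (cderivV (f := id) (Z0 t s) (cderiv_id _))).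
have B0 : boundary Z Zt Zs K a b 0 (2 * pi) = 0.
  apply: (boundary0 rho0) => //.
  - move=> s; have := cderM cder_logistic (cder_cst (cis s)); congr cder.
    by apply/funext => t; rewrite mulr0 addr0.
  - by move=> t; apply: cderZ; exact: cder_cis.
  - by move=> s; apply: curveM => //; exact: curve_cst.
  - move=> t; apply: curveM; first exact: curve_cst.
    by apply: curveM; [exact: curve_cst | exact: curve_cis].
  - move=> t s; rewrite cabsM cabs_cis mulr1 cabsr ger0_norm.
      by case/andP: (logistic'_bound t).
    by case/andP: (logistic'_bound t).
  - move=> t s; rewrite !cabsM cabs_cis cabsi !mulr1 cabsr.
    by have /andP[l0 /ltW l1] := logistic_range t; rewrite gtr0_norm.
  - exact: ltW two_pi_gt0.
have S0 : side K (Z^~ (2 * pi)) (Zt^~ (2 * pi)) a b = side K (Z^~ 0) (Zt^~ 0) a b.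
  by congr cint; apply/funext => t; rewrite /Z /Zt cis_period.
have cH t : curve (fun x => H (Z t x)).
  apply: (curve_comp (h := Z t)).
    move=> x; have [|l Hl] := @dH (Z t x); first by rewrite Zn; exact: logistic_range.
    exact: cderiv_cont Hl.
  by apply: curveM; [exact: curve_cst | exact: curve_cis].
have S1 t : side K (Z t) (Zs t) 0 (2 * pi) = 'i * cint 0 (2 * pi) (fun x => H (Z t x)).
  rewrite -cintZ //; congr cint; apply/funext => x; rewrite /K.
  have -> : Zs t x = 'i * Z t x by rewrite /Zs mulrCA.
  by field.
have cancel (k x y z w u v : C) : k != 0 -> x + y - z - w = 0 -> z = x -> y = k * u ->
    w = k * v -> v = u.
  move=> k0 E zx yu wv; rewrite zx yu wv in E.
  apply: (mulfI k0); apply/esym/subr0_eq; rewrite -E; ring.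
have i0 : ('i : C) != 0 by rewrite -cabs_gt0 cabsi.
have E := cancel _ _ _ _ _ _ _ i0 B0 S0 (S1 b) (S1 a).
by rewrite /mean; congr (_ * _); exact: E.
Qed.

Lemma circle_mean s : ccont H 0 -> 0 < s < rho ->
  mean (fun t => H (s%:C * cis t)) = H 0.
Proof.
move=> cH0 hs; apply/eqP; rewrite -subr_eq0 -cabs_eq0 eq_le cabs_ge0 andbT.
apply/ler_addgt0Pr => e e0; rewrite add0r.
have e2 : 0 < e / 2 by rewrite divr_gt0.
have [d d0 Hd] := cH0 _ e2.
pose s' := Num.min d rho / 2.
have m0 : 0 < Num.min d rho by rewrite lt_min d0.
have s'0 : 0 < s' by rewrite divr_gt0.
have s'm : s' < Num.min d rho by rewrite ltr_pdivrMr // ltr_pMr // ltr1n.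
have hs' : 0 < s' < rho by rewrite s'0 /=; apply: lt_le_trans s'm _; rewrite ge_min lexx orbT.
rewrite (circle_cst hs hs').
have cs : curve (fun t => s'%:C * cis t).
  by apply: curveM; [exact: curve_cst | exact: curve_cis].
have cn t : cabs (s'%:C * cis t) = s' by rewrite cabsM cabs_cis mulr1 cabsr gtr0_norm.
have cH : curve (fun t => H (s'%:C * cis t)).
  apply: (curve_comp (h := fun t => s'%:C * cis t)) => // x.
  have [|l Hl] := @dH (s'%:C * cis x); first by rewrite cn.
  exact: cderiv_cont Hl.
rewrite -[X in _ - X]mean_cst -meanB //; last exact: curve_cst.
have -> : e = 2 * (e / 2) by field.
apply: mean_bound; first by apply: curveB => //; exact: curve_cst.
move=> x; have := Hd (s'%:C * cis x); rewrite add0r; apply.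
by rewrite cn; apply: lt_le_trans s'm _; rewrite ge_min lexx.
Qed.

End MeanValue.
End CircleMeans.
Arguments cis {R} t.

(** * Taylor expansion in a disc *)

Section Taylor.
Variable R : realType.
Local Notation C := R[i].

Definition csum_to (a : nat -> C) (w s : C) := forall e : R, 0 < e ->
  exists N0, forall N, (N0 <= N)%N -> cabs (\sum_(0 <= j < N) a j * w ^+ j - s) <= e.

Lemma ccont_near (f g : C -> C) z (d : R) : 0 < d ->
  (forall t, cabs t < d -> f (z + t) = g (z + t)) -> ccont f z -> ccont g z.
Proof.
move=> d0 fg H e e0; have [r r0 Hr] := H e e0.
exists (Num.min d r); first by rewrite lt_min d0.
move=> t; rewrite lt_min => /andP[td tr]; rewrite -fg //.
have <- : f z = g z by have := fg 0; rewrite cabs0 addr0; apply.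
exact: Hr.
Qed.

Section Centered.
Variables (rho : R) (f : C -> C).
Hypothesis rho0 : 0 < rho.
Hypothesis df : forall z, cabs z < rho -> exists l, cderiv f z l.

Definition tcoef j := mean (fun t => f ((rho / 2)%:C * cis t) * ((rho / 2)%:C * cis t) ^- j).

Let r2 : 0 < rho / 2 < rho.
Proof. by rewrite divr_gt0 //= ltr_pdivrMr // ltr_pMr // ltr1n. Qed.

Let circle (s t : R) : 0 < s -> cabs (s%:C * cis t) = s.
Proof. by move=> s0; rewrite cabsM cabs_cis mulr1 cabsr gtr0_norm. Qed.

Let curve_circle (s : R) : curve (fun t => s%:C * cis t).
Proof. by apply: curveM; [exact: curve_cst | exact: curve_cis]. Qed.

Lemma tcoefE j s : 0 < s < rho ->
  tcoef j = mean (fun t => f (s%:C * cis t) * (s%:C * cis t) ^- j).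
Proof.
move=> hs; apply: (circle_cst (H := fun z => f z * z ^- j) rho0) => // z /andP[z0 zr].
have [l Hl] := df zr; have zn : z != 0 by rewrite -cabs_gt0.
eexists; apply: (cderivM Hl).
apply: (cderivV (f := fun x => x ^+ j)); first by rewrite expf_neq0.
exact: (cderivX j (cderiv_id z)).
Qed.

Lemma mean_neg j s : (0 < j)%N -> 0 < s < rho ->
  mean (fun t => f (s%:C * cis t) * (s%:C * cis t) ^+ j) = 0.
Proof.
move=> j0 hs; rewrite (circle_mean (H := fun z => f z * z ^+ j) rho0 _ _ hs).
- by rewrite expr0n (gtn_eqF j0) mulr0.
- move=> z /andP[z0 zr]; have [l Hl] := df zr.
  by eexists; exact: (cderivM Hl (cderivX j (cderiv_id z))).
- have [|l Hl] := @df 0; first by rewrite cabs0.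
  exact: (cderiv_cont (cderivM Hl (cderivX j (cderiv_id 0)))).
Qed.

Lemma tcoef0 : tcoef 0 = f 0.
Proof.
have -> : tcoef 0 = mean (fun t => f ((rho / 2)%:C * cis t)).
  by congr mean; apply/funext => t; rewrite expr0 invr1 mulr1.
rewrite (circle_mean rho0 _ _ r2) //.
  by move=> z /andP[z0 zr]; exact: df.
by have [|l Hl] := @df 0; [rewrite cabs0 | exact: cderiv_cont Hl].
Qed.

Section Point.
Variable z : C.
Hypothesis zr : cabs z < rho.
Hypothesis z0 : z != 0.

Let s := cabs z.
Let s0 : 0 < s. Proof. by rewrite cabs_gt0. Qed.
Let hs : 0 < s < rho. Proof. by rewrite s0. Qed.

Let dq : exists q : C -> C, (forall w, cabs w < rho -> ccont q w) /\
  forall w, (w - z) * q w = f w - f z.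
Proof.
have [l Hl] := df zr.
exists (fun w => if w == z then l else (f w - f z) / (w - z)); split; last first.
  move=> w; case: eqVneq => [->|wz]; first by rewrite !subrr mul0r.
  by rewrite mulrC divfK // subr_eq0.
move=> w wr; case: (eqVneq w z) => [->|wz].
  move=> e e0; have [d d0 Hd] := Hl e e0; exists d => // t td.
  rewrite eqxx; case: eqVneq => [_|zt]; first by rewrite subrr cabs0 ltW.
  have t0 : t != 0 by apply: contra zt => /eqP ->; rewrite addr0.
  have -> : z + t - z = t by ring.
  have -> : (f (z + t) - f z) / t - l = (f (z + t) - f z - t * l) / t by field.
  by rewrite cabsM cabsV ler_pdivrMr ?cabs_gt0 // Hd.
have [k Hk] := df wr.
have wz0 : w - z != 0 by rewrite subr_eq0.
have d0 : 0 < cabs (w - z) by rewrite cabs_gt0.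
apply: (@ccont_near (fun w => (f w - f z) / (w - z)) _ w _ d0).
  move=> t td; case: eqVneq => // E; move: td.
  have -> : t = - (w - z) by rewrite -E; ring.
  by rewrite cabsN ltxx.
apply: cderiv_cont; apply: (cderivM (cderivB Hk (cderiv_cst (f z) w))).
exact: (cderivV (f := fun x => x - z) wz0 (cderivB (cderiv_id w) (cderiv_cst z w))).
Qed.

(** The circle used passes through [z] itself. There the difference quotient [q] is merely
    continuous, but [(w - z) * q w = f w - f z] gives two-term recurrences for its Fourier
    coefficients [c] and [c']. They telescope: the Taylor remainder after [N.+1] terms has modulus
    [s * cabs (c N)]. *)
Lemma taylor_at : csum_to tcoef z (f z).
Proof.
have [q [cq Hq]] := dq.
pose Q t := q (s%:C * cis t).
have cQ : curve Q.
  apply: (curve_comp (h := fun t => s%:C * cis t)) => // x.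
  by apply: cq; rewrite circle.
have cf : curve (fun t => f (s%:C * cis t)).
  apply: (curve_comp (h := fun t => s%:C * cis t)) => // x.
  have [|l Hl] := @df (s%:C * cis x); first by rewrite circle.
  exact: cderiv_cont Hl.
pose V (t : R) := conjc (cis t).
have cV : curve V by apply: curveJ; exact: curve_cis.
have V1 t : cabs (V t) = 1 by rewrite /V cabsJ cabs_cis.
have mV n : (0 < n)%N -> mean (fun t => V t ^+ n) = 0.
  move=> n0; have -> : (fun t => V t ^+ n) = (fun t => conjc (cis t ^+ n)).
    by apply/funext => t; rewrite rmorphXn.
  by rewrite meanJ ?mean_pow_cis ?conjc0 //; apply: curveX; exact: curve_cis.
have EV t : cis t * V t = 1 by rewrite mulCJ cabs_cis expr1n.
pose c j := fcoef (@cis R) Q j.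
pose c' j := mean (fun t : R => Q t * cis t ^+ j).
have cEj j : curve (fun t : R => cis t ^+ j) by apply: curveX; exact: curve_cis.
have cVj j : curve (fun t => V t ^+ j) by exact: curveX.
have Hs : s%:C != 0 :> C by rewrite -cabs_gt0 cabsr gtr0_norm.
have HQ t : s%:C * cis t * Q t - z * Q t = f (s%:C * cis t) - f z.
  by rewrite -Hq -mulrBl.
have neg j : s%:C * c' j.+1 - z * c' j =
    mean (fun t => f (s%:C * cis t) * cis t ^+ j) - f z * mean (fun t => cis t ^+ j).
  rewrite -!meanZ -?meanB //.
  - by congr mean; apply/funext => t; rewrite -mulrBl -HQ exprS; ring.
  - exact: curveM.
  - by apply: curveM => //; exact: curve_cst.
  - by apply: curveM; [exact: curve_cst | exact: curveM].
  - by apply: curveM; [exact: curve_cst | exact: curveM].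
  - exact: curveM.
  - exact: curveM.
have neg1 j : (0 < j)%N -> s%:C * c' j.+1 = z * c' j.
  move=> j0; apply/subr0_eq; rewrite neg mean_pow_cis // mulr0 subr0.
  have sj : s%:C ^+ j != 0 :> C by rewrite expf_neq0.
  apply: (mulfI sj); rewrite mulr0 -(mean_neg j0 hs) -meanZ; last exact: curveM.
  by congr mean; apply/funext => t; rewrite exprMn; ring.
(* Since [cabs z = s], the recurrence [neg1] preserves moduli, so all coefficients of negative index
   have the same modulus. They also tend to 0, by Bessel's inequality for the conjugate of [cis]. *)
have c1 : c' 1%N = 0.
  have cst j : cabs (c' j.+1) = cabs (c' 1%N).
    elim: j => // j IH; rewrite -IH; have := neg1 j.+1 isT => /(congr1 cabs).
    rewrite (cabsM s%:C) (cabsM z) cabsr gtr0_norm // => E.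
    exact: (mulfI (lt0r_neq0 s0)).
  apply/eqP; rewrite -cabs_eq0 -[_ == 0]negbK; apply/negP => n1.
  have p1 : 0 < cabs (c' 1%N) by rewrite lt_def n1 cabs_ge0.
  have [N0 HN0] := fcoef_cvg0 cV V1 mV cQ (divr_gt0 p1 (ltr0Sn _ 1)).
  have := HN0 N0.+1 (leqnSn _).
  have -> : fcoef V Q N0.+1 = c' N0.+1.
    by congr mean; apply/funext => t; rewrite /V conjcK.
  by rewrite cst; lra.
have pos j : s%:C * c j - z * c j.+1 = s%:C ^+ j.+1 * tcoef j.+1.
  have -> : tcoef j.+1 = mean (fun t => s%:C ^- j.+1 * (f (s%:C * cis t) * V t ^+ j.+1)).
    rewrite (tcoefE _ hs); congr mean; apply/funext => t.
    have -> : V t = (cis t)^-1.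
      by apply: (mulfI (cis_neq0 t)); rewrite EV divff // cis_neq0.
    by rewrite exprMn exprVn; field; rewrite !expf_neq0 // cis_neq0.
  rewrite meanZ; last exact: curveM.
  rewrite [RHS]mulVKf; last by rewrite expf_neq0.
  transitivity (mean (fun t => f (s%:C * cis t) * V t ^+ j.+1) -
     f z * mean (fun t => V t ^+ j.+1)); last by rewrite mV // mulr0 subr0.
  rewrite -!meanZ -?meanB //.
  - congr mean; apply/funext => t; rewrite -mulrBl -HQ exprS.
    transitivity (s%:C * (Q t * V t ^+ j) * (cis t * V t) - z * (Q t * (V t * V t ^+ j))).
      by rewrite EV mulr1.
    by rewrite /V; ring.
  - exact: curveM.
  - by apply: curveM => //; exact: curve_cst.
  - by apply: curveM; [exact: curve_cst | exact: curveM].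
  - by apply: curveM; [exact: curve_cst | exact: curveM].
  - exact: curveM.
  - exact: curveM.
pose u := z / s%:C.
have zu : z = s%:C * u by rewrite /u; field.
have u1 : cabs u = 1 by rewrite cabsM cabsV cabsr gtr0_norm // divff // gt_eqF.
clearbody u.
have part N : \sum_(0 <= j < N.+1) tcoef j * z ^+ j - f z = - (s%:C * u ^+ N.+1 * c N).
  elim: N => [|N IH].
    rewrite big_nat1 expr0 mulr1 expr1 -zu.
    have := neg 0%N; rewrite c1 mulr0 sub0r => H.
    have m1 : mean (fun t : R => cis t ^+ 0) = 1.
      rewrite -[RHS]mean_cst; congr mean; apply/funext => t; by rewrite expr0.
    rewrite m1 mulr1 in H.
    have a0 : mean (fun t => f (s%:C * cis t) * cis t ^+ 0) = tcoef 0.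
      rewrite (tcoefE _ hs); congr mean; apply/funext => t.
      by rewrite !expr0 invr1.
    rewrite a0 in H; rewrite -H; congr (- (_ * _)).
  rewrite big_nat_recr //= addrAC IH.
  have -> : tcoef N.+1 * z ^+ N.+1 = u ^+ N.+1 * (s%:C * c N - z * c N.+1).
    have -> : z ^+ N.+1 = s%:C ^+ N.+1 * u ^+ N.+1 by rewrite -exprMn -zu.
    by rewrite pos; ring.
  have -> : z * c N.+1 = s%:C * u * c N.+1 by rewrite -zu.
  by rewrite [u ^+ N.+2]exprS; ring.
move=> e e0; have es : 0 < e / s by rewrite divr_gt0.
have mE n : (0 < n)%N -> mean (fun t : R => cis t ^+ n) = 0 by exact: mean_pow_cis.
have [N0 HN0] := fcoef_cvg0 (@curve_cis R) (@cabs_cis R) mE cQ es.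
exists N0.+1 => -[//|N]; rewrite ltnS => /HN0 H.
rewrite part cabsN (cabsM (s%:C * _)) (cabsM s%:C) cabsX u1 expr1n mulr1 cabsr.
rewrite gtr0_norm // mulrC -ler_pdivlMr //; exact: H.
Qed.

End Point.

Lemma taylor_centered z : cabs z < rho -> csum_to tcoef z (f z).
Proof.
move=> zr; have [->|z0] := eqVneq z 0; last exact: taylor_at.
move=> e e0; exists 1%N => -[//|N] _.
rewrite big_nat_recl //= expr0 mulr1 big1 ?addr0 ?tcoef0 ?subrr ?cabs0 ?ltW //.
by move=> i _; rewrite exprS mul0r mulr0.
Qed.

End Centered.

Lemma taylor (f : C -> C) (w : C) (rho : R) : 0 < rho ->
  (forall z, cabs (z - w) < rho -> exists l, cderiv f z l) ->
  exists a : nat -> C, forall h, cabs h < rho -> csum_to a h (f (w + h)).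
Proof.
move=> r0 df; exists (tcoef rho (fun h => f (w + h))) => h hr.
apply: (@taylor_centered rho (fun h => f (w + h))) => // z zr.
have [|l Hl] := df (w + z); first by rewrite addrC addKr.
exists l => e e0; have [d d0 Hd] := Hl e e0; exists d => // t td.
by rewrite addrA; exact: Hd.
Qed.

End Taylor.

(** * Complex power series and their derivatives *)

Section ComplexPowerSeries.
Variable R : realType.
Local Notation C := R[i].
Implicit Types (f df : C -> C) (a : nat -> C).

Lemma cpow_quad (x t : C) (s : R) (k : nat) : cabs x <= s -> cabs (x + t) <= s ->
  s ^+ 2 * cabs ((x + t) ^+ k - x ^+ k - k%:R * x ^+ k.-1 * t) <=
    k%:R ^+ 2 * s ^+ k * cabs t ^+ 2.
Proof.
move=> xs xts; have s0 : 0 <= s by apply: le_trans xs; exact: cabs_ge0.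
elim: k => [|k IH].
  by rewrite !expr0 subrr !mul0r subr0 cabs0 mulr0 expr0n !mul0r.
set E := (X in s ^+ 2 * cabs X) in IH.
have -> : (x + t) ^+ k.+1 - x ^+ k.+1 - k.+1%:R * x ^+ k.+1.-1 * t =
    (x + t) * E + k%:R * x ^+ k.-1 * t ^+ 2.
  rewrite /E /=; case: k {IH E} => [|k] /=; first by rewrite !expr0 !expr1; ring.
  by rewrite !exprS -!natr1; ring.
have H1 : s ^+ 2 * cabs ((x + t) * E) <= s * (k%:R ^+ 2 * s ^+ k * cabs t ^+ 2).
  rewrite (cabsM (x + t)) mulrCA; apply: ler_pM; rewrite ?cabs_ge0 //.
  exact: mulr_ge0 (sqr_ge0 s) (cabs_ge0 _).
have H2 : s ^+ 2 * cabs (k%:R * x ^+ k.-1 * t ^+ 2) <= k%:R * s ^+ k.+1 * cabs t ^+ 2.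
  case: k {IH E H1} => [|k] /=; first by rewrite !mul0r cabs0 mulr0.
  have kE : (k.+1%:R : C) = (k.+1%:R : R)%:C by rewrite rmorph_nat.
  rewrite (cabsM (k.+1%:R * _)) (cabsM k.+1%:R) !cabsX kE cabsr normr_nat.
  have -> : s ^+ 2 * (k.+1%:R * cabs x ^+ k * cabs t ^+ 2) =
    cabs x ^+ k * (s ^+ 2 * (k.+1%:R * cabs t ^+ 2)) by ring.
  have -> : k.+1%:R * s ^+ k.+2 * cabs t ^+ 2 =
      s ^+ k * (s ^+ 2 * (k.+1%:R * cabs t ^+ 2)) by rewrite !exprS; ring.
  apply: ler_wpM2r.
    exact: mulr_ge0 (sqr_ge0 s) (mulr_ge0 (ler0n _ _) (sqr_ge0 _)).
  by apply: lerXn2r; rewrite ?nnegrE ?cabs_ge0.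
apply: le_trans (ler_wpM2l (sqr_ge0 s) (cabsD _ _)) _.
rewrite mulrDr; apply: le_trans (lerD H1 H2) _.
rewrite -[k.+1%:R]natr1 (exprS s k).
have -> : s * (k%:R ^+ 2 * s ^+ k * cabs t ^+ 2) + k%:R * (s * s ^+ k) * cabs t ^+ 2 =
   (k%:R ^+ 2 + k%:R) * (s * s ^+ k * cabs t ^+ 2) by ring.
rewrite -[leRHS]mulrA; apply: ler_wpM2r.
  by rewrite mulr_ge0 ?sqr_ge0 // mulr_ge0 // exprn_ge0.
by rewrite sqrrD1 -addrA lerD2l mulr2n -addrA lerDl addr_ge0.
Qed.

Lemma csum_terms a w s : csum_to a w s -> exists M : R, forall n, cabs (a n * w ^+ n) <= M.
Proof.
move=> H; have [N0 HN0] := H 1 ltr01.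
pose B := \big[Num.max/0]_(0 <= n < N0) cabs (a n * w ^+ n).
exists (B + 2) => n; have B0 : 0 <= B.
  by rewrite /B; elim/big_rec: _ => // i x _ x0; rewrite le_max x0 orbT.
have [nN|Nn] := ltnP n N0.
  apply: (@le_trans _ _ B); last by rewrite lerDl.
  rewrite /B big_mkord; exact: (le_bigmax _ (fun i : 'I_N0 => cabs (a i * w ^+ i)) (Ordinal nN)).
have := HN0 n.+1 (leqW Nn); have := HN0 n Nn; rewrite big_nat_recr //=.
set S := \sum_(0 <= j < n) _ => h1 h2.
have -> : a n * w ^+ n = (S + a n * w ^+ n - s) - (S - s) by ring.
apply: le_trans (cabsB _ _) _; lra.
Qed.

Lemma csum_bound a (rho s : R) f : 0 < s < rho ->
  (forall h, cabs h < rho -> csum_to a h (f h)) ->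
  exists M : R, forall n, cabs (a n) * s ^+ n <= M.
Proof.
move=> /andP[s0 sr] H; have [|M HM] := csum_terms (H s%:C _).
  by rewrite cabsr gtr0_norm.
by exists M => n; have := HM n; rewrite cabsM cabsX cabsr gtr0_norm.
Qed.

Lemma csum_bound_ge0 a (s M : R) : (forall n, cabs (a n) * s ^+ n <= M) -> 0 <= M.
Proof. by move=> /(_ 0%N); apply: le_trans; rewrite expr0 mulr1 cabs_ge0. Qed.

Lemma geo_half (N : nat) : \sum_(0 <= n < N) (2^-1 : R) ^+ n <= 2.
Proof.
have := @bsum_geo R 1 2^-1 ler01; rewrite (_ : 1 / (1 - 2^-1) = 2); last by field.
move=> /(_ _ (iota 0 N) (iota_uniq _ _)) H.
rewrite /index_iota subn0; apply: le_trans (H _).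
  by apply: ler_sum => i _; rewrite mul1r ger0_norm ?exprn_ge0 // invr_ge0.
by rewrite invr_ge0 ler0n /= invf_lt1 // ltr1n.
Qed.

(* Summing n^2 (s/8)^n <= s^n / 2^n gives the factor 2. *)
Lemma csum_quad a (s M : R) (h t : C) N : 0 < s ->
  (forall n, cabs (a n) * s ^+ n <= M) -> cabs h <= s / 8 -> cabs (h + t) <= s / 8 ->
  cabs (\sum_(0 <= j < N) a j * (h + t) ^+ j - \sum_(0 <= j < N) a j * h ^+ j -
    t * \sum_(0 <= j < N) a j * (j%:R * h ^+ j.-1)) <=
  128 * M / s ^+ 2 * cabs t ^+ 2.
Proof.
move=> s0 HM hs hts; have M0 := csum_bound_ge0 HM.
rewrite mulr_sumr -!sumrB.
apply: le_trans (cabs_sum _ _) _.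
have s8 : 0 < (s / 8) ^+ 2 by rewrite exprn_gt0 // divr_gt0.
apply: (@le_trans _ _ (\sum_(0 <= j < N) (64 * M / s ^+ 2 * cabs t ^+ 2) * 2^-1 ^+ j)).
  apply: ler_sum => j _.
  have -> : a j * (h + t) ^+ j - a j * h ^+ j - t * (a j * (j%:R * h ^+ j.-1)) =
     a j * ((h + t) ^+ j - h ^+ j - j%:R * h ^+ j.-1 * t) by ring.
  rewrite cabsM -(ler_pM2l s8) mulrCA.
  apply: le_trans (ler_wpM2l (cabs_ge0 _) (cpow_quad j hs hts)) _.
  have -> : (s / 8) ^+ 2 * (64 * M / s ^+ 2 * cabs t ^+ 2 * 2^-1 ^+ j) =
    M * (2^-1 ^+ j * cabs t ^+ 2) by field; rewrite gt_eqF.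
  have -> : cabs (a j) * (j%:R ^+ 2 * (s / 8) ^+ j * cabs t ^+ 2) =
     (cabs (a j) * s ^+ j) * ((j%:R ^+ 2 * 8^-1 ^+ j) * cabs t ^+ 2).
    by rewrite exprMn; ring.
  apply: ler_pM => //; first by rewrite mulr_ge0 ?cabs_ge0 // exprn_ge0 // ltW.
    by rewrite !mulr_ge0 ?exprn_ge0 ?invr_ge0 // cabs_ge0.
  rewrite ler_wpM2r ?sqr_ge0 //.
  have -> : (8^-1 : R) = 4^-1 * 2^-1 by field.
  rewrite exprMn mulrA ler_piMl ?exprn_ge0 ?invr_ge0 // exprVn.
  by rewrite ler_pdivrMr ?exprn_gt0 // mul1r; exact: le_sqr_pow4.
rewrite -mulr_sumr; apply: le_trans (ler_wpM2l _ (geo_half N)) _.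
  by rewrite mulr_ge0 ?sqr_ge0 // divr_ge0 ?sqr_ge0 // mulr_ge0.
rewrite le_eqVlt; apply/orP; left; apply/eqP; field; by rewrite gt_eqF.
Qed.

Lemma csum_lim a w s b : csum_to a w s ->
  (exists N0, forall N, (N0 <= N)%N -> cabs (\sum_(0 <= j < N) a j * w ^+ j) <= b) ->
  cabs s <= b.
Proof.
move=> H [N0 HN0]; apply/ler_addgt0Pr => e e0; have [N1 HN1] := H e e0.
have := HN0 _ (leq_maxl N0 N1); have := HN1 _ (leq_maxr N0 N1).
set S := \sum_(0 <= j < _) _ => h1 h2.
have -> : s = S - (S - s) by ring.
by apply: le_trans (cabsB _ _) _; exact: lerD.
Qed.

Definition dcoefs a n : C := n.+1%:R * a n.+1.

Lemma sum_dcoefs a (h : C) N : \sum_(0 <= j < N.+1) a j * (j%:R * h ^+ j.-1) =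
  \sum_(0 <= j < N) dcoefs a j * h ^+ j.
Proof.
rewrite big_nat_recl //= mul0r mulr0 add0r; apply: eq_bigr => j _.
by rewrite /dcoefs mulrCA mulrA.
Qed.

(** The derived partial sums are compared with [df h] through difference quotients with one fixed
    step [t0], small enough for the quadratic error. Only then is [N] taken large, to the precision
    [e / 6 * t0], which survives division by [t0]. *)
Lemma csum_deriv a (s M : R) f df : 0 < s -> (forall n, cabs (a n) * s ^+ n <= M) ->
  (forall h, cabs h < s -> csum_to a h (f h)) ->
  (forall h, cabs h < s -> cderiv f h (df h)) ->
  forall h, cabs h < s / 8 -> csum_to (dcoefs a) h (df h).
Proof.
move=> s0 HM Hf Hdf h hs e e0; have M0 := csum_bound_ge0 HM.
have hs1 : cabs h < s by lra.
have e3 : 0 < e / 3 by rewrite divr_gt0.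
have [d d0 Hd] := Hdf h hs1 _ e3.
pose K := 128 * M / s ^+ 2; have K0 : 0 <= K.
  by rewrite divr_ge0 ?sqr_ge0 // mulr_ge0.
have K1 : 0 < K + 1 by rewrite ltr_wpDl.
pose t0 := Num.min (Num.min d (s / 8 - cabs h)) (e / 3 / (K + 1)) / 2.
have m0 : 0 < Num.min (Num.min d (s / 8 - cabs h)) (e / 3 / (K + 1)).
  by rewrite !lt_min d0 subr_gt0 hs divr_gt0.
have t00 : 0 < t0 by rewrite divr_gt0.
have : t0 < Num.min (Num.min d (s / 8 - cabs h)) (e / 3 / (K + 1)).
  by rewrite ltr_pdivrMr // ltr_pMr // ltr1n.
rewrite !lt_min => /andP[/andP[t1 t2] t3].
have ct : cabs (t0%:C : C) = t0 by rewrite cabsr gtr0_norm.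
have hts : cabs (h + t0%:C) < s / 8.
  by apply: le_lt_trans (cabsD _ _) _; rewrite ct; lra.
have hts1 : cabs (h + t0%:C) < s by lra.
have e6 : 0 < e / 6 * t0 by rewrite mulr_gt0 // divr_gt0.
have [N1 HN1] := Hf _ hs1 _ e6; have [N2 HN2] := Hf _ hts1 _ e6.
exists (maxn N1 N2) => N; rewrite geq_max => /andP[n1 n2].
have {HN1} L1 := HN1 N.+1 (leqW n1); have {HN2} L2 := HN2 N.+1 (leqW n2).
have Q := csum_quad N.+1 s0 HM (ltW hs) (ltW hts).
have D := Hd t0%:C; rewrite ct in D Q; have {}D := D t1.
rewrite -sum_dcoefs.
move: L1 L2 Q D; set S1 := \sum_(0 <= j < _) _; set S2 := \sum_(0 <= j < _) _.
set S3 := \sum_(0 <= j < _) _ => L1 L2 Q D.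
rewrite -(ler_pM2l t00) -{1}ct -cabsM.
have -> : t0%:C * (S3 - df h) = (f (h + t0%:C) - f h - t0%:C * df h) -
   (S2 - S1 - t0%:C * S3) + ((S2 - f (h + t0%:C)) - (S1 - f h)) by ring.
apply: le_trans (cabsD _ _) _; apply: le_trans (lerD (cabsB _ _) (cabsB _ _)) _.
apply: le_trans (lerD (lerD D Q) (lerD L2 L1)) _.
rewrite -/K; have : K * t0 ^+ 2 <= e / 3 * t0.
  rewrite expr2 mulrA ler_pM2r // mulrC; move: t3; rewrite ltr_pdivlMr // => /ltW.
  by apply: le_trans; rewrite ler_wpM2l ?lerDl // ltW.
have -> : t0 * e = e / 3 * t0 + e / 3 * t0 + (e / 6 * t0 + e / 6 * t0) by field.
by move=> h3; rewrite lerD2r lerD2l.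
Qed.

(** Here [f] is not assumed differentiable. Applied to the derived series, this shows that the
    derivative of a holomorphic function is again differentiable. *)
Lemma csum_cderiv0 a (s M : R) f : 0 < s -> (forall n, cabs (a n) * s ^+ n <= M) ->
  (forall h, cabs h < s -> csum_to a h (f h)) -> cderiv f 0 (a 1%N).
Proof.
move=> s0 HM Hf e e0; have M0 := csum_bound_ge0 HM.
pose K := 128 * M / s ^+ 2; have K0 : 0 <= K.
  by rewrite divr_ge0 ?sqr_ge0 // mulr_ge0.
have K1 : 0 < K + 1 by rewrite ltr_wpDl.
exists (Num.min (s / 8) (e / (K + 1))); first by rewrite lt_min !divr_gt0.
move=> t; rewrite lt_min add0r => /andP[t1 t2].
have ts : cabs t < s by lra.
have f0 : csum_to a 0 (f 0) by apply: Hf; rewrite cabs0.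
have H0 : cabs (f t - f 0 - t * a 1%N) <= K * cabs t ^+ 2.
  apply/ler_addgt0Pr => x x0; have x2 : 0 < x / 2 by rewrite divr_gt0.
  have [N1 HN1] := f0 _ x2; have [N2 HN2] := Hf _ ts _ x2.
  pose N := maxn 2 (maxn N1 N2).
  have L1 : cabs (\sum_(0 <= j < N) a j * 0 ^+ j - f 0) <= x / 2.
    by apply: HN1; rewrite !leq_max leqnn orbT.
  have L2 : cabs (\sum_(0 <= j < N) a j * t ^+ j - f t) <= x / 2.
    by apply: HN2; rewrite !leq_max leqnn !orbT.
  have := @csum_quad a s M 0 t N s0 HM; rewrite cabs0 add0r => /(_ _ (ltW t1)).
  have -> : \sum_(0 <= j < N) a j * (j%:R * 0 ^+ j.-1) = a 1%N.
    have -> : N = (N - 2).+2 by rewrite -addn2 subnK // leq_max.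
    rewrite !big_nat_recl //= mul0r mulr0 add0r mul1r expr0 mulr1 big1 ?addr0 //.
    by move=> i _; rewrite exprS mul0r !mulr0.
  move: L1 L2; set S1 := \sum_(0 <= j < N) _; set S2 := \sum_(0 <= j < N) _.
  move=> L1 L2 Q; have {}Q : cabs (S2 - S1 - t * a 1%N) <= K * cabs t ^+ 2.
    by apply: Q; rewrite divr_ge0 // ltW.
  have -> : f t - f 0 - t * a 1%N = (S2 - S1 - t * a 1%N) - ((S2 - f t) - (S1 - f 0)).
    by ring.
  apply: le_trans (cabsB _ _) _; apply: lerD => //.
  apply: le_trans (cabsB _ _) _; lra.
apply: le_trans H0 _; rewrite expr2 mulrA ler_wpM2r ?cabs_ge0 // mulrC.
move: t2; rewrite ltr_pdivlMr // => /ltW; apply: le_trans.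
by rewrite ler_wpM2l ?lerDl // cabs_ge0.
Qed.

Lemma csum0 a s : csum_to a 0 s -> s = a 0%N.
Proof.
move=> H; apply/subr0_eq/eqP; rewrite -cabs_eq0 eq_le cabs_ge0 andbT.
apply/ler_addgt0Pr => e e0; rewrite add0r; have [N0 HN0] := H e e0.
have := HN0 N0.+1 (leqnSn _); rewrite big_nat_recl //= expr0 mulr1 big1 ?addr0.
  by rewrite cabs_distC.
by move=> i _; rewrite exprS mul0r mulr0.
Qed.

End ComplexPowerSeries.

(** * Holomorphic functions *)

Section Holomorphic.
Variable R : realType.
Local Notation C := (R[i]^o).
Implicit Types (f g : C -> C) (Om : set C) (z w h : R[i]).

Definition copen Om := forall z, Om z -> exists2 r : R, 0 < r &
  forall w, cabs (w - z) < r -> Om w.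

Lemma open_copen Om : open Om -> copen Om.
Proof.
move=> oO z Oz; have /nbhs_ballP[e e0 He] : nbhs (z : C) Om by exact: open_nbhs_nbhs.
have eE : e = (complex.Re e)%:C.
  by move: (e0); rewrite /= ltcE; case: (e) => a b /= /andP[/eqP-> _].
exists (complex.Re e); first by move: e0; rewrite /= ltcE => /andP[].
move=> w wz; apply: He; rewrite -ball_normE /= eE normcE' ltcR cabs_distC.
exact: wz.
Qed.

Lemma copen_open Om : copen Om -> open Om.
Proof.
move=> H; rewrite openE => z Oz; have [r r0 Hr] := H z Oz.
apply/nbhs_ballP; exists r%:C; first by rewrite /= ltcR.
move=> w; rewrite -ball_normE /= normcE' ltcR cabs_distC; exact: Hr.
Qed.

Definition cball (z : R[i]) (r : R) : set C := [set w | cabs (w - z) < r].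

Lemma copen_ball z r : copen (cball z r).
Proof.
move=> w; rewrite /cball /= => wz; exists (r - cabs (w - z)); first by rewrite subr_gt0.
move=> x xw; have -> : x - z = (x - w) + (w - z) by ring.
by apply: le_lt_trans (cabsD _ _) _; rewrite -ltrBrDr.
Qed.

Lemma holomorphicP Om f : holomorphic_on Om f <->
  forall z, Om z -> cderiv f z (derive1 f z).
Proof.
split=> H z Oz.
  by apply/(@cderivP R f z); rewrite derive1E; apply: derivableP; exact: H.
by have /(@cderivP R f z)[] := H z Oz.
Qed.

Lemma cderiv_derive1 f z l : cderiv f z l -> derive1 f z = l.
Proof. by move=> /(@cderivP R f z) [_ <-]; rewrite derive1E. Qed.

Lemma holo_intro Om f : (forall z, Om z -> exists l, cderiv f z l) -> holomorphic_on Om f.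
Proof.
move=> H; apply/holomorphicP => z Oz; have [l Hl] := H z Oz.
by rewrite (cderiv_derive1 Hl).
Qed.

Lemma holo_sub Om Om' f : Om' `<=` Om -> holomorphic_on Om f -> holomorphic_on Om' f.
Proof. by move=> s H z /s; exact: H. Qed.

Lemma cderiv_shift f w h l : cderiv (fun x => f (w + x)) h l <-> cderiv f (w + h) l.
Proof.
by split=> H e e0; have [d d0 Hd] := H e e0; exists d => // t td; have := Hd t td;
  rewrite addrA.
Qed.

Lemma holo_taylor Om f w (r : R) : holomorphic_on Om f -> 0 < r -> cball w r `<=` Om ->
  exists a : nat -> R[i], forall h, cabs h < r -> csum_to a h (f (w + h)).
Proof.
move=> /holomorphicP Hf r0 sub; apply: taylor => // z zr.
by exists (derive1 f z); apply: Hf; exact: sub.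
Qed.

(** For holomorphy of the derivative, [f] is expanded anew about each nearby [z]: the derived series
    represents [derive1 f] around [z], and the sum of a power series is differentiable at its
    centre. *)
Lemma taylor_derive1 f w (r : R) (a : nat -> R[i]) : 0 < r ->
  holomorphic_on (cball w r) f ->
  (forall h, cabs h < r -> csum_to a h (f (w + h))) ->
  exists2 s : R, 0 < s <= r & (forall h, cabs h < s ->
     csum_to (dcoefs a) h (derive1 f (w + h))) /\
  holomorphic_on (cball w s) (derive1 f).
Proof.
move=> r0 /holomorphicP Hf Ha.
have d h : cabs h < r -> cderiv (fun x => f (w + x)) h (derive1 f (w + h)).
  by move=> hr; apply/cderiv_shift/Hf; rewrite /cball /= addrC addKr.
have r2 : 0 < r / 2 < r by rewrite divr_gt0 //= ltr_pdivrMr // ltr_pMr // ltr1n.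
have [M HM] := csum_bound r2 Ha; have [r20 r2r] := andP r2.
have D := csum_deriv r20 HM (fun h hr => Ha h (lt_trans hr r2r))
  (fun h hr => d h (lt_trans hr r2r)).
have s0 : 0 < r / 2 / 8 / 2 by rewrite !divr_gt0.
exists (r / 2 / 8 / 2); first by rewrite s0 /=; lra.
split=> [h hr|]; first by apply: D; apply: lt_trans hr _; lra.
apply: holo_intro => z zr.
pose h0 := z - w.
have z0 : w + h0 = z by rewrite /h0 addrC subrK.
have c0 : cabs h0 < r by apply: lt_trans zr _; lra.
have rr : 0 < r - cabs h0 by rewrite subr_gt0.
have [|b Hb] := @taylor R f z (r - cabs h0) rr.
  move=> x xz; exists (derive1 f x); apply: Hf; rewrite /cball /=.
  have -> : x - w = (x - z) + h0 by rewrite /h0; ring.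
  by apply: le_lt_trans (cabsD _ _) _; rewrite -ltrBrDr.
pose q := r - cabs h0.
have q2 : 0 < q / 2 < q by rewrite divr_gt0 //= ltr_pdivrMr // ltr_pMr // ltr1n.
have [N HN] := csum_bound q2 Hb; have [q20 q2q] := andP q2.
have dz h : cabs h < q -> cderiv (fun x => f (z + x)) h (derive1 f (z + h)).
  move=> hr; apply/cderiv_shift/Hf; rewrite /cball /=.
  have -> : z + h - w = h + h0 by rewrite /h0; ring.
  by apply: le_lt_trans (cabsD _ _) _; rewrite -ltrBrDr.
have D' := csum_deriv q20 HN (fun h hr => Hb h (lt_trans hr q2q))
  (fun h hr => dz h (lt_trans hr q2q)).
have q8 : 0 < q / 2 / 8 by rewrite divr_gt0.
have q16 : 0 < q / 2 / 8 / 2 < q / 2 / 8.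
  by rewrite divr_gt0 //= ltr_pdivrMr // ltr_pMr // ltr1n.
have [N' HN'] := csum_bound q16 D'; have [q160 q168] := andP q16.
have := csum_cderiv0 q160 HN' (fun h hr => D' h (lt_trans hr q168)).
by move=> /(@cderiv_shift (derive1 f) z 0); rewrite addr0; exists (dcoefs b 1%N).
Qed.

Lemma holo_derive1 Om f : copen Om -> holomorphic_on Om f -> holomorphic_on Om (derive1 f).
Proof.
move=> oO Hf z Oz; have [r r0 Hr] := oO z Oz.
have Hb : holomorphic_on (cball z r) f by apply: holo_sub Hf.
have [a Ha] := holo_taylor Hb r0 (@subset_refl _ _).
have [s /andP[s0 _] [_ H]] := taylor_derive1 r0 Hb Ha.
by apply: H; rewrite /cball /= subrr cabs0.
Qed.

Lemma holo_derive1n n Om f : copen Om -> holomorphic_on Om f ->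
  holomorphic_on Om (derive1n n f).
Proof. by move=> oO Hf; elim: n => [//|n IH]; rewrite derive1nS; exact: holo_derive1. Qed.

Lemma taylor_coef n f w (r : R) (a : nat -> R[i]) : 0 < r ->
  holomorphic_on (cball w r) f ->
  (forall h, cabs h < r -> csum_to a h (f (w + h))) ->
  derive1n n f w = n`!%:R * a n.
Proof.
elim: n f r a => [|n IH] f r a r0 Hf Ha.
  by rewrite derive1n0 fact0 mul1r -[w]addr0; apply: csum0; apply: Ha; rewrite cabs0.
have [s /andP[s0 _] [Hs Hs']] := taylor_derive1 r0 Hf Ha.
rewrite derive1Sn (IH (derive1 f) s (dcoefs a) s0 Hs' Hs) /dcoefs factS natrM; ring.
Qed.

Lemma taylor_derive1n Om f w h (r : R) : holomorphic_on Om f ->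
  cball w r `<=` Om -> cabs h < r ->
  csum_to (fun n => derive1n n f w / n`!%:R) h (f (w + h)).
Proof.
move=> Hf sub hr; have r0 : 0 < r by apply: le_lt_trans hr; exact: cabs_ge0.
have [a Ha] := holo_taylor Hf r0 sub.
have Hb : holomorphic_on (cball w r) f by exact: holo_sub Hf.
suff -> : (fun n => derive1n n f w / n`!%:R) = a by exact: Ha.
apply/funext => n; rewrite (taylor_coef n r0 Hb Ha); field.
by rewrite pnatr_eq0 -lt0n fact_gt0.
Qed.

Lemma derive1n_near n f g z (r : R) : 0 < r -> (forall w, cabs (w - z) < r -> f w = g w) ->
  derive1n n f z = derive1n n g z.
Proof.
elim: n f g r => [|n IH] f g r r0 H.
  by rewrite !derive1n0; apply: H; rewrite subrr cabs0.
rewrite !derive1Sn; apply: (IH _ _ r r0) => w wr; rewrite !derive1E.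
apply: near_eq_derive; have [s s0 Hs] := copen_ball wr.
apply/nbhs_ballP; exists s%:C; first by rewrite /= ltcR.
move=> x; rewrite -ball_normE /= normcE' ltcR cabs_distC => xs.
by apply: H; exact: Hs.
Qed.

End Holomorphic.

(** * Substitution into power series and the identity theorem *)

Section QuadraticPowers.
Variable R : realType.
Local Notation C := R[i].

(* (P, Q) = pq g t q k encodes (g + e q)^k = P + e Q, where q e^2 = - t. *)
Fixpoint pq (g t q : R) (k : nat) : R * R :=
  if k is k'.+1 then let: (P, Q) := pq g t q k' in (g * P - t * Q, g * Q + q * P)
  else (1, 0).

Lemma pq_complex g q k : (g +i* q) ^+ k = (pq g q q k).1 +i* (pq g q q k).2 :> C.
Proof.
elim: k => [|k IH]; first by rewrite expr0.
rewrite exprS IH /=; case: (pq _ _ _ _) => P Q /=.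
by apply: complex_eq; rewrite ?cReM ?cImM /=; ring.
Qed.

Lemma pq_root g r k : (g +i* r) ^+ k = (pq g (r ^+ 2) 1 k).1 +i* (r * (pq g (r ^+ 2) 1 k).2) :> C.
Proof.
elim: k => [|k IH]; first by rewrite expr0 /= mulr0.
rewrite exprS IH /=; case: (pq _ _ _ _) => P Q /=.
by apply: complex_eq; rewrite ?cReM ?cImM /=; ring.
Qed.

Section Rep.
Variables (n : nat) (r A B D L tau : R) (g t q : 'rV[R]_n -> R).
Hypotheses (r0 : 0 < r) (tau0 : 0 <= tau).
Hypotheses (Hg : rep r A g) (Ht : rep r B t) (Hq : rep r D q).
Hypotheses (HL1 : A + tau * B <= L) (HL2 : A * tau + D <= L * tau).

(** [HL1] and [HL2] say that one multiplication preserves the pair of bounds [(1, tau)] up to the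
    factor [L]. The weight [tau] balances the two entries when [q = 1] is not small while [t] is. *)
Lemma pq_rep k : rep r (L ^+ k) (fun h => (pq (g h) (t h) (q h) k).1) /\
  rep r (tau * L ^+ k) (fun h => (pq (g h) (t h) (q h) k).2).
Proof.
have A0 : 0 <= A by case: Hg => c [/bsum_ge0].
have B0 : 0 <= B by case: Ht => c [/bsum_ge0].
have L0 : 0 <= L by apply: le_trans HL1; rewrite addr_ge0 // mulr_ge0.
elim: k => [|k [IP IQ]].
  split; first by have := @rep_cst R n r 1; rewrite normr1 expr0.
  by apply: (rep_le _ (@rep_cst R n r 0)); rewrite normr0 expr0 mulr1.
split.
  apply: (@rep_le _ _ _ (A * L ^+ k + `|-1| * (B * (tau * L ^+ k)))).
    rewrite normrN1 mul1r exprS mulrA (mulrC B) -mulrDl ler_wpM2r ?exprn_ge0 //.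
  apply: eq_rep (repD (repM r0 Hg IP) (repZ (-1) (repM r0 Ht IQ))) => h _ /=.
  by case: (pq _ _ _ _) => P Q /=; rewrite mulN1r.
apply: (@rep_le _ _ _ (A * (tau * L ^+ k) + D * L ^+ k)).
  by rewrite mulrA -mulrDl exprS mulrA (mulrC tau) ler_wpM2r ?exprn_ge0.
apply: eq_rep (repD (repM r0 Hg IQ) (repM r0 Hq IP)) => h _ /=.
by case: (pq _ _ _ _).
Qed.

Lemma pq_series (a b : nat -> R) (M : R) : 0 < L ->
  (forall k, `|a k| * (2 * L) ^+ k <= M) -> (forall k, `|b k| * (2 * L) ^+ k <= M) ->
  exists G N, rep r N G /\ forall h, small r h ->
    hsum (fun k => a k * (pq (g h) (t h) (q h) k).1 + b k * (pq (g h) (t h) (q h) k).2)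
      (G h).
Proof.
move=> L0 Ha Hb; pose term k h := a k * (pq (g h) (t h) (q h) k).1 +
  b k * (pq (g h) (t h) (q h) k).2.
pose W k := (M + M * tau) * (2^-1 : R) ^+ k.
have M0 : 0 <= M by apply: le_trans (Ha 0%N); rewrite expr0 mulr1.
have MM : 0 <= M + M * tau by rewrite addr_ge0 // mulr_ge0.
have Hterm k : rep r (W k) (term k).
  have [HP HQ] := pq_rep k.
  apply: (rep_le _ (repD (repZ (a k) HP) (repZ (b k) HQ))).
  have e c : `|c| * (2 * L) ^+ k <= M -> `|c| * L ^+ k <= M * 2^-1 ^+ k.
    rewrite exprMn => H; rewrite exprVn ler_pdivlMr ?exprn_gt0 //.
    by apply: le_trans H; rewrite -mulrA [L ^+ k * _]mulrC.
  rewrite /W mulrDl; apply: lerD; first exact: e.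
  by rewrite mulrCA [M * tau]mulrC -mulrA ler_wpM2l // e.
have bW : bsum W (2 * (M + M * tau)).
  have h2 : 0 <= (2^-1 : R) < 1 by rewrite invr_ge0 ler0n /= invf_lt1 // ltr1n.
  have := bsum_geo MM h2; have -> // : (M + M * tau) / (1 - 2^-1) = 2 * (M + M * tau).
  have -> : 1 - 2^-1 = 2^-1 :> R by field.
  by rewrite invrK mulrC.
have /choice[G HG] (h : 'rV[R]_n) : exists S, small r h -> hsum (term ^~ h) S.
  have [hh|nh] := pselect (small r h); last by exists 0.
  have /bsum_hsum[S HS] : bsum (term ^~ h) (2 * (M + M * tau)).
    apply: le_bsum bW => k; have [c Hc] := Hterm k.
    apply: le_trans (repc_bound Hc hh) _; exact: ler_norm.
  by exists S.
exists G, (2 * (M + M * tau)); split; last exact: HG.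
exact: (rep_hsum r0 Hterm bW HG).
Qed.

End Rep.

Lemma csum_Re (a : nat -> C) (w s : C) : csum_to a w s ->
  series (fun k => complex.Re (a k * w ^+ k)) @ \oo --> complex.Re s.
Proof.
move=> H; apply/cvgrPdist_le => e e0; have [N0 HN0] := H e e0.
exists N0 => // N /HN0; apply: le_trans; rewrite distrC.
have -> : series (fun k => complex.Re (a k * w ^+ k)) N =
    complex.Re (\sum_(0 <= j < N) a j * w ^+ j).
  by rewrite /series /=; elim/big_ind2: _ => //= x1 x2 y1 y2 -> ->; rewrite cReD.
by rewrite -cReN -cReD; exact: cabs_Re.
Qed.

Lemma csum_Im (a : nat -> C) (w s : C) : csum_to a w s ->
  series (fun k => complex.Im (a k * w ^+ k)) @ \oo --> complex.Im s.
Proof.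
move=> H; apply/cvgrPdist_le => e e0; have [N0 HN0] := H e e0.
exists N0 => // N /HN0; apply: le_trans; rewrite distrC.
have -> : series (fun k => complex.Im (a k * w ^+ k)) N =
    complex.Im (\sum_(0 <= j < N) a j * w ^+ j).
  by rewrite /series /=; elim/big_ind2: _ => //= x1 x2 y1 y2 -> ->; rewrite cImD.
by rewrite -cImN -cImD; exact: cabs_Im.
Qed.

Lemma hsum_eq_lim (f g : nat -> R) S T : f =1 g -> hsum f S -> series g @ \oo --> T -> S = T.
Proof. by move=> /funext -> /hsum_series h1 h2; exact: cvg_unique h1 h2. Qed.

Section Compose.
Variables (n : nat) (a : 'rV[R]_n).
Local Notation V := 'rV[R]_n.

Lemma ana_holo (F : R[i]^o -> R[i]^o) (p : C) (rho : R) (g1 g2 : V -> R) : 0 < rho ->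
  holomorphic_on (cball p rho) F -> ana g1 a -> ana g2 a -> g1 a +i* g2 a = p ->
  ana (fun x => complex.Re (F (g1 x +i* g2 x))) a /\
  ana (fun x => complex.Im (F (g1 x +i* g2 x))) a.
Proof.
move=> rho0 HF Hg1 Hg2 ga.
have [c Hc] := holo_taylor HF rho0 (@subset_refl _ _).
have r2 : 0 < rho / 2 < rho by rewrite divr_gt0 //= ltr_pdivrMr // ltr_pMr // ltr1n.
have [M HM] := csum_bound r2 Hc.
pose L := rho / 4; have L0 : 0 < L by rewrite divr_gt0.
have L2 : 0 < L / 2 by rewrite divr_gt0.
have k1 : ana (fun x => g1 x - complex.Re p) a by apply: anaB => //; exact: ana_cst.
have k2 : ana (fun x => g2 x - complex.Im p) a by apply: anaB => //; exact: ana_cst.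
have [|r1 r10 Hr1] := ana_small L2 k1; first by rewrite -ga /= subrr.
have [|r3 r30 Hr3] := ana_small L2 k2; first by rewrite -ga /= subrr.
pose r := Num.min r1 r3.
have r0 : 0 < r by rewrite lt_min r10.
have R1 := Hr1 r; have R2 := Hr3 r.
have {}R1 : rep r (L / 2) (fun h => g1 (a + h) - complex.Re p).
  by apply: R1; rewrite r0 /= ge_min lexx.
have {}R2 : rep r (L / 2) (fun h => g2 (a + h) - complex.Im p).
  by apply: R2; rewrite r0 /= ge_min lexx orbT.
have LL : 2 * L = rho / 2 by rewrite /L; field.
have b1 k : `|complex.Re (c k)| * (2 * L) ^+ k <= M.
  apply: le_trans (HM k); rewrite LL ler_wpM2r ?cabs_Re // exprn_ge0 // ltW //.
  by case/andP: r2.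
have b2 k : `|complex.Im (c k)| * (2 * L) ^+ k <= M.
  apply: le_trans (HM k); rewrite LL ler_wpM2r ?cabs_Im // exprn_ge0 // ltW //.
  by case/andP: r2.
have b3 k : `|- complex.Im (c k)| * (2 * L) ^+ k <= M by rewrite normrN.
have le1 : L / 2 + 1 * (L / 2) <= L by rewrite mul1r -splitr.
have le2 : L / 2 * 1 + L / 2 <= L * 1 by rewrite !mulr1 -splitr.
(* With [t] and [q] both equal to the second function, the encoded root is ['i]: the pair consists
   of the real and imaginary parts of a power. *)
have [G [N [HG HGs]]] := pq_series r0 ler01 R1 R2 R2 le1 le2 L0 b1 b3.
have [G' [N' [HG' HGs']]] := pq_series r0 ler01 R1 R2 R2 le1 le2 L0 b2 b1.
have wE h : small r h -> let w := (g1 (a + h) - complex.Re p) +i* (g2 (a + h) - complex.Im p) in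
   cabs w < rho /\ g1 (a + h) +i* g2 (a + h) = p + w.
  move=> hh w; rewrite /w; split; last by apply: complex_eq; rewrite ?cReD ?cImD /=; ring.
  apply: le_lt_trans (cabs_le _) _ => /=.
  have [d1 D1] := R1; have [d2 D2] := R2.
  have := repc_bound D1 hh; have := repc_bound D2 hh; rewrite /L; lra.
split.
  exists r, N; split=> //; apply: eq_rep HG => h hh; have [wr we] := wE h hh.
  rewrite we; apply: hsum_eq_lim (HGs h hh) (csum_Re (Hc _ wr)) => k.
  by rewrite pq_complex cReM /=; ring.
exists r, N'; split=> //; apply: eq_rep HG' => h hh; have [wr we] := wE h hh.
rewrite we; apply: hsum_eq_lim (HGs' h hh) (csum_Im (Hc _ wr)) => k.
by rewrite pq_complex cImM /=; ring.
Qed.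

(** Conjugating the expansion gives a second expansion of the same function about the same real
    point; uniqueness of Taylor coefficients makes them self-conjugate. *)
Lemma real_coef (F : R[i]^o -> R[i]^o) (u rho : R) (c : nat -> C) : 0 < rho ->
  holomorphic_on (cball u%:C rho) F ->
  (forall z, cabs (z - u%:C) < rho -> F (conjc z) = conjc (F z)) ->
  (forall h, cabs h < rho -> csum_to c h (F (u%:C + h))) ->
  forall k, complex.Im (c k) = 0.
Proof.
move=> rho0 HF HJ Hc k.
have Hc' h : cabs h < rho -> csum_to (fun k => conjc (c k)) h (F (u%:C + h)).
  move=> hr e e0; have hr' : cabs (conjc h) < rho by rewrite cabsJ.
  have [N0 HN0] := Hc _ hr' e e0; exists N0 => N /HN0.
  have -> : F (u%:C + conjc h) = conjc (F (u%:C + h)).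
    rewrite -HJ; first by congr F; apply: complex_eq; case: h {hr hr' HN0} => x y /=; rewrite ?oppr0 ?addr0 ?opprD ?oppr0.
    by rewrite addrC addKr.
  rewrite -cabsJ rmorphB /= conjcK; apply: le_trans; rewrite le_eqVlt; apply/orP; left.
  apply/eqP; congr (cabs (_ - _)); rewrite rmorph_sum; apply: eq_bigr => i _.
  by rewrite rmorphM rmorphXn /= conjcK.
have e1 := taylor_coef k rho0 HF Hc; have e2 := taylor_coef k rho0 HF Hc'.
have n0 : (k`!%:R : C) != 0 by rewrite pnatr_eq0 -lt0n fact_gt0.
have : c k = conjc (c k) by apply: (mulfI n0); rewrite -e1 e2.
by case: (c k) => x y [] /eqP; rewrite -addr_eq0 -mulr2n mulrn_eq0 /= => /eqP.
Qed.

(** [s] stands for the squared length of the vector part, whose root is not analytic where it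
    vanishes. Real Taylor coefficients leave only even powers of the root in the real part and odd
    ones in the imaginary part. *)
Lemma ana_axial0 (F : R[i]^o -> R[i]^o) (u rho : R) (g s : V -> R) : 0 < rho ->
  holomorphic_on (cball u%:C rho) F ->
  (forall z, cabs (z - u%:C) < rho -> F (conjc z) = conjc (F z)) ->
  ana g a -> ana s a -> g a = u -> s a = 0 -> (forall x, 0 <= s x) ->
  ana (fun x => complex.Re (F (g x +i* Num.sqrt (s x)))) a /\
  exists2 B, ana B a & \forall x \near a, complex.Im (F (g x +i* Num.sqrt (s x))) = Num.sqrt (s x) * B x.
Proof.
move=> rho0 HF HJ Hg Hs ga sa s_ge0.
have [c Hc] := holo_taylor HF rho0 (@subset_refl _ _).
have cr := real_coef rho0 HF HJ Hc.
have r2 : 0 < rho / 2 < rho by rewrite divr_gt0 //= ltr_pdivrMr // ltr_pMr // ltr1n.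
have [M HM] := csum_bound r2 Hc.
pose L := rho / 4; have L0 : 0 < L by rewrite divr_gt0.
have L2 : 0 < L / 2 by rewrite divr_gt0.
have L4 : 0 < L ^+ 2 / 4 by rewrite divr_gt0 // exprn_gt0.
have k1 : ana (fun x => g x - u) a by apply: anaB => //; exact: ana_cst.
have [|r1 r10 Hr1] := ana_small L2 k1; first by rewrite ga /= subrr.
have [r3 r30 Hr3] := ana_small L4 Hs sa.
pose r := Num.min r1 r3.
have r0 : 0 < r by rewrite lt_min r10.
have R1 : rep r (L / 2) (fun h => g (a + h) - u).
  by apply: Hr1; rewrite r0 /= ge_min lexx.
have R2 : rep r (L ^+ 2 / 4) (fun h => s (a + h)).
  by apply: Hr3; rewrite r0 /= ge_min lexx orbT.
have R3 : rep r 1 (fun _ : V => 1 : R) by have := @rep_cst R n r 1; rewrite normr1.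
have LL : 2 * L = rho / 2 by rewrite /L; field.
have b1 k : `|complex.Re (c k)| * (2 * L) ^+ k <= M.
  apply: le_trans (HM k); rewrite LL ler_wpM2r ?cabs_Re // exprn_ge0 // ltW //.
  by case/andP: r2.
have b0 k : `|(fun=> 0 : R) k| * (2 * L) ^+ k <= M.
  by rewrite normr0 mul0r; apply: le_trans (b1 0%N); rewrite expr0 mulr1.
have tau0 : 0 <= 2 / L by rewrite divr_ge0 // ltW.
have le1 : L / 2 + 2 / L * (L ^+ 2 / 4) <= L.
  by rewrite le_eqVlt; apply/orP; left; apply/eqP; field; rewrite gt_eqF.
have le2 : L / 2 * (2 / L) + 1 <= L * (2 / L).
  by rewrite le_eqVlt; apply/orP; left; apply/eqP; field; rewrite gt_eqF.
(* With [q = 1] and [t = s] the encoded root is ['i] times the square root of [s], so the root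
   itself never enters the power series. *)
have [G [N [HG HGs]]] := pq_series r0 tau0 R1 R2 R3 le1 le2 L0 b1 b0.
have [G' [N' [HG' HGs']]] := pq_series r0 tau0 R1 R2 R3 le1 le2 L0 b0 b1.
have wE h : small r h -> let w := (g (a + h) - u) +i* Num.sqrt (s (a + h)) in
   cabs w < rho /\ g (a + h) +i* Num.sqrt (s (a + h)) = u%:C + w.
  move=> hh w; rewrite /w; split; last first.
    by apply: complex_eq; rewrite ?cReD ?cImD /=; ring.
  apply: le_lt_trans (cabs_le _) _ => /=.
  have [d1 D1] := R1; have [d2 D2] := R2.
  have B1 := repc_bound D1 hh; have B2 := repc_bound D2 hh.
  rewrite (ger0_norm (sqrtr_ge0 _)).
  have B3 : Num.sqrt (s (a + h)) <= L / 2.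
    rewrite -[L / 2]ger0_norm ?(ltW L2) // -sqrtr_sqr ler_wsqrtr //.
    apply: le_trans (ler_norm _) _; apply: le_trans B2 _.
    by rewrite le_eqVlt; apply/orP; left; apply/eqP; field.
  apply: le_lt_trans (lerD B1 B3) _; rewrite /L; lra.
split.
  exists r, N; split=> //; apply: eq_rep HG => h hh; have [wr we] := wE h hh.
  rewrite we; apply: hsum_eq_lim (HGs h hh) (csum_Re (Hc _ wr)) => k.
  by rewrite pq_root cReM cr sqr_sqrtr //=; ring.
exists (fun x => G' (x - a)).
  exists r, N'; split=> //; apply: eq_rep HG' => h _; by rewrite addrC addrA addNr add0r.
apply/nbhs_small; exists r => // h hh; have [wr we] := wE h hh.
have -> : a + h - a = h by rewrite addrC addKr.
rewrite we; symmetry.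
apply: hsum_eq_lim (hsumZ (Num.sqrt (s (a + h))) (HGs' h hh)) (csum_Im (Hc _ wr)) => k.
by rewrite pq_root cImM cr sqr_sqrtr //=; ring.
Qed.

End Compose.
End QuadraticPowers.

(** * Connectedness and the identity theorem *)

Section Identity.
Variable R : realType.
Local Notation C := R[i].

(** [P] is locally constant on [Om], so the points where it holds and those where it fails form two
    open subsets of a connected set. *)
Lemma connected_ind (Om P : set R[i]^o) : connected Om ->
  (forall z, Om z -> exists2 r : R, 0 < r & forall w, cabs (w - z) < r ->
     Om w /\ (P w <-> P z)) ->
  (exists2 z, Om z & P z) -> forall z, Om z -> P z.
Proof.
move=> cOm H [z0 Oz0 Pz0] z Oz.
have oP (Q : set R[i]^o) : (forall z w, Om z -> (P w <-> P z) -> Q z -> Q w) ->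
    open (Om `&` Q).
  move=> QP; apply: copen_open => x [Ox Qx]; have [r r0 Hr] := H x Ox.
  by exists r => // w /Hr[Ow PE]; split=> //; exact: QP Ox PE Qx.
suff : Om `&` P = Om by move=> /seteqP[_ /(_ z Oz)[]].
apply: cOm; first by exists z0.
  by exists (Om `&` P); [apply: oP => x w _ <- //|rewrite setIA setIid].
exists (~` (Om `&` ~` P)).
  by apply: open_closedC; apply: oP => x w _ e; rewrite /setC /= e.
apply/seteqP; split=> x [Ox Px]; split=> //; first by case.
by apply: contrapT => nP; apply: Px.
Qed.

Definition pt2 (u v : R) : 'rV[R]_2 := \row_i (if i == ord0 then u else v).

Definition pt2c (z : C) := pt2 (complex.Re z) (complex.Im z).

Lemma pt2c_near z (P : set 'rV[R]_2) : nbhs (pt2c z) P ->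
  exists2 d : R, 0 < d & forall w, cabs (w - z) < d -> P (pt2c w).
Proof.
move=> /nbhs_small[d d0 Hd]; exists d => // w wz.
have -> : pt2c w = pt2c z + (pt2c w - pt2c z) by rewrite addrC subrK.
apply: Hd => i; rewrite !mxE; case: eqP => _.
  by rewrite -cReN -cReD; apply: le_trans (cabs_Re _) (ltW wz).
by rewrite -cImN -cImD; apply: le_trans (cabs_Im _) (ltW wz).
Qed.

(** The property propagated is vanishing near the point, not at it. Where it fails, some iterated
    derivative is nonzero, hence nonzero nearby, so failure is an open condition too. *)
Lemma ana_identity (Om : set R[i]^o) (h : 'rV[R]_2 -> R) : copen Om -> connected Om ->
  (forall z, Om z -> ana h (pt2c z)) ->
  (exists2 z, Om z & \forall y \near pt2c z, h y = 0) ->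
  forall z, Om z -> h (pt2c z) = 0.
Proof.
move=> oOm cOm Hh Hz z Oz.
suff : \forall y \near pt2c z, h y = 0 by exact: nbhs_singleton.
move: z Oz; apply: (connected_ind cOm) Hz => z Oz; have [r r0 Hr] := oOm z Oz.
have [Pz|nP] := pselect (\forall y \near pt2c z, h y = 0).
  have /pt2c_near[d d0 Hd] := nbhs_interior Pz.
  exists (Num.min r d); first by rewrite lt_min r0.
  move=> w; rewrite lt_min => /andP[/Hr Ow /Hd Pw]; split=> //.
have [s Hs] : exists s : seq 'I_2, derivs s h (pt2c z) != 0.
  apply: contrapT => Hn; apply: nP; apply: ana_eq0; first exact: Hh.
  by move=> s; apply: contrapT => /eqP Hs; apply: Hn; exists s.
have /pt2c_near[d d0 Hd] : \forall y \near pt2c z, derivs s h y != 0.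
  have := differentiable_continuous (ana_differentiable (ana_derivs s (Hh _ Oz))).
  by move=> /cvgr_neq0; apply.
exists (Num.min r d); first by rewrite lt_min r0.
move=> w; rewrite lt_min => /andP[/Hr Ow /Hd Pw]; split=> //; split=> // Hw.
by move: Pw; rewrite (nbhs_singleton (derivs_near0 s Hw)) eqxx.
Qed.

Lemma holo_ana (F : R[i]^o -> R[i]^o) (Om : set R[i]^o) z : copen Om ->
  holomorphic_on Om F -> Om z ->
  ana (fun y : 'rV_2 => complex.Re (F (y ord0 ord0 +i* y ord0 ord_max))) (pt2c z) /\
  ana (fun y : 'rV_2 => complex.Im (F (y ord0 ord0 +i* y ord0 ord_max))) (pt2c z).
Proof.
move=> oOm HF Oz; have [r r0 Hr] := oOm z Oz.
apply: (@ana_holo _ _ _ F z r) => //; try exact: ana_coord.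
  by apply: holo_sub HF => w; exact: Hr.
by rewrite !mxE /=; case: (z).
Qed.

Lemma holo_real_derive (F : R[i]^o -> R[i]^o) (Om : set R[i]^o) : copen Om ->
  holomorphic_on Om F -> (forall t : R, Om t%:C -> F t%:C = 0) ->
  forall t : R, Om t%:C -> derive1 F t%:C = 0.
Proof.
move=> oOm HF F0 t Ot; have /holomorphicP/(_ _ Ot) := HF.
set l := derive1 F _ => Hl; have [r r0 Hr] := oOm _ Ot.
apply/eqP; rewrite -cabs_eq0 eq_le cabs_ge0 andbT; apply/ler_addgt0Pl => e e0.
rewrite addr0; have [d d0 Hd] := Hl e e0.
pose s := Num.min r d / 2; have m0 : 0 < Num.min r d by rewrite lt_min r0.
have s0 : 0 < s by rewrite divr_gt0.
have sm : s < Num.min r d by rewrite ltr_pdivrMr // ltr_pMr // ltr1n.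
have cs : cabs (s%:C) = s by rewrite cabsr gtr0_norm.
have [sr sd] : s < r /\ s < d by move: sm; rewrite lt_min => /andP[].
have := Hd s%:C; rewrite cs => /(_ sd); rewrite -rmorphD /= !F0 //; last first.
  apply: Hr; have -> : (t + s)%:C - t%:C = s%:C by apply: complex_eq; rewrite ?cReD ?cImD /=; ring.
  by rewrite cs.
by rewrite subrr sub0r cabsN cabsM cs mulrC ler_pM2r.
Qed.

(** Complex derivatives may be computed with real increments, so all of them vanish on the real
    trace. Taylor's expansion then gives zero on a disc, and the theorem in two real variables takes
    over. *)
Lemma holo_identity (Om : set R[i]^o) (F : R[i]^o -> R[i]^o) : copen Om -> connected Om ->
  holomorphic_on Om F -> (exists t : R, Om t%:C) ->
  (forall t : R, Om t%:C -> F t%:C = 0) -> forall z, Om z -> F z = 0.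
Proof.
move=> oOm cOm HF [t Ot] F0.
have D0 n : holomorphic_on Om (derive1n n F) /\
    forall s : R, Om s%:C -> derive1n n F s%:C = 0.
  elim: n => [|n [IH1 IH2]]; first by [].
  split; first exact: holo_derive1n.
  by rewrite derive1nS; exact: holo_real_derive IH1 IH2.
have [r r0 Hr] := oOm _ Ot.
have Fr w : cabs (w - t%:C) < r -> F w = 0.
  move=> wr; have := taylor_derive1n HF Hr wr.
  rewrite (_ : t%:C + (w - t%:C) = w); last by rewrite addrC subrK.
  move=> H; apply/eqP; rewrite -cabs_eq0 eq_le cabs_ge0 andbT.
  apply: csum_lim H _; exists 0%N => N _; rewrite big1 ?cabs0 // => j _.
  by rewrite (D0 j).2 // !mul0r.
have Hnear : \forall y \near pt2c t%:C, F ((y : 'rV[R]_2) ord0 ord0 +i* y ord0 ord_max) = 0.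
  apply/nbhs_small; exists (r / 3); first by rewrite divr_gt0.
  move=> h hh; apply: Fr; apply: le_lt_trans (cabs_le _) _.
  rewrite cReD cImD cReN cImN !mxE /=.
  rewrite addrAC subrr !add0r oppr0 addr0.
  by apply: le_lt_trans (lerD (hh _) (hh _)) _; lra.
move=> z Oz; apply: complex_eq.
  have := @ana_identity Om (fun y => complex.Re (F (y ord0 ord0 +i* y ord0 ord_max))) oOm cOm.
  move=> /(_ (fun z Oz => (holo_ana oOm HF Oz).1)) /(_ _ z Oz).
  rewrite !mxE /=; case: (z) {Oz} => x y /= -> //; exists t%:C => //.
  by apply: filterS Hnear => ? ->.
have := @ana_identity Om (fun y => complex.Im (F (y ord0 ord0 +i* y ord0 ord_max))) oOm cOm.
move=> /(_ (fun z Oz => (holo_ana oOm HF Oz).2)) /(_ _ z Oz).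
rewrite !mxE /=; case: (z) {Oz} => x y /= -> //; exists t%:C => //.
by apply: filterS Hnear => ? ->.
Qed.

End Identity.

(** * Reciprocals and square roots of analytic functions *)

Section InverseSqrt.
Variables (R : realType) (n : nat).
Implicit Types (g : 'rV[R]_n -> R) (a : 'rV[R]_n).
Local Notation C := R[i].

Lemma ana_inv g a : ana g a -> g a != 0 -> ana (fun x => (g x)^-1) a.
Proof.
move=> Hg g0; have [] := @ana_holo R n a (fun z => z^-1) (g a)%:C `|g a| g (fun=> 0).
- by rewrite normr_gt0.
- apply: holo_intro => z; rewrite /cball /= => zg.
  exists (- 1 / z ^+ 2); apply: (@cderivV _ id); last exact: cderiv_id.
  by apply: contraTneq zg => ->; rewrite sub0r cabsN cabsr ltxx.
- by [].
- exact: ana_cst.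
- by [].
move=> H _; apply: eq1_ana H => x.
by rewrite -[g x +i* 0]/((g x)%:C) -fmorphV.
Qed.

Lemma sqrtc_Re_gt0 (z : C) : 0 < complex.Re z -> 0 < complex.Re (sqrtc z).
Proof.
case: z => x y /= x0; rewrite sqrtr_gt0 divr_gt0 // ltr_wpDl ?sqrtr_ge0 //.
Qed.

(** The increment factors as [t = (b - a) * (b + a)]. Both roots have positive real part, so
    [cabs (b + a)] is bounded below by the real part of [a]. *)
Lemma sqrtc_cderiv (z : C) : 0 < complex.Re z -> cderiv (@sqrtc R) z (2 * sqrtc z)^-1.
Proof.
move=> z0 e e0; set a := sqrtc z; have a0 : 0 < complex.Re a by exact: sqrtc_Re_gt0.
pose al := complex.Re a; pose d := Num.min (complex.Re z) (2 * e * al ^+ 3).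
have d0 : 0 < d by rewrite lt_min z0 /= !mulr_gt0 ?exprn_gt0.
exists d => // t; rewrite lt_min => /andP[tz te].
have zt : 0 < complex.Re (z + t).
  by rewrite cReD; have := cabs_Re t; rewrite ler_norml => /andP[]; lra.
set b := sqrtc (z + t); have b0 : 0 < complex.Re b by exact: sqrtc_Re_gt0.
have Ea : a ^+ 2 = z by exact: sqr_sqrtc.
have Eb : b ^+ 2 = z + t by exact: sqr_sqrtc.
have Et : t = (b - a) * (b + a).
  have -> : t = b ^+ 2 - a ^+ 2 by rewrite Ea Eb addrC addKr.
  by rewrite subr_sqr.
have al_a : al <= cabs a by apply: le_trans (cabs_Re _); exact: ler_norm.
have al_ab : al <= cabs (b + a).
  apply: le_trans (cabs_Re _); apply: le_trans (ler_norm _); rewrite cReD.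
  by rewrite lerDr ltW.
have a_neq0 : a != 0 by rewrite -cabs_gt0; apply: lt_le_trans al_a.
have ba : cabs (b - a) * al <= cabs t.
  by rewrite Et cabsM ler_wpM2l ?cabs_ge0.
have -> : b - a - t / (2 * a) = - ((b - a) ^+ 2 / (2 * a)).
  by rewrite Et; field.
rewrite cabsN Et cabsM cabsV [cabs (2 * a)]cabsM [cabs ((b - a) * _)]cabsM cabsX.
have -> : cabs (2 : C) = 2 by rewrite -[2](@rmorph_nat _ _ (real_complex R)) cabsr ger0_norm.
have [ba0 al0] : 0 <= cabs (b - a) /\ 0 < al by split=> //; exact: cabs_ge0.
have ba2 : cabs (b - a) <= 2 * e * al ^+ 2.
  by rewrite -(ler_pM2r al0); apply: le_trans ba _; apply: le_trans (ltW te) _; rewrite exprSr mulrA.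
move: ba0 ba2 al_a al_ab; move: (cabs (b - a)) (cabs a) (cabs (b + a)) => x y w x0 xle ly lw.
have y0 : 0 < y by exact: lt_le_trans ly.
rewrite ler_pdivrMr ?mulr_gt0 // expr2.
have -> : e * (x * w) * (2 * y) = x * (2 * e * w * y) by ring.
rewrite ler_wpM2l //; apply: le_trans xle _.
by rewrite expr2 mulrA ler_pM // ?mulr_ge0 ?ler_wpM2l ?mulr_ge0 // ltW.
Qed.

Lemma ana_sqrt g a : ana g a -> 0 < g a -> ana (fun x => Num.sqrt (g x)) a.
Proof.
move=> Hg g0; have [] := @ana_holo R n a (@sqrtc R) (g a)%:C (g a) g (fun=> 0).
- by [].
- apply: holo_intro => z; rewrite /cball /= => zg.
  exists (2 * sqrtc z)^-1; apply: sqrtc_cderiv.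
  have := cabs_Re (z - (g a)%:C); rewrite cReD cReN /= ler_norml => /andP[].
  move: zg; set c := cabs _; lra.
- by [].
- exact: ana_cst.
- by [].
move=> H _; apply: eq_ana H.
have : \forall x \near a, 0 < g x.
  have := differentiable_continuous (ana_differentiable Hg).
  by move=> /cvgr_gt; apply.
apply: filterS => x gx; rewrite -[g x +i* 0]/((g x)%:C) sqrtc_sqrtr //=.
by rewrite lecR ltW.
Qed.

End InverseSqrt.

(** * Clifford-valued calculus *)

Section CliffordCalculus.
Variables (R : realType) (m : nat).
Local Notation Cl := (clifford R m).

Section Analytic.
Variable n : nat.
Implicit Types (F G : 'rV[R]_n -> Cl) (x e : 'rV[R]_n).

Definition cana F x := forall A, ana (fun y => F y A) x.

Lemma cana_cst (c : Cl) x : cana (fun=> c) x.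
Proof. by move=> A; exact: ana_cst. Qed.

Lemma canaD F G x : cana F x -> cana G x -> cana (fun y => F y + G y) x.
Proof.
by move=> HF HG A; apply: eq1_ana (anaD (HF A) (HG A)) => y; rewrite ffunE.
Qed.

Lemma canaN F x : cana F x -> cana (fun y => - F y) x.
Proof. by move=> HF A; apply: eq1_ana (anaN (HF A)) => y; rewrite ffunE. Qed.

Lemma canaM F G x : cana F x -> cana G x -> cana (fun y => F y * G y) x.
Proof.
move=> HF HG A; apply: (@eq1_ana _ _ (fun y => \sum_(B : {set 'I_m})
   cl_sign R B (symdiff B A) * (F y B * G y (symdiff B A)))).
  by move=> y; rewrite ffunE.
by apply: ana_sum => B _; apply: anaZ; exact: anaM.
Qed.

Lemma canaZ (k : 'rV[R]_n -> R) F x : ana k x -> cana F x -> cana (fun y => k y *: F y) x.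
Proof.
by move=> Hk HF A; apply: eq1_ana (anaM Hk (HF A)) => y; rewrite ffunE.
Qed.

Lemma cana_sum (I : Type) (s : seq I) (P : pred I) (F : I -> 'rV[R]_n -> Cl) x :
  (forall i, P i -> cana (F i) x) -> cana (fun y => \sum_(i <- s | P i) F i y) x.
Proof.
move=> H A; apply: (@eq1_ana _ _ (fun y => \sum_(i <- s | P i) F i y A)).
  by move=> y; rewrite sum_ffunE.
by apply: ana_sum => i /H; exact.
Qed.

Lemma eq_cana F G x : (\forall y \near x, F y = G y) -> cana F x -> cana G x.
Proof.
by move=> H HF A; apply: eq_ana (HF A); apply: filterS H => y ->.
Qed.

End Analytic.

Section DirectionalDerivative.
Variable V : normedModType R.
Implicit Types (F G : V -> Cl) (x e : V).

Definition pder e F x (D : Cl) := forall A, is_derive x e (fun y => F y A) (D A).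

Lemma pder_cst e c x : pder e (fun=> c) x 0.
Proof. by move=> A; rewrite ffunE; exact: is_derive_cst. Qed.

Lemma pderD e F G x D E : pder e F x D -> pder e G x E ->
  pder e (fun y => F y + G y) x (D + E).
Proof.
move=> HF HG A; have := is_deriveD (HF A) (HG A); rewrite ffunE.
by congr is_derive; apply/funext => y; rewrite ffunE.
Qed.

Lemma pderN e F x D : pder e F x D -> pder e (fun y => - F y) x (- D).
Proof.
move=> HF A; have := is_deriveN (HF A); rewrite ffunE.
by congr is_derive; apply/funext => y; rewrite ffunE.
Qed.

Lemma pder_sum e (I : Type) (s : seq I) (F : I -> V -> Cl) x D :
  (forall i, pder e (F i) x (D i)) ->
  pder e (fun y => \sum_(i <- s) F i y) x (\sum_(i <- s) D i).
Proof.
move=> H; elim: s => [|i s IH].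
  rewrite big_nil (_ : (fun _ => _) = fun=> 0); first exact: pder_cst.
  by apply/funext => y; rewrite big_nil.
rewrite big_cons (_ : (fun _ => _) = fun y => F i y + \sum_(j <- s) F j y).
  exact: pderD.
by apply/funext => y; rewrite big_cons.
Qed.

Lemma pderZ e (k : V -> R) F x d D : is_derive x e k d -> pder e F x D ->
  pder e (fun y => k y *: F y) x (d *: F x + k x *: D).
Proof.
move=> Hk HF A; have := is_deriveM Hk (HF A).
rewrite !ffunE (_ : k x *: D A + F x A *: d = d * F x A + k x * D A); last first.
  by rewrite addrC /GRing.scale /= mulrC.
by congr is_derive; apply/funext => y; rewrite ffunE.
Qed.

Lemma pderM e F G x D E : pder e F x D -> pder e G x E ->
  pder e (fun y => F y * G y) x (D * G x + F x * E).
Proof.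
move=> HF HG A.
pose t B y := cl_sign R B (symdiff B A) * (F y B * G y (symdiff B A)).
pose dt B := cl_sign R B (symdiff B A) *
  (D B * G x (symdiff B A) + F x B * E (symdiff B A)).
have Ht B : is_derive x e (t B) (dt B).
  have := is_deriveZ (cl_sign R B (symdiff B A)) (is_deriveM (HF B) (HG (symdiff B A))).
  rewrite /dt [D B * _ + _]addrC [D B * _]mulrC; exact.
have : forall s, is_derive x e (fun y => \sum_(B <- s) t B y) (\sum_(B <- s) dt B).
  elim=> [|B s IH].
    rewrite big_nil (_ : (fun _ => _) = fun=> 0); first exact: is_derive_cst.
    by apply/funext => y; rewrite big_nil.
  rewrite big_cons (_ : (fun _ => _) = fun y => t B y + \sum_(j <- s) t j y).
    exact: is_deriveD.
  by apply/funext => y; rewrite big_cons.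
move=> /(_ (index_enum _)).
rewrite (_ : \sum_(B <- _) dt B = (D * G x + F x * E) A); last first.
  by rewrite !ffunE -big_split; apply: eq_bigr => B _; rewrite /dt /= mulrDr.
by congr is_derive; apply/funext => y; rewrite ffunE.
Qed.

Lemma pder_near e F G x D : (\forall y \near x, F y = G y) -> pder e F x D -> pder e G x D.
Proof.
move=> H HF A; apply: near_eq_is_derive (HF A).
by apply: filterS H => y ->.
Qed.

End DirectionalDerivative.

Section Operators.
Local Notation point := 'rV[R]_m.+1.
Implicit Types (F G : point -> Cl) (x : point).
Local Notation E i := (delta_mx ord0 i : point).

Lemma cana_pder F x i : cana F x -> pder (E i) F x (partial i F x).
Proof.
move=> HF A; rewrite ffunE; have [H _] := ana_deriv i (HF A).
exact: derivableP.
Qed.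

Lemma pder_partial F x i D : pder (E i) F x D -> partial i F x = D.
Proof. by move=> H; apply/ffunP => A; rewrite ffunE; exact: derive_val. Qed.

Lemma cana_partial F x i : cana F x -> cana (partial i F) x.
Proof.
move=> HF A; have [_ H] := ana_deriv i (HF A).
by apply: eq1_ana H => y; rewrite ffunE.
Qed.

Lemma partial_near F G x i : (\forall y \near x, F y = G y) -> partial i F x = partial i G x.
Proof.
move=> H; apply/ffunP => A; rewrite !ffunE; apply: near_eq_derive.
by apply: filterS H => y ->.
Qed.

Lemma partialD F G x i : cana F x -> cana G x ->
  partial i (fun y => F y + G y) x = partial i F x + partial i G x.
Proof. by move=> HF HG; apply: pder_partial; apply: pderD; exact: cana_pder. Qed.

Lemma partialN F x i : cana F x -> partial i (fun y => - F y) x = - partial i F x.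
Proof. by move=> HF; apply: pder_partial; apply: pderN; exact: cana_pder. Qed.

Lemma partial_sum (I : Type) (s : seq I) (F : I -> point -> Cl) x i :
  (forall j, cana (F j) x) ->
  partial i (fun y => \sum_(j <- s) F j y) x = \sum_(j <- s) partial i (F j) x.
Proof.
by move=> HF; apply: pder_partial; apply: pder_sum => j; exact: cana_pder.
Qed.

Lemma partial_cstM (c : Cl) F x i : cana F x ->
  partial i (fun y => c * F y) x = c * partial i F x.
Proof.
move=> HF; apply: pder_partial; rewrite -[c * _]add0r -(mul0r (F x)).
by apply: pderM; [exact: pder_cst | exact: cana_pder].
Qed.

Lemma partial_comm F x i j : cana F x ->
  partial i (partial j F) x = partial j (partial i F) x.
Proof.
move=> HF; apply/ffunP => A.
have e k l : partial k (partial l F) x A = 'D_(E k) ('D_(E l) (fun y => F y A)) x.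
  by rewrite ffunE; congr ('D__ _ x); apply/funext => y; rewrite ffunE.
have := ana_comm i j (HF A) => c.
exact: (etrans (e i j) (etrans c (esym (e j i)))).
Qed.

Lemma cana_Dvec F x : cana F x -> cana (Dvec F) x.
Proof.
move=> HF; apply: cana_sum => j _; apply: canaM; first exact: cana_cst.
exact: cana_partial.
Qed.

Lemma cana_Dop F x : cana F x -> cana (Dop F) x.
Proof. by move=> HF; apply: canaD; [exact: cana_partial|exact: cana_Dvec]. Qed.

Lemma cana_Dbar F x : cana F x -> cana (Dbar F) x.
Proof.
by move=> HF; apply: canaD; [exact: cana_partial|apply: canaN; exact: cana_Dvec].
Qed.

Lemma cana_laplacian F x : cana F x -> cana (laplacian F) x.
Proof. by move=> HF; apply: cana_sum => j _; do 2 apply: cana_partial. Qed.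

Lemma Dvec_near F G x : (\forall y \near x, F y = G y) -> Dvec F x = Dvec G x.
Proof. by move=> H; apply: eq_bigr => j _; rewrite (partial_near _ H). Qed.

Lemma Dop_near F G x : (\forall y \near x, F y = G y) -> Dop F x = Dop G x.
Proof. by move=> H; rewrite /Dop (partial_near _ H) (Dvec_near H). Qed.

Lemma Dbar_near F G x : (\forall y \near x, F y = G y) -> Dbar F x = Dbar G x.
Proof. by move=> H; rewrite /Dbar (partial_near _ H) (Dvec_near H). Qed.

Lemma laplacian_near F G x : (\forall y \near x, F y = G y) ->
  laplacian F x = laplacian G x.
Proof.
move=> H; apply: eq_bigr => j _; apply: partial_near.
by apply: filterS (nbhs_interior H) => y; exact: partial_near.
Qed.

Lemma partial_Dvec F x i : cana F x -> partial i (Dvec F) x = Dvec (partial i F) x.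
Proof.
move=> HF; rewrite partial_sum; last first.
  by move=> j; apply: canaM; [exact: cana_cst | exact: cana_partial].
apply: eq_bigr => j _; rewrite partial_cstM; last exact: cana_partial.
by rewrite (partial_comm i (lift ord0 j) HF).
Qed.

Lemma DvecD F G x : cana F x -> cana G x ->
  Dvec (fun y => F y + G y) x = Dvec F x + Dvec G x.
Proof.
move=> HF HG; rewrite -big_split; apply: eq_bigr => j _ /=.
by rewrite partialD // mulrDr.
Qed.

Lemma DvecN F x : cana F x -> Dvec (fun y => - F y) x = - Dvec F x.
Proof.
move=> HF; rewrite -sumrN; apply: eq_bigr => j _ /=.
by rewrite partialN // mulrN.
Qed.

Lemma Dvec_sum (I : Type) (s : seq I) (F : I -> point -> Cl) x :
  (forall j, cana (F j) x) ->
  Dvec (fun y => \sum_(j <- s) F j y) x = \sum_(j <- s) Dvec (F j) x.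
Proof.
move=> HF; rewrite exchange_big; apply: eq_bigr => j _ /=.
by rewrite partial_sum // mulr_sumr.
Qed.

Lemma laplacian_Dvec F x : (\forall y \near x, cana F y) ->
  laplacian (Dvec F) x = Dvec (laplacian F) x.
Proof.
move=> /[dup] /nbhs_singleton HF nF; rewrite [RHS]Dvec_sum; last first.
  by move=> j; do 2 apply: cana_partial.
apply: eq_bigr => i _; rewrite -partial_Dvec; last exact: cana_partial.
by apply: partial_near; apply: filterS nF => y; exact: partial_Dvec.
Qed.

(** The double sum is added to its transpose: anticommutation together with the symmetry of second
    derivatives removes the mixed terms and doubles the diagonal ones. *)
Lemma Dvec_Dvec F x : cana F x ->
  Dvec (Dvec F) x = - \sum_(j < m) partial (lift ord0 j) (partial (lift ord0 j) F) x.
Proof.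
move=> HF; pose P j l := partial (lift ord0 j) (partial (lift ord0 l) F) x.
have PC j l : P j l = P l j by exact: partial_comm.
pose S := \sum_(j < m) \sum_(l < m) cl_gen R j * cl_gen R l * P j l.
have -> : Dvec (Dvec F) x = S.
  apply: eq_bigr => j _; rewrite partial_sum; last first.
    by move=> l; apply: canaM; [exact: cana_cst | exact: cana_partial].
  rewrite mulr_sumr; apply: eq_bigr => l _; rewrite partial_cstM ?mulrA //.
  exact: cana_partial.
have S2 : S + S = - (\sum_(j < m) P j j) *+ 2.
  rewrite {2}/S exchange_big -big_split -sumrN -sumrMnl; apply: eq_bigr => j _ /=.
  rewrite -big_split (bigD1 j) //= big1 ?addr0; last first.
    move=> l lj; rewrite (PC l j) -mulrDl cl_gen_anticomm eq_sym (negbTE lj).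
    by rewrite mul0rn oppr0 mul0r.
  by rewrite -mulrDl cl_gen_anticomm eqxx mulNr mulrnAl mul1r mulNrn.
have two : (2 : R) != 0 by rewrite pnatr_eq0.
apply: (scalerI two); rewrite !scaler_nat mulr2n S2 //.
Qed.

Lemma Dop_Dbar F x : (\forall y \near x, cana F y) -> Dop (Dbar F) x = laplacian F x.
Proof.
move=> /[dup] /nbhs_singleton HF nF.
have [H0 HD] : cana (partial ord0 F) x /\ cana (Dvec F) x.
  by split; [exact: cana_partial|exact: cana_Dvec].
rewrite /Dop /Dbar partialD //; last exact: canaN.
rewrite DvecD //; last exact: canaN.
rewrite partialN // DvecN // Dvec_Dvec // partial_Dvec // opprK addrA subrK.
by rewrite /laplacian big_ord_recl.
Qed.

End Operators.
End CliffordCalculus.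

(** * Polar coordinates of paravectors *)

Section Geometry.
Variables (R : realType) (m : nat).
Local Notation C := R[i].
Local Notation Cl := (clifford R m).
Local Notation point := 'rV[R]_m.+1.
Implicit Types (w : 'rV[R]_m) (x y : point).

Lemma enorm_ge0 w : 0 <= enorm w. Proof. exact: sqrtr_ge0. Qed.

Lemma enorm_sq w : enorm w ^+ 2 = \sum_j w ord0 j ^+ 2.
Proof. by rewrite sqr_sqrtr // sumr_ge0 // => j _; exact: sqr_ge0. Qed.

Lemma enormZ v w : enorm (v *: w) = `|v| * enorm w.
Proof.
rewrite /enorm -sqrtr_sqr -sqrtrM ?sqr_ge0 // mulr_sumr; congr Num.sqrt.
by apply: eq_bigr => j _; rewrite mxE exprMn.
Qed.

Lemma enorm_eq0 w : (enorm w == 0) = (w == 0).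
Proof.
apply/eqP/eqP => [w0|->]; last first.
  by rewrite -[0 in LHS](scale0r 0) enormZ normr0 mul0r.
have : enorm w ^+ 2 = 0 by rewrite w0 expr0n.
rewrite enorm_sq => /eqP; rewrite psumr_eq0; last by move=> j _; exact: sqr_ge0.
move=> /allP H; apply/rowP => j; rewrite mxE.
by have := H j (mem_index_enum _); rewrite /= sqrf_eq0 => /eqP.
Qed.

Lemma enorm_gt0 w : (0 < enorm w) = (w != 0).
Proof. by rewrite lt_neqAle enorm_ge0 andbT eq_sym enorm_eq0. Qed.

Lemma onevec0 : onevec (0 : 'rV[R]_m) = 0.
Proof. by rewrite /onevec big1 // => j _; rewrite mxE scale0r. Qed.

Lemma onevecZ v w : onevec (v *: w) = v *: onevec w.
Proof.
by rewrite /onevec scaler_sumr; apply: eq_bigr => j _; rewrite mxE scalerA.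
Qed.

Lemma onevec_sq w : onevec w * onevec w = (- enorm w ^+ 2)%:A.
Proof.
have two : (2 : R) != 0 by rewrite pnatr_eq0.
apply: (scalerI two); rewrite !scaler_nat.
pose S := \sum_(j < m) \sum_(l < m) (w ord0 j * w ord0 l) *: (cl_gen R j * cl_gen R l).
have -> : onevec w * onevec w = S.
  rewrite /onevec mulr_suml; apply: eq_bigr => j _; rewrite mulr_sumr.
  by apply: eq_bigr => l _; rewrite -scalerAl -scalerAr scalerA.
rewrite mulr2n {2}/S exchange_big -big_split enorm_sq -sumrN scaler_suml -sumrMnl.
apply: eq_bigr => j _ /=; rewrite -big_split (bigD1 j) //= big1 ?addr0; last first.
  move=> l lj; rewrite [w ord0 l * _]mulrC -scalerDr cl_gen_anticomm eq_sym (negbTE lj).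
  by rewrite mul0rn oppr0 scaler0.
rewrite -scalerDr cl_gen_anticomm eqxx -expr2 scalerN scaleNr mulNrn.
by rewrite -scalerMnr.
Qed.

Lemma onevec_unit w : enorm w = 1 -> onevec w * onevec w = - 1.
Proof. by move=> w1; rewrite onevec_sq w1 expr1n scaleN1r. Qed.

Lemma sc_mk u w : sc (mkpoint u w) = u.
Proof. by rewrite /sc mxE unlift_none. Qed.

Lemma vc_mk u w : vc (mkpoint u w) = w.
Proof. by apply/rowP => j; rewrite !mxE liftK. Qed.

Lemma mk_scvc x : mkpoint (sc x) (vc x) = x.
Proof. by apply/rowP => i; rewrite mxE; case: unliftP => [j ->|->]; rewrite ?mxE. Qed.

Lemma unit_vector : (0 < m)%N -> exists w, enorm w = 1.
Proof.
move=> m0; exists (delta_mx ord0 (Ordinal m0)); apply/eqP.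
rewrite -sqrtr1 /enorm; apply/eqP; congr Num.sqrt.
rewrite (bigD1 (Ordinal m0)) //= big1 ?addr0 ?mxE ?eqxx ?expr1n // => j /negbTE j0.
by rewrite mxE j0 andbF expr0n.
Qed.

Definition zof x : C := sc x +i* enorm (vc x).

Lemma zof_mk u v w : enorm w = 1 -> zof (mkpoint u (v *: w)) = u +i* `|v|.
Proof. by move=> w1; rewrite /zof sc_mk vc_mk enormZ w1 mulr1. Qed.

Lemma polar x : (0 < m)%N -> exists2 w, enorm w = 1 & x = mkpoint (sc x) (enorm (vc x) *: w).
Proof.
move=> m0; have [v0|v0] := eqVneq (vc x) 0.
  have [w w1] := unit_vector m0; exists w => //.
  by rewrite v0 (eqP (_ : enorm 0 == 0)) ?enorm_eq0 // scale0r -v0 mk_scvc.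
have r0 : enorm (vc x) != 0 by rewrite enorm_eq0.
exists ((enorm (vc x))^-1 *: vc x).
  by rewrite enormZ ger0_norm ?invr_ge0 ?enorm_ge0 // mulVf.
by rewrite scalerA mulfV // scale1r mk_scvc.
Qed.

Definition csym (Om : set R[i]^o) := forall z, Om z -> Om (conjc z).

(** In [slice_domain] the number [v] may have either sign. Symmetry allows it to be replaced by its
    absolute value, so membership is tested at the single point [zof x]. *)
Lemma slice_domainP Om x : (0 < m)%N -> csym Om -> slice_domain m Om x <-> Om (zof x).
Proof.
move=> m0 sOm; split.
  move=> [u [v [w [Ouv w1 ->]]]]; rewrite zof_mk //.
  have [v0|v0] := leP 0 v; first by rewrite ger0_norm.
  by rewrite ltr0_norm //; exact: (sOm _ Ouv).
have [w w1 xE] := polar x m0; move=> Oz.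
by exists (sc x), (enorm (vc x)), w.
Qed.

Lemma ana_sc x : ana (fun y : point => sc y) x.
Proof. exact: ana_coord. Qed.

Lemma ana_vc j x : ana (fun y : point => vc y ord0 j) x.
Proof. by apply: eq1_ana (ana_coord (lift ord0 j) x) => y; rewrite mxE. Qed.

Lemma ana_enorm_sq x : ana (fun y : point => \sum_j vc y ord0 j ^+ 2) x.
Proof. by apply: ana_sum => j _; apply: anaM; exact: ana_vc. Qed.

Lemma cana_onevec x : cana (fun y : point => onevec (vc y)) x.
Proof.
by apply: cana_sum => j _; apply: canaZ; [exact: ana_vc|exact: cana_cst].
Qed.

Lemma enorm_cont : continuous (fun y : point => enorm (vc y)).
Proof.
move=> x; apply: (continuous_comp (f := fun y : point => \sum_j vc y ord0 j ^+ 2)).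
  exact: differentiable_continuous (ana_differentiable (ana_enorm_sq x)).
exact: sqrt_continuous.
Qed.

Lemma near_enorm x : vc x != 0 -> \forall y \near x, vc y != 0.
Proof.
rewrite -enorm_gt0 => x0; have := @enorm_cont x; move=> /cvgr_gt => /(_ _ x0).
by apply: filterS => y; rewrite enorm_gt0.
Qed.

Lemma ana_enorm x : vc x != 0 -> ana (fun y : point => enorm (vc y)) x.
Proof.
move=> x0; apply: ana_sqrt; first exact: ana_enorm_sq.
by rewrite -enorm_sq exprn_gt0 // enorm_gt0.
Qed.

Lemma zof_near x (d : R) : 0 < d -> \forall y \near x, cabs (zof y - zof x) < d.
Proof.
move=> d0; have d2 : 0 < d / 2 by rewrite divr_gt0.
have c1 : {for x, continuous (fun y : point => sc y)}.
  exact: differentiable_continuous (ana_differentiable (ana_sc x)).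
move/cvgrPdist_lt : c1 => /(_ _ d2) H1.
have /cvgrPdist_lt/(_ _ d2) H2 := @enorm_cont x.
apply: filterS2 H1 H2 => y; rewrite distrC [X in _ -> X < _ -> _]distrC => h1 h2.
apply: le_lt_trans (cabs_le _) _; rewrite cReD cImD cReN cImN /=.
by rewrite (splitr d); exact: ltrD.
Qed.

Lemma near_slice Om x : (0 < m)%N -> csym Om -> copen Om -> slice_domain m Om x ->
  \forall y \near x, slice_domain m Om y.
Proof.
move=> m0 sOm oOm /slice_domainP => /(_ m0 sOm) /oOm[r r0 Hr].
by apply: filterS (zof_near x r0) => y /Hr Oy; apply/slice_domainP.
Qed.

(** The axis has no interior: a small step [d *: w] leaves it. A nonzero difference on the axis
    would persist there, where the functions agree. Identities computed off the axis are extended to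
    it in this way. *)
Lemma cana_dense (F G : point -> Cl) x : (0 < m)%N -> cana F x -> cana G x ->
  (\forall y \near x, vc y != 0 -> F y = G y) -> F x = G x.
Proof.
move=> m0 HF HG H; have [x0|x0] := eqVneq (vc x) 0; last by apply: (nbhs_singleton H).
apply/ffunP => A; apply/eqP; rewrite -subr_eq0; apply/negP => /negP ne.
have c : {for x, continuous (fun y : point => F y A - G y A)}.
  apply: differentiable_continuous; apply: ana_differentiable.
  by apply: anaB; [exact: HF|exact: HG].
have nn : \forall y \near x, F y A - G y A != 0 by move: c => /cvgr_neq0; apply.
have /nbhs_small[d d0 Hd] : \forall y \near x, F y A - G y A != 0 /\
  (vc y != 0 -> F y = G y) by exact: filterI nn H.
have [w w1] := unit_vector m0.
have [|y0 yE] := Hd (mkpoint 0 (d *: w)).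
  move=> i; rewrite mxE; case: unliftP => [j _|_]; last by rewrite normr0 ltW.
  rewrite mxE normrM (gtr0_norm d0) ler_piMr ?(ltW d0) //.
  rewrite -w1 -[`|_|]ger0_norm // -sqrtr_sqr /enorm ler_wsqrtr //.
  rewrite real_normK ?num_real // (bigD1 j) //= lerDl sumr_ge0 // => k _; exact: sqr_ge0.
move: y0; rewrite yE ?subrr ?eqxx //.
have -> : vc (x + mkpoint 0 (d *: w)) = d *: w.
  have -> : vc (x + mkpoint 0 (d *: w)) = vc x + vc (mkpoint 0 (d *: w)).
    by apply/rowP => j; rewrite !mxE.
  by rewrite x0 add0r vc_mk.
by rewrite -enorm_eq0 enormZ w1 mulr1 normr_eq0 gt_eqF.
Qed.

End Geometry.

(** * The set where Taylor discs at real points fit *)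

Section Core.
Variable R : realType.
Local Notation C := R[i].

Lemma taylor_coreP (Om : set R[i]^o) (z : C) : taylor_core Om z <->
  exists2 rho : R, `|complex.Im z| < rho & cball (complex.Re z)%:C rho `<=` Om.
Proof.
have e (w : C) rho : (`|w - (complex.Re z)%:C| < rho%:C) = (cabs (w - (complex.Re z)%:C) < rho).
  by rewrite normcE' ltcR.
split=> [[rho [h1 h2]]|[rho h1 h2]]; exists rho => //.
  by move=> w; rewrite /cball /= => h; apply: h2; rewrite e.
by split=> // w; rewrite e; exact: h2.
Qed.

Lemma conjc_cball u r (w : C) : cabs (w - u%:C) < r -> cabs (conjc w - u%:C) < r.
Proof. by rewrite -cabsJ rmorphB /= oppr0. Qed.

Lemma csym_cball u r : csym (cball (u%:C : C) r).
Proof. by move=> z; exact: conjc_cball. Qed.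

Lemma core_sub (Om : set R[i]^o) : taylor_core Om `<=` Om.
Proof.
move=> z /taylor_coreP[rho h1 h2]; apply: h2; rewrite /cball /=.
apply: le_lt_trans (cabs_le _) _; rewrite cReD cImD cReN cImN /=.
by rewrite subrr normr0 add0r oppr0 addr0.
Qed.

Lemma core_sym (Om : set R[i]^o) : csym (taylor_core Om).
Proof.
by move=> [u v] /taylor_coreP[rho h1 h2]; apply/taylor_coreP; exists rho; rewrite //= normrN.
Qed.

Lemma core_open (Om : set R[i]^o) : copen (taylor_core Om).
Proof.
(* The slack pays for the displacement of the centre, the change of ordinate and the loss of radius,
   each at most [d]. *)
move=> z /taylor_coreP[rho h1 h2]; pose d := (rho - `|complex.Im z|) / 4.
have d0 : 0 < d by rewrite divr_gt0 // subr_gt0.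
exists d => // w wz; apply/taylor_coreP; exists (rho - d).
  have := cabs_Im (w - z); rewrite cImD cImN.
  have := ler_normD (complex.Im z) (complex.Im w - complex.Im z).
  by rewrite addrCA subrr addr0; move: wz; rewrite /d; lra.
move=> y yw; apply: h2; rewrite /cball /=.
have -> : y - (complex.Re z)%:C =
    (y - (complex.Re w)%:C) + (complex.Re w - complex.Re z)%:C.
  by apply: complex_eq; rewrite ?cReD ?cImD ?cReN ?cImN /=; ring.
apply: le_lt_trans (cabsD _ _) _; rewrite cabsr.
have := cabs_Re (w - z); rewrite cReD cReN; move: yw wz; rewrite /cball /=; lra.
Qed.

Lemma core_real (Om : set R[i]^o) (t : R) : copen Om -> Om t%:C -> taylor_core Om t%:C.
Proof.
move=> oOm /oOm[r r0 Hr]; apply/taylor_coreP; exists r; first by rewrite normr0.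
by move=> w; exact: Hr.
Qed.

Lemma core_ball u v (r : R) : `|v| < r -> taylor_core (cball (u%:C : C) r) (u +i* v).
Proof. by move=> vr; apply/taylor_coreP; exists r. Qed.

Lemma core_mono (Om Om' : set R[i]^o) : Om `<=` Om' -> taylor_core Om `<=` taylor_core Om'.
Proof.
move=> H z /taylor_coreP[rho h1 h2]; apply/taylor_coreP; exists rho => //.
exact: subset_trans H.
Qed.

End Core.

(** * Axially symmetric functions *)

Section Gradient.
Variable R : realType.
Local Notation C := R[i].

Lemma chain_complex (V : normedModType R) (x e : V) (g1 g2 : V -> R) (d1 d2 : R)
    (F : C -> C) (l : C) :
  is_derive x e g1 d1 -> is_derive x e g2 d2 -> cderiv F (g1 x +i* g2 x) l ->
  is_derive x e (fun y => complex.Re (F (g1 y +i* g2 y))) (complex.Re (l * (d1 +i* d2))) /\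
  is_derive x e (fun y => complex.Im (F (g1 y +i* g2 y))) (complex.Im (l * (d1 +i* d2))).
Proof.
move=> H1 H2 HF; set D := d1 +i* d2; set p := g1 x +i* g2 x in HF.
have : forall eps : R, 0 < eps -> exists2 d : R, 0 < d & forall t : R, `|t| < d ->
    cabs (F (g1 (t *: e + x) +i* g2 (t *: e + x)) - F p - t%:C * (l * D)) <= eps * `|t|.
  move=> e0 e00.
  have l0 : 0 < cabs l + 1 by rewrite ltr_wpDl ?cabs_ge0.
  have D0 : 0 < cabs D + 1 by rewrite ltr_wpDl ?cabs_ge0.
  pose e1 := e0 / (2 * (cabs D + 1)); have e10 : 0 < e1 by rewrite divr_gt0 // mulr_gt0.
  have [d d0 Hd] := HF _ e10.
  pose e2 := Num.min 1 (e0 / (2 * (cabs l + 1))) / 2.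
  have e20 : 0 < e2 by rewrite divr_gt0 // lt_min ltr01 divr_gt0 // mulr_gt0.
  have [d3 d30 K1] := (is_deriveP _ _ _ _).1 H1 _ e20.
  have [d4 d40 K2] := (is_deriveP _ _ _ _).1 H2 _ e20.
  pose d5 := d / (cabs D + 1); have d50 : 0 < d5 by rewrite divr_gt0.
  exists (Num.min d5 (Num.min d3 d4)); first by rewrite !lt_min d30 d40 d50.
  move=> t; rewrite !lt_min => /andP[t5 /andP[/K1 {}K1 /K2 {}K2]].
  set s := (g1 (t *: e + x) +i* g2 (t *: e + x)) - p.
  have -> : g1 (t *: e + x) +i* g2 (t *: e + x) = p + s by rewrite /s [p + _]addrC subrK.
  have Ks : cabs (s - t%:C * D) <= 2 * e2 * `|t|.
    apply: le_trans (cabs_le _) _; rewrite -mulrA mulr_natl mulr2n.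
    have -> : s - t%:C * D = (g1 (t *: e + x) - g1 x - t *: d1) +i*
        (g2 (t *: e + x) - g2 x - t *: d2).
      apply: complex_eq; rewrite /s /p /D !(cReD, cImD, cReN, cImN, cReM, cImM) /=;
      rewrite /GRing.scale /=; ring.
    exact: lerD.
  have [h1 h2] : 2 * e2 <= 1 /\ 2 * e2 <= e0 / (2 * (cabs l + 1)).
    rewrite /e2 mulrC divfK ?pnatr_eq0 //; split; by rewrite ge_min lexx ?orbT.
  have ts : cabs s <= (cabs D + 1) * `|t|.
    rewrite -(subrK (t%:C * D) s); apply: le_trans (cabsD _ _) _.
    rewrite mulrDl mul1r addrC cabsM cabsr [`|t| * _]mulrC lerD2l; apply: le_trans Ks _.
    by rewrite ler_piMl.
  have sd : cabs s < d.
    by apply: le_lt_trans ts _; rewrite mulrC -ltr_pdivlMr.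
  have -> : F (p + s) - F p - t%:C * (l * D) =
    (F (p + s) - F p - s * l) + (s - t%:C * D) * l by ring.
  apply: le_trans (cabsD _ _) _.
  have L1 : cabs (F (p + s) - F p - s * l) <= e0 / 2 * `|t|.
    apply: le_trans (Hd s sd) _; apply: le_trans (ler_wpM2l (ltW e10) ts) _.
    by rewrite mulrA /e1 (_ : e0 / (2 * (cabs D + 1)) * (cabs D + 1) = e0 / 2) //;
      field; rewrite gt_eqF.
  have L2 : cabs ((s - t%:C * D) * l) <= e0 / 2 * `|t|.
    rewrite cabsM; apply: (@le_trans _ _ (e0 / (2 * (cabs l + 1)) * `|t| * (cabs l + 1))).
      apply: ler_pM; rewrite ?cabs_ge0 ?lerDl //; apply: le_trans Ks _.
      by rewrite ler_wpM2r.
    rewrite mulrAC (_ : e0 / (2 * (cabs l + 1)) * (cabs l + 1) = e0 / 2) //.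
    by field; rewrite gt_eqF.
  have -> : e0 * `|t| = e0 / 2 * `|t| + e0 / 2 * `|t| by field.
  exact: lerD.
move=> H; split; apply/is_deriveP => eps /H[d d0 Hd]; exists d => // t /Hd;
  apply: le_trans.
  have -> : t *: complex.Re (l * D) = complex.Re (t%:C * (l * D)).
    by rewrite [RHS]cReM /= mul0r subr0.
  by rewrite -!cReN -!cReD; exact: cabs_Re.
have -> : t *: complex.Im (l * D) = complex.Im (t%:C * (l * D)).
  by rewrite [RHS]cImM /= mul0r addr0.
by rewrite -!cImN -!cImD; exact: cabs_Im.
Qed.

(* The gradient of phi at (u, v) is (a, b), expressed by the chain rule. *)
Definition grad (phi : R -> R -> R) (u v a b : R) :=
  forall (V : normedModType R) (x e : V) (g1 g2 : V -> R) (d1 d2 : R),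
    is_derive x e g1 d1 -> is_derive x e g2 d2 -> g1 x = u -> g2 x = v ->
    is_derive x e (fun y => phi (g1 y) (g2 y)) (a * d1 + b * d2).

Lemma gradD phi psi u v a b c d : grad phi u v a b -> grad psi u v c d ->
  grad (fun u v => phi u v + psi u v) u v (a + c) (b + d).
Proof.
move=> H K V x e g1 g2 d1 d2 h1 h2 e1 e2.
have := is_deriveD (H V x e g1 g2 d1 d2 h1 h2 e1 e2) (K V x e g1 g2 d1 d2 h1 h2 e1 e2).
by rewrite addrACA -!mulrDl.
Qed.

Lemma gradM phi psi u v a b c d : grad phi u v a b -> grad psi u v c d ->
  grad (fun u v => phi u v * psi u v) u v (a * psi u v + phi u v * c) (b * psi u v + phi u v * d).
Proof.
move=> H K V x e g1 g2 d1 d2 h1 h2 e1 e2.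
have := is_deriveM (H V x e g1 g2 d1 d2 h1 h2 e1 e2) (K V x e g1 g2 d1 d2 h1 h2 e1 e2).
rewrite /GRing.scale /= e1 e2.
set X := (X in is_derive _ _ _ X -> _); set Y := (Y in _ -> is_derive _ _ _ Y).
by have -> : X = Y by rewrite /X /Y; ring.
Qed.

Lemma grad_cst k u v : grad (fun _ _ => k) u v 0 0.
Proof. by move=> V x e g1 g2 d1 d2 _ _ _ _; rewrite !mul0r addr0; exact: is_derive_cst. Qed.

Lemma gradZ k phi u v a b : grad phi u v a b -> grad (fun u v => k * phi u v) u v (k * a) (k * b).
Proof. by move=> H; have := gradM (@grad_cst k u v) H; rewrite !mul0r !add0r. Qed.

Lemma grad_sum (I : Type) (s : seq I) (phi : I -> R -> R -> R) u v a b :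
  (forall i, grad (phi i) u v (a i) (b i)) ->
  grad (fun u v => \sum_(i <- s) phi i u v) u v (\sum_(i <- s) a i) (\sum_(i <- s) b i).
Proof.
move=> H; elim: s => [|i s IH].
  rewrite !big_nil (_ : (fun _ _ => _) = fun _ _ => 0); first exact: grad_cst.
  by apply/funext => x; apply/funext => y; rewrite big_nil.
rewrite !big_cons (_ : (fun _ _ => _) =
    fun u v => phi i u v + \sum_(j <- s) phi j u v); first exact: gradD.
by apply/funext => x; apply/funext => y; rewrite big_cons.
Qed.

Lemma grad_Vpow p u v : v != 0 -> grad (fun _ v => v^-1 ^+ p) u v 0 (- p%:R * v^-1 ^+ p.+1).
Proof.
move=> v0; have H : grad (fun _ v => v^-1) u v 0 (- v^-1 ^+ 2).
  move=> V x e g1 g2 d1 d2 h1 h2 e1 e2.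
  have vC : v%:C != 0 by rewrite -(rmorph0 (real_complex R)) (inj_eq (@complexI R)).
  have Hl : cderiv (fun z : C => z^-1) (g2 x +i* (0 : R)) ((- v^-1 ^+ 2)%:C).
    have := cderivV (f := id) vC (cderiv_id _).
    by rewrite e2 mulN1r rmorphN rmorphXn /= fmorphV exprVn.
  have [] := chain_complex h2 (is_derive_cst (0 : R) x e) Hl.
  have -> : complex.Re ((- v^-1 ^+ 2)%:C * (d2 +i* 0)) = 0 * d1 + - v^-1 ^+ 2 * d2.
    by rewrite cReM /= mul0r subr0 mul0r add0r.
  move=> K _; move: K.
  by congr is_derive; apply/funext => y; rewrite -[g2 y +i* 0]/((g2 y)%:C) -fmorphV.
elim: p => [|p IH].
  rewrite mulNr mul0r oppr0 (_ : (fun _ _ => _) = fun _ _ => 1); first exact: grad_cst.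
  by apply/funext => x; apply/funext => y; rewrite expr0.
have := gradM H IH; rewrite mul0r mulr0 addr0.
rewrite (_ : _ + _ * _ = - p.+1%:R * v^-1 ^+ p.+2); last by rewrite -natr1 !exprS; ring.
by congr grad; apply/funext => x; apply/funext => y; rewrite exprS.
Qed.

Lemma grad_Im (F : C -> C) u v l : cderiv F (u +i* v) l ->
  grad (fun u v => complex.Im (F (u +i* v))) u v (complex.Im l) (complex.Re l).
Proof.
move=> HF V x e g1 g2 d1 d2 h1 h2 e1 e2; rewrite -e1 -e2 in HF.
have [_] := chain_complex h1 h2 HF; rewrite cImM /=.
by rewrite addrC [complex.Im l * _]mulrC [d1 * _]mulrC.
Qed.

Lemma grad_Re (F : C -> C) u v l : cderiv F (u +i* v) l ->
  grad (fun u v => complex.Re (F (u +i* v))) u v (complex.Re l) (- complex.Im l).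
Proof.
move=> HF V x e g1 g2 d1 d2 h1 h2 e1 e2; rewrite -e1 -e2 in HF.
have [+ _] := chain_complex h1 h2 HF; by rewrite cReM /= mulNr.
Qed.

(** This allows an identity that holds near [v] to be differentiated in its second variable. *)
Lemma grad_near0 phi u v a b : grad phi u v a b -> v != 0 ->
  (\forall y \near v, phi u y = 0) -> b = 0.
Proof.
move=> H v0 Hn; have h1 : is_derive v 1 (fun _ : R => u) 0 by exact: is_derive_cst.
have h2 : is_derive v 1 (fun y : R => y) 1 by exact: is_derive_id.
have := H _ v 1 (fun _ => u) (fun y => y) 0 1 h1 h2 erefl erefl.
rewrite mulr0 mulr1 add0r => K; rewrite -(@derive_val _ _ _ _ _ _ _ K).
rewrite (near_eq_derive _ Hn); exact: derive_cst.
Qed.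

End Gradient.

(** * The iterates of $v^{-1}\partial_v$ *)

Section AxialPowers.
Variable R : realType.
Local Notation C := R[i].

(** Coefficients in $(v^{-1}\partial_v)^k(v^{-1}g)=\sum_l q_{k,l}\,v^{-(2k+1-l)}g^{(l)}$. In the
    recursion the first term differentiates the power of $v$ and the second differentiates $g$. For
    $g(v)=\mathrm{Im}F(u+iv)$ each derivative of $g$ brings a factor ['i] before [F]. *)
Fixpoint qc (k l : nat) : R :=
  if k is k'.+1 then - (2 * k' + 1 - l)%N%:R * qc k' l +
    (if l is l'.+1 then qc k' l' else 0)
  else (l == 0)%:R.

Lemma qc_gt k l : (k < l)%N -> qc k l = 0.
Proof.
elim: k l => [|k IH] [|l] //= kl; rewrite !IH ?mulr0 ?addr0 //.
exact: ltnW.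
Qed.

(* [axp k F] is [(v^-1 d/dv)^k (v^-1 Im F(u + iv))]. *)
Definition axp k (F : R[i]^o -> R[i]^o) (u v : R) : R :=
  \sum_(l < k.+1) qc k l * (v^-1 ^+ (2 * k + 1 - l) *
    complex.Im ('i ^+ l * derive1n l F (u +i* v))).

Lemma axp0 F u v : axp 0 F u v = v^-1 * complex.Im (F (u +i* v)).
Proof. by rewrite /axp big_ord_recl big_ord0 addr0 /= !mul1r. Qed.

Lemma derive1nSr l (F : R[i]^o -> R[i]^o) : derive1n l (derive1 F) = derive1n l.+1 F.
Proof. by rewrite /derive1n -iterSr. Qed.

Lemma axp_sum1 (I : nat -> R) (w : R) :
  \sum_(l < 2) qc 1 l * (w ^+ (2 * 1 + 1 - l) * I l) = - w ^+ 3 * I 0%N + w ^+ 2 * I 1%N.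
Proof.
pose f l := qc 1 l * (w ^+ (2 * 1 + 1 - l) * I l).
have -> : \sum_(l < 2) qc 1 l * (w ^+ (2 * 1 + 1 - l) * I l) = f 0%N + f 1%N.
  by rewrite !big_ord_recl big_ord0 addr0.
rewrite /f; have -> : (2 * 1 + 1 - 0 = 3)%N by []; have -> : (2 * 1 + 1 - 1 = 2)%N by [].
have -> : qc 1 0 = -1 by rewrite /=; have -> : (2 * 0 + 1 - 0 = 1)%N by []; ring.
have -> : qc 1 1 = 1 by rewrite /=; ring.
ring.
Qed.

Lemma axp_sum2 (I : nat -> R) (w : R) :
  \sum_(l < 3) qc 2 l * (w ^+ (2 * 2 + 1 - l) * I l) =
  3 * w ^+ 5 * I 0%N - 3 * w ^+ 4 * I 1%N + w ^+ 3 * I 2.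
Proof.
pose f l := qc 2 l * (w ^+ (2 * 2 + 1 - l) * I l).
have -> : \sum_(l < 3) qc 2 l * (w ^+ (2 * 2 + 1 - l) * I l) = f 0%N + f 1%N + f 2%N.
  by rewrite !big_ord_recl big_ord0 addr0 addrA.
rewrite /f; have -> : (2 * 2 + 1 - 0 = 5)%N by []; have -> : (2 * 2 + 1 - 1 = 4)%N by [].
have -> : (2 * 2 + 1 - 2 = 3)%N by [].
have e1 : (2 * 0 + 1 - 0 = 1)%N by [].
have -> : qc 2 0 = 3.
  by rewrite /= e1; have -> : (2 * 1 + 1 - 0 = 3)%N by []; ring.
have -> : qc 2 1 = -3.
  by rewrite /= e1; have -> : (2 * 1 + 1 - 1 = 2)%N by []; ring.
have -> : qc 2 2 = 1 by rewrite /=; ring.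
ring.
Qed.

Variables (Om : set R[i]^o) (F : R[i]^o -> R[i]^o).
Hypotheses (oOm : copen Om) (HF : holomorphic_on Om F).

Lemma cderiv_derive1n l z : Om z -> cderiv (derive1n l F) z (derive1n l.+1 F z).
Proof.
move=> Oz; have /holomorphicP : holomorphic_on Om (derive1n l F) by exact: holo_derive1n.
by move=> /(_ z Oz); rewrite derive1nS.
Qed.

(** The recursion of [qc] is Leibniz's rule for the derivative in [v]; the derivative in [u] falls
    on [F] alone. *)
Lemma grad_axp k u v : Om (u +i* v) -> v != 0 ->
  grad (axp k F) u v (axp k (derive1 F) u v) (v * axp k.+1 F u v).
Proof.
move=> Oz v0; pose I l := complex.Im ('i ^+ l * derive1n l F (u +i* v)).
have gI l : grad (fun u v => complex.Im ('i ^+ l * derive1n l F (u +i* v))) u v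
    (complex.Im ('i ^+ l * derive1n l (derive1 F) (u +i* v))) (I l.+1).
  have := grad_Im (cderivZ ('i ^+ l) (cderiv_derive1n l Oz)).
  have -> : complex.Re ('i ^+ l * derive1n l.+1 F (u +i* v)) = I l.+1.
    rewrite /I exprS -mulrA [in RHS]cImM /=; ring.
  by rewrite derive1nSr.
have := grad_sum (index_enum 'I_k.+1) (fun l : 'I_k.+1 =>
   gradZ (qc k l) (gradM (@grad_Vpow R (2 * k + 1 - l) u v v0) (gI l))).
rewrite -/(axp k F); set a := \sum_(i <- _) _; set b := \sum_(i <- _) _.
have -> : a = axp k (derive1 F) u v.
  by apply: eq_bigr => l _; rewrite mul0r add0r.
suff -> : b = v * axp k.+1 F u v by [].
have -> : v * axp k.+1 F u v = \sum_(l < k.+2) qc k.+1 l * (v^-1 ^+ (2 * k + 2 - l) * I l).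
  rewrite /axp mulr_sumr; apply: eq_bigr => l _.
  have -> : (2 * k.+1 + 1 - l = (2 * k + 2 - l).+1)%N by have := ltn_ord l; lia.
  by rewrite exprS /I; field.
have -> : b = \sum_(l < k.+1) (- (2 * k + 1 - l)%N%:R * qc k l * (v^-1 ^+ (2 * k + 2 - l) * I l))
   + \sum_(l < k.+1) qc k l * (v^-1 ^+ (2 * k + 1 - l) * I l.+1).
  rewrite -big_split; apply: eq_bigr => l _ /=.
  have -> : (2 * k + 2 - l = (2 * k + 1 - l).+1)%N by have := ltn_ord l; lia.
  rewrite -/(I l); ring.
have -> : \sum_(l < k.+2) qc k.+1 l * (v^-1 ^+ (2 * k + 2 - l) * I l) =
  \sum_(l < k.+2) - (2 * k + 1 - l)%N%:R * qc k l * (v^-1 ^+ (2 * k + 2 - l) * I l) +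
  \sum_(l < k.+2) (if l : nat is l'.+1 then qc k l' else 0) * (v^-1 ^+ (2 * k + 2 - l) * I l).
  by rewrite -big_split; apply: eq_bigr => l _ /=; rewrite mulrDl.
congr (_ + _).
  by rewrite [in RHS]big_ord_recr /= qc_gt // mulr0 mul0r addr0.
rewrite [in RHS]big_ord_recl /= mul0r add0r; apply: eq_bigr => l _.
by have -> : (2 * k + 2 - bump 0 l = 2 * k + 1 - l)%N by rewrite /bump /=; lia.
Qed.

End AxialPowers.

(** This is the harmonicity of $\mathrm{Im}F$ rewritten for $T_k$. Applying $v^{-1}\partial_v$ to
    the identity for [k] gives the one for [k.+1], the factor [v ^+ 2] contributing the additional 2
    to the constant. *)
Lemma axp_ode (R : realType) (Om : set R[i]^o) (F : R[i]^o -> R[i]^o) k u v :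
  copen Om -> holomorphic_on Om F -> Om (u +i* v) -> v != 0 ->
  axp k (derive1 (derive1 F)) u v + v ^+ 2 * axp k.+2 F u v +
    (2 * k + 3)%:R * axp k.+1 F u v = 0.
Proof.
move=> oOm HF; elim: k u v => [|k IH] u v Oz v0.
  pose I l := complex.Im ('i ^+ l * derive1n l F (u +i* v)).
  have -> : axp 2 F u v = _ := axp_sum2 I v^-1.
  have -> : axp 1 F u v = _ := axp_sum1 I v^-1.
  have -> : axp 0 (derive1 (derive1 F)) u v = - v^-1 * I 2.
    have i2 : 'i ^+ 2 = -1 :> R[i] by apply: complex_eq; rewrite expr2 ?cReM ?cImM /=; ring.
    by rewrite axp0 /I i2 mulN1r cImN mulrNN.
  have -> : (2 * 0 + 3 = 3)%N by [].
  by move: (I 0%N) (I 1%N) (I 2) => a b c; clear -v0; field.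
have HF1 := holo_derive1 oOm HF; have HF2 := holo_derive1 oOm HF1.
have gv2 : grad (fun _ v => v ^+ 2 : R) u v 0 (2 * v).
  move=> V x e g1 g2 d1 d2 h1 h2 e1 e2; have := is_deriveX 2 h2.
  rewrite e2 mul0r add0r /GRing.scale /= expr1 mulr_natl; exact.
have G := gradD (gradD (grad_axp oOm HF2 k Oz v0)
  (gradM gv2 (grad_axp oOm HF k.+2 Oz v0))) (gradZ (2 * k + 3)%:R (grad_axp oOm HF k.+1 Oz v0)).
have : forall y : R, Om (u +i* y) -> y != 0 -> axp k (derive1 (derive1 F)) u y +
   y ^+ 2 * axp k.+2 F u y + (2 * k + 3)%:R * axp k.+1 F u y = 0 by move=> y; exact: IH.
move=> Hy; have [r r0 Hr] := oOm _ Oz.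
have := grad_near0 G v0 _.
have Hn : \forall y \near v, axp k (derive1 (derive1 F)) u y +
   y ^+ 2 * axp k.+2 F u y + (2 * k + 3)%:R * axp k.+1 F u y = 0.
  have n1 : \forall y \near v, y != 0 by apply: open_nbhs_nbhs; split; [exact: open_neq|].
  have n2 : \forall y \near v, `|v - y| < r by apply/nbhs_ballP; exists r.
  apply: filterS2 n1 n2 => y y0 yr; apply: Hy => //; apply: Hr.
  by apply: le_lt_trans (cabs_le _) _; rewrite cReD cImD cReN cImN /= subrr normr0 add0r distrC.
move=> /(_ Hn); move/(congr1 (fun x => v^-1 * x)); rewrite mulr0 => <-.
have -> : (2 * k.+1 + 3 = 2 + (2 * k + 3))%N by lia.
by rewrite natrD; field.
Qed.

(** * The operators on axial functions off the real axis *)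

Section SliceOperators.
Variables (R : realType) (m : nat).
Local Notation C := R[i].
Local Notation Cl := (clifford R m).
Local Notation point := 'rV[R]_m.+1.
Local Notation E i := (delta_mx ord0 i : point).
Implicit Types (x y : point) (phi psi : R -> R -> Cl).

Lemma is_derive_coord (i j : 'I_m.+1) x :
  is_derive x (E j) (fun y : point => y ord0 i) (i == j)%:R.
Proof.
apply/is_deriveP => e e0; exists 1 => // t _.
rewrite !mxE eqxx /GRing.scale /= (_ : _ + _ - _ - _ = 0); last by ring.
by rewrite normr0 mulr_ge0 // ltW.
Qed.

Lemma is_derive_enorm0 x : vc x != 0 ->
  is_derive x (E ord0) (fun y : point => enorm (vc y)) 0.
Proof.
move=> x0; have [H _] := ana_deriv ord0 (ana_enorm x0).
suff -> : 0 = 'D_(E ord0) (fun y : point => enorm (vc y)) x by exact: derivableP.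
symmetry; have : is_derive x (E ord0) (fun y : point => enorm (vc y)) 0.
  apply/is_deriveP => e e0; exists 1 => // t _.
  have -> : vc (t *: E ord0 + x) = vc x.
    by apply/rowP => j; rewrite !mxE eqxx /= mulr0 add0r.
  by rewrite subrr sub0r scaler0 normrN normr0 mulr_ge0 // ltW.
by move=> K; exact: derive_val.
Qed.

(** Analyticity off the axis gives existence of the derivative; its value then follows by
    differentiating the square of the norm, which is a polynomial. *)
Lemma is_derive_enorm j x : vc x != 0 ->
  is_derive x (E (lift ord0 j)) (fun y : point => enorm (vc y))
    (vc x ord0 j / enorm (vc x)).
Proof.
move=> x0; have r0 : enorm (vc x) != 0 by rewrite enorm_eq0.
have [H _] := ana_deriv (lift ord0 j) (ana_enorm x0); have {}H := derivableP H.
set d := 'D__ _ _ in H.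
suff -> : vc x ord0 j / enorm (vc x) = d by [].
have H2 := is_deriveM H H.
have K : is_derive x (E (lift ord0 j)) (fun y : point => \sum_k vc y ord0 k ^+ 2)
    (2 * vc x ord0 j).
  have : is_derive x (E (lift ord0 j)) (fun y : point => \sum_k vc y ord0 k ^+ 2)
    (\sum_k ((lift ord0 k == lift ord0 j)%:R * vc x ord0 k *+ 2)).
    elim: (index_enum _) => [|k s IH].
      rewrite big_nil (_ : (fun _ => _) = fun=> 0); first exact: is_derive_cst.
      by apply/funext => y; rewrite big_nil.
    rewrite big_cons (_ : (fun _ => _) = fun y : point => vc y ord0 k ^+ 2 +
       \sum_(l <- s) vc y ord0 l ^+ 2).
      apply: is_deriveD => //.
      have := is_deriveX 2 (is_derive_coord (lift ord0 k) (lift ord0 j) x).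
      rewrite /GRing.scale /= expr1 /vc mxE.
      set X := (X in is_derive _ _ _ X -> _); set Y := (Y in _ -> is_derive _ _ _ Y).
      have -> : X = Y by rewrite /X /Y; ring.
      by congr is_derive; apply/funext => y; rewrite mxE.
    by apply/funext => y; rewrite big_cons.
  congr is_derive; rewrite (bigD1 j) //= big1 ?addr0; first by rewrite eqxx mul1r mulr_natl.
  by move=> k /negbTE kj; rewrite (inj_eq lift_inj) kj mul0r mul0rn.
have e : (fun y : point => enorm (vc y) * enorm (vc y)) =
    (fun y : point => \sum_k vc y ord0 k ^+ 2).
  by apply/funext => y; rewrite -enorm_sq expr2.
rewrite -[X in is_derive _ _ X]/(fun y : point => enorm (vc y) * enorm (vc y)) e in H2.
have : 2 * vc x ord0 j = 2 * (enorm (vc x) * d).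
  rewrite -(@derive_val _ _ _ _ _ _ _ K) (@derive_val _ _ _ _ _ _ _ H2).
  by rewrite /GRing.scale /=; ring.
have two : (2 : R) != 0 by rewrite pnatr_eq0.
by move=> /(mulfI two) ->; rewrite mulrC mulKf.
Qed.

Definition radial phi x : Cl := phi (sc x) (enorm (vc x)).

Definition cgrad phi u v (a b : Cl) :=
  forall A, grad (fun u v => phi u v A) u v (a A) (b A).

Lemma pder_rad0 phi x a b : vc x != 0 -> cgrad phi (sc x) (enorm (vc x)) a b ->
  pder (E ord0) (radial phi) x a.
Proof.
move=> x0 H A; have := H A _ x (E ord0) _ _ _ _ (is_derive_coord ord0 ord0 x)
  (is_derive_enorm0 x0) erefl erefl.
by rewrite eqxx mulr1 mulr0 addr0.
Qed.

Lemma pder_rad phi x a b j : vc x != 0 -> cgrad phi (sc x) (enorm (vc x)) a b ->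
  pder (E (lift ord0 j)) (radial phi) x ((vc x ord0 j / enorm (vc x)) *: b).
Proof.
move=> x0 H A; have := H A _ x (E (lift ord0 j)) _ _ _ _
  (is_derive_coord ord0 (lift ord0 j) x) (is_derive_enorm j x0) erefl erefl.
by rewrite (negbTE (neq_lift ord0 j)) mulr0 add0r ffunE mulrC.
Qed.

Lemma pder_vc k j x : is_derive x (E (lift ord0 j)) (fun y : point => vc y ord0 k) (k == j)%:R.
Proof.
have := is_derive_coord (lift ord0 k) (lift ord0 j) x; rewrite (inj_eq lift_inj).
by congr is_derive; apply/funext => y; rewrite mxE.
Qed.

Lemma pder_onevec0 x : pder (E ord0) (fun y : point => onevec (vc y)) x 0.
Proof.
have := @pder_sum R m _ (E ord0) _ (index_enum 'I_m) (fun k (y : point) => vc y ord0 k *: cl_gen R k) x (fun=> 0).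
rewrite big1 //; apply => k.
have H : is_derive x (E ord0) (fun y : point => vc y ord0 k) 0.
  have := is_derive_coord (lift ord0 k) ord0 x; rewrite eq_sym (negbTE (neq_lift _ _)).
  by congr is_derive; apply/funext => y; rewrite mxE.
have := pderZ H (pder_cst (E ord0) (cl_gen R k) x).
by rewrite scale0r scaler0 addr0.
Qed.

Lemma pder_onevec j x : pder (E (lift ord0 j)) (fun y : point => onevec (vc y)) x (cl_gen R j).
Proof.
have := @pder_sum R m _ (E (lift ord0 j)) _ (index_enum 'I_m)
  (fun k (y : point) => vc y ord0 k *: cl_gen R k) x (fun k => (k == j)%:R *: cl_gen R k).
rewrite (bigD1 j) //= big1 ?addr0; last by move=> k /negbTE ->; rewrite scale0r.
rewrite eqxx scale1r; apply => k.
have := pderZ (pder_vc k j x) (pder_cst (E (lift ord0 j)) (cl_gen R k) x).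
by rewrite scaler0 addr0.
Qed.

Lemma gen_sq j : cl_gen R j * cl_gen R j = -1 :> Cl.
Proof.
have two : (2 : R) != 0 by rewrite pnatr_eq0.
apply: (scalerI two); rewrite !scaler_nat mulr2n cl_gen_anticomm eqxx mulNrn //.
Qed.

Lemma scalerA_div (a r : R) (T : Cl) : r != 0 -> (a / r) *: (r *: T) = a *: T.
Proof. by move=> r0; rewrite scalerA divfK. Qed.

Section AxialForm.
Variables (phi psi : R -> R -> Cl) (G : point -> Cl) (x : point) (phu phv psu psv : Cl).
Hypotheses (x0 : vc x != 0)
  (Hphi : cgrad phi (sc x) (enorm (vc x)) phu phv)
  (Hpsi : cgrad psi (sc x) (enorm (vc x)) psu psv)
  (HG : \forall y \near x, radial phi y + onevec (vc y) * radial psi y = G y).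

Lemma axial_partial0 : partial ord0 G x = phu + onevec (vc x) * psu.
Proof.
apply: pder_partial; apply: pder_near HG _.
have := pderD (pder_rad0 x0 Hphi) (pderM (pder_onevec0 x) (pder_rad0 x0 Hpsi)).
by rewrite mul0r add0r.
Qed.

(** The squares of the [m] generators produce [- m%:R], and the square of [onevec (vc x)] turns the
    radial derivative of [psi] into a multiple of the real number [enorm (vc x)]. *)
Lemma axial_Dvec : Dvec G x = (enorm (vc x))^-1 *: (onevec (vc x) * phv) -
  m%:R *: radial psi x - enorm (vc x) *: psv.
Proof.
set r := enorm (vc x); have r0 : r != 0 by rewrite enorm_eq0.
have -> : Dvec G x = \sum_(j < m) (r^-1 *: (vc x ord0 j *: cl_gen R j * phv) -
    radial psi x + r^-1 *: (vc x ord0 j *: cl_gen R j * (onevec (vc x) * psv))).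
  apply: eq_bigr => j _; rewrite (@pder_partial _ _ _ _ _ ((vc x ord0 j / r) *: phv +
    (cl_gen R j * radial psi x + onevec (vc x) * ((vc x ord0 j / r) *: psv)))); last first.
    apply: pder_near HG _.
    exact: pderD (pder_rad j x0 Hphi) (pderM (pder_onevec j x) (pder_rad j x0 Hpsi)).
  rewrite !mulrDr -scalerAr addrA; congr (_ + _ + _).
  - by rewrite -scalerAl scalerA mulrC.
  - by rewrite mulrA gen_sq mulN1r.
  - by rewrite -!scalerAr -!scalerAl scalerA mulrC.
rewrite !big_split /= -!scaler_sumr -!mulr_suml sumrN sumr_const card_ord.
rewrite -/(onevec (vc x)) mulrA onevec_sq -/r -scaler_nat.
have -> : r^-1 *: ((- r ^+ 2)%:A * psv) = - (r *: psv).
  by rewrite -scalerAl mul1r scalerA mulrN expr2 mulKf // scaleNr.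
by [].
Qed.

End AxialForm.

Definition fam_holo (Om : set R[i]^o) (f : {set 'I_m} -> R[i]^o -> R[i]^o) :=
  forall A, intrinsic_holomorphic Om (f A).

Definition fRe (f : {set 'I_m} -> R[i]^o -> R[i]^o) (u v : R) : Cl :=
  [ffun A => complex.Re (f A (u +i* v))].

Definition fIm (f : {set 'I_m} -> R[i]^o -> R[i]^o) (u v : R) : Cl :=
  [ffun A => complex.Im (f A (u +i* v))].

Definition slice_fam f : point -> Cl := axial (fRe f) (fIm f).

Definition dfam (f : {set 'I_m} -> R[i]^o -> R[i]^o) A := derive1 (f A).

Definition axpf k (f : {set 'I_m} -> R[i]^o -> R[i]^o) (u v : R) : Cl :=
  [ffun A => axp k (f A) u v].

(** The imaginary part absorbs the division by the radius, so that the unit vector is replaced by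
    [onevec (vc x)], which is linear in the coordinates. *)
Lemma slice_famE f x : vc x != 0 ->
  radial (fRe f) x + onevec (vc x) * radial (axpf 0 f) x = slice_fam f x.
Proof.
move=> x0; rewrite /slice_fam /axial; congr (_ + _); rewrite -scalerAl scalerAr.
by congr (_ * _); apply/ffunP => A; rewrite !ffunE axp0.
Qed.

Lemma intrinsic_conj (Om : set R[i]^o) F z : csym Om -> intrinsic_holomorphic Om F -> Om z ->
  F (conjc z) = conjc (F z).
Proof.
case: z => u v sOm [_ HF] Oz; have [h1 h2] := HF u v Oz.
by rewrite -[conjc _]/(u -i* v); apply: complex_eq; rewrite ?h1 ?h2; case: (F _).
Qed.

Section Chain.
Variables (Om : set R[i]^o) (f : {set 'I_m} -> R[i]^o -> R[i]^o).
Hypotheses (m0 : (0 < m)%N) (oOm : copen Om) (sOm : csym Om) (Hf : fam_holo Om f).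

Lemma cgrad_axpf k u v : Om (u +i* v) -> v != 0 ->
  cgrad (axpf k f) u v (axpf k (dfam f) u v) (v *: axpf k.+1 f u v).
Proof.
move=> Oz v0 A; have := grad_axp oOm (Hf A).1 k Oz v0; rewrite !ffunE.
by congr grad; apply/funext => a; apply/funext => b; rewrite ffunE.
Qed.

Lemma cgrad_fRe u v : Om (u +i* v) ->
  cgrad (fRe f) u v (fRe (dfam f) u v) (- fIm (dfam f) u v).
Proof.
move=> Oz A; have /holomorphicP := (Hf A).1; move=> /(_ _ Oz) /grad_Re.
rewrite !ffunE; by congr grad; apply/funext => a; apply/funext => b; rewrite ffunE.
Qed.

Lemma near_off x : slice_domain m Om x -> vc x != 0 ->
  \forall y \near x, slice_domain m Om y /\ vc y != 0.
Proof.
by move=> Ox x0; apply: filterI; [exact: near_slice|exact: near_enorm].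
Qed.

(** By the Cauchy-Riemann equations the derivatives of [f] cancel. What remains are [m] negative
    copies of $T_0 f$ from differentiating [onevec], and one positive copy from differentiating
    $v^{-1}$. *)
Lemma Dop_slice_fam x : slice_domain m Om x -> vc x != 0 ->
  Dop (slice_fam f) x = - (m%:R - 1) *: radial (axpf 0 f) x.
Proof.
move=> Ox x0; have Oz := (slice_domainP x m0 sOm).1 Ox.
have r0 : enorm (vc x) != 0 by rewrite enorm_eq0.
have g1 := cgrad_fRe Oz; have g2 := @cgrad_axpf 0 _ _ Oz r0.
have near_eq : \forall y \near x, radial (fRe f) y + onevec (vc y) * radial (axpf 0 f) y = slice_fam f y.
  by apply: filterS (near_off Ox x0) => y [_]; exact: slice_famE.
rewrite /Dop (axial_partial0 x0 g1 g2 near_eq) (axial_Dvec x0 g1 g2 near_eq).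
have e1 : axpf 0 (dfam f) (sc x) (enorm (vc x)) =
    (enorm (vc x))^-1 *: fIm (dfam f) (sc x) (enorm (vc x)).
  by apply/ffunP => A; rewrite !ffunE axp0.
have e2 : enorm (vc x) *: (enorm (vc x) *: axpf 1 f (sc x) (enorm (vc x))) =
    fRe (dfam f) (sc x) (enorm (vc x)) - radial (axpf 0 f) x.
  apply/ffunP => A; rewrite !ffunE axp0.
  pose I l := complex.Im ('i ^+ l * derive1n l (f A) (zof x)).
  have -> : axp 1 (f A) (sc x) (enorm (vc x)) = _ := axp_sum1 I (enorm (vc x))^-1.
  have -> : I 0%N = complex.Im (f A (zof x)) by rewrite /I expr0 mul1r.
  have -> : I 1%N = complex.Re (dfam f A (zof x)).
    by rewrite /I expr1 [LHS]cImM /= mul0r mul1r add0r.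
  rewrite -/(zof x); move: (complex.Im _) (complex.Re _) => a b.
  by move: (enorm (vc x)) r0 => r r0; field.
rewrite e1 e2 mulrN scalerN -scalerAr.
move: (_^-1 *: _) (fRe _ _ _) (radial _ _) => a b c.
by apply/ffunP => A; rewrite !ffunE; ring.
Qed.

Lemma partial0_axpf k c (G : point -> Cl) x : slice_domain m Om x -> vc x != 0 ->
  (\forall y \near x, c *: radial (axpf k f) y = G y) ->
  partial ord0 G x = c *: radial (axpf k (dfam f)) x.
Proof.
move=> Ox x0 HG; have Oz := (slice_domainP x m0 sOm).1 Ox.
have r0 : enorm (vc x) != 0 by rewrite enorm_eq0.
apply: pder_partial; apply: pder_near HG _.
have := pderZ (is_derive_cst c x (E ord0)) (pder_rad0 x0 (@cgrad_axpf k _ _ Oz r0)).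
by rewrite scale0r add0r.
Qed.

Lemma partial_axpf k c (G : point -> Cl) x j : slice_domain m Om x -> vc x != 0 ->
  (\forall y \near x, c *: radial (axpf k f) y = G y) ->
  partial (lift ord0 j) G x = (c * vc x ord0 j) *: radial (axpf k.+1 f) x.
Proof.
move=> Ox x0 HG; have Oz := (slice_domainP x m0 sOm).1 Ox.
have r0 : enorm (vc x) != 0 by rewrite enorm_eq0.
apply: pder_partial; apply: pder_near HG _.
have := pderZ (is_derive_cst c x (E (lift ord0 j))) (pder_rad j x0 (@cgrad_axpf k _ _ Oz r0)).
by rewrite scale0r add0r scalerA_div // scalerA.
Qed.

End Chain.

Lemma fam_dfam Om f : copen Om -> csym Om -> fam_holo Om f -> fam_holo Om (dfam f).
Proof.
move=> oOm sOm Hf A; split; first exact: holo_derive1 (Hf A).1.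
move=> u v Oz; suff -> : dfam f A (u -i* v) = conjc (dfam f A (u +i* v)).
  by case: (dfam f A (u +i* v)).
set z := u +i* v; have /holomorphicP/(_ z Oz) Hd := (Hf A).1.
apply: cderiv_derive1 => e e0; have [d d0 Hd'] := Hd e e0.
have [r r0 Hr] := oOm z Oz.
exists (Num.min d r); first by rewrite lt_min d0.
move=> t; rewrite lt_min => /andP[td tr]; rewrite -(cabsJ t) in td tr *.
have := Hd' _ td; rewrite -cabsJ !rmorphB rmorphM /= conjcK.
rewrite -(intrinsic_conj sOm (Hf A) Oz) -(intrinsic_conj sOm (Hf A) (z := z + conjc t)).
  by rewrite rmorphD /= conjcK.
by apply: Hr; rewrite addrC addKr.
Qed.

Section Chain2.
Variables (Om : set R[i]^o) (f : {set 'I_m} -> R[i]^o -> R[i]^o).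
Hypotheses (m0 : (0 < m)%N) (oOm : copen Om) (sOm : csym Om) (Hf : fam_holo Om f).

(** The vector variables contribute $m\,T_{k+1}f+r^2T_{k+2}f$. By [axp_ode] the last term and the
    second derivative in $x_0$ together amount to $-(2k+3)T_{k+1}f$. *)
Lemma laplacian_axpf k (c : R) (G : point -> Cl) x : slice_domain m Om x -> vc x != 0 ->
  (\forall y \near x, c *: radial (axpf k f) y = G y) ->
  laplacian G x = (c * (m%:R - (2 * k + 3)%:R)) *: radial (axpf k.+1 f) x.
Proof.
move=> Ox x0 HG; have Oz := (slice_domainP x m0 sOm).1 Ox.
have r0 : enorm (vc x) != 0 by rewrite enorm_eq0.
have Hf1 := fam_dfam oOm sOm Hf.
have nn : \forall y \near x, (slice_domain m Om y /\ vc y != 0) /\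
    \forall y' \near y, c *: radial (axpf k f) y' = G y'.
  by apply: filterI; [exact: (near_off m0 oOm sOm)|exact: nbhs_interior].
have H0 : partial ord0 (partial ord0 G) x = c *: radial (axpf k (dfam (dfam f))) x.
  apply: (partial0_axpf m0 oOm sOm Hf1 Ox x0).
  by apply: filterS nn => y [[Oy y0] Hy]; rewrite (partial0_axpf m0 oOm sOm Hf Oy y0 Hy).
have Hj j : partial (lift ord0 j) (partial (lift ord0 j) G) x =
    c *: radial (axpf k.+1 f) x + (c * vc x ord0 j ^+ 2) *: radial (axpf k.+2 f) x.
  apply: pder_partial; apply: (pder_near (F := fun y => (c * vc y ord0 j) *: radial (axpf k.+1 f) y)).
    by apply: filterS nn => y [[Oy y0] Hy]; rewrite (partial_axpf m0 oOm sOm Hf j Oy y0 Hy).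
  have H1 := is_deriveM (is_derive_cst c x (E (lift ord0 j))) (pder_vc j j x).
  have {}H1 : is_derive x (E (lift ord0 j)) (fun y : point => c * vc y ord0 j) c.
    by move: H1; rewrite scaler0 addr0 eqxx [cst c x *: 1]mulr1.
  have := pderZ H1 (pder_rad j x0 (@cgrad_axpf Om f oOm Hf k.+1 _ _ Oz r0)).
  by rewrite scalerA_div // scalerA -mulrA -expr2.
rewrite /laplacian big_ord_recl H0 (eq_bigr _ (fun j _ => Hj j)) big_split /=.
rewrite sumr_const card_ord -scaler_nat -scaler_suml -mulr_sumr -enorm_sq.
apply/ffunP => A; rewrite !ffunE.
have := axp_ode k oOm (Hf A).1 Oz r0.
rewrite -[axp k (dfam (dfam f) A) _ _]/(axp k (derive1 (derive1 (f A))) (sc x) (enorm (vc x))).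
move: (axp k _ _ _) (axp k.+1 _ _ _) (axp k.+2 _ _ _) => a d b H.
have -> : a = - (enorm (vc x) ^+ 2 * b) - (2 * k + 3)%:R * d.
  by apply/eqP; rewrite -subr_eq0 opprD !opprK addrA; apply/eqP.
by ring.
Qed.

End Chain2.
End SliceOperators.

(** * Analytic functions of axial form *)

Section AxialAnalytic.
Variables (R : realType) (m : nat).
Local Notation C := R[i].
Local Notation Cl := (clifford R m).
Local Notation point := 'rV[R]_m.+1.
Local Notation E i := (delta_mx ord0 i : point).
Implicit Types (x y : point).

Lemma ana_grad (phi : 'rV[R]_2 -> R) u v : ana phi (pt2 u v) ->
  exists a b, grad (fun u v => phi (pt2 u v)) u v a b.
Proof.
move=> /ana_quad[l [rho [K [rho0 K0 quad]]]]; exists (l ord0), (l ord_max).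
move=> V x e g1 g2 d1 d2 H1 H2 e1 e2; apply/is_deriveP => eps eps0.
pose B := `|d1| + `|d2| + 1; pose L := `|l ord0| + `|l ord_max| + 1.
have B0 : 0 < B by rewrite ltr_wpDl // addr_ge0.
have L0 : 0 < L by rewrite ltr_wpDl // addr_ge0.
pose eta := Num.min 1 (eps / (2 * L)).
have eta0 : 0 < eta by rewrite lt_min ltr01 divr_gt0 // mulr_gt0.
have [D1 D10 K1] := (is_deriveP _ _ _ _).1 H1 _ eta0.
have [D2 D20 K2] := (is_deriveP _ _ _ _).1 H2 _ eta0.
have KB : 0 < K * B ^+ 2 + 1 by rewrite ltr_wpDl // mulr_ge0 // sqr_ge0.
pose D3 := rho / B; pose D4 := eps / (2 * (K * B ^+ 2 + 1)).
have D30 : 0 < D3 by rewrite divr_gt0.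
have D40 : 0 < D4 by rewrite divr_gt0 // mulr_gt0.
exists (Num.min (Num.min D1 D2) (Num.min D3 D4)); first by rewrite !lt_min D10 D20 D30 D40.
move=> t; rewrite !lt_min => /andP[/andP[/K1 {}K1 /K2 {}K2] /andP[t3 t4]].
rewrite e1 in K1; rewrite e2 in K2; rewrite e1 e2.
set h1 := g1 (t *: e + x) - u in K1 *; set h2 := g2 (t *: e + x) - v in K2 *.
have [eta1 etaL] : eta <= 1 /\ L * eta <= eps / 2.
  split; first by rewrite /eta ge_min lexx.
  have -> : eps / 2 = L * (eps / (2 * L)) by field; rewrite gt_eqF.
  by rewrite ler_pM2l // /eta ge_min lexx orbT.
have hb (h d : R) : `|h - t *: d| <= eta * `|t| -> `|d| + 1 <= B -> `|h| <= B * `|t|.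
  move=> hd dB; rewrite -(subrK (t *: d) h); apply: le_trans (ler_normD _ _) _.
  apply: (@le_trans _ _ (`|t| + `|d| * `|t|)).
    apply: lerD; first by apply: le_trans hd _; rewrite ler_piMl.
    by rewrite [`|t *: d|]normrM mulrC.
  by rewrite -{1}(mul1r `|t|) -mulrDl addrC ler_wpM2r.
have b1 : `|h1| <= B * `|t| by apply: hb K1 _; rewrite lerD2r lerDl.
have b2 : `|h2| <= B * `|t| by apply: hb K2 _; rewrite lerD2r lerDr.
have sm : small (B * `|t|) (pt2 h1 h2) by move=> i; rewrite mxE; case: eqP.
have st : 0 <= B * `|t| <= rho.
  by rewrite mulr_ge0 ?(ltW B0) //= mulrC -ler_pdivlMr // ltW.
have := quad _ _ sm st.
have -> : pt2 u v + pt2 h1 h2 = pt2 (g1 (t *: e + x)) (g2 (t *: e + x)).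
  by apply/rowP => i; rewrite !mxE /h1 /h2; case: eqP => _; rewrite addrC subrK.
rewrite big_ord_recl big_ord1 !mxE eqxx /=.
have -> : lift ord0 ord0 = ord_max :> 'I_2 by apply: val_inj.
set P := phi _ - phi _ => Q.
have -> : P - t *: (l ord0 * d1 + l ord_max * d2) = (P - (l ord0 * h1 + l ord_max * h2)) +
   (l ord0 * (h1 - t *: d1) + l ord_max * (h2 - t *: d2)).
  by rewrite /GRing.scale /=; ring.
apply: le_trans (ler_normD _ _) _.
have -> : eps * `|t| = eps / 2 * `|t| + eps / 2 * `|t| by field.
apply: lerD.
  apply: le_trans Q _; rewrite exprMn mulrA [`|t| ^+ 2]expr2 mulrA ler_wpM2r //.
  apply: (@le_trans _ _ ((K * B ^+ 2 + 1) * `|t|)); first by rewrite ler_wpM2r // lerDl.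
  have -> : eps / 2 = (K * B ^+ 2 + 1) * D4 by rewrite /D4; field; rewrite gt_eqF.
  by rewrite ler_pM2l // ltW.
apply: le_trans (ler_normD _ _) _; rewrite !normrM.
apply: (@le_trans _ _ ((`|l ord0| + `|l ord_max|) * (eta * `|t|))).
  by rewrite mulrDl lerD // ler_wpM2l.
rewrite mulrA ler_wpM2r //; apply: le_trans etaL; rewrite ler_pM2r //.
by rewrite lerDl.
Qed.

Lemma cana_cgrad (phi : R -> R -> Cl) u v :
  cana (fun p : 'rV[R]_2 => phi (p ord0 ord0) (p ord0 ord_max)) (pt2 u v) ->
  exists a b, cgrad phi u v a b.
Proof.
move=> H.
have /choice[a Ha] A : exists a, exists b, grad (fun u v => phi u v A) u v a b.
  have [a [b Hab]] := ana_grad (H A); exists a, b; move: Hab.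
  by congr grad; apply/funext => s; apply/funext => t; rewrite !mxE.
have /choice[b Hb] A : exists b, grad (fun u v => phi u v A) u v (a A) b by exact: Ha.
by exists [ffun A => a A], [ffun A => b A] => A; rewrite !ffunE.
Qed.

Lemma cana_plane (G : point -> Cl) (u v : R) (w : 'rV[R]_m) :
  cana G (mkpoint u (v *: w)) ->
  cana (fun p : 'rV[R]_2 => G (mkpoint (p ord0 ord0) (p ord0 ord_max *: w))) (pt2 u v).
Proof.
move=> H A; pose k (j : 'I_m.+1) (p : 'rV[R]_2) :=
  mkpoint (p ord0 ord0) (p ord0 ord_max *: w) ord0 j.
have kE p : \row_j k j p = mkpoint (p ord0 ord0) (p ord0 ord_max *: w).
  by apply/rowP => j; rewrite mxE.
apply: (@eq1_ana _ _ (fun p => G (\row_j k j p) A)); first by move=> p; rewrite kE.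
apply: (ana_comp (phi := fun x => G x A)).
  by rewrite kE !mxE /=; exact: H.
move=> j; case: (unliftP ord0 j) => [i ->|->].
  apply: (@eq1_ana _ _ (fun p : 'rV[R]_2 => w ord0 i * p ord0 ord_max)).
    by move=> p; rewrite /k mxE liftK mxE mulrC.
  by apply: anaZ; exact: ana_coord.
apply: (@eq1_ana _ _ (fun p : 'rV[R]_2 => p ord0 ord0)); last exact: ana_coord.
by move=> p; rewrite /k mxE unlift_none.
Qed.

Definition axial_form (Om : set R[i]^o) (G : point -> Cl) := forall u v, Om (u +i* v) -> 0 < v ->
  exists a b, forall w, enorm w = 1 -> G (mkpoint u (v *: w)) = a + onevec w * b.

Lemma onevecN (w : 'rV[R]_m) : onevec (- w) = - onevec w.
Proof. by rewrite -scaleN1r onevecZ scaleN1r. Qed.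

Lemma enormN (w : 'rV[R]_m) : enorm (- w) = enorm w.
Proof. by rewrite -scaleN1r enormZ normrN1 mul1r. Qed.

(** The two components are recovered from a single plane, as half the sum of the values at [w] and
    [- w] and as a multiple of [onevec w] times their difference. They inherit analyticity from [G],
    also where [v = 0], and have the right parity by construction, so the axial form is needed only
    pointwise and for [v > 0]. *)
Lemma axial_analytic_intro (Om : set R[i]^o) (G : point -> Cl) : (0 < m)%N -> csym Om ->
  (forall x, slice_domain m Om x -> cana G x) -> axial_form Om G -> axial_analytic Om G.
Proof.
move=> m0 sOm HG HF; split.
  by move=> x Ox A; apply/analytic_atP; exact: HG.
have [w w1] := unit_vector R m0; have nw1 : enorm (- w) = 1 by rewrite enormN.
pose g w u v := G (mkpoint u (v *: w)).
pose al u v := 2^-1 *: (g w u v + g (- w) u v).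
pose be u v := - 2^-1 *: (onevec w * (g w u v - g (- w) u v)).
have Hg w' u v : enorm w' = 1 -> Om (u +i* v) ->
    cana (fun p : 'rV[R]_2 => g w' (p ord0 ord0) (p ord0 ord_max)) (pt2 u v).
  by move=> w'1 Ouv; apply: cana_plane; apply: HG; exists u, v, w'.
have two : (2 : R) != 0 by rewrite pnatr_eq0.
have half (T : Cl) : 2^-1 *: (T + T) = T.
  by rewrite -mulr2n -[T *+ 2]scaler_nat scalerA mulVf // scale1r.
exists al, be; split.
- move=> u v Ouv A; apply/analytic_atP; apply: canaZ; first exact: ana_cst.
  by apply: canaD; exact: Hg.
- move=> u v Ouv A; apply/analytic_atP; apply: canaZ; first exact: ana_cst.
  apply: canaM; first exact: cana_cst.
  by apply: canaD; [|apply: canaN]; exact: Hg.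
- move=> u v _; rewrite /al /be /g !scaleNr !scalerN opprK; split; first by rewrite addrC.
  by rewrite opprK -scalerN -mulrN opprB.
move=> x Ox; have Oz := (slice_domainP x m0 sOm).1 Ox; rewrite /axial.
(* On the axis [axial] drops the odd component, and [al] is the mean of two equal values. *)
have [x0|x0] := eqVneq (vc x) 0.
  rewrite x0 onevec0 scaler0 mul0r addr0 /al /g.
  have -> : enorm (0 : 'rV[R]_m) = 0 by apply/eqP; rewrite enorm_eq0.
  by rewrite (scale0r w) (scale0r (- w)) -x0 mk_scvc half.
have r0 : 0 < enorm (vc x) by rewrite enorm_gt0.
have [w' w'1 xE] := polar x m0.
have [a [b Hab]] := HF _ _ Oz r0.
have -> : al (sc x) (enorm (vc x)) = a.
  rewrite /al /g (Hab w) // (Hab (- w)) // onevecN mulNr addrACA subrr addr0.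
  exact: half.
have -> : be (sc x) (enorm (vc x)) = b.
  rewrite /be /g (Hab w) // (Hab (- w)) // onevecN mulNr opprD opprK addrACA subrr add0r.
  rewrite scaleNr scalerAr half mulrA.
  by rewrite onevec_unit // mulN1r opprK.
have -> : (enorm (vc x))^-1 *: onevec (vc x) = onevec w'.
  have {1 2}-> : vc x = enorm (vc x) *: w' by rewrite {1}xE vc_mk.
  by rewrite enormZ w'1 mulr1 ger0_norm ?enorm_ge0 // onevecZ scalerA mulVf ?scale1r // gt_eqF.
by rewrite {1}xE Hab.
Qed.

Lemma axial_analytic_cana Om (G : point -> Cl) x : axial_analytic Om G ->
  slice_domain m Om x -> cana G x.
Proof. by move=> [H _] Ox A; apply/analytic_atP; exact: H. Qed.

Lemma axial_rad (phi psi : R -> R -> Cl) x : vc x != 0 ->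
  axial phi psi x = radial phi x + onevec (vc x) * radial (fun u v => v^-1 *: psi u v) x.
Proof. by move=> _; rewrite /axial /radial -scalerAl scalerAr. Qed.

Lemma axial_form_local (Om : set R[i]^o) (G : point -> Cl) (a b : R -> R -> Cl) : (0 < m)%N ->
  (forall x, slice_domain m Om x -> vc x != 0 ->
     G x = radial a x + onevec (vc x) * radial b x) -> axial_form Om G.
Proof.
move=> m0 H u v Ouv v0; exists (a u v), (v *: b u v) => w w1.
have vw : vc (mkpoint u (v *: w)) != 0.
  by rewrite vc_mk -enorm_eq0 enormZ w1 mulr1 normr_eq0 gt_eqF.
rewrite H //; last by exists u, v, w.
by rewrite /radial sc_mk vc_mk enormZ w1 mulr1 gtr0_norm // onevecZ -scalerAl scalerAr.
Qed.

Lemma cgrad_Vscale (psi : R -> R -> Cl) u v a b : v != 0 -> cgrad psi u v a b ->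
  exists c d, cgrad (fun u v => v^-1 *: psi u v) u v c d.
Proof.
move=> v0 H.
exists (v^-1 *: a), (- v^-1 ^+ 2 *: psi u v + v^-1 *: b) => A.
have := gradM (@grad_Vpow R 1 u v v0) (H A).
rewrite !ffunE mul0r add0r expr1 mulN1r.
by congr grad; apply/funext => s; apply/funext => t; rewrite ffunE expr1.
Qed.

(** The gradients of the components are selected point by point. No regularity of the selected
    functions is required, because the image is known to be analytic independently. *)
Lemma axial_grad (Om : set R[i]^o) (G : point -> Cl) : (0 < m)%N -> copen Om -> csym Om ->
  axial_analytic Om G -> exists a0 b0 a1 b1 : R -> R -> Cl,
  forall x, slice_domain m Om x -> vc x != 0 ->
    partial ord0 G x = radial a0 x + onevec (vc x) * radial b0 x /\
    Dvec G x = radial a1 x + onevec (vc x) * radial b1 x.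
Proof.
move=> m0 oOm sOm [_ [al [be [Hal Hbe _ GE]]]].
pose ga u v := v^-1 *: be u v.
have /choice[D HD] (p : R * R) : exists D : Cl * Cl * (Cl * Cl), Om (p.1 +i* p.2) -> p.2 != 0 ->
    cgrad al p.1 p.2 D.1.1 D.1.2 /\ cgrad ga p.1 p.2 D.2.1 D.2.2.
  have [[Op p0]|nn] := pselect (Om (p.1 +i* p.2) /\ p.2 != 0); last first.
    by exists (0, 0, (0, 0)) => h1 h2; case: nn.
  have [a [b Hab]] : exists a b, cgrad al p.1 p.2 a b.
    by apply: cana_cgrad => A; apply/analytic_atP; exact: Hal.
  have [a' [b' Hab']] : exists a b, cgrad be p.1 p.2 a b.
    by apply: cana_cgrad => A; apply/analytic_atP; exact: Hbe.
  have [c [d Hcd]] := cgrad_Vscale p0 Hab'.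
  by exists (a, b, (c, d)).
exists (fun u v => (D (u, v)).1.1), (fun u v => (D (u, v)).2.1),
  (fun u v => - m%:R *: ga u v - v *: (D (u, v)).2.2), (fun u v => v^-1 *: (D (u, v)).1.2).
move=> x Ox x0; have Oz := (slice_domainP x m0 sOm).1 Ox.
have r0 : enorm (vc x) != 0 by rewrite enorm_eq0.
have [g1 g2] := HD (sc x, enorm (vc x)) Oz r0.
have HG : \forall y \near x, radial al y + onevec (vc y) * radial ga y = G y.
  apply: filterS (near_off m0 oOm sOm Ox x0) => y [Oy y0].
  by rewrite GE // axial_rad.
rewrite (axial_partial0 x0 g1 g2 HG) (axial_Dvec x0 g1 g2 HG); split=> //.
by rewrite /radial -scalerAr scaleNr [RHS]addrC addrA.
Qed.

Lemma laplacian_eq0 (Om : set R[i]^o) (G : point -> Cl) : (0 < m)%N -> copen Om -> csym Om ->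
  (forall x, slice_domain m Om x -> cana G x) ->
  (forall x, slice_domain m Om x -> vc x != 0 -> laplacian G x = 0) ->
  forall x, slice_domain m Om x -> laplacian G x = 0.
Proof.
move=> m0 oOm sOm HG H x Ox; apply: (cana_dense (G := fun=> 0)) => //.
- by apply: cana_laplacian; exact: HG.
- exact: cana_cst.
by apply: filterS (near_slice m0 sOm oOm Ox) => y Oy y0; exact: H.
Qed.

Section Harmonic.
Variables (Om : set R[i]^o) (G : point -> Cl).
Hypotheses (m0 : (0 < m)%N) (oOm : copen Om) (sOm : csym Om) (HG : AH Om G).

Let near_cana x : slice_domain m Om x -> \forall y \near x, cana G y.
Proof.
move=> Ox; apply: filterS (near_slice m0 sOm oOm Ox) => y Oy.
exact: axial_analytic_cana HG.1 Oy.
Qed.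

Lemma AM_Dbar : AM Om (Dbar G).
Proof.
split.
  apply: axial_analytic_intro => //.
    by move=> x Ox; apply: cana_Dbar; exact: axial_analytic_cana HG.1 Ox.
  have [a0 [b0 [a1 [b1 Hab]]]] := axial_grad m0 oOm sOm HG.1.
  apply: (@axial_form_local _ _ (fun u v => a0 u v - a1 u v) (fun u v => b0 u v - b1 u v)) => //.
  move=> x Ox x0; rewrite /Dbar; have [-> ->] := Hab x Ox x0.
  by rewrite /radial opprD addrACA -mulrN -mulrDr.
by move=> x Ox; rewrite Dop_Dbar; [exact: HG.2|exact: near_cana].
Qed.

Lemma AH_Dvec : AH Om (Dvec G).
Proof.
split.
  apply: axial_analytic_intro => //.
    by move=> x Ox; apply: cana_Dvec; exact: axial_analytic_cana HG.1 Ox.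
  have [a0 [b0 [a1 [b1 Hab]]]] := axial_grad m0 oOm sOm HG.1.
  by apply: (@axial_form_local _ _ a1 b1) => // x Ox x0; have [_ ->] := Hab x Ox x0.
move=> x Ox; rewrite laplacian_Dvec; last exact: near_cana.
rewrite (@Dvec_near _ _ _ (fun=> 0)); last first.
  by apply: filterS (near_slice m0 sOm oOm Ox) => y; exact: HG.2.
rewrite /Dvec big1 // => j _; rewrite (pder_partial (pder_cst _ _ _)).
by rewrite mulr0.
Qed.

End Harmonic.

Lemma AH_comb (Om : set R[i]^o) (F G : point -> Cl) (c d : R) : (0 < m)%N -> copen Om -> csym Om ->
  AH Om F -> AH Om G -> AH Om (fun x => c *: F x + d *: G x).
Proof.
move=> m0 oOm sOm HF HG.
have cF x : slice_domain m Om x -> cana (fun x => c *: F x) x.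
  by move=> Ox; apply: canaZ; [exact: ana_cst|exact: axial_analytic_cana HF.1 Ox].
have cG x : slice_domain m Om x -> cana (fun x => d *: G x) x.
  by move=> Ox; apply: canaZ; [exact: ana_cst|exact: axial_analytic_cana HG.1 Ox].
have lapZ k H i x : cana H x -> partial i (fun y => k *: H y) x = k *: partial i H x.
  move=> cH; apply: pder_partial.
  have := pderZ (is_derive_cst k x (E i)) (cana_pder i cH).
  by rewrite scale0r add0r.
split.
  apply: axial_analytic_intro => //.
    by move=> x Ox; apply: canaD; [exact: cF|exact: cG].
  have [_ [al [be [_ _ _ FE]]]] := HF.1; have [_ [al' [be' [_ _ _ GE]]]] := HG.1.
  apply: (@axial_form_local _ _ (fun u v => c *: al u v + d *: al' u v)
    (fun u v => c *: (v^-1 *: be u v) + d *: (v^-1 *: be' u v))) => //.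
  move=> x Ox x0; rewrite FE // GE // !axial_rad // /radial !scalerDr mulrDr addrACA.
  by rewrite !scalerAr.
move=> x Ox.
have lapE k H : AH Om H -> laplacian (fun y => k *: H y) x = k *: laplacian H x.
  move=> HH; rewrite /laplacian scaler_sumr; apply: eq_bigr => i _.
  have cH y : slice_domain m Om y -> cana H y by exact: axial_analytic_cana HH.1.
  rewrite -lapZ; last by apply: cana_partial; exact: cH.
  apply: partial_near; apply: filterS (near_slice m0 sOm oOm Ox) => y Oy.
  by rewrite lapZ //; exact: cH.
have -> : laplacian (fun y => c *: F y + d *: G y) x =
    laplacian (fun y => c *: F y) x + laplacian (fun y => d *: G y) x.
  rewrite /laplacian -big_split; apply: eq_bigr => i _ /=.
  rewrite -partialD; [|apply: cana_partial; exact: cF|apply: cana_partial; exact: cG].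
  apply: partial_near; apply: filterS (near_slice m0 sOm oOm Ox) => y Oy.
  by rewrite partialD //; [exact: cF|exact: cG].
by rewrite !lapE // HF.2 // HG.2 // !scaler0 addr0.
Qed.

End AxialAnalytic.

Lemma filter_fin (T : finType) (X : Type) (F : set_system X) (P : T -> set X) : Filter F ->
  (forall t, F (P t)) -> F [set x | forall t, P t x].
Proof.
move=> FF H; suff : F [set x | forall t, t \in enum T -> P t x].
  by apply: filterS => x Hx t; apply: Hx; rewrite mem_enum.
elim: (enum T) => [|t s IH]; first by apply: filterS (filterT : F setT).
apply: filterS2 (H t) IH => x h1 h2 t'; rewrite inE => /orP[/eqP -> //|]; exact: h2.
Qed.

(** * Slice functions and their images under $\Delta^n\mathcal{D}$ *)

Section SliceHarmonic.
Variables (R : realType) (m n : nat).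
Local Notation C := R[i].
Local Notation Cl := (clifford R m).
Local Notation point := 'rV[R]_m.+1.
Implicit Types (x y : point).
Variables (Om : set R[i]^o) (f : {set 'I_m} -> R[i]^o -> R[i]^o).
Hypotheses (mE : m = (2 * n + 3)%N) (oOm : copen Om) (sOm : csym Om) (Hf : fam_holo Om f).

Let m0 : (0 < m)%N. Proof. by rewrite mE addn3. Qed.

Let mR : m%:R = 2 * n%:R + 3 :> R. Proof. by rewrite mE natrD natrM. Qed.

(** Off the axis the radius is analytic. On the axis [ana_axial0] writes each imaginary part as the
    radius times an analytic function, and the radius cancels against the denominator of the unit
    vector. *)
Lemma cana_slice_fam x : slice_domain m Om x -> cana (slice_fam f) x.
Proof.
move=> Ox; have Oz := (slice_domainP x m0 sOm).1 Ox; have [r r0 Hr] := oOm Oz.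
have HB A : holomorphic_on (cball (zof x) r) (f A).
  by apply: holo_sub (Hf A).1 => w; exact: Hr.
have [x0|x0] := eqVneq (vc x) 0; last first.
  have Han A := ana_holo r0 (HB A) (ana_sc x) (ana_enorm x0) erefl.
  apply: (@eq_cana _ _ _ (fun y => radial (fRe f) y + onevec (vc y) * radial (axpf 0 f) y)).
    by apply: filterS (near_enorm x0) => y; exact: slice_famE.
  apply: canaD.
    by move=> A; apply: eq1_ana (Han A).1 => y; rewrite /radial ffunE.
  apply: canaM; first exact: cana_onevec.
  move=> A; have r1 : enorm (vc x) != 0 by rewrite enorm_eq0.
  apply: eq1_ana (anaM (ana_inv (ana_enorm x0) r1) (Han A).2) => y.
  by rewrite /radial ffunE axp0.
have e0 : enorm (vc x) = 0 by apply/eqP; rewrite enorm_eq0 x0.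
have zx : zof x = (sc x)%:C by rewrite /zof e0.
have H A : ana (fun y => complex.Re (f A (zof y))) x /\ exists2 B, ana B x &
    \forall y \near x, complex.Im (f A (zof y)) = enorm (vc y) * B y.
  rewrite zx in HB.
  apply: (ana_axial0 r0 (HB A) _ (ana_sc x) (ana_enorm_sq x) erefl).
  - by move=> z zr; apply: (intrinsic_conj sOm (Hf A)); apply: Hr; rewrite zx.
  - by rewrite -enorm_sq e0 expr0n.
  - by move=> y; rewrite -enorm_sq sqr_ge0.
have /choice[B HB2] A : exists B, ana B x /\
    \forall y \near x, complex.Im (f A (zof y)) = enorm (vc y) * B y.
  by have [_ [B h1 h2]] := H A; exists B.
have nB : \forall y \near x, forall A, complex.Im (f A (zof y)) = enorm (vc y) * B A y.
  by apply: filter_fin => A; exact: (HB2 A).2.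
apply: (@eq_cana _ _ _ (fun y => radial (fRe f) y + onevec (vc y) * [ffun A => B A y])).
  apply: filterS nB => y Hy; rewrite /slice_fam /axial; congr (_ + _).
  have [y0|y0] := eqVneq (vc y) 0; first by rewrite y0 onevec0 scaler0 !mul0r.
  rewrite -scalerAl scalerAr; congr (_ * _); apply/ffunP => A; rewrite !ffunE Hy mulKf //.
  by rewrite enorm_eq0.
apply: canaD.
  by move=> A; apply: eq1_ana (H A).1 => y; rewrite /radial ffunE.
apply: canaM; first exact: cana_onevec.
by move=> A; apply: eq1_ana (HB2 A).1 => y; rewrite ffunE.
Qed.

(** The product of $-(m-1)=-2(n+1)$, from $\mathcal{D}$, and of the factors $m-2k-3=2(n-k)$ for
    $k<n$, from the Laplacians. *)
Definition hcst : R := - (2 ^+ n.+1 * (n.+1)`!%:R).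

Lemma iter_laplacian j x : (j <= n)%N -> slice_domain m Om x -> vc x != 0 ->
  iter j (@laplacian R m) (Dop (slice_fam f)) x =
  (- (2 ^+ j.+1 * (n.+1 ^_ j.+1)%:R)) *: radial (axpf j f) x.
Proof.
elim: j x => [|j IH] x jn Ox x0.
  rewrite /= (Dop_slice_fam m0 oOm sOm Hf Ox x0) ffactn1 expr1; congr (_ *: _).
  by rewrite mR -natr1; ring.
have nn : \forall y \near x, (- (2 ^+ j.+1 * (n.+1 ^_ j.+1)%:R)) *: radial (axpf j f) y =
    iter j (@laplacian R m) (Dop (slice_fam f)) y.
  by apply: filterS (near_off m0 oOm sOm Ox x0) => y [Oy y0]; rewrite IH // ltnW.
rewrite iterS (laplacian_axpf m0 oOm sOm Hf Ox x0 nn); congr (_ *: _).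
rewrite mR [(n.+1 ^_ j.+2)%N]ffactnSr natrM natrB; last exact: leqW.
by rewrite natrD natrM -[n.+1%:R]natr1 -[j.+1%:R]natr1 [2 ^+ j.+2]exprS; ring.
Qed.

Lemma lapD_off x : slice_domain m Om x -> vc x != 0 ->
  lapD (slice_fam f) x = hcst *: radial (axpf n f) x.
Proof.
move=> Ox x0; rewrite /lapD; have -> : ((m - 3)./2 = n)%N by rewrite mE addnK mul2n doubleK.
by rewrite iter_laplacian // ffactnn.
Qed.

Lemma cana_lapD (g : point -> Cl) x : cana g x -> cana (lapD g) x.
Proof.
move=> Hg; rewrite /lapD; elim: (_./2) => [|j IH]; first exact: cana_Dop.
by rewrite iterS; exact: cana_laplacian.
Qed.

Lemma lapD_near (g h : point -> Cl) x : (\forall y \near x, g y = h y) -> lapD g x = lapD h x.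
Proof.
rewrite /lapD; elim: (_./2) x => [|j IH] x H; first exact: Dop_near.
by rewrite !iterS; apply: laplacian_near; apply: filterS (nbhs_interior H) => y; exact: IH.
Qed.

(** One Laplacian more meets the factor $m-(2n+3)=0$; this is what singles out the exponent
    $(m-3)/2$. *)
Lemma AH_lapD : AH Om (lapD (slice_fam f)).
Proof.
have cg x : slice_domain m Om x -> cana (lapD (slice_fam f)) x.
  by move=> Ox; apply: cana_lapD; exact: cana_slice_fam.
split.
  apply: axial_analytic_intro => //.
  apply: (@axial_form_local _ _ _ _ (fun u v => hcst *: axpf n f u v) (fun _ _ => 0)) => //.
  by move=> x Ox x0; rewrite lapD_off // /radial mulr0 addr0.
apply: laplacian_eq0 => // x Ox x0.
have nn : \forall y \near x, hcst *: radial (axpf n f) y = lapD (slice_fam f) y.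
  by apply: filterS (near_off m0 oOm sOm Ox x0) => y [Oy y0]; rewrite lapD_off.
rewrite (laplacian_axpf m0 oOm sOm Hf Ox x0 nn).
by rewrite mR natrD natrM subrr mulr0 scale0r.
Qed.

Lemma partial0_lapD x : slice_domain m Om x -> vc x != 0 ->
  partial ord0 (lapD (slice_fam f)) x = hcst *: radial (axpf n (dfam f)) x.
Proof.
move=> Ox x0; apply: (partial0_axpf m0 oOm sOm Hf Ox x0).
by apply: filterS (near_off m0 oOm sOm Ox x0) => y [Oy y0]; rewrite lapD_off.
Qed.

Lemma Dvec_lapD x : slice_domain m Om x -> vc x != 0 ->
  Dvec (lapD (slice_fam f)) x = onevec (vc x) * (hcst *: radial (axpf n.+1 f) x).
Proof.
move=> Ox x0; have nn : \forall y \near x, hcst *: radial (axpf n f) y = lapD (slice_fam f) y.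
  by apply: filterS (near_off m0 oOm sOm Ox x0) => y [Oy y0]; rewrite lapD_off.
rewrite /Dvec (eq_bigr (fun j => (vc x ord0 j *: cl_gen R j) * (hcst *: radial (axpf n.+1 f) x))).
  by rewrite -mulr_suml.
move=> j _; rewrite (partial_axpf m0 oOm sOm Hf j Ox x0 nn).
by rewrite -!scalerAr -scalerAl scalerA.
Qed.

End SliceHarmonic.

(** * Expansions in powers of the radius *)

Section AxialSeries.
Variable R : realType.
Local Notation C := R[i].

(* T_k f(u, v) = sum_i (-1)^(k+i) pc k i f^(2k+1+2i)(u) v^(2i) for real u. *)
Definition pc (k i : nat) : R := 2 ^+ k * (k + i)`!%:R / (i`!%:R * (2 * k + 1 + 2 * i)`!%:R).

(** The coefficient of $v^{M-2k-1}$ obtained by applying $(v^{-1}\partial_v)^kv^{-1}$ to $v^M/M!$.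
    For [l > M] the derivative of order [l] is zero, hence the default value. *)
Definition skc (k M : nat) : R :=
  \sum_(l < k.+1) qc R k l * (if (l <= M)%N then (M - l)`!%:R^-1 else 0).

Lemma fact_neq0 k : k`!%:R != 0 :> R.
Proof. by rewrite pnatr_eq0 -lt0n fact_gt0. Qed.

Lemma skcS k M : skc k.+1 M = (M%:R - (2 * k + 1)%:R) * skc k M.
Proof.
pose c l : R := if (l <= M)%N then (M - l)`!%:R^-1 else 0.
have cS l : c l.+1 = (M%:R - l%:R) * c l.
  rewrite /c; have [lM|Ml|<-] := ltngtP l M; last by rewrite subrr mul0r.
    have e : (M - l = (M - l.+1).+1)%N by rewrite subnSK.
    rewrite -natrB ?(ltnW lM) // e factS natrM invfM mulrA mulfV ?mul1r // pnatr_eq0.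
  by rewrite mulr0.
rewrite /skc -/c.
have -> : \sum_(l < k.+2) qc R k.+1 l * c l =
  \sum_(l < k.+2) - (2 * k + 1 - l)%N%:R * qc R k l * c l +
  \sum_(l < k.+2) (if l : nat is l'.+1 then qc R k l' else 0) * c l.
  by rewrite -big_split; apply: eq_bigr => l _ /=; rewrite mulrDl.
rewrite big_ord_recr /= qc_gt // mulr0 mul0r addr0.
rewrite [X in _ + X]big_ord_recl /= mul0r add0r -big_split mulr_sumr.
apply: eq_bigr => l _ /=; rewrite /bump /= add1n cS.
rewrite natrB; last by have := ltn_ord l; lia.
by rewrite -/(c l); ring.
Qed.

(** Each $v^{-1}\partial_v$ brings down the current exponent, which is $M-(2t+1)$ at stage $t$. *)
Lemma skc_prod k M : skc k M = (\prod_(t < k) (M%:R - (2 * t + 1)%:R)) / M`!%:R.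
Proof.
elim: k => [|k IH]; last by rewrite skcS IH big_ord_recr /=; ring.
by rewrite /skc big_ord_recl !big_ord0 addr0 /= mul1r subn0 mul1r.
Qed.

Lemma skc_eq0 k j : (j < k)%N -> skc k (2 * j + 1) = 0.
Proof.
by move=> jk; rewrite skc_prod (bigD1 (Ordinal jk)) //= subrr !mul0r.
Qed.

Lemma skc_pc k i : skc k (2 * k + 1 + 2 * i) = pc k i.
Proof.
rewrite skc_prod /pc invfM mulrA; congr (_ / _).
elim: k i => [|k IH] i; first by rewrite big_ord0 expr0 mul1r add0n mulfV ?fact_neq0.
rewrite big_ord_recl /= (eq_bigr (fun t : 'I_k => (2 * k + 1 + 2 * i)%:R - (2 * t + 1)%:R)).
  rewrite IH muln0 add0n exprS addSn factS natrM -!natrB; last by lia.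
  have -> : (2 * k.+1 + 1 + 2 * i - 1 = 2 * (k + i).+1)%N by lia.
  by rewrite natrM; ring.
move=> t _; rewrite -!natrB; [congr (_%:R)| |]; rewrite /bump /=; have := ltn_ord t; lia.
Qed.

Lemma series_shift (t : nat -> R) (l : nat) (S : R) :
  series t @ \oo --> S -> series (fun M => if (l <= M)%N then t (M - l)%N else 0) @ \oo --> S.
Proof.
move=> H; rewrite -(cvg_shiftn l).
suff -> : [sequence series (fun M => if (l <= M)%N then t (M - l)%N else 0) (K + l)%N]_K =
  series t by [].
apply/funext => K /=; rewrite /series /=; elim: K => [|K IH].
  rewrite add0n [RHS]big_geq // big_nat big1 // => i /andP[_ il].
  by rewrite leqNgt il.
by rewrite addSn !big_nat_recr //= IH leq_addl addnK.
Qed.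

Lemma csumZ (a : nat -> C) (w S c : C) : csum_to a w S -> csum_to (fun k => c * a k) w (c * S).
Proof.
move=> H e e0; have c0 : 0 < cabs c + 1 by rewrite ltr_wpDl ?cabs_ge0.
have [|N0 HN0] := H (e / (cabs c + 1)); first by rewrite divr_gt0.
exists N0 => N /HN0 K.
have -> : \sum_(0 <= j < N) c * a j * w ^+ j - c * S = c * (\sum_(0 <= j < N) a j * w ^+ j - S).
  by rewrite mulrBr mulr_sumr; congr (_ - _); apply: eq_bigr => j _; rewrite mulrA.
rewrite cabsM; apply: (@le_trans _ _ ((cabs c + 1) * (e / (cabs c + 1)))).
  by rewrite ler_pM ?cabs_ge0 // lerDl.
by rewrite mulrC divfK // gt_eqF.
Qed.

Lemma cvg_lin_sum (I : Type) (s : seq I) (c L : I -> R) (u : I -> nat -> R) :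
  (forall i, u i @ \oo --> L i) ->
  (fun K => \sum_(i <- s) c i * u i K) @ \oo --> \sum_(i <- s) c i * L i.
Proof.
move=> H; elim: s => [|i s IH].
  rewrite big_nil (_ : (fun K => _) = fun=> 0); first exact: cvg_cst.
  by apply/funext => K; rewrite big_nil.
rewrite big_cons (_ : (fun K => _) = (fun K => c i * u i K) \+ (fun K => \sum_(j <- s) c j * u j K)).
  by apply: cvgD => //; apply: cvgM => //; exact: cvg_cst.
by apply/funext => K; rewrite /= big_cons.
Qed.

Definition iIm (M : nat) : R := complex.Im ('i ^+ M : C).

Lemma iIm_even j : iIm (2 * j) = 0.
Proof.
rewrite /iIm exprM; have -> : 'i ^+ 2 = -1 :> C by apply: complex_eq; rewrite expr2 ?cReM ?cImM /=; ring.
by rewrite -signr_odd; case: (odd j); rewrite ?expr1 ?expr0 /= ?oppr0.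
Qed.

Lemma iIm_odd j : iIm (2 * j + 1) = (-1) ^+ j.
Proof.
rewrite /iIm exprD exprM; have -> : 'i ^+ 2 = -1 :> C by apply: complex_eq; rewrite expr2 ?cReM ?cImM /=; ring.
have -> : (-1) ^+ j = ((-1) ^+ j)%:C :> C by rewrite rmorphXn /= rmorphN1.
by rewrite expr1 cImM /=; ring.
Qed.

(** The series of the derivatives of order [l] are shifted by [l], so that all of them are indexed
    by the total order [M] and can be combined termwise. Even [M] vanish since ['i ^+ M] is real;
    odd [M] below [2 * k + 1] vanish by [skc_eq0], which removes the negative powers of [v]. *)
Lemma axp_series (Om : set R[i]^o) (F : R[i]^o -> R[i]^o) k u v (r : R) :
  holomorphic_on Om F -> copen Om -> cball (u%:C : C) r `<=` Om -> 0 < v < r ->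
  (forall N, complex.Im (derive1n N F u%:C) = 0) ->
  series (fun i => (-1) ^+ (k + i) * pc k i *
    complex.Re (derive1n (2 * k + 1 + 2 * i) F u%:C) * v ^+ (2 * i)) @ \oo --> axp k F u v.
Proof.
move=> HF oOm Hr /andP[v0 vr] dIm.
pose d N := complex.Re (derive1n N F u%:C); pose w : C := 0 +i* v.
have dE N : derive1n N F u%:C = (d N)%:C by apply: complex_eq => //=; exact: dIm.
have wr : cabs w < r.
  by apply: le_lt_trans (cabs_le _) _; rewrite /= normr0 add0r gtr0_norm.
have wE : u%:C + w = u +i* v by apply: complex_eq; rewrite ?cReD ?cImD /= ?addr0 ?add0r.
have wX N : w ^+ N = 'i ^+ N * (v ^+ N)%:C.
  have -> : w = 'i * v%:C by apply: complex_eq; rewrite ?cReM ?cImM /=; ring.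
  by rewrite exprMn rmorphXn.
pose T l M := if (l <= M)%N then iIm M * d M * v ^+ (M - l) / (M - l)`!%:R else 0.
have HT l : series (T l) @ \oo --> complex.Im ('i ^+ l * derive1n l F (u +i* v)).
  have HFl : holomorphic_on Om (derive1n l F) by exact: holo_derive1n.
  have := series_shift l (csum_Im (csumZ ('i ^+ l) (taylor_derive1n HFl Hr wr))); rewrite wE.
  set T' := (fun M => _); suff -> : T l = T' by [].
  apply/funext => M; rewrite /T /T'; case: leqP => // lM.
  have -> : derive1n (M - l) (derive1n l F) u%:C = (d M)%:C.
    by rewrite /derive1n -iterD subnK // -dE.
  have -> : 'i ^+ l * ((d M)%:C / (M - l)`!%:R) * w ^+ (M - l) =
      'i ^+ M * (d M * v ^+ (M - l) / (M - l)`!%:R)%:C :> C.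
    have -> : 'i ^+ M = 'i ^+ l * 'i ^+ (M - l) :> C by rewrite -exprD subnKC.
    by rewrite wX !rmorphM /= fmorphV rmorph_nat; ring.
  by rewrite cImM /= mulr0 add0r -/(iIm M); ring.
have vn0 : v != 0 by rewrite gt_eqF.
have := @cvg_lin_sum _ (index_enum 'I_k.+1) (fun l => qc R k l * v^-1 ^+ (2 * k + 1 - l)) _ _
  (fun l : 'I_k.+1 => HT l).
have -> : \sum_(l < k.+1) qc R k l * v^-1 ^+ (2 * k + 1 - l) *
    complex.Im ('i ^+ l * derive1n l F (u +i* v)) = axp k F u v.
  by apply: eq_bigr => l _; rewrite mulrA.
pose W M := iIm M * d M * v ^+ M * v^-1 ^+ (2 * k + 1) * skc k M.
have -> : (fun K => \sum_(l < k.+1) qc R k l * v^-1 ^+ (2 * k + 1 - l) * series (T l) K) = series W.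
  apply/funext => K; rewrite /series /=.
  rewrite (eq_bigr (fun l : 'I_k.+1 => \sum_(0 <= M < K) qc R k l * v^-1 ^+ (2 * k + 1 - l) * T l M)).
    rewrite exchange_big; apply: eq_bigr => M _ /=; rewrite /W /skc mulr_sumr.
    apply: eq_bigr => l _; rewrite /T; case: leqP => lM; last by rewrite !mulr0.
    have e1 : v^-1 ^+ (2 * k + 1) = v^-1 ^+ (2 * k + 1 - l) * v^-1 ^+ l.
      by rewrite -exprD subnK //; have := ltn_ord l; lia.
    have e2 : v ^+ M = v ^+ (M - l) * v ^+ l by rewrite -exprD subnK.
    have e3 : v ^+ l * v^-1 ^+ l = 1 by rewrite -exprMn mulfV // expr1n.
    rewrite e1 e2; set a := v^-1 ^+ (_ - l) ; set b := (_)^-1; set c := v ^+ (M - l).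
    have -> : iIm M * d M * (c * v ^+ l) * (a * v^-1 ^+ l) * (qc R k l * b) =
      (v ^+ l * v^-1 ^+ l) * (iIm M * d M * c * a * qc R k l * b) by ring.
    by rewrite e3; ring.
  by move=> l _; rewrite mulr_sumr.
have W0 j : W (2 * j)%N = 0 by rewrite /W iIm_even !mul0r.
have W1 j : (j < k)%N -> W (2 * j + 1)%N = 0 by move=> jk; rewrite /W skc_eq0 ?mulr0.
have W2 i : W (2 * k + 1 + 2 * i)%N = (-1) ^+ (k + i) * pc k i * d (2 * k + 1 + 2 * i)%N * v ^+ (2 * i).
  rewrite /W skc_pc; have {1}-> : (2 * k + 1 + 2 * i = 2 * (k + i) + 1)%N by lia.
  rewrite iIm_odd [v ^+ (2 * k + 1 + 2 * i)]exprD [v ^+ (2 * k + 1) * _]mulrC.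
  have e : v ^+ (2 * k + 1) * v^-1 ^+ (2 * k + 1) = 1 by rewrite -exprMn mulfV // expr1n.
  set a := v ^+ (2 * k + 1) in e *; set b := v^-1 ^+ _ in e *.
  set s := (-1) ^+ _; set c := v ^+ (2 * i); set D := d _; set p := pc k i.
  have -> : s * D * (c * a) * b * p = (a * b) * (s * D * c * p) by ring.
  by rewrite e; ring.
have Z j : (j <= k)%N -> \sum_(0 <= i < 2 * j) W i = 0.
  elim: j => [|j IHj] jk; first by rewrite big_geq.
  have -> : (2 * j.+1 = (2 * j + 1).+1)%N by lia.
  by rewrite big_nat_recr //= W1 // addr0 addn1 big_nat_recr //= W0 addr0 IHj // ltnW.
(* Only the orders [2 * k + 1 + 2 * i] survive, so the desired partial sums form a subsequence of
   those of [W]. *)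
pose e K := (2 * k + 1 + 2 * K)%N.
have Ee K : series W (e K) = series (fun i => (-1) ^+ (k + i) * pc k i *
    d (2 * k + 1 + 2 * i)%N * v ^+ (2 * i)) K.
  elim: K => [|K IH].
    rewrite /e muln0 addn0 /series /= [RHS]big_geq //.
    rewrite addn1 big_nat_recr //= W0 addr0.
    exact: Z.
  have -> : e K.+1 = (e K).+2 by rewrite /e; lia.
  rewrite seriesSr seriesSr IH [RHS]seriesSr W2.
  have -> : (e K).+1 = (2 * (k + K + 1))%N by rewrite /e; lia.
  by rewrite W0 addr0.
move=> HW; have -> : series (fun i => (-1) ^+ (k + i) * pc k i *
    complex.Re (derive1n (2 * k + 1 + 2 * i) F u%:C) * v ^+ (2 * i)) = series W \o e.
  by apply/funext => K; rewrite /= Ee.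
apply: cvg_comp HW; apply/cvgnyPge => A; exists A => // K /= AK; rewrite /e; lia.
Qed.

(** Boundedness of the terms at [rho] makes everything after the first term at most a constant times
    [v]; continuity then fixes the value at 0, where [0 ^+ s] is 1 for [s = 0]. *)
Lemma even_series_limit (phi : R -> R) (b : nat -> R) (s : nat) (r : R) : 0 < r ->
  (forall v, 0 < v < r -> series (fun i => b i * v ^+ (2 * i + s)) @ \oo --> phi v) ->
  {for 0, continuous phi} -> phi 0 = b 0%N * 0 ^+ s.
Proof.
move=> r0 H cphi; pose rho := r / 2.
have [rho0 rhor] : 0 < rho /\ rho < r.
  by rewrite /rho divr_gt0 //= ltr_pdivrMr // ltr_pMr // ltr1n.
have rho2 : 0 < rho < r by rewrite rho0.
have [M M0 HM] : exists2 M, 0 < M & forall i, `|b i| * rho ^+ (2 * i + s) <= M.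
  have [K [_ HK]] := cvg_series_bounded (cvgP _ (H rho rho2)).
  exists (`|K| + 1) => [|i]; first by rewrite ltr_wpDl.
  have KK : K < `|K| + 1 by apply: le_lt_trans (ler_norm _) _; rewrite ltrDl.
  have := HK _ KK i Logic.I; rewrite /= normrM => h; apply: le_trans h.
  by rewrite (ger0_norm (exprn_ge0 _ (ltW rho0))).
have bound v : 0 < v <= rho / 2 -> `|phi v - b 0%N * v ^+ s| <= 2 * M * (v / rho).
  move=> /andP[v0 vr]; pose q := v / rho.
  have [q0 q2] : 0 <= q /\ q <= 2^-1.
    split; first by rewrite /q divr_ge0 // ltW.
    by rewrite /q ler_pdivrMr // mulrC.
  have q1 : q <= 1 by apply: le_trans q2 _; rewrite invf_le1 // ler1n.
  have vE j : v ^+ j = q ^+ j * rho ^+ j by rewrite -exprMn /q divfK // gt_eqF.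
  have partial N : `|series (fun i => b i * v ^+ (2 * i + s)) N.+1 - b 0%N * v ^+ s| <= 2 * M * q.
    rewrite /series /= big_nat_recl //= muln0 add0n addrAC subrr add0r.
    apply: le_trans (ler_norm_sum _ _ _) _.
    apply: (@le_trans _ _ (\sum_(0 <= i < N) M * q * (2^-1) ^+ i)).
      apply: ler_sum => i _; rewrite normrM vE.
      rewrite (ger0_norm (mulr_ge0 (exprn_ge0 _ q0) (exprn_ge0 _ (ltW rho0)))).
      rewrite mulrCA mulrC -[M * q * _]mulrA; apply: ler_pM => //.
      - by rewrite mulr_ge0 // exprn_ge0 // ltW.
      - by rewrite exprn_ge0.
      have -> : (2 * i.+1 + s = (i + (i + s + 1)).+1)%N by lia.
      rewrite exprS ler_wpM2l // exprD; apply: (@le_trans _ _ (q ^+ i)).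
        by rewrite ler_piMr ?exprn_ge0 // exprn_ile1.
      by apply: lerXn2r; rewrite ?nnegrE ?invr_ge0.
    have -> : 2 * M * q = M * q * 2 by ring.
    have Mq : 0 <= M * q := mulr_ge0 (ltW M0) q0.
    rewrite -mulr_sumr ler_wpM2l //.
    exact: geo_half.
  have v_r : 0 < v < r.
    rewrite v0 /=; apply: le_lt_trans vr _; apply: lt_trans rhor.
    by rewrite ltr_pdivrMr // ltr_pMr // ltr1n.
  apply/ler_addgt0Pl => eps eps0.
  have /cvgrPdist_lt/(_ _ eps0)[N0 _ HN0] := H v v_r.
  have h1 := HN0 N0.+1 (leqnSn _); have h2 := partial N0; move: h1 h2 => /=.
  set S := series _ _ => h1 h2.
  have -> : phi v - b 0%N * v ^+ s = (phi v - S) + (S - b 0%N * v ^+ s) by ring.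
  by apply: le_trans (ler_normD _ _) _; apply: lerD => //; exact: ltW.
apply/eqP; rewrite -subr_eq0; apply/negP => /negP ne.
pose psi v := phi v - b 0%N * v ^+ s.
have cpsi : {for 0, continuous psi}.
  apply: continuousB => //; apply: continuousM; first exact: cst_continuous.
  exact: exprn_continuous.
have e0 : 0 < `|psi 0| / 2 by rewrite divr_gt0 // normr_gt0.
have /cvgrPdist_lt/(_ _ e0)/nbhs_ballP[d d0 Hd] := cpsi.
pose v := Num.min (d / 2) (Num.min (rho / 2) (`|psi 0| / 2 / (2 * M) * rho)).
have v0 : 0 < v by rewrite !lt_min !divr_gt0 //= mulr_gt0 // divr_gt0 // mulr_gt0.
have [v1 v2 v3] : [/\ v <= d / 2, v <= rho / 2 & v <= `|psi 0| / 2 / (2 * M) * rho].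
  by split; rewrite /v !ge_min lexx ?orbT.
have := Hd v _; rewrite /ball /= sub0r normrN gtr0_norm // => /(_ _).
have dd : v < d by apply: le_lt_trans v1 _; rewrite ltr_pdivrMr // ltr_pMr // ltr1n.
move=> /(_ dd) h1.
have vb : 0 < v <= rho / 2 by rewrite v0.
have h2 := bound v vb; rewrite -/(psi v) in h2.
have h3 : 2 * M * (v / rho) <= `|psi 0| / 2.
  rewrite mulrA ler_pdivrMr // mulrC -ler_pdivlMr ?mulr_gt0 //.
  by rewrite mulrAC.
have := ler_normD (psi 0 - psi v) (psi v); rewrite subrK.
move: h1 h2 h3; set a := `|psi 0|; set b' := `|_ - _|; set c := `|psi v|; set D := 2 * M * _.
lra.
Qed.

End AxialSeries.

(** * The Gamma function *)

Section GammaFacts.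
Variable R : realType.
Notation mu := (@lebesgue_measure R).

Definition gint (p t : R) : R := t `^ p * expR (- t).

Lemma gint_ge0 p t : 0 <= gint p t.
Proof. by rewrite mulr_ge0 ?powR_ge0 // ltW ?expR_gt0. Qed.

Lemma gint_derive (x t : R) : 0 < x -> 0 < t ->
  is_derive t 1 (gint x) (gint (x - 1) t * (x - t)).
Proof.
move=> x0 t0; have H1 := is_derive1_powR x t0.
have H2 : is_derive t 1 (fun s : R => expR (- s)) (- expR (- t)).
  have := is_derive1_comp (is_derive_expR (- t)) (is_deriveN (is_derive_id t 1)).
  by rewrite /GRing.scale /= mulrN1.
have := is_deriveM H1 H2; rewrite /gint /GRing.scale /=.
set X := (X in is_derive _ _ _ X -> _); set Y := (Y in _ -> is_derive _ _ _ Y).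
by have -> : X = Y by rewrite /X /Y -(mulr_powRB1 (ltW t0) x0); ring.
Qed.

Lemma gint_cont p t : 0 < t -> {for t, continuous (gint p)}.
Proof.
move=> t0; apply: continuousM.
  apply: differentiable_continuous; apply/derivable1_diffP.
  by apply: derivable_powR; rewrite in_itv /= t0.
apply: continuous_comp; first exact: opp_continuous.
exact: continuous_expR.
Qed.

Lemma gint_right0 p : 0 <= p -> gint p t @[t --> 0^'+] --> gint p 0.
Proof.
move=> p0; apply: cvgM; last first.
  apply: cvg_at_right_filter; apply: continuous_comp; first exact: opp_continuous.
  exact: continuous_expR.
have [->|p1] := eqVneq p 0.
  rewrite powRr0 (_ : (fun t : R => t `^ 0) = fun=> 1); first exact: cvg_cst.
  by apply/funext => t; rewrite powRr0.
by rewrite powR0 //; apply: powR_cvg0; rewrite lt_neqAle eq_sym p1.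
Qed.

Lemma gint_within p : 0 <= p -> {within `[0, +oo[, continuous (gint p)}.
Proof.
move=> p0; apply/continuous_within_itvcyP; split; last exact: gint_right0.
by move=> t; rewrite in_itv /= andbT; exact: gint_cont.
Qed.

Lemma gint_lim p : gint p t @[t --> +oo] --> (0 : R).
Proof.
have [k pk] : exists k : nat, p <= k%:R.
  by exists (Num.bound `|p|); apply: le_trans (ler_norm p) (ltW (archi_boundP _)).
pose c : R := (k.+1)`!%:R.
have c0 : 0 < c by rewrite ltr0n fact_gt0.
apply/cvgrPdist_le => e e0; near=> t.
have t1 : 1 <= t by near: t; exact: nbhs_pinfty_ge.
have t2 : c / e <= t by near: t; apply: nbhs_pinfty_ge; rewrite num_real.
have t0 : 0 < t by apply: lt_le_trans t1.
rewrite sub0r normrN ger0_norm ?gint_ge0 // /gint expRN ler_pdivrMr ?expR_gt0 //.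
apply: (@le_trans _ _ (t ^+ k)); first by rewrite -powR_mulrn ?(ltW t0) // ler_powR.
apply: (@le_trans _ _ (e * (t ^+ k.+1 / c))).
  have -> : e * (t ^+ k.+1 / c) = t ^+ k * (t * e / c) by rewrite exprS; ring.
  by rewrite ler_peMr ?exprn_ge0 ?(ltW t0) // ler_pdivlMr // mul1r -ler_pdivrMr.
rewrite ler_pM2l //; apply: le_trans (expR_ge1Dxn k (ltW t0)); by rewrite lerDr.
Unshelve. all: by end_near. Qed.

Lemma gint_meas p (D : set R) : measurable D -> measurable_fun D (fun t => (gint p t)%:E).
Proof.
move=> mD; apply/measurable_EFinP; apply: measurable_funTS.
apply: measurable_funM; first exact: measurable_powR.
apply: continuous_measurable_fun => t; apply: continuous_comp; first exact: opp_continuous.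
exact: continuous_expR.
Qed.

(** Kept in the extended reals, where a nonnegative integrand always has an integral: the functional
    equation can then be proved before any convergence. *)
Definition GI p : \bar R := (\int[mu]_(t in `[0%R, +oo[) (gint p t)%:E)%E.

Lemma GammaE x : Gamma x = fine (GI (x - 1)).
Proof.
rewrite /Gamma /Rintegral /GI; congr fine; apply: integral_itv_obnd_cbnd.
exact: gint_meas.
Qed.

Lemma GI_split p x : 0 < x -> (GI p = \int[mu]_(t in `[0%R, x]) (gint p t)%:E +
  \int[mu]_(t in `[x, +oo[) (gint p t)%:E)%E.
Proof.
move=> x0; rewrite -[X in (_ = _ + X)%E]integral_itv_obnd_cbnd; last exact: gint_meas.
rewrite -ge0_integral_setU //=; last 3 first.
- by apply: gint_meas; exact: measurableU.
- by move=> t _; rewrite lee_fin gint_ge0.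
- apply/disj_setPLR => t /=; rewrite !in_itv /= => /andP[_ tx]; rewrite andbT => h.
  by move: (le_lt_trans tx h); rewrite ltxx.
congr integral; apply/seteqP; split=> t /=; rewrite !in_itv /= !andbT.
  by move=> ->; case: (leP t x) => _; [left|right].
by move=> [/andP[]//|]; move=> /ltW; apply: le_trans; exact: ltW.
Qed.

(** The derivative of [gint x] changes sign at [t = x]. Cutting there keeps every integrand
    nonnegative, so integration by parts needs no integrability; the boundary term [gint x x] is the
    same on both sides and cancels in [GI_rec]. *)
Lemma GI_upper x : 1 <= x -> (\int[mu]_(t in `[x, +oo[) (gint x t)%:E =
  x%:E * \int[mu]_(t in `[x, +oo[) (gint (x - 1) t)%:E + (gint x x)%:E)%E.
Proof.
move=> x1; have x0 : 0 < x by apply: lt_le_trans x1.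
have mD : measurable [set` `[x, +oo[ : interval R] by [].
pose g t := gint (x - 1) t * (t - x).
have g0 t : x <= t -> 0 <= g t by move=> xt; rewrite mulr_ge0 ?gint_ge0 ?subr_ge0.
have -> : (gint x x)%:E = (\int[mu]_(t in `[x, +oo[) (g t)%:E)%E.
  rewrite (@ge0_continuous_FTC2y R g (fun t => - gint x t) x 0) //.
  - by rewrite -EFinB opprK add0r.
  - apply/continuous_within_itvcyP; split.
      move=> t; rewrite in_itv /= andbT => xt; apply: continuousM.
        by apply: gint_cont; exact: lt_trans xt.
      by apply: continuousB => //; exact: cst_continuous.
    apply: cvg_at_right_filter; apply: cvgM; first exact: gint_cont.
    by apply: cvgB; [exact: cvg_id|exact: cvg_cst].
  - by rewrite -oppr0; apply: cvgN; exact: gint_lim.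
  - move=> t xt; apply: derivableN.
    by case: (@gint_derive x t x0 (lt_trans x0 xt)).
  - by apply: cvgN; apply: cvg_at_right_filter; exact: gint_cont.
  - move=> t; rewrite in_itv /= andbT => xt; rewrite derive1E.
    have H := is_deriveN (@gint_derive x t x0 (lt_trans x0 xt)).
    by rewrite (@derive_val _ _ _ _ _ _ _ H) /g -mulrN opprB.
have mg : measurable_fun `[x, +oo[ (fun t => (g t)%:E).
  apply/measurable_EFinP; apply: measurable_funM.
    by apply/measurable_EFinP; exact: gint_meas.
  by apply: measurable_funB => //; exact: measurable_cst.
rewrite -ge0_integralZl_EFin //; last 3 first.
- by move=> t _; rewrite lee_fin gint_ge0.
- exact: gint_meas.
- exact: ltW.
rewrite -ge0_integralD //; last 3 first.
- by move=> t _; rewrite -EFinM lee_fin mulr_ge0 ?gint_ge0 // ltW.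
- by apply: measurable_funeM; exact: gint_meas.
- by move=> t /=; rewrite in_itv /= andbT => xt; rewrite lee_fin g0.
apply: eq_integral => t; rewrite inE /= in_itv /= andbT => xt.
rewrite -EFinM -EFinD; congr EFin.
by rewrite /g /gint -(mulr_powRB1 (le_trans (ltW x0) xt) x0); ring.
Qed.

(** [1 <= x] ensures that [gint (x - 1)] is continuous from the right at 0, as the fundamental
    theorem requires on the closed interval. *)
Lemma GI_lower x : 1 <= x -> (x%:E * \int[mu]_(t in `[0%R, x]) (gint (x - 1) t)%:E =
  \int[mu]_(t in `[0%R, x]) (gint x t)%:E + (gint x x)%:E)%E.
Proof.
move=> x1; have x0 : 0 < x by apply: lt_le_trans x1.
pose g t := gint (x - 1) t * (x - t).
have g0 t : t <= x -> 0 <= g t by move=> xt; rewrite mulr_ge0 ?gint_ge0 ?subr_ge0.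
have -> : (gint x x)%:E = (\int[mu]_(t in `[0%R, x]) (g t)%:E)%E.
  rewrite (@continuous_FTC2 R g (gint x) 0 x) //.
  - have -> : gint x 0 = 0 by rewrite /gint powR0 ?mul0r // gt_eqF.
    by rewrite sube0.
  - have H : {within `[0, +oo[, continuous g}.
      apply/continuous_within_itvcyP; split.
        move=> t; rewrite in_itv /= andbT => xt; apply: continuousM; first exact: gint_cont.
        by apply: continuousB => //; exact: cst_continuous.
      apply: cvgM; first by apply: gint_right0; rewrite subr_ge0.
      by apply: cvg_at_right_filter; apply: cvgB; [exact: cvg_cst|exact: cvg_id].
    by apply: continuous_subspaceW H => t /=; rewrite !in_itv /= andbT => /andP[].
  - split.
    + move=> t; rewrite in_itv /= => /andP[t0 _].
      by case: (@gint_derive x t x0 t0).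
    + by apply: gint_right0; exact: ltW.
    + by apply: cvg_at_left_filter; exact: gint_cont.
  - move=> t; rewrite in_itv /= => /andP[t0 _]; rewrite derive1E.
    by have H := @gint_derive x t x0 t0; rewrite (@derive_val _ _ _ _ _ _ _ H).
have mg : measurable_fun `[0, x] (fun t => (g t)%:E).
  apply/measurable_EFinP; apply: measurable_funM.
    by apply/measurable_EFinP; exact: gint_meas.
  by apply: measurable_funB => //; exact: measurable_cst.
rewrite -ge0_integralZl_EFin //; last 3 first.
- by move=> t _; rewrite lee_fin gint_ge0.
- exact: gint_meas.
- exact: ltW.
rewrite -ge0_integralD //; last 3 first.
- by move=> t _; rewrite lee_fin gint_ge0.
- exact: gint_meas.
- by move=> t /=; rewrite in_itv /= => /andP[_ xt]; rewrite lee_fin g0.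
apply: eq_integral => t; rewrite inE /= in_itv /= => /andP[t0 xt].
rewrite -EFinM -EFinD; congr EFin.
by rewrite /g /gint -(mulr_powRB1 t0 x0); ring.
Qed.

Lemma GI_rec x : 1 <= x -> (GI x = x%:E * GI (x - 1))%E.
Proof.
move=> x1; have x0 : 0 < x by apply: lt_le_trans x1.
have ge0 D p : (0 <= \int[mu]_(t in D) (gint p t)%:E)%E.
  by apply: integral_ge0 => t _; rewrite lee_fin gint_ge0.
rewrite !(GI_split _ x0) ge0_muleDr // GI_upper // GI_lower //.
by rewrite -[RHS]addeA (addeC (gint x x)%:E).
Qed.

Lemma Gamma_rec (x : R) : 1 <= x -> Gamma (x + 1) = x * Gamma x.
Proof.
move=> x1; rewrite !GammaE addrK GI_rec //.
case: (GI (x - 1)) => [r| |] //=.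
  by rewrite gt0_muley ?mulr0 // lte_fin; apply: lt_le_trans x1.
by rewrite gt0_muleNy ?mulr0 // lte_fin; apply: lt_le_trans x1.
Qed.

Lemma gint0E : gint 0 = (fun t : R => expR (- t)).
Proof. by apply/funext => t; rewrite /gint powRr0 mul1r. Qed.

Lemma GI0 : GI 0 = 1%E.
Proof.
rewrite /GI (@ge0_continuous_FTC2y R _ (fun t => - expR (- t)) 0 0) //.
- by rewrite oppr0 expR0 -EFinB opprK add0r.
- by move=> t _; exact: gint_ge0.
- by apply: gint_within.
- by have H := gint_lim 0; rewrite gint0E in H; rewrite -[X in _ --> X]oppr0; apply: cvgN; exact: H.
- apply: cvgN; apply: cvg_at_right_filter; apply: continuous_comp; first exact: opp_continuous.
  exact: continuous_expR.
move=> t _; rewrite derive1E.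
have H2 : is_derive t 1 (fun s : R => expR (- s)) (- expR (- t)).
  have := is_derive1_comp (is_derive_expR (- t)) (is_deriveN (is_derive_id t 1)).
  by rewrite /GRing.scale /= mulrN1.
have H := is_deriveN H2; rewrite (@derive_val _ _ _ _ _ _ _ H) opprK.
by rewrite /gint powRr0 mul1r.
Qed.

Lemma Gamma_fact n : Gamma (n.+1%:R : R) = n`!%:R.
Proof.
elim: n => [|n IH]; first by rewrite GammaE subrr GI0.
by rewrite -natr1 Gamma_rec ?ler1n // IH factS natrM.
Qed.

(** At half-integers Gamma only has to be nonzero, because its values cancel; its exact value is not
    computed. The upper bound, from $\sqrt{t}\le 1+t$, matters as much as the lower one, since
    [fine] maps an infinite integral to 0. *)
Lemma Gamma_half_gt0 : 0 < Gamma (3 / 2 : R).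
Proof.
rewrite GammaE; have -> : 3 / 2 - 1 = 2^-1 :> R by field.
have GI1 : GI 1 = 1%E by rewrite GI_rec // subrr GI0 mule1.
have le2 : (GI 2^-1 <= 2%:E)%E.
  have -> : 2%:E = (GI 0 + GI 1)%E by rewrite GI0 GI1 -EFinD.
  rewrite /GI -ge0_integralD //; last 4 first.
  - by move=> t _; rewrite lee_fin gint_ge0.
  - exact: gint_meas.
  - by move=> t _; rewrite lee_fin gint_ge0.
  - exact: gint_meas.
  apply: ge0_le_integral => //.
  - by move=> t _; rewrite lee_fin gint_ge0.
  - exact: gint_meas.
  - by apply: emeasurable_funD; exact: gint_meas.
  move=> t /=; rewrite in_itv /= andbT => t0; rewrite -EFinD lee_fin /gint -mulrDl.
  rewrite ler_wpM2r ?(ltW (expR_gt0 _)) // powRr0 powRr1 // powR12_sqrt //.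
  by have := sqr_ge0 (Num.sqrt t - 1); rewrite sqrrB1 sqr_sqrtr //; have := sqrtr_ge0 t; lra.
have ge1 : ((expR (-1))%:E <= GI 2^-1)%E.
  have -> : (expR (-1))%:E = (\int[mu]_(t in `[1%R, +oo[) (gint 0 t)%:E)%E.
    rewrite (@ge0_continuous_FTC2y R _ (fun t => - expR (- t)) 1 0) //.
    - by rewrite -EFinB opprK add0r.
    - by move=> t _; exact: gint_ge0.
    - apply/continuous_within_itvcyP; split.
        by move=> t; rewrite in_itv /= andbT => t1; apply: gint_cont; exact: lt_trans t1.
      by apply: cvg_at_right_filter; exact: gint_cont.
    - by have H := gint_lim 0; rewrite gint0E in H; rewrite -[X in _ --> X]oppr0; apply: cvgN; exact: H.
    - apply: cvgN; apply: cvg_at_right_filter; apply: continuous_comp; first exact: opp_continuous.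
      exact: continuous_expR.
    move=> t _; rewrite derive1E.
    have H2 : is_derive t 1 (fun s : R => expR (- s)) (- expR (- t)).
      have := is_derive1_comp (is_derive_expR (- t)) (is_deriveN (is_derive_id t 1)).
      by rewrite /GRing.scale /= mulrN1.
    have H := is_deriveN H2; rewrite (@derive_val _ _ _ _ _ _ _ H) opprK.
    by rewrite /gint powRr0 mul1r.
  apply: (@le_trans _ _ (\int[mu]_(t in `[1%R, +oo[) (gint 2^-1 t)%:E)%E).
    apply: ge0_le_integral => //.
    - by move=> t _; rewrite lee_fin gint_ge0.
    - exact: gint_meas.
    - exact: gint_meas.
    move=> t /=; rewrite in_itv /= andbT => t1; rewrite lee_fin /gint.
    by rewrite ler_wpM2r ?(ltW (expR_gt0 _)) // ler_powR // invr_ge0.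
  apply: ge0_subset_integral => //.
  - exact: gint_meas.
  - by move=> t _; rewrite lee_fin gint_ge0.
  by move=> t /=; rewrite !in_itv /= !andbT; apply: le_trans.
apply: fine_gt0; apply/andP; split; first by apply: lt_le_trans ge1; rewrite lte_fin expR_gt0.
by apply: le_lt_trans le2 _; rewrite ltry.
Qed.

Lemma Gamma_half_odd_gt0 n : 0 < Gamma ((2 * n + 3)%:R / 2 : R).
Proof.
elim: n => [|n IH]; first exact: Gamma_half_gt0.
have -> : (2 * n.+1 + 3)%:R / 2 = (2 * n + 3)%:R / 2 + 1 :> R.
  have -> : (2 * n.+1 + 3 = (2 * n + 3) + 2)%N by lia.
  by rewrite natrD mulrDl divff // pnatr_eq0.
have h1 : 1 <= (2 * n + 3)%:R / 2 :> R by rewrite ler_pdivlMr // mul1r ler_nat; lia.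
by rewrite Gamma_rec // mulr_gt0 //; apply: lt_le_trans h1.
Qed.

End GammaFacts.

(** * The series of the extension operators *)

Section Coefficients.
Variables (R : realType) (n m : nat).
Hypothesis mE : m = (2 * n + 3)%N.

Lemma pc_rec k j : pc R k j.+1 = pc R k j / (2 * j.+1%:R * (2 * k + 2 * j + 3)%:R).
Proof.
rewrite /pc.
have -> : (2 * k + 1 + 2 * j.+1 = (2 * k + 1 + 2 * j).+2)%N by lia.
have -> : (k + j.+1 = (k + j).+1)%N by lia.
rewrite !factS !natrM.
have -> : (2 * k + 1 + 2 * j).+2 = (2 * k + 2 * j + 3)%N by lia.
have -> : ((2 * k + 1 + 2 * j).+1 = 2 * (k + j).+1)%N by lia.
rewrite natrM.
have h1 : (k + j).+1%:R != 0 :> R by rewrite pnatr_eq0.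
have h2 : j.+1%:R != 0 :> R by rewrite pnatr_eq0.
have h3 : (2 * k + 2 * j + 3)%:R != 0 :> R by rewrite pnatr_eq0 addn3.
have h4 := fact_neq0 R j; have h5 := fact_neq0 R (2 * k + 1 + 2 * j).
move: (k + j).+1%:R j.+1%:R (2 * k + 2 * j + 3)%:R j`!%:R (2 * k + 1 + 2 * j)`!%:R h1 h2 h3 h4 h5.
by move=> a b c d e a0 b0 c0 d0 e0; field; rewrite a0 b0 c0 d0 e0.
Qed.

Lemma pc_succ k j : pc R k.+1 j = 2 * j.+1%:R * pc R k j.+1.
Proof.
rewrite /pc.
have -> : (2 * k.+1 + 1 + 2 * j = 2 * k + 1 + 2 * j.+1)%N by lia.
have -> : (k.+1 + j = k + j.+1)%N by lia.
rewrite factS natrM exprS.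
have h2 : j.+1%:R != 0 :> R by rewrite pnatr_eq0.
have h4 := fact_neq0 R j; have h5 := fact_neq0 R (2 * k + 1 + 2 * j.+1).
move: j.+1%:R j`!%:R (2 * k + 1 + 2 * j.+1)`!%:R h2 h4 h5.
by move=> b d e b0 d0 e0; field; rewrite b0 d0 e0.
Qed.

Lemma m_half : m%:R / 2 = (2 * n + 3)%:R / 2 :> R. Proof. by rewrite mE. Qed.

Lemma m_half_ge1 j : 1 <= m%:R / 2 + j%:R :> R.
Proof.
apply: (@le_trans _ _ (m%:R / 2)); last by rewrite lerDl.
by rewrite m_half ler_pdivlMr // mul1r ler_nat; lia.
Qed.

Lemma Gamma_m_gt0 j : 0 < Gamma (m%:R / 2 + j%:R : R).
Proof.
elim: j => [|j IH]; first by rewrite addr0 m_half Gamma_half_odd_gt0.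
rewrite -[j.+1%:R]natr1 addrA Gamma_rec ?m_half_ge1 // mulr_gt0 //.
by apply: lt_le_trans (m_half_ge1 j).
Qed.

(** The origin of $\gamma_m$: it is [hcst] times the coefficient of $f^{(2n+1)}$ in $T_nf$ on the
    axis. The Gamma value is the factorial of [n.+1]. *)
Lemma gammaE : gamma_const R m = hcst R n * ((-1) ^+ n * pc R n 0).
Proof.
rewrite /gamma_const.
have -> : m.-1 = (2 * n.+1)%N by rewrite mE; lia.
have -> : (2 * n.+1)./2 = n.+1 by rewrite mul2n doubleK.
have -> : m.+1%:R / 2 = n.+2%:R :> R.
  have -> : m.+1 = (2 * n.+2)%N by rewrite mE; lia.
  by rewrite natrM mulrAC divff ?mul1r // pnatr_eq0.
rewrite Gamma_fact /hcst /pc addn0 muln0 addn0 fact0 mul1r.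
have -> : (2 * n.+1 = (2 * n + 1).+1)%N by lia.
rewrite !factS !natrM.
have -> : (2 * n + 1).+1 = (2 * n.+1)%N by lia.
have -> : 2 ^+ (2 * n.+1) = 2 ^+ n.+1 * 2 ^+ n.+1 :> R by rewrite -exprD; congr (_ ^+ _); lia.
rewrite natrM [(-1) ^+ n.+1]exprS [2 ^+ n.+1]exprS.
have h1 : n.+1%:R != 0 :> R by rewrite pnatr_eq0.
have h5 := fact_neq0 R (2 * n + 1).
move: n.+1%:R n`!%:R (2 * n + 1)`!%:R (2 ^+ n) ((-1) ^+ n) h1 h5.
by move=> b c e p s b0 e0; field; rewrite b0 e0.
Qed.

Lemma hcst_neq0 : hcst R n != 0.
Proof. by rewrite oppr_eq0 mulf_neq0 ?fact_neq0 // expf_neq0 // pnatr_eq0. Qed.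

Lemma gamma_neq0 : gamma_const R m != 0.
Proof.
rewrite gammaE !mulf_neq0 ?hcst_neq0 ?invr_neq0 ?mulf_neq0 ?fact_neq0 //.
by rewrite expf_neq0 // oppr_eq0 oner_eq0.
Qed.

(** Both sides agree at 0 by [gammaE] and are multiplied by $-1/(4(j+1)(\frac m2+j))$ when $j$
    increases by one, on the left through the functional equation of Gamma and on the right through
    [pc_rec]. *)
Lemma gck_coef0 j : gamma_const R m * Gamma (m%:R / 2) *
   ((-1) ^+ j / (2 ^+ (2 * j) * j`!%:R * Gamma (m%:R / 2 + j%:R))) =
  hcst R n * ((-1) ^+ (n + j) * pc R n j).
Proof.
elim: j => [|j IH].
  rewrite muln0 addr0 addn0 fact0 !expr0 !mul1r mulfK ?gammaE //.
  by have := Gamma_m_gt0 0; rewrite addr0 => /gt_eqF ->.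
rewrite pc_rec addnS [(-1) ^+ _.+1]exprS [_ ^+ (n + j).+1]exprS mulrA.
have g0 := Gamma_m_gt0 j; have hx := m_half_ge1 j.
have e : m%:R / 2 + j.+1%:R = m%:R / 2 + j%:R + 1 :> R by rewrite -[j.+1%:R]natr1 addrA.
rewrite e Gamma_rec // factS natrM.
have -> : 2 ^+ (2 * j.+1) = 4 * 2 ^+ (2 * j) :> R.
  by have -> : (2 * j.+1 = (2 * j).+2)%N; [lia|rewrite !exprS; ring].
have xE : (2 * n + 2 * j + 3)%:R = 2 * (m%:R / 2 + j%:R) :> R.
  have -> : (2 * n + 2 * j + 3 = m + 2 * j)%N by lia.
  by rewrite natrD natrM; field.
rewrite xE; set x := m%:R / 2 + j%:R in g0 hx IH *.
have x0 : x != 0 by rewrite gt_eqF //; apply: lt_le_trans hx.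
have j0 : j.+1%:R != 0 :> R by rewrite pnatr_eq0.
have -> : hcst R n * (-1 * (-1) ^+ (n + j) * (pc R n j / (2 * j.+1%:R * (2 * x)))) =
  hcst R n * ((-1) ^+ (n + j) * pc R n j) * (- (2 * j.+1%:R * (2 * x))^-1) by ring.
rewrite -IH; have p0 : 2 ^+ (2 * j) != 0 :> R by rewrite expf_neq0 // pnatr_eq0.
have f0 := fact_neq0 R j; have {}g0 : Gamma x != 0 by rewrite gt_eqF.
move: (gamma_const R m) (Gamma (m%:R / 2)) (Gamma x) (2 ^+ (2 * j)) ((-1) ^+ j) j`!%:R j.+1%:R g0 p0 f0 j0.
move=> a b c d s t k c0 d0 t0 k0; field.
by rewrite x0 k0 c0 t0 d0.
Qed.

(** The coefficients of the vector part at [j] are those of the scalar part at [j.+1], up to the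
    factor that [pc_succ] isolates. *)
Lemma gck_coef1 j : gamma_const R m * Gamma (m%:R / 2) / 2 *
   ((-1) ^+ j / (2 ^+ (2 * j) * j`!%:R * Gamma (m%:R / 2 + j%:R + 1))) =
  - hcst R n * ((-1) ^+ (n.+1 + j) * pc R n.+1 j).
Proof.
have H := gck_coef0 j.+1.
have e : m%:R / 2 + j.+1%:R = m%:R / 2 + j%:R + 1 :> R by rewrite -[j.+1%:R]natr1 addrA.
rewrite e in H; rewrite pc_succ addSnnS.
have -> : - hcst R n * ((-1) ^+ (n + j.+1) * (2 * j.+1%:R * pc R n j.+1)) =
  - (2 * j.+1%:R) * (hcst R n * ((-1) ^+ (n + j.+1) * pc R n j.+1)) by ring.
rewrite -H factS natrM.
have -> : 2 ^+ (2 * j.+1) = 4 * 2 ^+ (2 * j) :> R.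
  by have -> : (2 * j.+1 = (2 * j).+2)%N; [lia|rewrite !exprS; ring].
rewrite [(-1) ^+ j.+1]exprS.
have g0 : Gamma (m%:R / 2 + j%:R + 1) != 0 :> R.
  by have := Gamma_m_gt0 j.+1; rewrite e => /gt_eqF ->.
have j0 : j.+1%:R != 0 :> R by rewrite pnatr_eq0.
have p0 : 2 ^+ (2 * j) != 0 :> R by rewrite expf_neq0 // pnatr_eq0.
have f0 := fact_neq0 R j.
move: (gamma_const R m) (Gamma (m%:R / 2)) (Gamma (_ + 1)) (2 ^+ (2 * j)) ((-1) ^+ j) j`!%:R j.+1%:R g0 p0 f0 j0.
move=> a b c d s t k c0 d0 t0 k0; field.
by rewrite k0 c0 t0 d0.
Qed.

End Coefficients.

(** * Restriction of intrinsic functions to the real axis *)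

Section RealTrace.
Variable R : realType.
Local Notation C := R[i].

Lemma near_real (Om : set R[i]^o) (t : R) : copen Om -> Om t%:C -> \forall s \near t, Om s%:C.
Proof.
move=> oOm /oOm[r r0 Hr]; apply/nbhs_ballP; exists r => // s ts; apply: Hr.
by have -> : s%:C - t%:C = (s - t)%:C; [rewrite rmorphB|rewrite cabsr distrC].
Qed.

Lemma real_derive1 (F : C -> C) (t : R) l : cderiv F t%:C l ->
  is_derive t 1 (fun s : R => complex.Re (F s%:C)) (complex.Re l).
Proof.
move=> H; have [] := chain_complex (is_derive_id t 1) (is_derive_cst (0 : R) t 1) H.
by rewrite -[1 +i* 0]/(1 : C) mulr1.
Qed.

Lemma real_derive1n (Om : set R[i]^o) (F : R[i]^o -> R[i]^o) (c : R) (a : R -> R) N t :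
  copen Om -> holomorphic_on Om F ->
  (forall t, Om t%:C -> a t = c * complex.Re (F t%:C)) -> Om t%:C ->
  derive1n N a t = c * complex.Re (derive1n N F t%:C).
Proof.
move=> oOm HF Ha; elim: N t => [|N IH] t Ot; first exact: Ha.
rewrite [in LHS]derive1nS derive1E.
have H := is_deriveZ c (real_derive1 (cderiv_derive1n oOm HF N Ot)).
rewrite -[RHS](@derive_val _ _ _ _ _ _ _ H); apply: near_eq_derive.
by apply: filterS (near_real oOm Ot) => s; exact: IH.
Qed.

Lemma intrinsic_real (Om : set R[i]^o) F (t : R) : intrinsic_holomorphic Om F -> Om t%:C ->
  complex.Im (F t%:C) = 0.
Proof.
move=> [_ H] Ot; have [_] := H t 0 Ot; rewrite -[t -i* 0]/(t +i* (- 0)) oppr0.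
by move=> /eqP; rewrite -addr_eq0 -mulr2n mulrn_eq0 /= => /eqP.
Qed.

(** For [m = 0] there is one index set only, so a single function is a family and [fam_dfam]
    applies. *)
Lemma intrinsic_derive1 (Om : set R[i]^o) F : copen Om -> csym Om ->
  intrinsic_holomorphic Om F -> intrinsic_holomorphic Om (derive1 F).
Proof. by move=> oOm sOm HF; exact: (@fam_dfam R 0 Om (fun=> F) oOm sOm (fun=> HF) finset.set0). Qed.

Lemma intrinsic_derive1n (Om : set R[i]^o) F N : copen Om -> csym Om ->
  intrinsic_holomorphic Om F -> intrinsic_holomorphic Om (derive1n N F).
Proof.
move=> oOm sOm HF; elim: N => [|N IH]; first exact: HF.
by rewrite derive1nS; exact: (intrinsic_derive1 oOm sOm IH).
Qed.

Lemma series_at0 (b : nat -> R) : series (fun i => b i * 0 ^+ (2 * i)) @ \oo --> b 0%N.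
Proof.
rewrite -(cvg_shiftn 1).
have -> : [sequence series (fun i => b i * 0 ^+ (2 * i)) (K + 1)%N]_K = fun=> b 0%N.
  apply/funext => K /=; rewrite addn1 /series /= big_nat_recl //= muln0 expr0 mulr1.
  by rewrite big1 ?addr0 // => i _; rewrite mulnS expr0n /= mulr0.
exact: cvg_cst.
Qed.

Lemma cvg_seriesZ (c : R) (u : nat -> R) (l : R) : series u @ \oo --> l ->
  series (fun i => c * u i) @ \oo --> c * l.
Proof.
move=> H; have -> : series (fun i => c * u i) = (fun K => c * series u K).
  by apply/funext => K; rewrite /series /= mulr_sumr.
by apply: cvgM => //; exact: cvg_cst.
Qed.

End RealTrace.

(** * Series for the images of slice functions, including the axis *)

Section Sums.
Variables (R : realType) (m n : nat).
Local Notation C := R[i].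
Local Notation Cl := (clifford R m).
Local Notation point := 'rV[R]_m.+1.
Hypothesis mE : m = (2 * n + 3)%N.

Let m0 : (0 < m)%N. Proof. by rewrite mE addn3. Qed.

Lemma enorm_coord (w : 'rV[R]_m) j : `|w ord0 j| <= enorm w.
Proof.
rewrite -[`|_|]ger0_norm // -sqrtr_sqr /enorm ler_wsqrtr //.
rewrite real_normK ?num_real // (bigD1 j) //= lerDl sumr_ge0 // => k _; exact: sqr_ge0.
Qed.

Lemma line_cont (G : point -> Cl) u (w : 'rV[R]_m) A : enorm w = 1 -> cana G (mkpoint u 0) ->
  {for 0, continuous (fun v : R => G (mkpoint u (v *: w)) A)}.
Proof.
move=> w1 cG; have := differentiable_continuous (ana_differentiable (cG A)) => cc.
change ((fun v : R => G (mkpoint u (v *: w)) A) @ (0 : R) --> G (mkpoint u ((0 : R) *: w)) A).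
rewrite scale0r => P /cc /nbhs_small[d d0 Hd].
apply/nbhs_ballP; exists d => // v; rewrite /ball /= sub0r normrN => vd.
have -> : mkpoint u (v *: w) = mkpoint u 0 + mkpoint 0 (v *: w).
  by apply/rowP => i; rewrite !mxE; case: unliftP => [j _|_]; rewrite ?mxE ?add0r ?addr0.
apply: Hd => i; rewrite mxE; case: unliftP => [j _|_]; last by rewrite normr0 ltW.
rewrite mxE normrM; apply: le_trans (ltW vd); rewrite ler_piMr //.
by rewrite -w1; exact: enorm_coord.
Qed.

Variables (Om : set R[i]^o) (f : {set 'I_m} -> R[i]^o -> R[i]^o).
Hypotheses (oOm : copen Om) (sOm : csym Om) (Hf : fam_holo Om f).

Definition tser (k : nat) (g : {set 'I_m} -> R[i]^o -> R[i]^o) (x : point) A (i : nat) : R :=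
  (-1) ^+ (k + i) * pc R k i * complex.Re (derive1n (2 * k + 1 + 2 * i) (g A) (sc x)%:C) *
  enorm (vc x) ^+ (2 * i).

Lemma axpf_series k g x A : fam_holo Om g -> slice_domain m (taylor_core Om) x -> vc x != 0 ->
  series (tser k g x A) @ \oo --> axpf k g (sc x) (enorm (vc x)) A.
Proof.
move=> Hg /slice_domainP => /(_ m0 (@core_sym _ _)) /taylor_coreP[rho /= h1 h2] x0.
have r0 : 0 < enorm (vc x) by rewrite enorm_gt0.
rewrite ffunE; apply: (axp_series (Hg A).1 oOm h2).
  by rewrite r0 /=; apply: le_lt_trans (ler_norm _) h1.
move=> N; apply: (intrinsic_real (intrinsic_derive1n N oOm sOm (Hg A))); apply: h2.
have : cabs ((sc x)%:C - (sc x)%:C) < rho by rewrite subrr cabs0; apply: le_lt_trans h1.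
exact.
Qed.

Lemma core_slice x : slice_domain m (taylor_core Om) x -> slice_domain m Om x.
Proof.
move=> /slice_domainP => /(_ m0 (@core_sym _ _)) /core_sub Oz.
by apply/slice_domainP.
Qed.

Lemma core_line x (w : 'rV[R]_m) : enorm w = 1 -> vc x = 0 ->
  slice_domain m (taylor_core Om) x ->
  exists2 rho : R, 0 < rho & forall v : R, `|v| < rho ->
    slice_domain m (taylor_core Om) (mkpoint (sc x) (v *: w)).
Proof.
move=> w1 x0 /slice_domainP => /(_ m0 (@core_sym _ _)) /taylor_coreP[rho /= h1 h2].
exists rho; first exact: le_lt_trans h1.
by move=> v vr; exists (sc x), v, w; split=> //; apply/taylor_coreP; exists rho.
Qed.

(** At a point of the axis [G] is approached along a line in the direction [w]. There the values are
    sums of even power series in [v], and [even_series_limit] identifies their limit with the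
    constant term. *)
Lemma series_extend k g (G : point -> Cl) c x : fam_holo Om g ->
  (forall y, slice_domain m Om y -> cana G y) ->
  (forall y, slice_domain m Om y -> vc y != 0 -> G y = c *: radial (axpf k g) y) -> c != 0 ->
  slice_domain m (taylor_core Om) x ->
  exists T : Cl, G x = c *: T /\ forall A, series (tser k g x A) @ \oo --> T A.
Proof.
move=> Hg cG GE c0 Cx; have Ox := core_slice Cx.
have [x0|x0] := eqVneq (vc x) 0; last first.
  by exists (radial (axpf k g) x); split=> [|A]; [exact: GE|exact: axpf_series].
have [w w1] := unit_vector R m0.
have xE : x = mkpoint (sc x) 0 by rewrite -x0 mk_scvc.
have [rho rho0 Hrho] := core_line w1 x0 Cx.
have r0 : enorm (vc x) = 0 by apply/eqP; rewrite enorm_eq0 x0.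
exists (c^-1 *: G x); split=> [|A]; first by rewrite scalerA mulfV // scale1r.
rewrite /tser r0 ffunE.
pose b i := (-1) ^+ (k + i) * pc R k i * complex.Re (derive1n (2 * k + 1 + 2 * i) (g A) (sc x)%:C).
have H v : 0 < v < rho -> series (fun i => c * b i * v ^+ (2 * i + 0)) @ \oo -->
    G (mkpoint (sc x) (v *: w)) A.
  move=> /andP[v0 vr]; have vr' : `|v| < rho by rewrite gtr0_norm.
  have Cv := Hrho v vr'; have vw : enorm (v *: w) = v by rewrite enormZ w1 mulr1 gtr0_norm.
  have v1 : vc (mkpoint (sc x) (v *: w)) != 0 by rewrite vc_mk -enorm_eq0 vw gt_eqF.
  rewrite GE ?ffunE //; last exact: core_slice.
  have := @cvg_seriesZ _ c _ _ (@axpf_series k g _ A Hg Cv v1).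
  rewrite /tser /radial ffunE !sc_mk !vc_mk vw.
  set u1 := series _; set u2 := series _; suff -> : u1 = u2 by [].
  by rewrite /u1 /u2; congr series; apply/funext => i; rewrite /b addn0; ring.
have cx : cana G (mkpoint (sc x) 0) by rewrite -xE; exact: cG.
have := even_series_limit rho0 H (line_cont w1 cx); rewrite scale0r -xE expr0 mulr1 => ->.
by rewrite mulKf //; exact: series_at0.
Qed.

Lemma dfam_derive1n (g : {set 'I_m} -> R[i]^o -> R[i]^o) N A :
  derive1n N (dfam g A) = derive1n N.+1 (g A).
Proof. exact: derive1nSr. Qed.

Lemma lapD_series x : slice_domain m (taylor_core Om) x ->
  exists T : Cl, lapD (slice_fam f) x = hcst R n *: T /\
    forall A, series (tser n f x A) @ \oo --> T A.
Proof.
move=> Cx; apply: (series_extend Hf _ _ (hcst_neq0 _ _) Cx).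
  by move=> y Oy; apply: cana_lapD; exact: (cana_slice_fam mE oOm sOm Hf).
by move=> y Oy y0; exact: (lapD_off mE oOm sOm Hf).
Qed.

Lemma partial0_series x : slice_domain m (taylor_core Om) x ->
  exists T : Cl, partial ord0 (lapD (slice_fam f)) x = hcst R n *: T /\
    forall A, series (tser n (dfam f) x A) @ \oo --> T A.
Proof.
move=> Cx; have Hdf := fam_dfam oOm sOm Hf.
apply: (series_extend Hdf _ _ (hcst_neq0 _ _) Cx).
  move=> y Oy; apply: cana_partial; apply: cana_lapD.
  exact: (cana_slice_fam mE oOm sOm Hf).
by move=> y Oy y0; exact: (partial0_lapD mE oOm sOm Hf).
Qed.

(** Off the axis the image is [onevec] times a function of the radius, so its values at opposite
    points cancel. By continuity twice the value on the axis is 0. *)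
Lemma Dvec_lapD_axis x : slice_domain m (taylor_core Om) x -> vc x = 0 ->
  Dvec (lapD (slice_fam f)) x = 0.
Proof.
move=> Cx x0; have Ox := core_slice Cx; set G := Dvec _.
have xE : x = mkpoint (sc x) 0 by rewrite -x0 mk_scvc.
have cG : cana G x.
  by apply: cana_Dvec; apply: cana_lapD; exact: (cana_slice_fam mE oOm sOm Hf).
have [w w1] := unit_vector R m0; have nw1 : enorm (- w) = 1 by rewrite enormN.
have [rho rho0 Hrho] := core_line w1 x0 Cx.
apply/ffunP => A; rewrite [RHS]ffunE.
pose phi v := G (mkpoint (sc x) (v *: w)) A + G (mkpoint (sc x) (v *: - w)) A.
have H v : 0 < v < rho -> series (fun i => 0 * v ^+ (2 * i + 0)) @ \oo --> phi v.
  move=> /andP[v0 vr]; have vr' : `|v| < rho by rewrite gtr0_norm.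
  have vw : enorm (v *: w) = v by rewrite enormZ w1 mulr1 gtr0_norm.
  have nvw : enorm (v *: - w) = v by rewrite enormZ nw1 mulr1 gtr0_norm.
  have Cv := core_slice (Hrho v vr').
  have Cv' : slice_domain m Om (mkpoint (sc x) (v *: - w)).
    have vr2 : `|- v| < rho by rewrite normrN.
    by have := core_slice (Hrho (- v) vr2); rewrite scaleNr -scalerN.
  have -> : phi v = 0.
    rewrite /phi /G (Dvec_lapD mE oOm sOm Hf Cv); last by rewrite vc_mk -enorm_eq0 vw gt_eqF.
    rewrite (Dvec_lapD mE oOm sOm Hf Cv'); last by rewrite vc_mk -enorm_eq0 nvw gt_eqF.
    rewrite /radial !sc_mk !vc_mk vw nvw !onevecZ onevecN scalerN mulNr [X in _ + X]ffunE.
    by rewrite subrr.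
  have -> : series (fun i => 0 * v ^+ (2 * i + 0)) = fun=> 0.
    by apply/funext => K; rewrite /series /= big1 // => i _; rewrite mul0r.
  exact: cvg_cst.
have c0 : {for 0, continuous phi}.
  by apply: continuousD; apply: line_cont; rewrite -?xE.
have := even_series_limit rho0 H c0; rewrite mul0r /phi !scale0r -xE.
by move=> /eqP; rewrite -mulr2n mulrn_eq0 /= => /eqP.
Qed.

Lemma Dvec_series x : slice_domain m (taylor_core Om) x ->
  exists T : Cl, Dvec (lapD (slice_fam f)) x = onevec (vc x) * (hcst R n *: T) /\
    forall A, series (tser n.+1 f x A) @ \oo --> T A.
Proof.
move=> Cx; have [x0|x0] := eqVneq (vc x) 0.
  pose b A i := (-1) ^+ (n.+1 + i) * pc R n.+1 i *
    complex.Re (derive1n (2 * n.+1 + 1 + 2 * i) (f A) (sc x)%:C).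
  exists [ffun A => b A 0%N]; split=> [|A]; first by rewrite Dvec_lapD_axis // x0 onevec0 mul0r.
  have r0 : enorm (vc x) = 0 by apply/eqP; rewrite enorm_eq0 x0.
  rewrite [[ffun _ => _] A]ffunE.
  have -> : tser n.+1 f x A = (fun i => b A i * 0 ^+ (2 * i)) by rewrite /tser r0.
  exact: series_at0.
exists (radial (axpf n.+1 f) x); split=> [|A]; last exact: axpf_series.
by apply: (Dvec_lapD mE oOm sOm Hf) => //; exact: core_slice.
Qed.

End Sums.

(** * Extensions of prescribed data *)

Section Solutions.
Variables (R : realType) (m n : nat).
Local Notation C := R[i].
Local Notation Cl := (clifford R m).
Local Notation point := 'rV[R]_m.+1.
Hypothesis mE : m = (2 * n + 3)%N.

Let m0 : (0 < m)%N. Proof. by rewrite mE addn3. Qed.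

Lemma core_sc (Om : set R[i]^o) (x : point) : slice_domain m (taylor_core Om) x -> Om (sc x)%:C.
Proof.
move=> /slice_domainP => /(_ m0 (@core_sym _ _)) /taylor_coreP[rho /= h1 h2]; apply: h2.
have : cabs ((sc x)%:C - (sc x)%:C) < rho by rewrite subrr cabs0; apply: le_lt_trans h1.
exact.
Qed.

Lemma derive1nD (a b : nat) (V : normedModType R[i]) (F : R[i]^o -> V) :
  derive1n a (derive1n b F) = derive1n (a + b) F.
Proof. by elim: a => [|a IH] //; rewrite addSn !derive1nS IH. Qed.

Section Terms.
Variables (Om : set R[i]^o) (f : {set 'I_m} -> R[i]^o -> R[i]^o).
Hypotheses (oOm : copen Om) (sOm : csym Om) (Hf : fam_holo Om f).

(** The datum [a] is a multiple of the derivative of order [N] of [f A], and the series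
    differentiates it [o j] times more; the total must be the order occurring in [tser]. Both rows
    of the diagram and both of their components are instances. *)
Lemma series_terms k N (o : nat -> nat) (a : R -> R) A (D : nat -> R) d x (T : R) :
  slice_domain m (taylor_core Om) x ->
  (forall t, Om t%:C -> a t = gamma_const R m * complex.Re (derive1n N (f A) t%:C)) ->
  (forall j, o j + N = 2 * k + 1 + 2 * j)%N ->
  (forall j, gamma_const R m * ((-1) ^+ j / D j) = d * ((-1) ^+ (k + j) * pc R k j)) ->
  series (tser k f x A) @ \oo --> T ->
  series (fun j => (-1) ^+ j * enorm (vc x) ^+ (2 * j) / D j * derive1n (o j) a (sc x))
    @ \oo --> d * T.
Proof.
move=> Cx Ha Ho HD /(@cvg_seriesZ _ d _ _); set u := fun i => _; set v := fun i => _.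
suff -> : u = v by [].
apply/funext => j; rewrite /u /v /tser.
have HF := (intrinsic_derive1n N oOm sOm (Hf A)).1.
rewrite (real_derive1n (o j) oOm HF Ha (core_sc Cx)) derive1nD Ho.
set y := complex.Re _.
have -> : (-1) ^+ j * enorm (vc x) ^+ (2 * j) / D j * (gamma_const R m * y) =
  gamma_const R m * ((-1) ^+ j / D j) * enorm (vc x) ^+ (2 * j) * y by ring.
by rewrite HD; ring.
Qed.

End Terms.

Let Gam_neq0 : Gamma (m%:R / 2 : R) != 0.
Proof. by have := Gamma_m_gt0 R mE 0; rewrite addr0 => /gt_eqF ->. Qed.

Lemma coefD1 j : gamma_const R m *
   ((-1) ^+ j / (2 ^+ (2 * j) * j`!%:R * Gamma (m%:R / 2 + j%:R))) =
  (Gamma (m%:R / 2))^-1 * hcst R n * ((-1) ^+ (n + j) * pc R n j).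
Proof.
rewrite -[RHS]mulrA -(@gck_coef0 R n m mE j).
by move: (_ / (_ * Gamma _)) (gamma_const R m) (Gamma _) Gam_neq0 => a b c c0; field.
Qed.

Lemma coefD2 j : gamma_const R m *
   ((-1) ^+ j / (2 ^+ (2 * j) * j`!%:R * Gamma (m%:R / 2 + j%:R + 1))) =
  - (2 / Gamma (m%:R / 2)) * hcst R n * ((-1) ^+ (n.+1 + j) * pc R n.+1 j).
Proof.
have -> : - (2 / Gamma (m%:R / 2)) * hcst R n * ((-1) ^+ (n.+1 + j) * pc R n.+1 j) =
  2 / Gamma (m%:R / 2) * (- hcst R n * ((-1) ^+ (n.+1 + j) * pc R n.+1 j)) by ring.
rewrite -(@gck_coef1 R n m mE j).
move: ((-1) ^+ j / _) (gamma_const R m) (Gamma (m%:R / 2)) Gam_neq0 => a b c c0.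
by field.
Qed.

Lemma HGCK_terms0 Om f (A0 : R -> Cl) x (T : Cl) : copen Om -> csym Om -> fam_holo Om f ->
  slice_domain m (taylor_core Om) x ->
  (forall t A, Om t%:C -> A0 t A =
     gamma_const R m * complex.Re (derive1n (2 * n + 1) (f A) t%:C)) ->
  (forall A, series (tser n f x A) @ \oo --> T A) ->
  cl_sum (fun j =>
        ((-1) ^+ j * enorm (vc x) ^+ (2 * j) /
         (2 ^+ (2 * j) * j`!%:R * Gamma (m%:R / 2 + j%:R)))
        *: cl_derive (2 * j) A0 (sc x)) ((Gamma (m%:R / 2))^-1 * hcst R n *: T).
Proof.
move=> oOm sOm Hf Cx HA HT A.
have -> : ((Gamma (m%:R / 2))^-1 * hcst R n *: T) A = (Gamma (m%:R / 2))^-1 * hcst R n * T A.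
  by rewrite ffunE.
under eq_fun do rewrite !ffunE.
apply: (series_terms oOm sOm Hf Cx (N := (2 * n + 1)%N) (k := n)) => //.
- by move=> t Ot; exact: HA.
- by move=> j; rewrite addnC.
- exact: coefD1.
Qed.

Lemma HGCK_terms1 Om f (a : R -> Cl) x (T : Cl) N (o : nat -> nat) : copen Om -> csym Om -> fam_holo Om f ->
  slice_domain m (taylor_core Om) x ->
  (forall t A, Om t%:C -> a t A = gamma_const R m * complex.Re (derive1n N (f A) t%:C)) ->
  (forall j, o j + N = 2 * n.+1 + 1 + 2 * j)%N ->
  (forall A, series (tser n.+1 f x A) @ \oo --> T A) ->
  cl_sum (fun j =>
        ((-1) ^+ j * enorm (vc x) ^+ (2 * j) /
         (2 ^+ (2 * j) * j`!%:R * Gamma (m%:R / 2 + j%:R + 1)))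
        *: cl_derive (o j) a (sc x)) (- (2 / Gamma (m%:R / 2)) * hcst R n *: T).
Proof.
move=> oOm sOm Hf Cx HA Ho HT A.
have -> : (- (2 / Gamma (m%:R / 2)) * hcst R n *: T) A = - (2 / Gamma (m%:R / 2)) * hcst R n * T A.
  by rewrite ffunE.
under eq_fun do rewrite !ffunE.
apply: (series_terms oOm sOm Hf Cx (N := N) (k := n.+1)) => //.
- by move=> t Ot; exact: HA.
- exact: coefD2.
Qed.

Lemma HGCK_lapD Om f (A0 A1 : R -> Cl) x : copen Om -> csym Om -> fam_holo Om f ->
  (forall t A, Om t%:C -> A0 t A =
     gamma_const R m * complex.Re (derive1n (2 * n + 1) (f A) t%:C)) ->
  (forall t, Om t%:C -> A1 t = 0) ->
  slice_domain m (taylor_core Om) x -> HGCK_sum A0 A1 x (lapD (slice_fam f) x).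
Proof.
move=> oOm sOm Hf H0 H1 Cx; have [T [-> HT]] := lapD_series mE oOm sOm Hf Cx.
exists ((Gamma (m%:R / 2))^-1 * hcst R n *: T), 0; split.
- exact: (HGCK_terms0 oOm sOm Hf Cx H0 HT).
- move=> A; rewrite ffunE.
  have hh : holomorphic_on Om (fun=> 0) by move=> z _; exact: derivable_cst.
  have ha t : Om t%:C -> A1 t A = 0 * complex.Re ((fun=> 0 : R[i]) t%:C).
    by move=> /H1 ->; rewrite ffunE mul0r.
  under eq_fun do rewrite !ffunE (real_derive1n _ oOm hh ha (core_sc Cx)) mul0r mulr0.
  have -> : series (fun=> 0) = fun=> 0 :> R.
    by apply/funext => K; rewrite /series /= big1.
  exact: cvg_cst.
- by rewrite mulr0 scaler0 addr0 scalerA mulrA mulfV // mul1r.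
Qed.

Lemma HGCK_solution Om f k (A0 A1 : R -> Cl) : copen Om -> csym Om -> fam_holo Om f ->
  fam_holo Om k ->
  (forall t A, Om t%:C -> A0 t A =
     gamma_const R m * complex.Re (derive1n (2 * n + 1) (f A) t%:C)) ->
  (forall t A, Om t%:C -> A1 t A =
     gamma_const R m * complex.Re (derive1n (2 * n + 3) (k A) t%:C)) ->
  exists h : point -> Cl, AH Om h /\
    forall x, slice_domain m (taylor_core Om) x -> HGCK_sum A0 A1 x (h x).
Proof.
move=> oOm sOm Hf Hk H0 H1.
(* The factor [- m%:R] is the product of [m%:R / 2] in [HGCK_sum] and the [- 2] of [coefD2]. *)
exists (fun x => 1 *: lapD (slice_fam f) x + (- m%:R) *: Dvec (lapD (slice_fam k)) x); split.
  apply: (AH_comb _ _ m0 oOm sOm); first exact: (AH_lapD mE oOm sOm Hf).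
  by apply: (AH_Dvec m0 oOm sOm); exact: (AH_lapD mE oOm sOm Hk).
move=> x Cx; have [T [-> HT]] := lapD_series mE oOm sOm Hf Cx.
have [T1 [-> HT1]] := Dvec_series mE oOm sOm Hk Cx.
exists ((Gamma (m%:R / 2))^-1 * hcst R n *: T), (- (2 / Gamma (m%:R / 2)) * hcst R n *: T1).
split.
- exact: (HGCK_terms0 oOm sOm Hf Cx H0 HT).
- apply: (HGCK_terms1 oOm sOm Hk Cx H1) HT1 => j; lia.
- rewrite [1 *: _]scale1r scalerDr !scalerA mulrA mulfV // mul1r; congr (_ + _).
  rewrite -!scalerAr !scalerA; congr (_ *: _).
  rewrite -[_ *: 2^-1]/(_ * 2^-1); move: Gam_neq0; set g := Gamma _.
  by move: g (hcst R n) m%:R => a b c a0; field.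
Qed.

(** The two series arise separately: [partial ord0] supplies the derivatives of [f0] of even order
    and [- Dvec] those of odd order. *)
Lemma GCK_lapD Om f (f0 : R -> Cl) x : copen Om -> csym Om -> fam_holo Om f ->
  (forall t A, Om t%:C -> f0 t A =
     gamma_const R m * complex.Re (derive1n (2 * n + 2) (f A) t%:C)) ->
  slice_domain m (taylor_core Om) x -> GCK_sum f0 x (Dbar (lapD (slice_fam f)) x).
Proof.
move=> oOm sOm Hf H0 Cx; have [T [e HT]] := partial0_series mE oOm sOm Hf Cx.
have [T1 [e1 HT1]] := Dvec_series mE oOm sOm Hf Cx; rewrite /Dbar e e1.
exists ((Gamma (m%:R / 2))^-1 * hcst R n *: T), (- (2 / Gamma (m%:R / 2)) * hcst R n *: T1).
split.
- apply: (HGCK_terms0 oOm sOm (fam_dfam oOm sOm Hf) Cx _ HT) => t A Ot.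
  by rewrite dfam_derive1n -addnS; exact: H0.
- apply: (HGCK_terms1 oOm sOm Hf Cx H0) HT1 => j; lia.
- rewrite scalerDr !scalerA mulrA mulfV // mul1r; congr (_ + _).
  rewrite -!scalerAr !scalerA -scaleNr; congr (_ *: _).
  by move: (Gamma _) (hcst R n) Gam_neq0 => a b a0; field.
Qed.

End Solutions.

(** * Uniqueness of sums and locality of the axial form *)

Section Unicity.
Variables (R : realType) (m : nat).
Local Notation Cl := (clifford R m).
Local Notation point := 'rV[R]_m.+1.

Lemma cl_sum_uniq (u : nat -> Cl) s t : cl_sum u s -> cl_sum u t -> s = t.
Proof. by move=> hs ht; apply/ffunP => A; exact: (cvg_unique _ (hs A) (ht A)). Qed.

Lemma HGCK_sum_uniq (A0 A1 : R -> Cl) x s t : HGCK_sum A0 A1 x s -> HGCK_sum A0 A1 x t -> s = t.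
Proof.
move=> [s0 [s1 [h0 h1 ->]]] [t0 [t1 [k0 k1 ->]]].
by rewrite (cl_sum_uniq h0 k0) (cl_sum_uniq h1 k1).
Qed.

Lemma GCK_sum_uniq (f0 : R -> Cl) x s t : GCK_sum f0 x s -> GCK_sum f0 x t -> s = t.
Proof.
move=> [s0 [s1 [h0 h1 ->]]] [t0 [t1 [k0 k1 ->]]].
by rewrite (cl_sum_uniq h0 k0) (cl_sum_uniq h1 k1).
Qed.

(** A slice domain over a symmetric [V] contains the whole sphere through each of its points, so one
    local function already gives the axial form on that sphere. *)
Lemma axial_analytic_local (U : set R[i]^o) (h : point -> Cl) : (0 < m)%N -> csym U ->
  (forall x, slice_domain m U x -> exists V g,
     [/\ copen V, csym V, slice_domain m V x, axial_analytic V g &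
       forall y, slice_domain m V y -> h y = g y]) -> axial_analytic U h.
Proof.
move=> m0 sU H; apply: axial_analytic_intro => //.
  move=> x /H[V [g [oV sV Vx Hg hg]]].
  apply: eq_cana (axial_analytic_cana Hg Vx).
  by apply: filterS (near_slice m0 sV oV Vx) => y /hg.
move=> u v Uuv v0; have [w w1] := unit_vector R m0.
have Ux : slice_domain m U (mkpoint u (v *: w)) by exists u, v, w.
have [V [g [oV sV Vx [_ [al [be [_ _ _ Hg]]]] hg]]] := H _ Ux.
have zE w' : enorm w' = 1 -> slice_domain m V (mkpoint u (v *: w')).
  move=> w'1; move: Vx => /slice_domainP => /(_ m0 sV); rewrite zof_mk // gtr0_norm // => Vz.
  by exists u, v, w'.
exists (al u v), (be u v) => w' w'1; have Vw := zE w' w'1.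
rewrite hg // Hg // /axial sc_mk vc_mk enormZ w'1 mulr1 gtr0_norm //.
by rewrite onevecZ scalerA mulVf ?scale1r // gt_eqF.
Qed.

End Unicity.

(** * Primitives on discs *)

Section Primitives.
Variable R : realType.
Local Notation C := R[i].

Lemma cderivJ (F : C -> C) z l : cderiv F (conjc z) l ->
  cderiv (fun z => conjc (F (conjc z))) z (conjc l).
Proof.
move=> H e e0; have [d d0 Hd] := H e e0; exists d => // t td.
have := Hd (conjc t); rewrite cabsJ => /(_ td); rewrite -[cabs (_ - _ - _)]cabsJ.
by rewrite !rmorphB !rmorphM !rmorphD /= !conjcK.
Qed.

(** The average of a function and its Schwarz reflection. It turns holomorphic functions into
    intrinsic ones and preserves real values on the real axis. *)
Definition symm (F : C -> C) z := (2^-1)%:C * (F z + conjc (F (conjc z))).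

Lemma symm_cderiv (F : C -> C) z l k : cderiv F z l -> cderiv F (conjc z) k ->
  cderiv (symm F) z ((2^-1)%:C * (l + conjc k)).
Proof. by move=> h1 h2; apply: cderivZ; apply: cderivD => //; exact: cderivJ. Qed.

Lemma symm_intrinsic (Om : set R[i]^o) (F : R[i]^o -> R[i]^o) : csym Om -> holomorphic_on Om F ->
  intrinsic_holomorphic Om (symm F).
Proof.
move=> sOm /holomorphicP HF; split.
  apply: holo_intro => z Oz; have h1 := HF z Oz; have h2 := HF _ (sOm z Oz).
  by eexists; exact: symm_cderiv h1 h2.
move=> u v _; have e : symm F (u -i* v) = conjc (symm F (u +i* v)).
  rewrite /symm -[u -i* v]/(conjc (u +i* v)) conjcK.
  by case: (F _) (F _) => a b [c d]; apply: complex_eq => /=; ring.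
by rewrite e; case: (symm F _).
Qed.

Lemma complex_half (z : C) : (2^-1)%:C * (z + z) = z.
Proof. by case: z => a b; apply: complex_eq => /=; field. Qed.

Lemma symm_fix (f : C -> C) z : f (conjc z) = conjc (f z) -> symm f z = f z.
Proof. by move=> e; rewrite /symm e conjcK complex_half. Qed.

Lemma sum_linear_geo (x : R) N : 0 <= x < 1 ->
  \sum_(0 <= k < N) k.+1%:R * x ^+ k <= (1 - x) ^- 2.
Proof.
move=> /andP[x0 x1]; have x2 : 0 < (1 - x) ^+ 2 by rewrite exprn_gt0 // subr_gt0.
rewrite -[leRHS]mul1r ler_pdivlMr //.
have -> : (\sum_(0 <= k < N) k.+1%:R * x ^+ k) * (1 - x) ^+ 2 =
    1 - x ^+ N * (1 + N%:R * (1 - x)).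
  elim: N => [|N IH]; first by rewrite big_geq //; ring.
  by rewrite big_nat_recr //= mulrDl IH [x ^+ N.+1]exprS -[N.+1%:R]natr1; ring.
by rewrite gerBl mulr_ge0 ?exprn_ge0 // addr_ge0 // mulr_ge0 // subr_ge0 ltW.
Qed.

Section Antiderivative.
Variables (a : nat -> C) (f : C -> C) (rho : R).
Hypothesis Hf : forall h, cabs h < rho -> csum_to a h (f h).

Definition primc n : C := if n is k.+1 then a k / k.+1%:R else 0.

Lemma cabs_nat n : cabs (n%:R : C) = n%:R.
Proof. by rewrite -(rmorph_nat (@real_complex R)) cabsr normr_nat. Qed.

Lemma cabs_primc k : k.+1%:R * cabs (primc k.+1) = cabs (a k).
Proof. by rewrite -cabs_nat -cabsM mulrC divfK // pnatr_eq0. Qed.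

Lemma primc_bound (s M : R) : 0 < s -> (forall n, cabs (a n) * s ^+ n <= M) ->
  forall n, cabs (primc n) * s ^+ n <= M * s.
Proof.
move=> s0 HM; have M0 := csum_bound_ge0 HM; case=> [|k].
  by rewrite cabs0 mul0r mulr_ge0 // ltW.
rewrite exprSr mulrA ler_pM2r //; apply: le_trans (HM k).
rewrite ler_wpM2r ?exprn_ge0 ?(ltW s0) // -cabs_primc ler_peMl ?cabs_ge0 //.
by rewrite ler1n.
Qed.

Lemma csum_ex (b : nat -> C) (s M : R) h : 0 < s -> (forall n, cabs (b n) * s ^+ n <= M) ->
  cabs h < s -> exists l, csum_to b h l.
Proof.
move=> s0 HM hs; have M0 := csum_bound_ge0 HM.
have q1 : 0 <= cabs h / s < 1 by rewrite divr_ge0 ?cabs_ge0 ?(ltW s0) //= ltr_pdivrMr ?mul1r.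
have B n : cabs (b n * h ^+ n) <= M * (cabs h / s) ^+ n.
  have q0 := divr_ge0 (cabs_ge0 h) (ltW s0).
  have := ler_wpM2r (exprn_ge0 n q0) (HM n).
  by rewrite -mulrA -exprMn [s * _]mulrC divfK ?gt_eqF // cabsM cabsX.
have G := bsum_geo M0 q1.
have nn n : 0 <= M * (cabs h / s) ^+ n by apply: le_trans (B n); exact: cabs_ge0.
have [S1 H1] : exists S, hsum (fun n => complex.Re (b n * h ^+ n)) S.
  apply: bsum_hsum; apply: le_bsum G => n; rewrite [leRHS]ger0_norm //.
  by apply: le_trans (B n); exact: cabs_Re.
have [S2 H2] : exists S, hsum (fun n => complex.Im (b n * h ^+ n)) S.
  apply: bsum_hsum; apply: le_bsum G => n; rewrite [leRHS]ger0_norm //.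
  by apply: le_trans (B n); exact: cabs_Im.
exists (S1 +i* S2) => e e0; have e2 : 0 < e / 2 by rewrite divr_gt0.
have /cvgrPdist_le/(_ _ e2)[N1 _ HN1] := hsum_series H1.
have /cvgrPdist_le/(_ _ e2)[N2 _ HN2] := hsum_series H2.
exists (maxn N1 N2) => N; rewrite geq_max => /andP[n1 n2].
have := HN1 N n1; have := HN2 N n2; set S := \sum_(0 <= j < N) _.
have -> : series (fun k => complex.Re (b k * h ^+ k)) N = complex.Re S.
  by rewrite /series /S /=; elim/big_ind2: _ => //= x1 x2 y1 y2 -> ->; rewrite cReD.
have -> : series (fun k => complex.Im (b k * h ^+ k)) N = complex.Im S.
  by rewrite /series /S /=; elim/big_ind2: _ => //= x1 x2 y1 y2 -> ->; rewrite cImD.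
move=> h2 h1; apply: le_trans (cabs_le _) _.
rewrite cReD cImD cReN cImN /= distrC [X in _ + X]distrC.
by rewrite [leRHS](splitr e) lerD.
Qed.

(** No fixed fraction of the radius may be lost, since the primitive is needed on the whole disc.
    The estimate therefore uses radii [q < s] strictly between [cabs h] and [rho]; division by
    [j.+1] in the primitive leaves only the linear factor of [sum_linear_geo]. *)
Lemma primc_cderiv F h : (forall h, cabs h < rho -> csum_to (primc) h (F h)) ->
  cabs h < rho -> cderiv F h (f h).
Proof.
move=> HF hr.
have aux (q s M c k : R) j : q != 0 -> s != 0 ->
    q ^+ 2 * (M / q * c * (k * (q / s) ^+ j)) = M * (k * (q ^+ j.+1 / s ^+ j) * c).
  move=> q0 /(expf_neq0 j); rewrite expr_div_n [q ^+ j.+1]exprS.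
  by move: (q ^+ j) (s ^+ j) => y z z0; field; rewrite q0 z0.
pose q := (2 * cabs h + rho) / 3; pose s := (cabs h + 2 * rho) / 3.
have h0 := cabs_ge0 h.
have hq : cabs h < q by rewrite /q; lra.
have qs : q < s by rewrite /q /s; lra.
have sr : s < rho by rewrite /s; lra.
have q0 : 0 < q by lra.
have s0 : 0 < s by lra.
have [|M HM] := csum_bound _ Hf (s := s); first by rewrite s0.
have M0 := csum_bound_ge0 HM.
have x1 : 0 <= q / s < 1 by rewrite divr_ge0 ?(ltW q0) ?(ltW s0) //= ltr_pdivrMr ?mul1r.
pose K := M * (1 - q / s) ^- 2 / q.
have K0 : 0 <= K by rewrite !mulr_ge0 ?invr_ge0 ?exprn_ge0 ?subr_ge0 ?(ltW q0) //; case/andP: x1 => _ /ltW.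
have Q t N : cabs (h + t) <= q ->
    cabs (\sum_(0 <= j < N.+1) primc j * (h + t) ^+ j - \sum_(0 <= j < N.+1) primc j * h ^+ j -
      t * \sum_(0 <= j < N) a j * h ^+ j) <= K * cabs t ^+ 2.
  move=> ht; rewrite !big_nat_recl //= !mul0r !add0r mulr_sumr -!sumrB.
  apply: le_trans (cabs_sum _ _) _; rewrite /K -mulrA -mulrA mulrA.
  have -> : M / (1 - q / s) ^+ 2 * (q^-1 * cabs t ^+ 2) =
     (M * q^-1 * cabs t ^+ 2) * (1 - q / s) ^- 2 by ring.
  apply: le_trans (ler_wpM2l _ (sum_linear_geo N x1)); last first.
    exact: mulr_ge0 (divr_ge0 M0 (ltW q0)) (sqr_ge0 _).
  rewrite mulr_sumr; apply: ler_sum => j _.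
  have j0 : j.+1%:R != 0 :> C by rewrite pnatr_eq0.
  have -> : a j / j.+1%:R * (h + t) ^+ j.+1 - a j / j.+1%:R * h ^+ j.+1 - t * (a j * h ^+ j) =
     primc j.+1 * ((h + t) ^+ j.+1 - h ^+ j.+1 - j.+1%:R * h ^+ j.+1.-1 * t).
    by rewrite /=; move: j.+1%:R j0 => k k0; field.
  rewrite cabsM -(ler_pM2l (exprn_gt0 2 q0)) mulrCA.
  apply: le_trans (ler_wpM2l (cabs_ge0 _) (cpow_quad j.+1 (ltW hq) ht)) _.
  have -> : cabs (primc j.+1) * (j.+1%:R ^+ 2 * q ^+ j.+1 * cabs t ^+ 2) =
    j.+1%:R * cabs (primc j.+1) * (j.+1%:R * q ^+ j.+1 * cabs t ^+ 2) by ring.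
  rewrite cabs_primc.
  have -> : q ^+ 2 * (M / q * cabs t ^+ 2 * (j.+1%:R * (q / s) ^+ j)) =
     M * (j.+1%:R * (q ^+ j.+1 / s ^+ j) * cabs t ^+ 2).
    by apply: aux; rewrite gt_eqF.
  have -> : cabs (a j) * (j.+1%:R * q ^+ j.+1 * cabs t ^+ 2) =
     (cabs (a j) * s ^+ j) * (j.+1%:R * (q ^+ j.+1 / s ^+ j) * cabs t ^+ 2).
    by field; rewrite gt_eqF ?exprn_gt0.
  apply: ler_wpM2r; last exact: HM.
  by rewrite !mulr_ge0 ?invr_ge0 ?exprn_ge0 ?(ltW q0) ?(ltW s0) // cabs_ge0.
move=> e e0; have K1 : 0 < K + 1 by rewrite ltr_wpDl.
exists (Num.min (q - cabs h) (e / (K + 1))); first by rewrite lt_min subr_gt0 hq divr_gt0.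
move=> t; rewrite lt_min => /andP[t1 t2].
have ht : cabs (h + t) <= q by apply: le_trans (cabsD _ _) _; lra.
have htr : cabs (h + t) < rho by lra.
apply: (@le_trans _ _ (K * cabs t ^+ 2)).
  apply/ler_addgt0Pr => x x0; have x3 : 0 < x / 3 by rewrite divr_gt0.
  have y0 : 0 < x / 3 / (cabs t + 1) by rewrite divr_gt0 // ltr_wpDl ?cabs_ge0.
  have [N1 HN1] := HF _ hr _ x3; have [N2 HN2] := HF _ htr _ x3.
  have [N3 HN3] := Hf hr y0.
  pose N := maxn N1 (maxn N2 N3).
  have n1 : (N1 <= N)%N by rewrite leq_maxl.
  have n2 : (N2 <= N)%N by rewrite !leq_max leqnn orbT.
  have n3 : (N3 <= N)%N by rewrite !leq_max leqnn !orbT.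
  move: (HN1 N.+1 (leqW n1)) (HN2 N.+1 (leqW n2)) (HN3 N n3) (Q t N ht).
  set S1 := \sum_(0 <= j < _) _; set S2 := \sum_(0 <= j < _) _; set S3 := \sum_(0 <= j < _) _.
  move=> L1 L2 L3 L4.
  have -> : F (h + t) - F h - t * f h = (S2 - S1 - t * S3) + ((S1 - F h) + t * (S3 - f h) - (S2 - F (h + t))).
    by ring.
  apply: le_trans (cabsD _ _) _; apply: lerD => //.
  apply: le_trans (cabsB _ _) _; apply: le_trans (lerD (cabsD _ _) (lexx _)) _.
  have L5 : cabs (t * (S3 - f h)) <= x / 3.
    rewrite cabsM; apply: le_trans (ler_wpM2l (cabs_ge0 _) L3) _.
    rewrite mulrCA ler_piMr ?(ltW x3) // ler_pdivrMr ?mul1r ?lerDl //.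
    by rewrite ltr_wpDl ?cabs_ge0.
  have -> : x = x / 3 + x / 3 + x / 3 by field.
  by rewrite lerD // lerD.
rewrite expr2 mulrA ler_wpM2r ?cabs_ge0 // mulrC.
move: t2; rewrite ltr_pdivlMr // => /ltW; apply: le_trans.
by rewrite ler_wpM2l ?lerDl // cabs_ge0.
Qed.

Lemma antiderivative : exists F, forall h, cabs h < rho -> cderiv F h (f h).
Proof.
have /choice[F HF] : forall h, exists l, cabs h < rho -> csum_to primc h l.
  move=> h; case: (ltP (cabs h) rho) => hr; last by exists 0.
  pose s := (cabs h + rho) / 2; have h0 := cabs_ge0 h.
  have hs : cabs h < s by rewrite /s; lra.
  have s0 : 0 < s by lra.
  have sr : s < rho by rewrite /s; lra.
  have [|M HM] := csum_bound _ Hf (s := s); first by rewrite s0.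
  by have [l Hl] := csum_ex s0 (primc_bound s0 HM) hs; exists l.
by exists F => h hr; exact: primc_cderiv.
Qed.

End Antiderivative.

(** The centre is real, so the disc is symmetric and a primitive can be made intrinsic by [symm];
    its derivative is still [f], because [f] commutes with conjugation. *)
Lemma disc_primitives (u rho : R) : intrinsic_primitives (cball u%:C rho : set R[i]^o).
Proof.
case: (ltP 0 rho) => rho0; last first.
  move=> f Hf; exists f; split=> // z; rewrite /cball /= => zr.
  by have := le_lt_trans (cabs_ge0 _) zr; rewrite ltNge rho0.
move=> f Hf; have [c Hc] := holo_taylor Hf.1 rho0 (@subset_refl _ _).
have [G HG] := antiderivative Hc.
pose F z := G (- u%:C + z).
have HF z : cball u%:C rho z -> cderiv F z (f z).
  move=> zr; have zE : u%:C + (- u%:C + z) = z by rewrite addrA subrr add0r.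
  by apply/cderiv_shift; rewrite -[X in cderiv _ _ (f X)]zE; apply: HG; rewrite addrC.
have hF : holomorphic_on (cball u%:C rho : set R[i]^o) F.
  by apply: holo_intro => z zr; exists (f z); exact: HF.
exists (symm F); split; first exact: symm_intrinsic (@csym_cball _ _ _) hF.
move=> z zr; have zr' := @csym_cball _ u rho z zr.
rewrite (cderiv_derive1 (symm_cderiv (HF z zr) (HF _ zr'))).
rewrite (intrinsic_conj (@csym_cball _ u rho) Hf zr) conjcK; exact: complex_half.
Qed.

Lemma iter_primitives (D : set R[i]^o) N f : copen D -> intrinsic_primitives D ->
  intrinsic_holomorphic D f -> exists F, intrinsic_holomorphic D F /\
    forall z, D z -> derive1n N F z = f z.
Proof.
move=> oD pD; elim: N f => [|N IH] f Hf; first by exists f.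
have [F0 [H0 E0]] := IH f Hf; have [F [HF E]] := pD F0 H0.
exists F; split=> // z Dz; rewrite -derive1nSr -E0 //.
by have [r r0 Hr] := oD z Dz; apply: (derive1n_near _ r0) => w /Hr; exact: E.
Qed.

Definition extends_intrinsic (D : set R[i]^o) (a : R -> R) :=
  exists F, intrinsic_holomorphic D F /\ forall t, D t%:C -> F t%:C = (a t)%:C.

Lemma intrinsicZ (D : set R[i]^o) (c : R) G : intrinsic_holomorphic D G ->
  intrinsic_holomorphic D (fun z => c%:C * G z).
Proof.
move=> [HG EG]; split.
  move: HG => /holomorphicP HG; apply: holo_intro => z Dz.
  by eexists; apply: cderivZ; exact: HG.
move=> u v Dz; have [e1 e2] := EG u v Dz.
by rewrite !cReM !cImM /= !mul0r !subr0 !addr0 e1 e2 mulrN.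
Qed.

Lemma real_primitive (D : set R[i]^o) N c a : copen D -> intrinsic_primitives D -> c != 0 ->
  extends_intrinsic D a -> exists F, intrinsic_holomorphic D F /\
    forall t, D t%:C -> a t = c * complex.Re (derive1n N F t%:C).
Proof.
move=> oD pD c0 [G [HG EG]].
have [F [HF EF]] := iter_primitives N oD pD (intrinsicZ c^-1 HG).
exists F; split=> // t Dt; rewrite EF // EG // -rmorphM /=.
by rewrite mulrA divff // mul1r.
Qed.

Lemma calA_extends (Om : set R[i]^o) a : csym Om -> calA Om a -> extends_intrinsic Om a.
Proof.
move=> sOm [_ [F [[HF EF] _]]]; exists (symm F); split; first exact: symm_intrinsic.
by move=> t Ot; rewrite symm_fix ?EF //= oppr0 ?EF //= oppr0.
Qed.

Lemma extends_sub (D Om : set R[i]^o) a : D `<=` Om -> extends_intrinsic Om a -> extends_intrinsic D a.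
Proof.
move=> sub [F [[HF EF] E]]; exists F; split; last by move=> t /sub; exact: E.
by split; [exact: holo_sub HF|move=> u v /sub; exact: EF].
Qed.

End Primitives.

(** * Analytic data on the real trace and their derivatives *)

Section CalA.
Variable R : realType.
Local Notation C := R[i].

Lemma calA_intro (Om : set R[i]^o) F a : copen Om -> connected Om -> (exists t : R, Om t%:C) ->
  holomorphic_on Om F -> (forall t, Om t%:C -> F t%:C = (a t)%:C) -> calA Om a.
Proof.
move=> oOm cOm rOm HF EF; split=> [t Ot|].
  apply/analytic_atP; have [r r0 Hr] := oOm _ Ot.
  have HB : holomorphic_on (cball t%:C r) F by exact: holo_sub HF.
  have g1 : ana (fun p : 'rV[R]_1 => p ord0 ord0) (const_mx t) by exact: ana_coord.
  have g2 : ana (fun p : 'rV[R]_1 => 0 : R) (const_mx t) by exact: ana_cst.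
  have [|H _] := ana_holo r0 HB g1 g2; first by rewrite mxE.
  apply: eq_ana H; apply/nbhs_small.
  have [d d0 Hd] := near_real oOm Ot; have d2 : 0 < d / 2 by rewrite divr_gt0.
  exists (d / 2) => // h hd; rewrite -[_ +i* 0]/(((const_mx t + h) ord0 ord0)%:C) EF //; apply: Hd.
  rewrite /ball_ /= !mxE opprD addNKr normrN; apply: le_lt_trans (hd ord0) _.
  by rewrite ltr_pdivrMr // ltr_pMr // ltr1n.
exists F; split=> [//|G [HG EG] z Oz]; apply/subr0_eq.
have HGF : holomorphic_on Om (fun z => G z - F z).
  move: HF HG => /holomorphicP HF /holomorphicP HG.
  by apply: holo_intro => w Ow; eexists; apply: cderivB; [exact: HG|exact: HF].
have GF t : Om t%:C -> G t%:C - F t%:C = 0 by move=> Ot; rewrite EF // EG // subrr.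
exact: (holo_identity oOm cOm HGF rOm GF Oz).
Qed.

Lemma calA_derive1n (Om : set R[i]^o) N c a : copen Om -> connected Om -> (exists t : R, Om t%:C) ->
  csym Om -> calA Om a -> calA Om (fun t => c * derive1n N a t).
Proof.
move=> oOm cOm rOm sOm /(calA_extends sOm)[F [HF EF]].
have HN := intrinsicZ c (intrinsic_derive1n N oOm sOm HF).
apply: (calA_intro oOm cOm rOm HN.1) => t Ot.
have Ha s : Om s%:C -> a s = 1 * complex.Re (F s%:C) by move=> /EF ->; rewrite mul1r.
rewrite (real_derive1n N oOm HF.1 Ha Ot) mul1r rmorphM; congr (_ * _).
by apply: complex_eq => //=; exact: (intrinsic_real (intrinsic_derive1n N oOm sOm HF) Ot).
Qed.

End CalA.

(** * Existence of the extensions *)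

Section Existence.
Variables (R : realType) (m n : nat).
Local Notation C := R[i].
Local Notation Cl := (clifford R m).
Local Notation point := 'rV[R]_m.+1.
Hypothesis mE : m = (2 * n + 3)%N.

Let m0 : (0 < m)%N. Proof. by rewrite mE addn3. Qed.

Lemma slice_mono (D Om : set R[i]^o) (x : point) : D `<=` Om ->
  slice_domain m D x -> slice_domain m Om x.
Proof. by move=> sub [u [v [w [/sub h1 h2 h3]]]]; exists u, v, w. Qed.

Definition cl_extends (D : set R[i]^o) (f0 : R -> Cl) :=
  forall A, extends_intrinsic D (fun t => f0 t A).

Lemma fam_primitive (D : set R[i]^o) N (f0 : R -> Cl) : copen D -> intrinsic_primitives D ->
  cl_extends D f0 -> exists f, fam_holo D f /\ forall t A, D t%:C ->
    f0 t A = gamma_const R m * complex.Re (derive1n N (f A) t%:C).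
Proof.
move=> oD pD H; have /choice[f Hf] A := real_primitive N oD pD (gamma_neq0 R mE) (H A).
by exists f; split=> [A|t A Dt]; [exact: (Hf A).1|exact: (Hf A).2].
Qed.

Lemma HGCK_exists (D : set R[i]^o) (A0 A1 : R -> Cl) : copen D -> csym D ->
  intrinsic_primitives D -> cl_extends D A0 -> cl_extends D A1 ->
  exists h : point -> Cl, AH D h /\
    forall x, slice_domain m (taylor_core D) x -> HGCK_sum A0 A1 x (h x).
Proof.
move=> oD sD pD H0 H1; have [f [Hf Ef]] := fam_primitive (2 * n + 1) oD pD H0.
have [k [Hk Ek]] := fam_primitive (2 * n + 3) oD pD H1.
exact: (HGCK_solution mE oD sD Hf Hk).
Qed.

Lemma GCK_exists (D : set R[i]^o) (f0 : R -> Cl) : copen D -> csym D ->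
  intrinsic_primitives D -> cl_extends D f0 ->
  exists h : point -> Cl, AM D h /\
    forall x, slice_domain m (taylor_core D) x -> GCK_sum f0 x (h x).
Proof.
move=> oD sD pD H0; have [f [Hf Ef]] := fam_primitive (2 * n + 2) oD pD H0.
exists (Dbar (lapD (slice_fam f))); split.
  by apply: (AM_Dbar m0 oD sD); exact: (AH_lapD mE oD sD Hf).
by move=> x; exact: (GCK_lapD mE oD sD Hf).
Qed.

Lemma core_disc (Om : set R[i]^o) (x : point) : slice_domain m (taylor_core Om) x ->
  exists2 rho : R, cball (sc x)%:C rho `<=` Om &
    slice_domain m (taylor_core (cball (sc x)%:C rho)) x.
Proof.
move=> /slice_domainP => /(_ m0 (@core_sym _ _)) /taylor_coreP[rho h1 h2]; exists rho => //.
by apply/slice_domainP => //; [exact: core_sym|exact: core_ball].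
Qed.

Lemma axial_analytic_sub (D Om : set R[i]^o) (g : point -> Cl) : D `<=` Om ->
  axial_analytic Om g -> axial_analytic D g.
Proof.
move=> sub [h1 [al [be [h2 h3 h4 h5]]]]; split.
  by move=> x /(slice_mono sub); exact: h1.
exists al, be; split.
- by move=> u v /sub; exact: h2.
- by move=> u v /sub; exact: h3.
- by move=> u v /sub; exact: h4.
- by move=> x /(slice_mono sub); exact: h5.
Qed.

(** Since [S] determines its value, values may be chosen point by point: on each disc the choice
    coincides with the local solution, and being analytic of axial form is a local property. *)
Lemma core_glue (Om : set R[i]^o) (S : point -> Cl -> Prop) :
  (forall x s t, S x s -> S x t -> s = t) ->
  (forall x, slice_domain m (taylor_core Om) x -> exists rho h,
     [/\ cball (sc x)%:C rho `<=` Om,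
       slice_domain m (taylor_core (cball (sc x)%:C rho)) x,
       axial_analytic (cball (sc x)%:C rho) h &
       forall y, slice_domain m (taylor_core (cball (sc x)%:C rho)) y -> S y (h y)]) ->
  exists h, axial_analytic (taylor_core Om) h /\
    forall x, slice_domain m (taylor_core Om) x -> S x (h x).
Proof.
move=> uS H; have /choice[h Hh] x : exists s, slice_domain m (taylor_core Om) x -> S x s.
  have [Cx|Cx] := pselect (slice_domain m (taylor_core Om) x); last by exists 0.
  by have [rho [g [_ Dx _ Hg]]] := H x Cx; exists (g x) => _; exact: Hg.
exists h; split=> //; apply: axial_analytic_local => //; first exact: core_sym.
move=> x Cx; have [rho [g [sub Dx Ag Hg]]] := H x Cx.
exists (taylor_core (cball (sc x)%:C rho)), g; split=> //.
- exact: core_open.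
- exact: core_sym.
- by apply: axial_analytic_sub Ag; exact: core_sub.
- move=> y Dy; apply: uS (Hg y Dy); apply: Hh.
  exact: slice_mono (core_mono sub) Dy.
Qed.

Lemma near_disc_eq (D : set R[i]^o) (S : point -> Cl -> Prop) (g h : point -> Cl) x :
  (forall x s t, S x s -> S x t -> s = t) -> slice_domain m (taylor_core D) x ->
  (forall y, slice_domain m (taylor_core D) y -> S y (g y)) ->
  (forall y, slice_domain m (taylor_core D) y -> S y (h y)) ->
  \forall y \near x, g y = h y.
Proof.
move=> uS Dx Hg Hh.
apply: filterS (near_slice m0 (@core_sym _ _) (@core_open _ _) Dx) => y Dy.
exact: uS (Hg y Dy) (Hh y Dy).
Qed.

Lemma near_HGCK_exists (Om : set R[i]^o) (A0 A1 : R -> Cl) :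
  cl_extends Om A0 -> cl_extends Om A1 -> exists h, near_HGCK Om A0 A1 h.
Proof.
move=> H0 H1.
have HD x : slice_domain m (taylor_core Om) x -> exists rho h,
     [/\ cball (sc x)%:C rho `<=` Om,
       slice_domain m (taylor_core (cball (sc x)%:C rho)) x,
       AH (cball (sc x)%:C rho) h &
       forall y, slice_domain m (taylor_core (cball (sc x)%:C rho)) y -> HGCK_sum A0 A1 y (h y)].
  move=> /core_disc[rho sub Dx]; exists rho.
  have [h [h1 h2]] := HGCK_exists (@copen_ball _ _ _) (@csym_cball _ _ _)
    (@disc_primitives _ _ _) (fun A => extends_sub sub (H0 A)) (fun A => extends_sub sub (H1 A)).
  by exists h.
have [|h [h1 h2]] := core_glue (@HGCK_sum_uniq _ _ A0 A1) (Om := Om).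
  by move=> x /HD[rho [h [? ? [? _] ?]]]; exists rho, h.
exists h; split=> //; split=> // x Cx; have [rho [g [sub Dx [_ g0] Hg]]] := HD x Cx.
rewrite (@laplacian_near _ _ h g) ?g0 //; first exact: slice_mono (@core_sub _ _) Dx.
apply: (near_disc_eq (@HGCK_sum_uniq _ _ A0 A1) Dx) => // y Dy; apply: h2.
exact: slice_mono (core_mono sub) Dy.
Qed.

Lemma near_GCK_exists (Om : set R[i]^o) (f0 : R -> Cl) :
  cl_extends Om f0 -> exists h, near_GCK Om f0 h.
Proof.
move=> H0.
have HD x : slice_domain m (taylor_core Om) x -> exists rho h,
     [/\ cball (sc x)%:C rho `<=` Om,
       slice_domain m (taylor_core (cball (sc x)%:C rho)) x,
       AM (cball (sc x)%:C rho) h &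
       forall y, slice_domain m (taylor_core (cball (sc x)%:C rho)) y -> GCK_sum f0 y (h y)].
  move=> /core_disc[rho sub Dx]; exists rho.
  have [h [h1 h2]] := GCK_exists (@copen_ball _ _ _) (@csym_cball _ _ _)
    (@disc_primitives _ _ _) (fun A => extends_sub sub (H0 A)).
  by exists h.
have [|h [h1 h2]] := core_glue (@GCK_sum_uniq _ _ f0) (Om := Om).
  by move=> x /HD[rho [h [? ? [? _] ?]]]; exists rho, h.
exists h; split=> //; split=> // x Cx; have [rho [g [sub Dx [_ g0] Hg]]] := HD x Cx.
rewrite (@Dop_near _ _ h g) ?g0 //; first exact: slice_mono (@core_sub _ _) Dx.
apply: (near_disc_eq (@GCK_sum_uniq _ _ f0) Dx) => // y Dy; apply: h2.
exact: slice_mono (core_mono sub) Dy.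
Qed.

(** Nothing is known of [g] beyond its sums. Near [x] these are also the sums of
    [lapD (slice_fam f)], where [f] is an iterated primitive over a disc, and [Dbar] depends only on
    the germ of a function. *)
Lemma Dbar_HGCK_sum (Om : set R[i]^o) (A0 A1 : R -> Cl) (g : point -> Cl) x :
  cl_extends Om A0 -> (forall t, real_trace Om t -> A1 t = 0) ->
  (forall x, slice_domain m (taylor_core Om) x -> HGCK_sum A0 A1 x (g x)) ->
  slice_domain m (taylor_core Om) x -> GCK_sum (cl_derive 1 A0) x (Dbar g x).
Proof.
move=> H0 H1 Hg /core_disc[rho sub Dx].
have [oD sD] := (@copen_ball _ (sc x)%:C rho, @csym_cball _ (sc x) rho).
have [f [Hf Ef]] := fam_primitive (2 * n + 1) oD (@disc_primitives _ _ _)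
  (fun A => extends_sub sub (H0 A)).
rewrite (@Dbar_near _ _ g (lapD (slice_fam f))); last first.
  apply: (near_disc_eq (@HGCK_sum_uniq _ _ A0 A1) Dx) => y Dy.
    by apply: Hg; exact: slice_mono (core_mono sub) Dy.
  by apply: (HGCK_lapD mE oD sD Hf) => // t /sub; exact: H1.
apply: (GCK_lapD mE oD sD Hf) => // t A Dt; rewrite ffunE.
have HN := (intrinsic_derive1n (2 * n + 1) oD sD (Hf A)).1.
rewrite (real_derive1n 1 oD HN (fun s Ds => Ef s A Ds) Dt) derive1nD.
by have -> : (1 + (2 * n + 1) = 2 * n + 2)%N by lia.
Qed.

(** The restriction to the plane of 1 and [w] is analytic in two real variables. The core contains a
    neighbourhood of each real point of [Om], which provides the germ to be propagated. *)
Lemma axial_unique (Om : set R[i]^o) (g h : point -> Cl) : copen Om -> connected Om ->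
  csym Om -> (exists t : R, Om t%:C) -> axial_analytic Om g -> axial_analytic Om h ->
  (forall x, slice_domain m (taylor_core Om) x -> g x = h x) ->
  forall x, slice_domain m Om x -> g x = h x.
Proof.
move=> oOm cOm sOm [t Ot] Hg Hh gh x [u [v [w [Ouv w1 ->]]]].
apply/subr0_eq/ffunP => A; rewrite [RHS]ffunE.
pose p (y : 'rV[R]_2) := (g (mkpoint (y ord0 ord0) (y ord0 ord_max *: w)) -
  h (mkpoint (y ord0 ord0) (y ord0 ord_max *: w))) A.
have -> : (g (mkpoint u (v *: w)) - h (mkpoint u (v *: w))) A = p (pt2c (u +i* v)).
  by rewrite /p !mxE.
apply: (ana_identity oOm cOm) Ouv => [z Oz|].
  have Oz' : slice_domain m Om (mkpoint (complex.Re z) (complex.Im z *: w)).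
    by exists (complex.Re z), (complex.Im z), w; split=> //; case: z Oz.
  have cg := cana_plane (axial_analytic_cana Hg Oz').
  have ch := cana_plane (axial_analytic_cana Hh Oz').
  exact: (canaD cg (canaN ch) A).
exists t%:C => //; have [d d0 Hd] := @core_open _ _ _ (core_real oOm Ot).
apply/nbhs_small; exists (d / 3); first by rewrite divr_gt0.
move=> y yd; rewrite /p gh ?subrr ?ffunE //.
exists ((pt2c t%:C + y) ord0 ord0), ((pt2c t%:C + y) ord0 ord_max), w; split=> //.
apply: Hd; apply: le_lt_trans (cabs_le _) _; rewrite cReD cImD cReN cImN !mxE /=.
have := yd ord0; have := yd ord_max.
rewrite oppr0 addr0 add0r [t + _]addrC addrK => h1 h2.
apply: (le_lt_trans (lerD h2 h1)); lra.
Qed.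

End Existence.

(** * Slice monogenic functions *)

Section PlaneDerivative.
Variable R : realType.

(** Total differentiability in the plane: the Cauchy-Riemann equations yield a complex derivative
    only together with such a joint estimate, not from partial derivatives alone. *)
Definition diff2 (f : R -> R -> R) u v a b := forall e : R, 0 < e -> exists2 d : R, 0 < d &
  forall s t, `|s| < d -> `|t| < d ->
    `|f (s + u) (t + v) - f u v - (s * a + t * b)| <= e * (`|s| + `|t|).

Lemma diff2_derive f u v a b : diff2 f u v a b ->
  is_derive u 1 (fun s => f s v) a /\ is_derive v 1 (fun t => f u t) b.
Proof.
move=> H; split; apply/is_deriveP => e e0; have [d d0 Hd] := H e e0; exists d => // t td.
  have := Hd t 0 td; rewrite normr0 => /(_ d0).
  by rewrite add0r mul0r addr0 addr0 -[t *: 1]/(t * 1) mulr1.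
have := Hd 0 t; rewrite normr0 => /(_ d0 td).
by rewrite add0r mul0r !add0r -[t *: 1]/(t * 1) mulr1.
Qed.

Lemma diff2_cauchy_riemann p q u v a b : diff2 p u v a b -> diff2 q u v (- b) a ->
  cderiv (fun z => p (complex.Re z) (complex.Im z) +i* q (complex.Re z) (complex.Im z))
    (u +i* v) (a +i* (- b)).
Proof.
move=> Hp Hq e e0; have e4 : 0 < e / 4 by rewrite divr_gt0.
have [d1 d10 Hd1] := Hp _ e4; have [d2 d20 Hd2] := Hq _ e4.
exists (Num.min d1 d2); first by rewrite lt_min d10.
move=> t; rewrite lt_min => /andP[t1 t2].
have hr := cabs_Re t; have hi := cabs_Im t.
have := Hd1 _ _ (le_lt_trans hr t1) (le_lt_trans hi t1).
have := Hd2 _ _ (le_lt_trans hr t2) (le_lt_trans hi t2).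
move: hr hi; set c := cabs t => hr hi h2 h1.
apply: le_trans (cabs_le _) _; rewrite !(cReD, cImD, cReN, cImN, cReM, cImM).
move: hr hi h1 h2; set s := complex.Re t; set r := complex.Im t => hr hi h1 h2.
rewrite -[complex.Re (u +i* v)]/u -[complex.Im (u +i* v)]/v [u + s]addrC [v + r]addrC.
rewrite -[complex.Re (a -i* b)]/a -[complex.Im (a -i* b)]/(- b).
have -> : s * a - r * - b = s * a + r * b by ring.
apply: le_trans (lerD h1 h2) _.
have : e / 4 * (`|s| + `|r|) <= e / 4 * (c + c) by rewrite ler_pM2l // lerD.
by have := e0; lra.
Qed.

End PlaneDerivative.

Section SliceMonogenic.
Variables (R : realType) (m : nat).
Local Notation C := R[i].
Local Notation Cl := (clifford R m).
Local Notation point := 'rV[R]_m.+1.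
Hypothesis m0 : (0 < m)%N.

Lemma mkpointD u v (w w' : 'rV[R]_m) : mkpoint (u + v) (w + w') = mkpoint u w + mkpoint v w'.
Proof. by apply/rowP => i; rewrite !mxE; case: unliftP => [j _|_]; rewrite ?mxE. Qed.

Lemma mkpointZ c u (w : 'rV[R]_m) : mkpoint (c * u) (c *: w) = c *: mkpoint u w.
Proof. by apply/rowP => i; rewrite !mxE; case: unliftP => [j _|_]; rewrite ?mxE. Qed.

Lemma differentiable_diff2 (f : point -> R) u v (w : 'rV[R]_m) : enorm w = 1 ->
  differentiable f (mkpoint u (v *: w)) ->
  exists a b, diff2 (fun s t => f (mkpoint s (t *: w))) u v a b.
Proof.
move=> w1 Hf; set x := mkpoint _ _ in Hf.
exists ('d f x (mkpoint 1 0)), ('d f x (mkpoint 0 w)) => e e0.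
have /eqaddoP/(_ e e0)/nbhs_normP[d d0 Hd] := diff_locally Hf.
exists (d / 2) => [|s t sd td]; first by rewrite divr_gt0.
pose h := mkpoint s (t *: w).
have hE : h = s *: mkpoint 1 0 + t *: mkpoint 0 w.
  by rewrite -!mkpointZ -mkpointD mulr1 mulr0 scaler0 addr0 add0r.
have hn : `|h| <= `|s| + `|t|.
  have -> : `|h| = mx_norm h by [].
  rewrite mx_normrE; apply: bigmax_le; first by rewrite addr_ge0.
  move=> [i j] _ /=; rewrite ord1 mxE; case: unliftP => [k _|_]; last by rewrite lerDl.
  rewrite mxE normrM; apply: (@le_trans _ _ `|t|); last by rewrite lerDr.
  by rewrite ler_piMr // -w1; exact: enorm_coord.
have hd : `|h| < d by apply: le_lt_trans hn _; rewrite [ltRHS](splitr d) ltrD.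
have := Hd h; rewrite /ball_ /= sub0r normrN => /(_ hd) Q.
have -> : mkpoint (s + u) ((t + v) *: w) = h + x by rewrite scalerDl mkpointD.
have -> : f (h + x) - f x - (s * 'd f x (mkpoint 1 0) + t * 'd f x (mkpoint 0 w)) =
    f (h + x) - (f x + 'd f x h).
  have -> : 'd f x h = s * 'd f x (mkpoint 1 0) + t * 'd f x (mkpoint 0 w).
    by rewrite hE linearD !linearZ.
  by rewrite [in RHS]opprD addrA.
by apply: le_trans Q _; rewrite ler_pM2l.
Qed.

Lemma onevecK (w : 'rV[R]_m) : enorm w = 1 -> forall a : Cl, onevec w * (onevec w * a) = - a.
Proof. by move=> w1 a; rewrite mulrA onevec_unit // mulN1r. Qed.

(** [axial] sees only the absolute value of [v]. For negative [v] the unit vector changes sign, and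
    so does the odd imaginary part. *)
Lemma slice_fam_mk (Om : set R[i]^o) f u v (w : 'rV[R]_m) : fam_holo Om f -> enorm w = 1 ->
  Om (u +i* v) -> slice_fam f (mkpoint u (v *: w)) = fRe f u v + onevec w * fIm f u v.
Proof.
move=> Hf w1 Oz; rewrite /slice_fam /axial sc_mk vc_mk enormZ w1 mulr1 onevecZ scalerA.
have Hr A := (Hf A).2 u v Oz.
case: (ltgtP v 0) => v0.
- rewrite ltr0_norm // invrN mulNr mulVf ?lt_eqF // scaleN1r.
  have -> : fRe f u (- v) = fRe f u v by apply/ffunP => A; rewrite !ffunE (Hr A).1.
  have -> : fIm f u (- v) = - fIm f u v by apply/ffunP => A; rewrite !ffunE (Hr A).2.
  by rewrite mulrNN.
- by rewrite gtr0_norm // mulVf ?gt_eqF // scale1r.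
- have f0 : fIm f u v = 0.
    apply/ffunP => A; rewrite !ffunE v0; apply: (intrinsic_real (Hf A)).
    by move: Oz; rewrite v0.
  by move: f0; rewrite v0 normr0 => ->; rewrite !mulr0.
Qed.

Lemma slice_mk (Om : set R[i]^o) u v (w : 'rV[R]_m) : csym Om -> enorm w = 1 ->
  slice_domain m Om (mkpoint u (v *: w)) -> Om (u +i* v).
Proof.
move=> sOm w1 /(slice_domainP _ m0 sOm); rewrite zof_mk //.
by have [v0|v0] := leP 0 v; [rewrite ger0_norm|rewrite ltr0_norm // => /sOm; rewrite /= opprK].
Qed.

Lemma near_slope (u v : R) (Om : set R[i]^o) : copen Om -> Om (u +i* v) ->
  (\forall s \near u, Om (s +i* v)) /\ (\forall t \near v, Om (u +i* t)).
Proof.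
move=> oOm /oOm[r r0 Hr]; split; apply/nbhs_ballP; exists r => //= s; rewrite /ball /= distrC => sr.
  apply: Hr; apply: le_lt_trans (cabs_le _) _; rewrite cReD cImD cReN cImN /=.
  by rewrite subrr normr0 addr0.
apply: Hr; apply: le_lt_trans (cabs_le _) _; rewrite cReD cImD cReN cImN /=.
by rewrite subrr normr0 add0r.
Qed.

Lemma pder_cl_derive (F : R -> Cl) t D : pder (1 : R) F t D -> cl_derive 1 F t = D.
Proof.
by move=> H; apply/ffunP => A; rewrite ffunE derive1n1 derive1E; exact: derive_val.
Qed.

Lemma SM_slice_fam (Om : set R[i]^o) f : copen Om -> csym Om -> fam_holo Om f ->
  (forall x, slice_domain m Om x -> cana (slice_fam f) x) -> SM Om (slice_fam f).
Proof.
move=> oOm sOm Hf cf; split=> [x Ox A|w u v w1 /(slice_mk sOm w1) Oz].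
  exact: ana_differentiable (cf x Ox A).
have [n1 n2] := near_slope oOm Oz.
have HC A : cderiv (f A) (u +i* v) (dfam f A (u +i* v)).
  by have /holomorphicP := (Hf A).1; exact.
have H1 A := chain_complex (is_derive_id u 1) (is_derive_cst v u 1) (HC A).
have H2 A := chain_complex (is_derive_cst u v 1) (is_derive_id v 1) (HC A).
pose a := fRe (dfam f) u v; pose b := fIm (dfam f) u v.
have W := pder_cst _ (onevec w).
have P1 : pder (1 : R) (fun s => fRe f s v) u a.
  move=> A; have [] := H1 A; rewrite cReM /= mulr1 mulr0 subr0 => H _.
  by rewrite ffunE; move: H; congr is_derive; apply/funext => s; rewrite ffunE.
have P2 : pder (1 : R) (fun s => fIm f s v) u b.
  move=> A; have [] := H1 A; rewrite cImM /= mulr1 mulr0 add0r => _ H.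
  by rewrite ffunE; move: H; congr is_derive; apply/funext => s; rewrite ffunE.
have P3 : pder (1 : R) (fun t => fRe f u t) v (- b).
  move=> A; have [] := H2 A; rewrite cReM /= mulr1 mulr0 sub0r => H _.
  by rewrite !ffunE; move: H; congr is_derive; apply/funext => s; rewrite ffunE.
have P4 : pder (1 : R) (fun t => fIm f u t) v a.
  move=> A; have [] := H2 A; rewrite cImM /= mulr1 mulr0 addr0 => _ H.
  by rewrite ffunE; move: H; congr is_derive; apply/funext => s; rewrite ffunE.
have E1 : pder (1 : R) (fun s => slice_fam f (mkpoint s (v *: w))) u (a + onevec w * b).
  have := pderD P1 (pderM (W R 1 u) P2); rewrite mul0r add0r; apply: pder_near.
  by apply: filterS n1 => s Os; rewrite (slice_fam_mk Hf).
have E2 : pder (1 : R) (fun t => slice_fam f (mkpoint u (t *: w))) v (- b + onevec w * a).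
  have := pderD P3 (pderM (W R 1 v) P4); rewrite mul0r add0r; apply: pder_near.
  by apply: filterS n2 => s Os; rewrite (slice_fam_mk Hf).
rewrite (pder_cl_derive E1) (pder_cl_derive E2) mulrDr onevecK // mulrN.
by rewrite addrA addrK subrr.
Qed.

(** Multiplication by [onevec w] plays the role of ['i] on the plane of [w]. The component [A] of
    [g] and the negative of that of [onevec w * g] form a Cauchy-Riemann pair, so no basis adapted
    to [w] has to be chosen to split [g] into holomorphic functions. *)
Definition slice_comp (w : 'rV[R]_m) (g : point -> Cl) A (z : C) : C :=
  g (mkpoint (complex.Re z) (complex.Im z *: w)) A -i*
  (onevec w * g (mkpoint (complex.Re z) (complex.Im z *: w))) A.

Lemma SM_holo (Om : set R[i]^o) g (w : 'rV[R]_m) A : SM Om g -> enorm w = 1 ->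
  holomorphic_on Om (slice_comp w g A : R[i]^o -> R[i]^o).
Proof.
move=> [Hd Hg] w1; apply: holo_intro => -[u v] Oz.
have Ox : slice_domain m Om (mkpoint u (v *: w)) by exists u, v, w.
have /choice[a Ha] B : exists ab : R * R,
    diff2 (fun s t => g (mkpoint s (t *: w)) B) u v ab.1 ab.2.
  by have [x [y H]] := differentiable_diff2 w1 (Hd _ Ox B); exists (x, y).
pose D1 : Cl := [ffun B => (a B).1]; pose D2 : Cl := [ffun B => (a B).2].
have P1 : pder (1 : R) (fun s => g (mkpoint s (v *: w))) u D1.
  by move=> B; rewrite ffunE; exact: (diff2_derive (Ha B)).1.
have P2 : pder (1 : R) (fun t => g (mkpoint u (t *: w))) v D2.
  by move=> B; rewrite ffunE; exact: (diff2_derive (Ha B)).2.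
have CR := Hg w u v w1 Ox; rewrite (pder_cl_derive P1) (pder_cl_derive P2) in CR.
have WD1 : onevec w * D1 = D2.
  have -> : D1 = - (onevec w * D2) by apply/eqP; rewrite -addr_eq0 CR.
  by rewrite mulrN onevecK // opprK.
have WD2 : onevec w * D2 = - D1 by rewrite -WD1 onevecK.
have Hq : differentiable (fun y => - (onevec w * g y) A) (mkpoint u (v *: w)).
  have -> : (fun y => - (onevec w * g y) A) = - \sum_(B : {set 'I_m})
      (fun y => cl_sign R B (symdiff B A) * onevec w B * g y (symdiff B A)).
    by apply/funext => y; rewrite ffunE fct_sumE /=; congr (- _); apply: eq_bigr => B _; rewrite mulrA.
  apply: differentiableN; elim/big_ind: _ => [|F G|B _].
  - exact: differentiable_cst.
  - exact: differentiableD.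
  - by apply: differentiableZ; exact: Hd.
have [p [q Hpq]] := differentiable_diff2 w1 Hq.
have Q := diff2_derive Hpq.
have Q1 : pder (1 : R) (fun s => - (onevec w * g (mkpoint s (v *: w)))) u (- D2).
  by have := pderN (pderM (pder_cst (1 : R) (onevec w) u) P1); rewrite mul0r add0r WD1.
have Q2 : pder (1 : R) (fun t => - (onevec w * g (mkpoint u (t *: w)))) v D1.
  by have := pderN (pderM (pder_cst (1 : R) (onevec w) v) P2); rewrite mul0r add0r WD2 opprK.
have ep : p = - (a A).2.
  have := Q1 A; rewrite 2!ffunE => K; have {}Q := Q.1.
  rewrite -(@derive_val _ _ _ _ _ _ _ Q) -(@derive_val _ _ _ _ _ _ _ K).
  by congr ('D__ _ u); apply/funext => s; rewrite [RHS]ffunE.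
have eq : q = (a A).1.
  have := Q2 A; rewrite ffunE => K; have {}Q := Q.2.
  rewrite -(@derive_val _ _ _ _ _ _ _ Q) -(@derive_val _ _ _ _ _ _ _ K).
  by congr ('D__ _ v); apply/funext => s; rewrite [RHS]ffunE.
have K : diff2 (fun s t => - (onevec w * g (mkpoint s (t *: w))) A) u v (- (a A).2) (a A).1.
  by rewrite -ep -eq.
by eexists; exact: (diff2_cauchy_riemann (Ha A) K).
Qed.

Lemma SM_unique (Om : set R[i]^o) g h : copen Om -> connected Om -> csym Om ->
  (exists t : R, Om t%:C) -> SM Om g -> SM Om h ->
  (forall t, Om t%:C -> g (mkpoint t 0) = h (mkpoint t 0)) ->
  forall x, slice_domain m Om x -> g x = h x.
Proof.
move=> oOm cOm sOm rOm Hg Hh gh x [u [v [w [Oz w1 ->]]]]; apply/ffunP => A.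
have HF : holomorphic_on Om (fun z => slice_comp w g A z - slice_comp w h A z).
  have /holomorphicP K := SM_holo Hg w1 (A := A); have /holomorphicP L := SM_holo Hh w1 (A := A).
  by apply: holo_intro => z Dz; eexists; apply: cderivB; [exact: K|exact: L].
have F0 t : Om t%:C -> slice_comp w g A t%:C - slice_comp w h A t%:C = 0.
  by move=> Ot; rewrite /slice_comp scale0r gh // subrr.
have := holo_identity oOm cOm HF rOm F0 Oz => /(congr1 (@complex.Re R)).
by rewrite cReD cReN /= => /subr0_eq.
Qed.

(** One direction [w] suffices to construct [f]. Symmetrizing discards the imaginary part of
    [slice_comp] on the real axis, where the slice function then equals [g]; uniqueness extends the
    equality to every other direction. *)
Lemma SM_intrinsic (Om : set R[i]^o) g : copen Om -> connected Om -> csym Om ->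
  (exists t : R, Om t%:C) -> SM Om g ->
  (forall f, fam_holo Om f -> forall x, slice_domain m Om x -> cana (slice_fam f) x) ->
  exists f, fam_holo Om f /\ forall x, slice_domain m Om x -> g x = slice_fam f x.
Proof.
move=> oOm cOm sOm rOm Hg cf; have [w w1] := unit_vector R m0.
pose f A : R[i]^o -> R[i]^o := symm (slice_comp w g A).
have Hf : fam_holo Om f by move=> A; apply: symm_intrinsic => //; exact: SM_holo.
exists f; split=> // x Ox; apply: SM_unique Ox => //.
  by apply: SM_slice_fam => //; exact: cf.
move=> t Ot; have := slice_fam_mk Hf w1 Ot; rewrite scale0r => ->.
have -> : fIm f t 0 = 0 by apply/ffunP => A; rewrite !ffunE; exact: (intrinsic_real (Hf A) Ot).
rewrite mulr0 addr0; apply/ffunP => A; rewrite ffunE /f /symm /slice_comp.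
by rewrite cReM cReD cImD /= oppr0 scale0r; field.
Qed.

End SliceMonogenic.

(** * The slice operator and the commutative diagram *)

Section Diagram.
Variables (R : realType) (m n : nat).
Local Notation C := R[i].
Local Notation Cl := (clifford R m).
Local Notation point := 'rV[R]_m.+1.

(** The normalized vector squares to [- 1] when [w] is nonzero, so powers follow those of a purely
    imaginary number; for [w = 0] both sides are powers of 0. *)
Lemma onevec_pow (w : 'rV[R]_m) j : let z := (0 +i* enorm w) ^+ j in
  onevec w ^+ j = (complex.Re z)%:A + complex.Im z *: ((enorm w)^-1 *: onevec w).
Proof.
set r := enorm w; set y := r^-1 *: onevec w => z; rewrite {}/z.
have wy : onevec w = r *: y.
  rewrite scalerA; have [r0|r0] := eqVneq r 0; last by rewrite mulfV // scale1r.
  have /eqP -> : w == 0 by rewrite -enorm_eq0 -/r r0.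
  by rewrite onevec0 scaler0.
have wwy : onevec w * y = (- r)%:A.
  rewrite -scalerAr onevec_sq -/r scalerA; congr (_ *: 1).
  by have [->|r0] := eqVneq r 0; [rewrite invr0 mul0r oppr0|field].
move: y wy wwy => y wy wwy.
elim: j => [|j IH]; first by rewrite !expr0 /= scale0r addr0 scale1r.
rewrite exprS IH mulrDr -!scalerAr mulr1 wwy exprSr; move: (_ ^+ j) => z.
rewrite cReM cImM /= !mulr0 sub0r addr0 {1}wy !scalerA addrC.
by congr (_ *: _ + _ *: _); rewrite mulrN.
Qed.

Section OverDomain.
Hypothesis mE : m = (2 * n + 3)%N.
Variable Om : set R[i]^o.
Hypotheses (oOm : copen Om) (cOm : connected Om) (sOm : csym Om) (rOm : exists t : R, Om t%:C).

Let m0 : (0 < m)%N. Proof. by rewrite mE addn3. Qed.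

(** Each component of the slice series is a finite combination of the real and imaginary parts of
    the Taylor series, at the real point [u], of the functions of the family. *)
Lemma S_sum_slice f (f0 : R -> Cl) x : fam_holo Om f ->
  (forall t A, Om t%:C -> f0 t A = complex.Re (f A t%:C)) ->
  slice_domain m (taylor_core Om) x -> S_sum f0 x (slice_fam f x).
Proof.
move=> Hf H0 Cx A; set u := sc x; set r := enorm (vc x); set y := r^-1 *: onevec (vc x).
have Ou : Om u%:C := core_sc mE Cx.
have [rho h1 h2] : exists2 rho, `|r| < rho & cball u%:C rho `<=` Om.
  by move: Cx => /slice_domainP => /(_ m0 (@core_sym _ _)) /taylor_coreP.
have cr : cabs (0 +i* r) < rho.
  by apply: le_lt_trans (cabs_le _) _; rewrite /= normr0 add0r.
pose c B j := derive1n j (f B) u%:C / j`!%:R.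
have Hc B : csum_to (c B) (0 +i* r) (f B (u +i* r)).
  have := taylor_derive1n (Hf B).1 h2 cr.
  by have -> : u%:C + (0 +i* r) = u +i* r by apply: complex_eq; rewrite /= ?addr0 ?add0r.
have cE B j : c B j = (derive1n j (fun t => f0 t B) u / j`!%:R)%:C.
  have e t : Om t%:C -> f0 t B = 1 * complex.Re (f B t%:C) by move=> Ot; rewrite mul1r H0.
  rewrite (real_derive1n j oOm (Hf B).1 e Ou) mul1r rmorphM fmorphV rmorph_nat; congr (_ / _).
  by apply: complex_eq => //=; exact: (intrinsic_real (intrinsic_derive1n j oOm sOm (Hf B)) Ou).
have -> : slice_fam f x A = complex.Re (f A (u +i* r)) +
    \sum_(B : {set 'I_m}) (cl_sign R B (symdiff B A) * y B) * complex.Im (f (symdiff B A) (u +i* r)).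
  rewrite /slice_fam /axial -/u -/r -/y !ffunE; congr (_ + _).
  by apply: eq_bigr => B _; rewrite [fIm _ _ _ _]ffunE mulrA.
have L1 := csum_Re (Hc A).
have L2 := @cvg_lin_sum R _ (index_enum _) (fun B : {set 'I_m} => cl_sign R B (symdiff B A) * y B)
  _ _ (fun B => csum_Im (Hc (symdiff B A))).
have := cvgD L1 L2; set s1 := _ + _; set s2 := series _ => L.
suff <- : s1 = s2 by apply: L.
apply/funext => K; rewrite /s1 /s2 /series /= -[RHS]/(\sum_(0 <= j < K) _).
under [X in _ + X = _]eq_bigr do rewrite mulr_sumr.
rewrite [X in _ + X = _]exchange_big -big_split /=; apply: eq_bigr => j _.
have rE B : complex.Re (c B j * (0 +i* r) ^+ j) =
    j`!%:R^-1 * (complex.Re ((0 +i* r) ^+ j) * derive1n j (fun t => f0 t B) u).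
  by rewrite cReM cE /= mul0r subr0; ring.
have iE B : complex.Im (c B j * (0 +i* r) ^+ j) =
    j`!%:R^-1 * (complex.Im ((0 +i* r) ^+ j) * derive1n j (fun t => f0 t B) u).
  by rewrite cImM cE /= mul0r addr0; ring.
rewrite rE onevec_pow -/r -/y mulrDl -scalerAl mul1r -scalerAl ![in RHS]ffunE mulrDr.
congr (_ + _); rewrite mulr_sumr mulr_sumr; apply: eq_bigr => B _.
by rewrite iE [cl_derive _ _ _ _]ffunE; ring.
Qed.

Lemma extends_fam (f0 : R -> Cl) : calA_Cl Om f0 ->
  exists f, fam_holo Om f /\ forall t A, Om t%:C -> f0 t A = complex.Re (f A t%:C).
Proof.
move=> H; have /choice[f Hf] A := calA_extends sOm (H A).
exists f; split=> [A|t A Ot]; first exact: (Hf A).1.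
by rewrite (Hf A).2.
Qed.

Lemma is_S_slice_fam f (f0 : R -> Cl) : fam_holo Om f ->
  (forall t A, Om t%:C -> f0 t A = complex.Re (f A t%:C)) -> is_S Om f0 (slice_fam f).
Proof.
move=> Hf H0; split; last by move=> x; exact: S_sum_slice.
by apply: SM_slice_fam => // x; exact: (cana_slice_fam mE oOm sOm Hf).
Qed.

Lemma is_S_unique (f0 : R -> Cl) g h : is_S Om f0 g -> is_S Om f0 h ->
  forall x, slice_domain m Om x -> g x = h x.
Proof.
move=> [Sg Hg] [Sh Hh]; apply: (SM_unique oOm cOm sOm rOm Sg Sh) => t Ot.
have [w w1] := unit_vector R m0.
have Ct : slice_domain m (taylor_core Om) (mkpoint t 0).
  by exists t, 0, w; split=> //; [exact: core_real|rewrite scale0r].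
exact: cl_sum_uniq (Hg _ Ct) (Hh _ Ct).
Qed.

Lemma AH_lapD_eq f (g : point -> Cl) : fam_holo Om f ->
  (forall x, slice_domain m Om x -> g x = slice_fam f x) -> AH Om (lapD g) /\
  forall x, slice_domain m Om x -> lapD g x = lapD (slice_fam f) x.
Proof.
move=> Hf gf; have E x : slice_domain m Om x -> lapD g x = lapD (slice_fam f) x.
  by move=> Ox; apply: lapD_near; apply: filterS (near_slice m0 sOm oOm Ox).
have [Af Lf] := AH_lapD mE oOm sOm Hf; split; last exact: E.
split.
  apply: (axial_analytic_local m0 sOm) => x Ox; exists Om, (lapD (slice_fam f)).
  by split; [exact: oOm|exact: sOm|exact: Ox|exact: Af|exact: E].
move=> x Ox; rewrite -[RHS](Lf x Ox); apply: laplacian_near.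
exact: filterS (near_slice m0 sOm oOm Ox).
Qed.

Lemma SM_lapD (g : point -> Cl) : SM Om g -> AH Om (lapD g).
Proof.
move=> Hg; have [|f [Hf gf]] := SM_intrinsic m0 oOm cOm sOm rOm Hg.
  by move=> f Hf x; exact: (cana_slice_fam mE oOm sOm Hf).
exact: (AH_lapD_eq Hf gf).1.
Qed.

(** Uniqueness identifies any admissible [g] with the slice function of the holomorphic extensions
    of [f0]. The data below are derivatives of [f0], so no primitive is taken. *)
Lemma lapD_S_square (f0 : R -> Cl) g : calA_Cl Om f0 -> is_S Om f0 g ->
  is_HGCK Om (fun t => gamma_const R m *: cl_derive (m - 2) f0 t) (fun=> 0) (lapD g).
Proof.
move=> /extends_fam[f [Hf H0]] Sg.
have gf := is_S_unique Sg (is_S_slice_fam Hf H0); have [Ag E] := AH_lapD_eq Hf gf.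
split; first exact: Ag.
move=> x Cx; rewrite E; last exact: slice_mono (@core_sub _ _) Cx.
apply: (HGCK_lapD mE oOm sOm Hf) => // t A Ot; rewrite !ffunE.
have e s : Om s%:C -> f0 s A = 1 * complex.Re (f A s%:C) by move=> Os; rewrite mul1r H0.
have -> : (m - 2 = 2 * n + 1)%N by rewrite mE; lia.
by rewrite (real_derive1n _ oOm (Hf A).1 e Ot) mul1r.
Qed.

Lemma HGCK_sumZ c (A0 A1 B0 B1 : R -> Cl) x s :
  (forall j A, derive1n j (fun t => B0 t A) (sc x) = c * derive1n j (fun t => A0 t A) (sc x)) ->
  (forall j A, derive1n j (fun t => B1 t A) (sc x) = c * derive1n j (fun t => A1 t A) (sc x)) ->
  HGCK_sum A0 A1 x s -> HGCK_sum B0 B1 x (c *: s).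
Proof.
move=> H0 H1 [s0 [s1 [h0 h1 ->]]]; exists (c *: s0), (c *: s1); split.
- move=> A; have := @cvg_seriesZ _ c _ _ (h0 A); rewrite ![(c *: s0) A]ffunE.
  set t1 := series _; set t2 := series _; suff -> : t1 = t2 by [].
  by congr series; apply/funext => j; rewrite !ffunE H0 mulrCA.
- move=> A; have := @cvg_seriesZ _ c _ _ (h1 A); rewrite ![(c *: s1) A]ffunE.
  set t1 := series _; set t2 := series _; suff -> : t1 = t2 by [].
  by congr series; apply/funext => j; rewrite !ffunE H1 mulrCA.
- rewrite -scalerAr !scalerDr !scalerA; congr (_ *: _ + _ *: _); first by rewrite mulrC.
  by ring.
Qed.

Lemma derive1n_0 j (t : R) : derive1n j (fun=> 0 : R) t = 0.
Proof.
have -> : derive1n j (fun=> 0 : R) = fun=> 0; last by [].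
by elim: j => [//|j IH]; rewrite derive1nS IH; apply/funext => s; rewrite derive1_cst.
Qed.

Lemma lapD_slice_fun (f : R[i]^o -> R[i]^o) : intrinsic_holomorphic Om f ->
  is_HGCK Om (fun t => (complex.Re (derive1n (m - 2) f t%:C))%:A) (fun=> 0)
    (fun x => (gamma_const R m)^-1 *: lapD (slice_fun m f) x).
Proof.
(* A scalar slice function is the one of the family supported on the empty index set, whose basis
   element is 1. *)
move=> Hf; pose F (A : {set 'I_m}) : R[i]^o -> R[i]^o := if A == finset.set0 then f else fun=> 0.
have oneE A : (1 : Cl) A = (A == finset.set0)%:R by exact: ffunE.
have HF : fam_holo Om F.
  move=> A; rewrite /F; case: eqP => // _; split; first by move=> z _; exact: derivable_cst.
  by move=> u v _ /=; rewrite oppr0.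
have -> : slice_fun m f = slice_fam F.
  apply/funext => x; rewrite /slice_fun /slice_fam; congr (axial _ _ x);
    apply/funext => u; apply/funext => v; apply/ffunP => A; rewrite [LHS]ffunE [RHS]ffunE oneE /F;
    by case: eqP => _; rewrite ?mulr1 ?mulr0.
have AF := AH_lapD mE oOm sOm HF; split.
  have := AH_comb (gamma_const R m)^-1 0 m0 oOm sOm AF AF.
  by congr AH; apply/funext => x; rewrite scale0r addr0.
move=> x Cx; have Ou := core_sc mE Cx.
pose B0 t : Cl := [ffun A => gamma_const R m * complex.Re (derive1n (2 * n + 1) (F A) t%:C)].
have m2 : (m - 2 = 2 * n + 1)%N by rewrite mE; lia.
have HN A := (intrinsic_derive1n (2 * n + 1) oOm sOm (HF A)).1.
have HS : HGCK_sum B0 (fun=> 0) x (lapD (slice_fam F) x).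
  by apply: (HGCK_lapD mE oOm sOm HF) => // t A Ot; rewrite ffunE.
apply: HGCK_sumZ HS => j A; last first.
  have -> : (fun t : R => (0 : Cl) A) = fun=> 0 by apply/funext => t; rewrite ffunE.
  by rewrite derive1n_0 mulr0.
have e1 t : Om t%:C -> B0 t A = gamma_const R m * complex.Re (derive1n (2 * n + 1) (F A) t%:C).
  by rewrite ffunE.
have e2 t : Om t%:C -> ((complex.Re (derive1n (m - 2) f t%:C))%:A : Cl) A =
    1 * complex.Re (derive1n (2 * n + 1) (F A) t%:C).
  move=> Ot; rewrite [LHS]ffunE oneE m2 mul1r /F; case: eqP => _; first by rewrite mulr1.
  have -> : derive1n (2 * n + 1) (fun=> 0 : R[i]^o) = (fun=> 0 : R[i]^o) :> (R[i]^o -> R[i]^o).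
    by elim: (2 * n + 1)%N => [//|k IH]; rewrite derive1nS IH; apply/funext => z; rewrite derive1_cst.
  exact: mulr0.
rewrite (real_derive1n j oOm (HN A) e1 Ou) (real_derive1n j oOm (HN A) e2 Ou) mul1r mulKf //.
exact: gamma_neq0 mE.
Qed.

Lemma calA_Cl_derive N c (f0 : R -> Cl) : calA_Cl Om f0 ->
  calA_Cl Om (fun t => c *: cl_derive N f0 t).
Proof.
move=> H A; have := calA_derive1n N c oOm cOm rOm sOm (H A).
by congr calA; apply/funext => t; rewrite !ffunE.
Qed.

Lemma calA_Cl_extends (f0 : R -> Cl) : calA_Cl Om f0 -> cl_extends Om f0.
Proof. by move=> H A; exact: calA_extends (H A). Qed.

End OverDomain.
End Diagram.

Theorem theorem5p6 (R : realType) (m : nat) (Om2 : set R[i]^o)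
    (m_ge3 : (3 <= m)%N) (m_odd : odd m) (Om2_dom : intrinsic_domain Om2) :
  (forall f : R[i]^o -> R[i]^o, intrinsic_holomorphic Om2 f ->
     exists h : 'rV[R]_m.+1 -> clifford R m,
       is_HGCK Om2 (fun t => (complex.Re (derive1n (m - 2) f t%:C))%:A) (fun=> 0) h /\
       forall x, slice_domain m Om2 x ->
         lapD (slice_fun m f) x = gamma_const R m *: h x) /\
  [/\
    (* the top row S, the right column and the left column *)
    [/\ forall f0 : R -> clifford R m, calA_Cl Om2 f0 -> exists g, is_S Om2 f0 g,
        forall g : 'rV[R]_m.+1 -> clifford R m, SM Om2 g -> AH Om2 (lapD g),
        forall g : 'rV[R]_m.+1 -> clifford R m, AH Om2 g -> AM Om2 (Dbar g),
        forall f0 : R -> clifford R m, calA_Cl Om2 f0 ->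
          calA_Cl Om2 (fun t => gamma_const R m *: cl_derive (m - 2) f0 t) &
        forall A0 : R -> clifford R m, calA_Cl Om2 A0 ->
          calA_Cl Om2 (cl_derive 1 A0)],
    (* the rows HGCK and GCK: sums of the series near the real axis ... *)
    (forall A0 A1 : R -> clifford R m, calA_Cl Om2 A0 -> calA_Cl Om2 A1 ->
       exists h, near_HGCK Om2 A0 A1 h) /\
    (forall f0 : R -> clifford R m, calA_Cl Om2 f0 -> exists h, near_GCK Om2 f0 h),
    (* ... and extensions to the whole of Omega *)
    intrinsic_primitives Om2 ->
      (forall A0 A1 : R -> clifford R m, calA_Cl Om2 A0 -> calA_Cl Om2 A1 ->
         exists h, is_HGCK Om2 A0 A1 h) /\
      (forall f0 : R -> clifford R m, calA_Cl Om2 f0 -> exists h, is_GCK Om2 f0 h),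
    (* the three operators are single-valued on Omega *)
    [/\ forall (f0 : R -> clifford R m) g h, is_S Om2 f0 g -> is_S Om2 f0 h ->
          forall x, slice_domain m Om2 x -> g x = h x,
        forall (A0 A1 : R -> clifford R m) g h,
          is_HGCK Om2 A0 A1 g -> is_HGCK Om2 A0 A1 h ->
          forall x, slice_domain m Om2 x -> g x = h x &
        forall (f0 : R -> clifford R m) g h, is_GCK Om2 f0 g -> is_GCK Om2 f0 h ->
          forall x, slice_domain m Om2 x -> g x = h x] &
    (* the two commutative squares; the pairs reached by the left column have
       second component 0 *)
    [/\ forall (f0 : R -> clifford R m) g, calA_Cl Om2 f0 -> is_S Om2 f0 g ->
       is_HGCK Om2 (fun t => gamma_const R m *: cl_derive (m - 2) f0 t) (fun=> 0)
         (lapD g),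
        forall (A0 A1 : R -> clifford R m) g, calA_Cl Om2 A0 ->
          (forall t, real_trace Om2 t -> A1 t = 0) ->
          is_HGCK Om2 A0 A1 g -> is_GCK Om2 (cl_derive 1 A0) (Dbar g) &
        forall (A0 A1 : R -> clifford R m) g, calA_Cl Om2 A0 ->
          (forall t, real_trace Om2 t -> A1 t = 0) ->
          near_HGCK Om2 A0 A1 g -> near_GCK Om2 (cl_derive 1 A0) (Dbar g)]].
Proof.
have [n mE] : exists n, m = (2 * n + 3)%N.
  exists (m - 3)./2; have := odd_double_half (m - 3).
  have -> : odd (m - 3) = false by rewrite oddB // m_odd.
  lia.
have [/open_copen oOm cOm rOm sOm] := Om2_dom.
have m0 : (0 < m)%N by rewrite mE addn3.
split.
  move=> f Hf; exists (fun x => (gamma_const R m)^-1 *: lapD (slice_fun m f) x).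
  split; first exact: (lapD_slice_fun mE oOm sOm Hf).
  by move=> x _; rewrite scalerA mulfV ?scale1r //; exact: gamma_neq0 mE.
split.
- split.
  + move=> f0 /(extends_fam sOm)[f [Hf H0]]; exists (slice_fam f).
    exact: (is_S_slice_fam mE oOm sOm Hf H0).
  + by move=> g; exact: (SM_lapD mE oOm cOm sOm rOm).
  + by move=> g; exact: (AM_Dbar m0 oOm sOm).
  + by move=> f0; exact: (calA_Cl_derive oOm cOm sOm rOm).
  + move=> A0 /(calA_Cl_derive oOm cOm sOm rOm 1 1).
    by congr calA_Cl; apply/funext => t; rewrite scale1r.
- split.
    move=> A0 A1 /(calA_Cl_extends sOm) H0 /(calA_Cl_extends sOm) H1.
    exact: (near_HGCK_exists mE H0 H1).
  by move=> f0 /(calA_Cl_extends sOm) H0; exact: (near_GCK_exists mE H0).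
- move=> pOm; split.
    move=> A0 A1 /(calA_Cl_extends sOm) H0 /(calA_Cl_extends sOm) H1.
    exact: (HGCK_exists mE oOm sOm pOm H0 H1).
  move=> f0 /(calA_Cl_extends sOm) H0; exact: (GCK_exists mE oOm sOm pOm H0).
- split.
  + by move=> f0 g h; exact: (is_S_unique mE oOm cOm sOm rOm).
  + move=> A0 A1 g h [[Ag _] Hg] [[Ah _] Hh].
    apply: (axial_unique oOm cOm sOm rOm Ag Ah) => x Cx.
    exact: HGCK_sum_uniq (Hg x Cx) (Hh x Cx).
  + move=> f0 g h [[Ag _] Hg] [[Ah _] Hh].
    apply: (axial_unique oOm cOm sOm rOm Ag Ah) => x Cx.
    exact: GCK_sum_uniq (Hg x Cx) (Hh x Cx).
- split.
  + by move=> f0 g; exact: (lapD_S_square mE oOm cOm sOm rOm).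
  + move=> A0 A1 g /(calA_Cl_extends sOm) H0 H1 [Hg Sg]; split.
      exact: (AM_Dbar m0 oOm sOm Hg).
    by move=> x; exact: (Dbar_HGCK_sum mE H0 H1 Sg).
  + move=> A0 A1 g /(calA_Cl_extends sOm) H0 H1 [Hg Sg]; split.
      exact: (AM_Dbar m0 (@core_open _ _) (@core_sym _ _) Hg).
    by move=> x; exact: (Dbar_HGCK_sum mE H0 H1 Sg).
Qed.
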